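(* Let $m=3$ and $$\eta=\lambda^{-1}\begin{pmatrix}0&\hat B_1\\-\hat B_1^tI_{1,1}&0\end{pmatrix}dz,\qquad \hat B_1=\frac12\begin{pmatrix}-i&1&i&-1&-2iz&2z\\ i&-1&i&-1&2iz&-2z\end{pmatrix}.$$ Then the associated family of the corresponding isotropic harmonic maps is $Y\wedge\hat Y$ ($\lambda\in S^1$), with $$Y=-\frac{\sqrt2}{2\varsigma}\begin{pmatrix}-1-r^2-\frac{r^4}4-\frac{r^6}9\\ 1-r^2+\frac{r^4}4+\frac{r^6}9\\ \frac{ir^2}2(\lambda^{-1}z-\lambda\bar z)\\ -\frac{r^2}2(\lambda^{-1}z+\lambda\bar z)\\ -i(\lambda^{-1}z-\lambda\bar z)\\ \lambda^{-1}z+\lambda\bar z\\ \frac{ir^2}3(\lambda^{-1}z^2-\lambda\bar z^2)\\ -\frac{r^2}3(\lambda^{-1}z^2+\lambda\bar z^2)\end{pmatrix},\qquad \hat Y=\frac{\sqrt2}{2\varsigma}\begin{pmatrix}1+r^2+\frac{5r^4}4+\frac{4r^6}9+\frac{r^8}{36}\\ 1-r^2-\frac{3r^4}4+\frac{4r^6}9-\frac{r^8}{36}\\ -i(\lambda^{-1}z-\lambda\bar z)(1+\frac{r^6}9)\\ (\lambda^{-1}z+\lambda\bar z)(1+\frac{r^6}9)\\ \frac{ir^2}2(\lambda^{-1}z-\lambda\bar z)(1+\frac{4r^2}3)\\ -\frac{r^2}2(\lambda^{-1}z+\lambda\bar z)(1+\frac{4r^2}3)\\ -i(\lambda^{-1}z^2-\lambda\bar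 z^2)(1-\frac{r^4}{12})\\ (\lambda^{-1}z^2+\lambda\bar z^2)(1-\frac{r^4}{12})\end{pmatrix},$$ where $r=|z|$ and $\varsigma=\left|1-\frac{r^4}4-\frac{2r^6}9\right|$. Moreover: (1) Write $\hat Y=(\hat y_0,\dots,\hat y_7)^t$. Then $\hat y=\frac1{\hat y_0}(\hat y_1,\dots,\hat y_7)^t=[\hat Y]$ is an H-totally isotropic Willmore immersion from $S^2=\mathbb C\cup\{\infty\}$ to $S^6$, with metric $$|\hat y_z|^2|dz|^2=\frac{2\left(1+4r^2+\frac{r^4}4+\frac{2r^6}9+\frac{4r^8}9+\frac{r^{10}}{36}+\frac{r^{12}}{81}\right)}{\left(1+r^2+\frac{5r^4}4+\frac{4r^6}9+\frac{r^8}{36}\right)^2}|dz|^2,$$ and $[\hat Y]$ has no dual surface. (2) Write $Y=(y_0,\dots,y_7)^t$. Then $y=\frac1{y_0}(y_1,\dots,y_7)^t=[Y]$ is an H-totally isotropic Willmore immersion from $\mathbb C$ to $S^6$, with metric $$|y_z|^2|dz|^2=\frac{2\left(1+\frac{r^4}4+\frac{4r^6}9\right)}{\left(1+r^2+\frac{r^4}4+\frac{r^6}9\right)^2}|dz|^2.$$ $[Y]$ is a Willmore map from $S^2$ with a branch point at $z=\infty$. Moreover, $y$ is conformally equivalent to the minimal surface in $\mathbb R^6$ $$x=\begin{pmatrix}i(\lambda^{-1}z-\lambda\bar z)\\ -(\lambda^{-1}z+\lambda\bar z)\\ -\frac{2i}{r^2}(\lambda^{-1}z-\lambda\bar z)\\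 \frac2{r^2}(\lambda^{-1}z+\lambda\bar z)\\ \frac{2i}3(\lambda^{-1}z^2-\lambda\bar z^2)\\ -\frac23(\lambda^{-1}z^2+\lambda\bar z^2)\end{pmatrix}.$$ (3) The harmonic map $Y\wedge\hat Y$ is not defined on the curve $1-\frac{r^4}4-\frac{2r^6}9=0$, but the maps $[Y]$ and $[\hat Y]$ are well defined on the whole two-sphere $S^2$.
   Context: **Light cone model.** $\mathbb R^{2m+2}_1$ is $\mathbb R^{2m+2}$ with $\langle x,w\rangle=-x_1w_1+\sum_{j\ge2}x_jw_j$, extended complex bilinearly; $I_{1,1}=\mathrm{diag}(-1,1)$. $S^{2m}$ is identified with the projectivized light cone via $[(x_0,x_1,\dots,x_{2m+1})]\mapsto\frac1{x_0}(x_1,\dots,x_{2m+1})$; conformal equivalence means equivalence under Möbius transformations (for surfaces in $\mathbb R^{2m}$, via the conformal embedding $\mathbb R^{2m}\subset S^{2m}$ by inverse stereographic projection). $|y_z|^2$ denotes $\langle y_z,y_{\bar z}\rangle$. For a conformal immersion $y:M\to S^{2m}$ of a Riemann surface and a local complex coordinate $z$, the canonical lift $Y$ is the lift of $y$ to the forward light cone with $|dY|^2=|dz|^2$. Put $V=\mathrm{Span}_{\mathbb R}\{Y,\mathrm{Re}\,Y_z,\mathrm{Im}\,Y_z,Y_{z\bar z}\}$, $V^\perp$ its orthogonal complement (the normal bundle), $D$ the connection on $V^\perp$ induced by projection. The conformal Hopf differential $\kappa\in\Gamma(V^\perp_{\mathbb C})$ and Schwarzian $s$ are defined by $Y_{zz}=-\frac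 s2Y+\kappa$. $y$ is Willmore (a critical point of $2i\int\langle\kappa,\bar\kappa\rangle dz\wedge d\bar z$) iff $D_{\bar z}D_{\bar z}\kappa+\frac{\bar s}2\kappa=0$. A Willmore surface admits a dual surface iff it is S-Willmore, i.e. $D_{\bar z}\kappa$ is a multiple of $\kappa$: $D_{\bar z}\kappa+\frac{\mu}2\kappa=0$ for some function $\mu$. **H-totally isotropic.** $y$ is totally isotropic if $\langle\partial_z^jY,\partial_z^lY\rangle=0$ for all $j,l\ge1$. Then locally there is an isotropic frame $E_1,\dots,E_m$ with $\langle E_j,E_l\rangle=0$, $\langle E_j,\bar E_l\rangle=2\delta_{jl}$, $Y_z\in\mathrm{Span}_{\mathbb C}\{E_1\}\bmod Y$, $\partial_z^jY\in\mathrm{Span}_{\mathbb C}\{E_j\}\bmod\mathrm{Span}_{\mathbb C}\{Y,E_1,\dots,E_{j-1}\}$ for $j=2,\dots,m$, and $\{E_j,\bar E_j\}_{j=2}^m$ a basis of $V^\perp_{\mathbb C}$. $y$ is H-totally isotropic if moreover $D_{\bar z}E_j\in\mathrm{Span}_{\mathbb C}\{E_2,\dots,E_m\}$ for all $j=2,\dots,m$. **Harmonic map of a normalized potential (DPW).** $G=SO^+(1,2m+1)$, $K=SO^+(1,1)\times SO(2m)$, $\sigma=\mathrm{Ad}(\mathrm{diag}(-I_2,I_{2m}))$. Given $\eta=\lambda^{-1}\eta_{-1}(z)dz$ as in the claim, let $F_-$ solve $F_-^{-1}dF_-=\eta$, $F_-(0,\lambda)=I$. Where possible (in particular near $z=0$)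 take the Iwasawa decomposition $F_-=F\cdot F_+$ with $F=F(z,\bar z,\lambda)$, $\lambda\in S^1$, a $\sigma$-twisted loop in $G$, $F(0,0,\lambda)=I$, and $F_+$ a $\sigma$-twisted loop in $G^{\mathbb C}$ extending holomorphically to $|\lambda|\le1$. For each $\lambda$, $F(\cdot,\lambda)$ is a frame of a harmonic map into $G/K$; these maps form the associated family. Writing $F=(e_0,\hat e_0,\psi_1,\hat\psi_1,\dots,\psi_m,\hat\psi_m)$, one sets $Y=\frac{\sqrt2}2(e_0-\hat e_0)$, $\hat Y=\frac{\sqrt2}2(e_0+\hat e_0)$ (determined up to the $SO^+(1,1)$ scaling freedom of the frame), and the harmonic map is $Y\wedge\hat Y$, the oriented Lorentzian plane spanned by $Y$ and $\hat Y$. *)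

(* Defs.v *)
(* MathComp / MathComp-Analysis.  Complex numbers are [R[i]] for [R : realType]
   and carry the topology of a [numFieldType].  All vectors and matrices have
   complex entries; the real ones are singled out by [mxOver Num.real]. *)
From HB Require Import structures.
From mathcomp Require Import all_boot all_order all_algebra complex.
From mathcomp Require Import all_classical all_reals all_analysis.

Set Implicit Arguments.
Unset Strict Implicit.
Unset Printing Implicit Defensive.

Import Order.TTheory GRing.Theory Num.Theory numFieldNormedType.Exports.

Local Open Scope classical_set_scope.
Local Open Scope ring_scope.

(* [R[i]] as a [numFieldType]: in this form it has its canonical topology. *)
Definition cplx (R : realType) : numFieldType := R[i].

Definition openC (R : realType) (U : set R[i]) : Prop :=
  open (U : set (cplx R)).

Definition connectedC (R : realType) (U : set R[i]) : Prop :=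
  connected (U : set (cplx R)).

Definition continuousC (R : realType) (f : R[i] -> R[i]) (z : R[i]) : Prop :=
  {for z, continuous (f : cplx R -> cplx R)}.

(* [derivable] over the field [cplx R]: complex differentiability. *)
Definition holomorphic (R : realType) (U : set R[i]) (f : R[i] -> R[i]) :
    Prop :=
  forall z, U z -> derivable (f : cplx R -> cplx R) (z : cplx R) 1.

(* Derivative of [f] at [z] in the direction [d], for the real structure of
   the plane. *)
Definition pderivable (R : realType) (d : R[i]) (f : R[i] -> R[i])
    (z : R[i]) : Prop :=
  derivable (fun t : R => complex.Re (f (z + real_complex R t * d))) 0 1 /\
  derivable (fun t : R => complex.Im (f (z + real_complex R t * d))) 0 1.

Definition pderive (R : realType) (d : R[i]) (f : R[i] -> R[i]) (z : R[i]) :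
    R[i] :=
  Complex (derive1 (fun t : R => complex.Re (f (z + real_complex R t * d))) 0)
          (derive1 (fun t : R => complex.Im (f (z + real_complex R t * d))) 0).

Fixpoint Ck (R : realType) (k : nat) (U : set R[i]) (f : R[i] -> R[i]) : Prop :=
  match k with
  | 0 => forall z, U z -> continuousC f z
  | k'.+1 => [/\ forall z, U z -> pderivable 1 f z /\ pderivable 'i f z,
                 Ck k' U (pderive 1 f) & Ck k' U (pderive 'i f)]
  end.

Definition smooth (R : realType) p q (U : set R[i])
    (f : R[i] -> 'M[R[i]]_(p, q)) : Prop :=
  forall k i j, Ck k U (fun z => f z i j).

(* With z = u + iv:  d/du, d/dv, d/dz = (d/du - i d/dv)/2 and
   d/d\bar z = (d/du + i d/dv)/2. *)
Definition du (R : realType) p q (f : R[i] -> 'M[R[i]]_(p, q)) (z : R[i]) :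
    'M[R[i]]_(p, q) :=
  \matrix_(i, j) pderive 1 (fun w => f w i j) z.

Definition dv (R : realType) p q (f : R[i] -> 'M[R[i]]_(p, q)) (z : R[i]) :
    'M[R[i]]_(p, q) :=
  \matrix_(i, j) pderive 'i (fun w => f w i j) z.

Definition dz (R : realType) p q (f : R[i] -> 'M[R[i]]_(p, q)) (z : R[i]) :
    'M[R[i]]_(p, q) :=
  2^-1 *: (du f z - 'i *: dv f z).

Definition dzb (R : realType) p q (f : R[i] -> 'M[R[i]]_(p, q)) (z : R[i]) :
    'M[R[i]]_(p, q) :=
  2^-1 *: (du f z + 'i *: dv f z).

Definition mxconj (R : realType) p q (A : 'M[R[i]]_(p, q)) : 'M[R[i]]_(p, q) :=
  map_mx (fun a : R[i] => Num.conj a) A.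

Definition realmx (R : realType) p q (A : 'M[R[i]]_(p, q)) : Prop :=
  A \is a mxOver Num.real.

(* Complex bilinear, not Hermitian. *)
Definition dot (R : realType) n (u v : 'cV[R[i]]_n) : R[i] :=
  \sum_j u j 0 * v j 0.

Definition lor (R : realType) n (u v : 'cV[R[i]]_n.+1) : R[i] :=
  - (u ord0 0 * v ord0 0)
  + \sum_(j < n) u (lift ord0 j) 0 * v (lift ord0 j) 0.

Definition minkowski (R : realType) n : 'M[R[i]]_n.+1 :=
  diag_mx (\row_j (if j == ord0 then -1 else 1)).

Definition on_sphere (R : realType) n (y : 'cV[R[i]]_n) : Prop :=
  realmx y /\ dot y y = 1.

(* [(x_0, ..., x_n)] |-> (x_1, ..., x_n) / x_0. *)
Definition bracket (R : realType) n (X : 'cV[R[i]]_n.+1) : 'cV[R[i]]_n :=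
  \col_j (X (lift ord0 j) 0 / X ord0 0).

Definition lift1 (R : realType) n (y : 'cV[R[i]]_n) : 'cV[R[i]]_n.+1 :=
  col_mx (1%:M : 'M[R[i]]_1) y.

(* Inverse stereographic projection R^n -> S^n. *)
Definition inv_stereo (R : realType) n (x : 'cV[R[i]]_n) : 'cV[R[i]]_n.+1 :=
  (1 + dot x x)^-1 *: col_mx ((1 - dot x x)%:M : 'M[R[i]]_1) (2 *: x).

Definition SO_C (R : realType) n (A : 'M[R[i]]_n.+1) : Prop :=
  A^T *m minkowski R n *m A = minkowski R n /\ \det A = 1.

(* Positivity of the (0,0) entry: the forward light cone is preserved. *)
Definition SOp (R : realType) n (A : 'M[R[i]]_n.+1) : Prop :=
  [/\ realmx A, SO_C A & 0 < A ord0 ord0].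

Definition Op (R : realType) n (A : 'M[R[i]]_n.+1) : Prop :=
  [/\ realmx A, A^T *m minkowski R n *m A = minkowski R n
    & 0 < A ord0 ord0].

Definition conformal_immersion (R : realType) n (U : set R[i])
    (y : R[i] -> 'cV[R[i]]_n) : Prop :=
  smooth U y /\
  forall z, U z -> [/\ 0 < dot (du y z) (du y z),
                       dot (du y z) (du y z) = dot (dv y z) (dv y z)
                     & dot (du y z) (dv y z) = 0].

(* The forward lift of [y] with |dY|^2 = |dz|^2. *)
Definition canonical_lift (R : realType) n (y : R[i] -> 'cV[R[i]]_n)
    (Y : R[i] -> 'cV[R[i]]_n.+1) : Prop :=
  smooth setT Y /\
  forall z, [/\ realmx (Y z) /\ 0 < Y z ord0 0,
                Y z = Y z ord0 0 *: lift1 (y z),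
                lor (du Y z) (du Y z) = 1,
                lor (dv Y z) (dv Y z) = 1
              & lor (du Y z) (dv Y z) = 0].

(* The complexification of V = Span_R {Y, Re Y_z, Im Y_z, Y_{z\bar z}}, and
   its orthogonal complement, at [z]. *)
Definition tangential (R : realType) n (Y : R[i] -> 'cV[R[i]]_n.+1)
    (z : R[i]) (v : 'cV[R[i]]_n.+1) : Prop :=
  exists a b c d : R[i],
    v = a *: Y z + b *: dz Y z + c *: mxconj (dz Y z) + d *: dzb (dz Y) z.

Definition normalC (R : realType) n (Y : R[i] -> 'cV[R[i]]_n.+1)
    (z : R[i]) (v : 'cV[R[i]]_n.+1) : Prop :=
  forall w, tangential Y z w -> lor v w = 0.

(* [w] is the projection of [v] to the (complexified) normal space at [z]. *)
Definition normal_part (R : realType) n (Y : R[i] -> 'cV[R[i]]_n.+1)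
    (z : R[i]) (v w : 'cV[R[i]]_n.+1) : Prop :=
  normalC Y z w /\ tangential Y z (v - w).

(* [chi] = D_{\bar z} [psi] at [z]. *)
Definition Dzb (R : realType) n (Y : R[i] -> 'cV[R[i]]_n.+1)
    (psi : R[i] -> 'cV[R[i]]_n.+1) (z : R[i]) (chi : 'cV[R[i]]_n.+1) : Prop :=
  normal_part Y z (dzb psi z) chi.

(* This determines [s] (the Schwarzian) and [kappa] (the conformal Hopf
   differential), since Y is nonzero and tangential. *)
Definition hopf_schwarz (R : realType) n (Y : R[i] -> 'cV[R[i]]_n.+1)
    (s : R[i] -> R[i]) (kappa : R[i] -> 'cV[R[i]]_n.+1) : Prop :=
  forall z, normalC Y z (kappa z) /\
            dz (dz Y) z = - (s z / 2) *: Y z + kappa z.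

(* D_{\bar z} D_{\bar z} kappa + (\bar s / 2) kappa = 0; all the data are
   determined by [y]. *)
Definition willmore (R : realType) n (y : R[i] -> 'cV[R[i]]_n) : Prop :=
  exists Y s kappa kappa1 kappa2,
    [/\ canonical_lift y Y, hopf_schwarz Y s kappa,
        forall z, Dzb Y kappa z (kappa1 z),
        forall z, Dzb Y kappa1 z (kappa2 z)
      & forall z, kappa2 z + (Num.conj (s z) / 2) *: kappa z = 0].

(* D_{\bar z} kappa + (mu / 2) kappa = 0: the Willmore surfaces that admit a
   dual surface. *)
Definition S_willmore (R : realType) n (y : R[i] -> 'cV[R[i]]_n) : Prop :=
  willmore y /\
  exists Y s kappa kappa1 (mu : R[i] -> R[i]),
    [/\ canonical_lift y Y, hopf_schwarz Y s kappa,
        forall z, Dzb Y kappa z (kappa1 z)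
      & forall z, kappa1 z + (mu z / 2) *: kappa z = 0].

Definition totally_isotropic (R : realType) n (Y : R[i] -> 'cV[R[i]]_n.+1) :
    Prop :=
  forall j l z, (0 < j)%N -> (0 < l)%N ->
    lor (iter j (@dz R _ _) Y z) (iter l (@dz R _ _) Y z) = 0.

(* The isotropic frame E_1, ..., E_m over [U]; the indices of [E] outside
   1, ..., m are not used.  The basis property of {E_j, \bar E_j : 2 <= j <= m}
   is membership and generation: linear independence is forced by the
   orthogonality relations. *)
Definition isotropic_frame (R : realType) n (m : nat)
    (Y : R[i] -> 'cV[R[i]]_n.+1) (U : set R[i])
    (E : nat -> R[i] -> 'cV[R[i]]_n.+1) : Prop :=
  (forall j, (1 <= j <= m)%N -> smooth U (E j)) /\
  forall z, U z ->
  [/\ forall j l, (1 <= j <= m)%N -> (1 <= l <= m)%N ->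
        lor (E j z) (E l z) = 0 /\
        lor (E j z) (mxconj (E l z)) = (if j == l then 2 else 0),
      forall j, (1 <= j <= m)%N -> exists a b (c : nat -> R[i]),
        iter j (@dz R _ _) Y z =
        a *: E j z + (b *: Y z + \sum_(1 <= l < j) c l *: E l z),
      forall j, (2 <= j <= m)%N ->
        normalC Y z (E j z) /\ normalC Y z (mxconj (E j z))
    & forall v, normalC Y z v -> exists a b : nat -> R[i],
        v = \sum_(2 <= j < m.+1) (a j *: E j z + b j *: mxconj (E j z))].

Definition H_totally_isotropic (R : realType) n (m : nat)
    (y : R[i] -> 'cV[R[i]]_n) : Prop :=
  exists2 Y, canonical_lift y Y &
  totally_isotropic Y /\
  forall z0, exists U E, [/\ openC U, U z0, isotropic_frame m Y U E &
    forall z j, U z -> (2 <= j <= m)%N -> exists chi (a : nat -> R[i]),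
      Dzb Y (E j) z chi /\ chi = \sum_(2 <= l < m.+1) a l *: E l z].

Definition HTI_willmore_immersion (R : realType) n (m : nat)
    (y : R[i] -> 'cV[R[i]]_n) : Prop :=
  [/\ forall z, on_sphere (y z), conformal_immersion setT y, willmore y
    & H_totally_isotropic m y].

(* S^2 = C \cup {\infty}, with [None] as the point at infinity. *)
Definition sphere (R : realType) : Type := option R[i].

Definition chart_0 (R : realType) (z : R[i]) : sphere R := Some z.

Definition chart_oo (R : realType) (w : R[i]) : sphere R :=
  if w == 0 then None else Some w^-1.

(* [P] is meant to be a property that does not depend on the local coordinate. *)
Definition in_charts (R : realType) (T : Type) (P : (R[i] -> T) -> Prop)
    (y : sphere R -> T) : Prop :=
  P (fun z => y (chart_0 z)) /\ P (fun w => y (chart_oo w)).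

(* The derivative of [y] vanishes to some finite order k > 0 at 0:
   y_w = w^k Phi with Phi continuous and nonzero at 0. *)
Definition branch_point_at_0 (R : realType) n (y : R[i] -> 'cV[R[i]]_n) : Prop :=
  exists k (Phi : R[i] -> 'cV[R[i]]_n),
    [/\ (0 < k)%N, forall j, continuousC (fun w => Phi w j 0) 0, Phi 0 != 0
      & forall w, dz y w = w ^+ k *: Phi w].

(* [y] is the map [Y] on the whole sphere: the values of [Y] are given by
   homogeneous coordinates on [D] and elsewhere by continuity. *)
Definition extends_bracket (R : realType) n (D : set R[i])
    (Y : R[i] -> 'cV[R[i]]_n.+1) (y : sphere R -> 'cV[R[i]]_n) : Prop :=
  [/\ in_charts (fun f => forall z j, continuousC (fun w => f w j 0) z) y,
      forall p, on_sphere (y p)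
    & forall z, D z -> y (chart_0 z) = bracket (Y z)].

(* The mean curvature vector of an immersion vanishes: for first fundamental
   form (e, f, g), g x_uu - 2 f x_uv + e x_vv has no normal component. *)
Definition minimal_surface (R : realType) n (U : set R[i])
    (x : R[i] -> 'cV[R[i]]_n) : Prop :=
  [/\ smooth U x, forall z, U z -> realmx (x z) &
  forall z, U z ->
    let e := dot (du x z) (du x z) in
    let f := dot (du x z) (dv x z) in
    let g := dot (dv x z) (dv x z) in
    0 < e * g - f ^+ 2 /\
    forall nu, realmx nu -> dot nu (du x z) = 0 -> dot nu (dv x z) = 0 ->
      dot nu (g *: du (du x) z - (2 * f) *: du (dv x) z + e *: dv (dv x) z)
      = 0].

(* [y] is the image of the surface [x] in R^n, placed in S^n by inverse
   stereographic projection, under a Moebius transformation. *)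
Definition moebius_equivalent (R : realType) n (U : set R[i])
    (y : R[i] -> 'cV[R[i]]_n.+1) (x : R[i] -> 'cV[R[i]]_n) : Prop :=
  exists2 A : 'M[R[i]]_n.+2, Op A &
  forall z, U z -> y z = bracket (A *m lift1 (inv_stereo (x z))).

(* sigma = Ad diag(-I_2, I_6). *)
Definition sigma8 (R : realType) (A : 'M[R[i]]_8) : 'M[R[i]]_8 :=
  let D : 'M[R[i]]_(2 + 6) := block_mx (- 1%:M) 0 0 1%:M in
  (D : 'M[R[i]]_8) *m A *m (D : 'M[R[i]]_8).

(* sigma-twisted loop in G = SO^+(1,7), on |lambda| = 1. *)
Definition loop_G (R : realType) (F : R[i] -> 'M[R[i]]_8) : Prop :=
  forall l, `|l| = 1 -> SOp (F l) /\ F (- l) = sigma8 (F l).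

(* sigma-twisted loop in G^C extending holomorphically to |lambda| <= 1. *)
Definition loop_plus (R : realType) (F : R[i] -> 'M[R[i]]_8) : Prop :=
  (exists O : set R[i], [/\ openC O, [set l | `|l| <= 1] `<=` O
     & forall i j, holomorphic O (fun l => F l i j)]) /\
  forall l, `|l| <= 1 -> SO_C (F l) /\ F (- l) = sigma8 (F l).

(* Iwasawa decomposition of a single loop. *)
Definition iwasawa (R : realType) (Fm F Fp : R[i] -> 'M[R[i]]_8) : Prop :=
  [/\ forall l, `|l| = 1 -> Fm l = F l *m Fp l, loop_G F & loop_plus Fp].

Definition Bhat (R : realType) (z : R[i]) : 'M[R[i]]_(2, 6) :=
  2^-1 *: \matrix_(i < 2, j < 6)
    nth 0 (nth [::]
      [:: [:: - 'i; 1; 'i; -1; - 2 * 'i * z; 2 * z];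
          [:: 'i; -1; 'i; -1; 2 * 'i * z; - 2 * z]] i) j.

(* The potential is eta = lambda^-1 eta_{-1}(z) dz. *)
Definition eta_m1 (R : realType) (z : R[i]) : 'M[R[i]]_8 :=
  (block_mx 0 (Bhat z) (- (Bhat z)^T *m minkowski R 1) 0 : 'M[R[i]]_(2 + 6)).

(* F_-^-1 dF_- = eta, F_-(0, lambda) = I. *)
Definition potential_solution (R : realType) (Fm : R[i] -> R[i] -> 'M[R[i]]_8) :
    Prop :=
  forall l, l != 0 ->
  [/\ smooth setT (fun z => Fm z l), Fm 0 l = 1%:M &
      forall z, [/\ Fm z l \in unitmx,
        invmx (Fm z l) *m dz (fun w => Fm w l) z = l^-1 *: eta_m1 z
      & invmx (Fm z l) *m dzb (fun w => Fm w l) z = 0]].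

(* [F] is a normalized frame on [U] obtained by Iwasawa decomposition. *)
Definition dpw_frame (R : realType) (U : set R[i])
    (Fm F Fp : R[i] -> R[i] -> 'M[R[i]]_8) : Prop :=
  [/\ openC U, U 0,
      forall l, `|l| = 1 -> smooth U (fun z => F z l) /\ F 0 l = 1%:M
    & forall z, U z -> iwasawa (Fm z) (F z) (Fp z)].

(* Oriented plane, as the set of its positively oriented bases. *)
Definition oriented_plane (R : realType) n (u v : 'cV[R[i]]_n) :
    set ('cV[R[i]]_n * 'cV[R[i]]_n) :=
  [set p | exists a b c d : R[i],
     [/\ [/\ a \is Num.real, b \is Num.real, c \is Num.real & d \is Num.real],
         0 < a * d - b * c, p.1 = a *: u + b *: v & p.2 = c *: u + d *: v]].

(* The harmonic map framed by [F] takes the value Y /\ Yh, and [Y], [Yh] are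
   the two null vectors read off from [F], up to the SO^+(1,1) freedom. *)
Definition frames_wedge (R : realType) (F : 'M[R[i]]_8)
    (Y Yh : 'cV[R[i]]_8) : Prop :=
  let e0 := col ord0 F in
  let eh0 := col (lift ord0 ord0) F in
  let YF := (sqrtC 2 / 2) *: (e0 - eh0) in
  let YhF := (sqrtC 2 / 2) *: (e0 + eh0) in
  oriented_plane YF YhF = oriented_plane Y Yh /\
  exists2 a : R[i], 0 < a & YF = a *: Y /\ YhF = a^-1 *: Yh.

Definition col_of (R : realType) n (s : seq R[i]) : 'cV[R[i]]_n :=
  \col_(i < n) s`_i.

Definition varsigma (R : realType) (z : R[i]) : R[i] :=
  let r := `|z| in `|1 - r ^+ 4 / 4 - 2 * r ^+ 6 / 9|.

Definition off_curve (R : realType) : set R[i] :=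
  [set z | 1 - `|z| ^+ 4 / 4 - 2 * `|z| ^+ 6 / 9 != 0].

Definition Yvec (R : realType) (l z : R[i]) : 'cV[R[i]]_8 :=
  let r := `|z| in
  let zb := Num.conj z in
  - (sqrtC 2 / (2 * varsigma z)) *: col_of 8
  [:: -1 - r ^+ 2 - r ^+ 4 / 4 - r ^+ 6 / 9;
      1 - r ^+ 2 + r ^+ 4 / 4 + r ^+ 6 / 9;
      'i * r ^+ 2 / 2 * (l^-1 * z - l * zb);
      - (r ^+ 2 / 2) * (l^-1 * z + l * zb);
      - 'i * (l^-1 * z - l * zb);
      l^-1 * z + l * zb;
      'i * r ^+ 2 / 3 * (l^-1 * z ^+ 2 - l * zb ^+ 2);
      - (r ^+ 2 / 3) * (l^-1 * z ^+ 2 + l * zb ^+ 2)].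

Definition Yhvec (R : realType) (l z : R[i]) : 'cV[R[i]]_8 :=
  let r := `|z| in
  let zb := Num.conj z in
  (sqrtC 2 / (2 * varsigma z)) *: col_of 8
  [:: 1 + r ^+ 2 + 5 * r ^+ 4 / 4 + 4 * r ^+ 6 / 9 + r ^+ 8 / 36;
      1 - r ^+ 2 - 3 * r ^+ 4 / 4 + 4 * r ^+ 6 / 9 - r ^+ 8 / 36;
      - 'i * (l^-1 * z - l * zb) * (1 + r ^+ 6 / 9);
      (l^-1 * z + l * zb) * (1 + r ^+ 6 / 9);
      'i * r ^+ 2 / 2 * (l^-1 * z - l * zb) * (1 + 4 * r ^+ 2 / 3);
      - (r ^+ 2 / 2) * (l^-1 * z + l * zb) * (1 + 4 * r ^+ 2 / 3);
      - 'i * (l^-1 * z ^+ 2 - l * zb ^+ 2) * (1 - r ^+ 4 / 12);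
      (l^-1 * z ^+ 2 + l * zb ^+ 2) * (1 - r ^+ 4 / 12)].

Definition xvec (R : realType) (l z : R[i]) : 'cV[R[i]]_6 :=
  let r := `|z| in
  let zb := Num.conj z in
  col_of 6
  [:: 'i * (l^-1 * z - l * zb);
      - (l^-1 * z + l * zb);
      - (2 * 'i / r ^+ 2) * (l^-1 * z - l * zb);
      2 / r ^+ 2 * (l^-1 * z + l * zb);
      2 * 'i / 3 * (l^-1 * z ^+ 2 - l * zb ^+ 2);
      - (2 / 3) * (l^-1 * z ^+ 2 + l * zb ^+ 2)].

(* Main.v *)
(** Use null coordinates on C^8: p = x_0 + x_1, q = x_0 - x_1, and in each of the
    three Euclidean planes the coefficients a_k of l^-1 (-i, 1) and b_k of
    l (i, 1).  In the corresponding basis E(l) the loop parameter disappears: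
    F_- = E(l) M(z) E(l)^-1 with M polynomial in z, and Y, \hat Y are, up to
    scalar functions, E(l) applied to polynomials in z and \bar z with integer
    coefficients.  Every pointwise identity thus becomes a decidable identity of
    integer polynomials.

    DPW.  Y, \hat Y and the Gram-Schmidt process for the pseudo-Hermitian form
    <F_- v, \bar{F_- w}>, applied along a flag compatible with the grading by
    powers of l, give the real factor of the Iwasawa decomposition off the curve;
    the other factor is polynomial in l.  Two decompositions differ by a real
    constant matrix, because a function holomorphic on the disc and real on the
    circle is constant (mean value property of f and f^2); it commutes with sigma
    and is a boost of the (Y, \hat Y)-plane by continuity.  On the curve a
    Gram-Schmidt vector becomes isotropic, and the same rigidity excludes a
    decomposition.

    Surfaces.  Each null field comes with two polynomial fields A, B that span,
    together with Y and Y_z, a maximal isotropic space which contains all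
    z-derivatives of Y and whose normal part P = span(A, B) is parallel for
    D_{\bar z}; this is H-total isotropy.  By the Codazzi equation the Willmore
    expression is real, and it lies in P, hence it vanishes.  The coordinate
    w = 1/z turns the polynomial fields into polynomial fields, which gives the
    extension to the sphere. *)

From Stdlib Require Import ZArith.
Require Import Defs.
From mathcomp Require Import all_boot all_order all_algebra complex.
From mathcomp Require Import all_classical all_reals all_analysis.
From mathcomp Require Import perm ring lra zify ssrZ.
Import Order.TTheory GRing.Theory Num.Theory numFieldNormedType.Exports.
Set Implicit Arguments.
Unset Strict Implicit.
Unset Printing Implicit Defensive.
Local Open Scope classical_set_scope.
Local Open Scope ring_scope.

(** * Directional derivatives and smooth functions *)

Section RealDifferentiability.
Variable R : realType.
Local Notation C := R[i].
Local Notation RtoC := (real_complex R).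
Implicit Types (f g : C -> C) (z d v : C).

(** Every field constructed below is given by a term of a small language ([expr]), closed under d/dz
    and d/d\bar z and containing inverses and inverse square roots; smoothness of all orders and the
    symmetry of mixed derivatives become syntactic. The objects over which the theorem quantifies (a
    competing canonical lift, solution of the potential equation, frame, or extension to the sphere)
    need not lie in this class, so the uniqueness arguments touch only their values and first
    derivatives. Square roots cannot enter an integer check: identities are verified for
    unnormalized fields, and the passage to unit length is made once, abstractly. Rigidity on the
    circle must apply to an arbitrary F_+, which is complex differentiable with no control on its
    derivative; hence Cauchy's theorem is proved by bisection. It is applied in the coordinates (s,
    t) of exp(s + i t): circles about 0 become segments, no point has to be cut out of the disc, and
    the value at the centre is recovered as s tends to minus infinity. *)

Lemma conjE z : Num.conj z = Complex (complex.Re z) (- complex.Im z).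
Proof. by case: z. Qed.

Lemma ReM z w : complex.Re (z * w) =
  complex.Re z * complex.Re w - complex.Im z * complex.Im w.
Proof. by case: z w => [a b] [c e]. Qed.

Lemma ImM z w : complex.Im (z * w) =
  complex.Re z * complex.Im w + complex.Im z * complex.Re w.
Proof. by case: z w => [a b] [c e]. Qed.

Lemma ReD z w : complex.Re (z + w) = complex.Re z + complex.Re w.
Proof. by case: z w => [a b] [c e]. Qed.

Lemma ImD z w : complex.Im (z + w) = complex.Im z + complex.Im w.
Proof. by case: z w => [a b] [c e]. Qed.

Lemma ReN z : complex.Re (- z) = - complex.Re z. Proof. by case: z. Qed.

Lemma ImN z : complex.Im (- z) = - complex.Im z. Proof. by case: z. Qed.

Lemma complexP z w : complex.Re z = complex.Re w -> complex.Im z = complex.Im w ->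
  z = w.
Proof. by case: z w => [a b] [c e] /= -> ->. Qed.

Definition sqnorm z : R := complex.Re z ^+ 2 + complex.Im z ^+ 2.

Lemma sqnorm_eq0 z : (sqnorm z == 0) = (z == 0).
Proof.
by rewrite /sqnorm paddr_eq0 ?sqr_ge0 // !sqrf_eq0 eq_complex.
Qed.

Lemma ReV z : complex.Re (z^-1) = complex.Re z / sqnorm z.
Proof. by case: z. Qed.

Lemma ImV z : complex.Im (z^-1) = - complex.Im z / sqnorm z.
Proof. by case: z => a b /=; rewrite mulNr. Qed.

(** The derivative as a relation with its value: [pderive] is total and says nothing where
    [pderivable] fails, and the rules below need both facts at once. *)
Definition dirder f z d v : Prop :=
  is_derive (0 : R) 1 (fun t : R => complex.Re (f (z + RtoC t * d)))
    (complex.Re v) /\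
  is_derive (0 : R) 1 (fun t : R => complex.Im (f (z + RtoC t * d)))
    (complex.Im v).

Lemma dirder_pderivable f z d v : dirder f z d v -> pderivable d f z.
Proof. by case=> [[h _] [h' _]]. Qed.

Lemma dirder_pderive f z d v : dirder f z d v -> pderive d f z = v.
Proof.
case=> h h'; rewrite /pderive !derive1E.
by rewrite (@derive_val _ _ _ _ _ _ _ h) (@derive_val _ _ _ _ _ _ _ h'); case: v {h h'}.
Qed.

Lemma pderivable_dirder d f z : pderivable d f z -> dirder f z d (pderive d f z).
Proof.
case=> h h'; split; rewrite /pderive /= derive1E; exact: derivableP.
Qed.

Lemma dirder_eq f z d v v' : dirder f z d v -> v = v' -> dirder f z d v'.
Proof. by move=> ? <-. Qed.

Lemma dirder_cst (c : C) z d : dirder (fun=> c) z d 0.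
Proof. by split; exact: is_derive_cst. Qed.

Lemma dirder_id z d : dirder id z d d.
Proof.
have H (a b : R) : is_derive (0:R) 1 (fun t : R => a + t * b) b.
  by apply: is_derive_eq; rewrite /GRing.scale /=; ring.
split.
  rewrite (_ : (fun _ => _) = fun t => complex.Re z + t * complex.Re d) //.
  by apply/funext => t; rewrite ReD ReM /= mul0r subr0.
rewrite (_ : (fun _ => _) = fun t => complex.Im z + t * complex.Im d) //.
by apply/funext => t; rewrite ImD ImM /= mul0r addr0.
Qed.

Lemma is_derive1D (a b : R -> R) (x da db : R) : is_derive x 1 a da ->
  is_derive x 1 b db -> is_derive x 1 (fun t => a t + b t) (da + db).
Proof. by move=> ? ?; exact: is_deriveD. Qed.

Lemma is_derive1N (a : R -> R) (x da : R) : is_derive x 1 a da ->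
  is_derive x 1 (fun t => - a t) (- da).
Proof. by move=> ?; exact: is_deriveN. Qed.

Lemma is_derive1M (a b : R -> R) (x da db : R) : is_derive x 1 a da ->
  is_derive x 1 b db -> is_derive x 1 (fun t => a t * b t) (da * b x + a x * db).
Proof.
move=> ha hb; have := is_deriveM ha hb.
by rewrite /GRing.scale /= addrC [b x * _]mulrC.
Qed.

Lemma is_derive1V (a : R -> R) (x da : R) : a x != 0 -> is_derive x 1 a da ->
  is_derive x 1 (fun t => (a t)^-1) (- da / a x ^+ 2).
Proof.
move=> a0 ha; have := is_deriveV a0 ha.
by rewrite /GRing.scale /= mulNr mulrC -mulNr.
Qed.

Lemma dirderD f g z d v w : dirder f z d v -> dirder g z d w ->
  dirder (fun z => f z + g z) z d (v + w).
Proof.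
move=> [f1 f2] [g1 g2]; split.
  under eq_fun do rewrite ReD.
  by rewrite ReD; exact: is_derive1D.
under eq_fun do rewrite ImD.
by rewrite ImD; exact: is_derive1D.
Qed.

Lemma dirderM f g z d v w : dirder f z d v -> dirder g z d w ->
  dirder (fun z => f z * g z) z d (v * g z + f z * w).
Proof.
move=> [f1 f2] [g1 g2].
have E0 : z + RtoC 0 * d = z by rewrite rmorph0 mul0r addr0.
split.
  under eq_fun do rewrite ReM.
  have := is_derive1D (is_derive1M f1 g1) (is_derive1N (is_derive1M f2 g2)).
  rewrite !E0 => h; apply: (is_derive_eq h).
  by rewrite ReD !ReM; ring.
under eq_fun do rewrite ImM.
have := is_derive1D (is_derive1M f1 g2) (is_derive1M f2 g1).
rewrite !E0 => h; apply: (is_derive_eq h).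
by rewrite ImD !ImM; ring.
Qed.

Lemma dirder_conj f z d v : dirder f z d v ->
  dirder (fun z => Num.conj (f z)) z d (Num.conj v).
Proof.
move=> [f1 f2]; split.
  by under eq_fun do rewrite conjE /=; rewrite conjE.
under eq_fun do rewrite conjE /=.
by rewrite conjE; exact: is_derive1N.
Qed.

Lemma dirderV f z d v : f z != 0 -> dirder f z d v ->
  dirder (fun z => (f z)^-1) z d (- v / (f z) ^+ 2).
Proof.
move=> fz0 [f1 f2].
have E0 : z + RtoC 0 * d = z by rewrite rmorph0 mul0r addr0.
have n0 : sqnorm (f (z + RtoC 0 * d)) != 0 by rewrite E0 sqnorm_eq0.
have dn : is_derive (0:R) 1 (fun t => sqnorm (f (z + RtoC t * d)))
    (2 * (complex.Re (f z) * complex.Re v + complex.Im (f z) * complex.Im v)).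
  have := is_derive1D (is_derive1M f1 f1) (is_derive1M f2 f2).
  rewrite !E0 => h; apply: (is_derive_eq h); ring.
have dV := @is_derive1V (fun t => sqnorm (f (z + RtoC t * d))) 0 _ n0 dn.
have d1 := is_derive1M f1 dV; have d2 := is_derive1M (is_derive1N f2) dV.
have vE : - v / f z ^+ 2 = - v * ((f z)^-1 * (f z)^-1) by rewrite expr2 invfM.
move: n0 d1 d2; rewrite !E0 => n0 d1 d2; split.
  under eq_fun do rewrite ReV.
  apply: (is_derive_eq d1); rewrite vE !ReM !ImM ReN ImN ReV ImV.
  move: n0; rewrite /sqnorm => n0; field; exact: n0.
under eq_fun do rewrite ImV.
apply: (is_derive_eq d2); rewrite vE !ImM !ReM ReN ImN ReV ImV.
move: n0; rewrite /sqnorm => n0; field; exact: n0.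
Qed.

(** This is w^(-1/2) for w > 0. It reads only the real part, so it is real-valued and invariant
    under conjugation for every argument. *)
Definition rsq (w : C) : C := RtoC (Num.sqrt (complex.Re w))^-1.

Lemma rsq_gt0 w : 0 < w -> 0 < rsq w.
Proof. by rewrite !ltcE /= eqxx invr_gt0 sqrtr_gt0 => /andP[]. Qed.

Lemma gt0_complex (w : C) : 0 < w -> 0 < complex.Re w /\ w = RtoC (complex.Re w).
Proof. by rewrite ltcE /= => /andP[/eqP h ?]; split => //; exact: complexP. Qed.

Lemma rsq_sqr w : 0 < w -> rsq w ^+ 2 * w = 1.
Proof.
move=> /gt0_complex [r0 ->].
rewrite /rsq /= -rmorphXn -rmorphM /= exprVn sqr_sqrtr ?ltW // mulVf ?rmorph1 //.
by rewrite gt_eqF.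
Qed.

Lemma conj_rsq w : Num.conj (rsq w) = rsq w.
Proof. by rewrite conjE /= oppr0. Qed.

Lemma near_dirder f g z d v (U : set C) : Defs.openC U -> U z ->
  (forall w, U w -> f w = g w) -> dirder f z d v -> dirder g z d v.
Proof.
move=> oU Uz fg [h1 h2].
suff nr : \forall t \near (0:R), f (z + RtoC t * d) = g (z + RtoC t * d).
  split; [apply: near_eq_is_derive h1|apply: near_eq_is_derive h2];
    by near=> t; rewrite (near nr t).
suff : \forall t \near (0:R), U (z + RtoC t * d).
  by apply: filterS => t /fg.
have /(@nbhs_ballP (cplx R)) [/= e e0 He] : nbhs (z : cplx R) U by apply: open_nbhs_nbhs.
have [e0' eR] := gt0_complex e0.
(* An upper bound of |d| that is positive also for [d = 0]. *)
pose nd := Num.sqrt (complex.Re d ^+ 2 + complex.Im d ^+ 2) + 1.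
have nd0 : 0 < nd by rewrite ltr_wpDl // sqrtr_ge0.
near=> t; apply: He; rewrite /ball /= opprD addNKr normrN normrM.
rewrite eR !normc_def /= expr0n /= addr0 sqrtr_sqr -rmorphM ltcR.
apply: le_lt_trans (_ : `|t| * nd < _).
  by rewrite ler_wpM2l // /nd lerDl.
rewrite -ltr_pdivlMr //.
near: t; apply/nbhs_ballP; exists (complex.Re e / nd) => /=; first by rewrite divr_gt0.
by move=> t; rewrite /ball /= sub0r normrN.
Unshelve. all: by end_near.
Qed.

Lemma dirder_rsq f z d v (U : set C) : Defs.openC U -> U z ->
  (forall w, U w -> 0 < f w) -> dirder f z d v ->
  dirder (fun z => rsq (f z)) z d (- 2^-1 * rsq (f z) ^+ 3 * v).
Proof.
move=> oU Uz fp [f1 f2]; have fz0 := fp _ Uz.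
have E0 : z + RtoC 0 * d = z by rewrite rmorph0 mul0r addr0.
have [r0 i0] := gt0_complex fz0.
(* Near [z] the function equals its own real part, so its derivative is real. *)
have v0 : complex.Im v = 0.
  have [_ H] : dirder (fun w => RtoC (complex.Re (f w))) z d v.
    by apply: (near_dirder oU Uz (f := f)) => // w /fp /gt0_complex[].
  by rewrite -(@derive_val _ _ _ _ _ _ _ H) /= derive_cst.
have cE : - 2^-1 * rsq (f z) ^+ 3 =
    RtoC (- 2^-1 * (Num.sqrt (complex.Re (f z)))^-1 ^+ 3).
  by rewrite rmorphM rmorphN fmorphV rmorph_nat rmorphXn.
split; last first.
  rewrite cE (_ : complex.Im _ = 0); first exact: is_derive_cst.
  by rewrite ImM /= v0 mulr0 mul0r addr0.
set a := fun t => complex.Re (f (z + RtoC t * d)) in f1.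
have a0 : a 0 = complex.Re (f z) by rewrite /a E0.
have r0' : 0 < a 0 by rewrite a0.
have ds := is_derive1_sqrt r0'.
have dc := is_derive1_comp ds f1.
have n0 : (Num.sqrt \o a) 0 != 0 by rewrite /= gt_eqF // sqrtr_gt0.
apply: (is_derive_eq (is_derive1V n0 dc)).
rewrite cE ReM /= mul0r subr0 -a0.
rewrite /= in n0; move: (Num.sqrt _) n0 => s s0; field.
by rewrite s0.
Qed.

End RealDifferentiability.

Section SmoothFunctions.
Variable R : realType.
Local Notation C := R[i].
Local Notation RtoC := (real_complex R).
Implicit Types (f g : C -> C) (z d v : C) (U : set C).

Lemma continuousC_dist f z : (forall e : R, 0 < e -> exists2 dl : R, 0 < dl &
    forall w, `|z - w| < RtoC dl -> `|f z - f w| < RtoC e) -> continuousC f z.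
Proof.
move=> H; apply/(@cvgrPdist_lt (cplx R) (cplx R) (cplx R) (nbhs (z : cplx R)) (nbhs_filter _) f) => e /gt0_complex[e0 ->].
have [dl dl0 Hd] := H _ e0.
apply/(@nbhs_ballP (cplx R)); exists (RtoC dl) => /=; first by rewrite ltcR.
by move=> w; rewrite /ball /=; exact: Hd.
Qed.

Lemma continuousC_distP f z : continuousC f z -> forall e : R, 0 < e ->
  exists2 dl : R, 0 < dl & forall w, `|z - w| < RtoC dl -> `|f z - f w| < RtoC e.
Proof.
move=> cf e e0; have e0' : 0 < RtoC e by rewrite ltcR.
have /(@cvgrPdist_lt (cplx R) (cplx R) (cplx R) (nbhs (z : cplx R)) (nbhs_filter _) f) /(_ _ e0') := cf.
move=> /(@nbhs_ballP (cplx R)) [dl /gt0_complex [dl0 ->] H].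
by exists (complex.Re dl) => // w hw; apply: H.
Qed.

Lemma continuousC_cst (c : C) z : continuousC (fun=> c) z.
Proof. exact: (@cst_continuous (cplx R) (cplx R) c z). Qed.

Lemma continuousC_id z : continuousC id z.
Proof. by move=> A. Qed.

Lemma continuousCD f g z : continuousC f z -> continuousC g z ->
  continuousC (fun z => f z + g z) z.
Proof. by move=> cf cg; have := @continuousD (cplx R) (cplx R) (cplx R) f g z cf cg. Qed.

Lemma continuousCM f g z : continuousC f z -> continuousC g z ->
  continuousC (fun z => f z * g z) z.
Proof. by move=> cf cg; have := @continuousM (cplx R) (cplx R) f g z cf cg. Qed.

Lemma continuousCV f z : f z != 0 -> continuousC f z ->
  continuousC (fun z => (f z)^-1) z.
Proof. by move=> cf cg; exact: (@continuousV (cplx R) (cplx R) f). Qed.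

Lemma continuousC_conj f z : continuousC f z ->
  continuousC (fun z => Num.conj (f z)) z.
Proof.
move=> /continuousC_distP H; apply: continuousC_dist => e /H[dl dl0 Hd].
by exists dl => // w /Hd; rewrite -rmorphB norm_conjC.
Qed.

Lemma continuousC_rsq f z : 0 < f z -> continuousC f z ->
  continuousC (fun z => rsq (f z)) z.
Proof.
move=> /gt0_complex[r0 _] /continuousC_distP H; apply: continuousC_dist => e e0.
have cs : {for complex.Re (f z), continuous (fun x : R => (Num.sqrt x)^-1)}.
  apply: continuousV; last exact: sqrt_continuous.
  by rewrite gt_eqF // sqrtr_gt0.
have /cvgrPdist_lt /(_ _ e0) /nbhs_ballP [d1 /= d10 H1] := cs.
have [dl dl0 Hd] := H _ d10; exists dl => // w /Hd hw.
rewrite /rsq -rmorphB normc_def /= expr0n /= addr0 sqrtr_sqr ltcR.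
apply: H1; rewrite /ball /=.
have := le_lt_trans (normc_ge_Re _) hw.
by rewrite ltcR ReD ReN.
Qed.

Lemma near_continuousC f g z U : Defs.openC U -> U z ->
  (forall w, U w -> f w = g w) -> continuousC f z -> continuousC g z.
Proof.
move=> oU Uz fg cf.
have nU : nbhs (z : cplx R) U by apply: open_nbhs_nbhs.
rewrite /continuousC /prop_for /continuous_at -fg //.
move=> A /cf; rewrite /= /nbhs /= => h; apply: filterS2 nU h => w /fg /= <-.
by [].
Qed.

Lemma openCT : Defs.openC [set: C]. Proof. exact: openT. Qed.

(** Reified functions of z and \bar z. Since [ediff] sends terms to terms, facts about derivatives
    of all orders follow by induction on one term. *)
Inductive expr :=
  | ECst of C | EVar | EConj | EAdd of expr & expr | EMul of expr & expr
  | EInv of expr | ERsq of expr.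

Fixpoint ev (e : expr) z : C := match e with
  | ECst c => c | EVar => z | EConj => Num.conj z
  | EAdd a b => ev a z + ev b z | EMul a b => ev a z * ev b z
  | EInv a => (ev a z)^-1 | ERsq a => rsq (ev a z)
  end.

Fixpoint wf U (e : expr) : Prop := match e with
  | EAdd a b | EMul a b => wf U a /\ wf U b
  | EInv a => wf U a /\ forall z, U z -> ev a z != 0
  | ERsq a => wf U a /\ forall z, U z -> 0 < ev a z
  | _ => True
  end.

(* Formal differential [a d/dz + b d/d\bar z]. *)
Fixpoint ediff (a b : C) (e : expr) : expr := match e with
  | ECst _ => ECst 0 | EVar => ECst a | EConj => ECst b
  | EAdd e f => EAdd (ediff a b e) (ediff a b f)
  | EMul e f => EAdd (EMul (ediff a b e) f) (EMul e (ediff a b f))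
  | EInv e => EMul (EMul (ECst (-1)) (EMul (EInv e) (EInv e))) (ediff a b e)
  | ERsq e => EMul (EMul (ECst (- 2^-1)) (EMul (ERsq e) (EMul (ERsq e) (ERsq e))))
                   (ediff a b e)
  end.

Fixpoint econj (e : expr) : expr := match e with
  | ECst c => ECst (Num.conj c) | EVar => EConj | EConj => EVar
  | EAdd e f => EAdd (econj e) (econj f)
  | EMul e f => EMul (econj e) (econj f)
  | EInv e => EInv (econj e) | ERsq e => ERsq (econj e)
  end.

Lemma rsqJ z : rsq (Num.conj z) = rsq z.
Proof. by case: z. Qed.

Lemma ev_econj e z : ev (econj e) z = Num.conj (ev e z).
Proof.
elim: e => //= [|e -> f ->|e -> f ->|e ->|e ->]; rewrite ?conjCK ?rmorphD ?rmorphM ?fmorphV //.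
by rewrite conj_rsq rsqJ.
Qed.

Lemma wf_econj U e : wf U e -> wf U (econj e).
Proof.
elim: e => //= [e he f hf [/he ? /hf] //|e he f hf [/he ? /hf] //|e he [/he ? H]|e he [/he ? H]].
  by split=> // z /H; rewrite ev_econj fmorph_eq0.
by split=> // z /H /gt0_complex[]; rewrite ev_econj !ltcE conjE /= => ? ->; rewrite oppr0 eqxx.
Qed.

Lemma wf_ediff U a b e : wf U e -> wf U (ediff a b e).
Proof.
by elim: e => //= [e he f hf [/he ? /hf] //|e he f hf [? ?]|e he [? ?]|e he [? ?]];
  do !split=> //; auto.
Qed.

Lemma ev_ediffE a b e z :
  ev (ediff a b e) z = a * ev (ediff 1 0 e) z + b * ev (ediff 0 1 e) z.
Proof.
by elim: e => [c|||e he f hf|e he f hf|e he|e he] /=; rewrite ?he ?hf; ring.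
Qed.

(** Symmetry of mixed derivatives on terms: once the formal rules are unfolded, both orders agree as
    ring expressions. *)
Lemma ev_ediffC a b a' b' e z :
  ev (ediff a b (ediff a' b' e)) z = ev (ediff a' b' (ediff a b e)) z.
Proof.
elim: e => [c|||e he f hf|e he f hf|e he|e he] //=; rewrite ?he ?hf //; ring.
Qed.

Lemma dirder_ev U e z d : Defs.openC U -> U z -> wf U e ->
  dirder (ev e) z d (ev (ediff d (Num.conj d) e) z).
Proof.
move=> oU Uz; elim: e => [c|||e he f hf|e he f hf|e he|e he] /=.
- by move=> _; exact: dirder_cst.
- by move=> _; exact: dirder_id.
- by move=> _; exact/dirder_conj/dirder_id.
- by case=> /he ? /hf; exact: dirderD.
- by case=> /he ? /hf; exact: dirderM.
- case=> /he h /(_ _ Uz) e0; apply: dirder_eq (dirderV e0 h) _.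
  by rewrite expr2 invfM; ring.
- case=> /he h p; apply: dirder_eq (dirder_rsq oU Uz p h) _.
  by rewrite !exprS expr0; ring.
Qed.

Lemma continuousC_ev U e z : U z -> wf U e -> continuousC (ev e) z.
Proof.
move=> Uz; elim: e => [c|||e he f hf|e he f hf|e he|e he] /=.
- by move=> _; exact: continuousC_cst.
- by move=> _; exact: continuousC_id.
- by move=> _; exact/continuousC_conj/continuousC_id.
- by case=> /he ? /hf; exact: continuousCD.
- by case=> /he ? /hf; exact: continuousCM.
- by case=> /he h /(_ _ Uz) h0; exact: continuousCV.
- by case=> /he h /(_ _ Uz) h0; exact: continuousC_rsq.
Qed.

(* A class of smooth functions that is visibly closed under [pderive]. *)
Definition sm U f := exists2 e, wf U e & forall z, U z -> f z = ev e z.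

Lemma sm_dirder U f e z d : Defs.openC U -> U z -> wf U e ->
  (forall z, U z -> f z = ev e z) ->
  dirder f z d (ev (ediff d (Num.conj d) e) z).
Proof.
move=> oU Uz we fe; apply: (near_dirder oU Uz (f := ev e)); last exact: dirder_ev Uz _.
by move=> w /fe.
Qed.

Lemma sm_Ck U f k : Defs.openC U -> sm U f -> Ck k U f.
Proof.
move=> oU; elim: k f => [|k IH] f [e we fe] /=.
  move=> z Uz; apply: (near_continuousC oU Uz (f := ev e)); first by move=> ? /fe.
  exact: continuousC_ev we.
split.
- by move=> z Uz; split; apply: dirder_pderivable; exact: sm_dirder fe.
- apply: IH; exists (ediff 1 (Num.conj 1) e); first exact: wf_ediff.
  by move=> z Uz; apply: dirder_pderive; exact: sm_dirder fe.
- apply: IH; exists (ediff 'i (Num.conj 'i) e); first exact: wf_ediff.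
  by move=> z Uz; apply: dirder_pderive; exact: sm_dirder fe.
Qed.

Lemma sm_continuousC U f z : Defs.openC U -> U z -> sm U f -> continuousC f z.
Proof. by move=> oU Uz /(sm_Ck 0 oU); exact. Qed.

Definition wz f z : C := 2^-1 * (pderive 1 f z - 'i * pderive 'i f z).
Definition wzb f z : C := 2^-1 * (pderive 1 f z + 'i * pderive 'i f z).

Lemma pderive_ev U f e z d : Defs.openC U -> U z -> wf U e ->
  (forall z, U z -> f z = ev e z) ->
  pderive d f z = d * ev (ediff 1 0 e) z + Num.conj d * ev (ediff 0 1 e) z.
Proof.
by move=> oU Uz we fe; rewrite (dirder_pderive (sm_dirder d oU Uz we fe)) ev_ediffE.
Qed.

Lemma ii : 'i * 'i = -1 :> C. Proof. by rewrite -expr2 sqrCi. Qed.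

Lemma wz_ev U f e z : Defs.openC U -> U z -> wf U e ->
  (forall z, U z -> f z = ev e z) -> wz f z = ev (ediff 1 0 e) z.
Proof.
move=> oU Uz we fe; rewrite /wz !(pderive_ev _ oU Uz we fe) conjC1 conjCi.
set a := ev _ _; set b := ev _ _.
have -> : 1 * a + 1 * b - 'i * ('i * a + - 'i * b) =
  a + b - ('i * 'i) * a + ('i * 'i) * b by ring.
by rewrite ii; field.
Qed.

Lemma wzb_ev U f e z : Defs.openC U -> U z -> wf U e ->
  (forall z, U z -> f z = ev e z) -> wzb f z = ev (ediff 0 1 e) z.
Proof.
move=> oU Uz we fe; rewrite /wzb !(pderive_ev _ oU Uz we fe) conjC1 conjCi.
set a := ev _ _; set b := ev _ _.
have -> : 1 * a + 1 * b + 'i * ('i * a + - 'i * b) =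
  a + b + ('i * 'i) * a - ('i * 'i) * b by ring.
by rewrite ii; field.
Qed.

Lemma pderive_wz U f z d : Defs.openC U -> U z -> sm U f ->
  pderive d f z = d * wz f z + Num.conj d * wzb f z.
Proof.
by move=> oU Uz [e we fe]; rewrite (pderive_ev d oU Uz we fe) (wz_ev oU Uz we fe) (wzb_ev oU Uz we fe).
Qed.

Lemma sm_cst U (c : C) : sm U (fun=> c). Proof. by exists (ECst c). Qed.
Lemma sm_id U : sm U id. Proof. by exists EVar. Qed.

Lemma sm_conj U f : sm U f -> sm U (fun z => Num.conj (f z)).
Proof.
by case=> e we fe; exists (econj e); [exact: wf_econj|move=> z /fe ->; rewrite ev_econj].
Qed.

Lemma smD U f g : sm U f -> sm U g -> sm U (fun z => f z + g z).
Proof.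
by move=> [e we fe] [e' we' fe']; exists (EAdd e e') => // z Uz; rewrite /= fe // fe'.
Qed.

Lemma smM U f g : sm U f -> sm U g -> sm U (fun z => f z * g z).
Proof.
by move=> [e we fe] [e' we' fe']; exists (EMul e e') => // z Uz; rewrite /= fe // fe'.
Qed.

Lemma smN U f : sm U f -> sm U (fun z => - f z).
Proof.
move=> [e we fe]; exists (EMul (ECst (-1)) e) => // z Uz.
by rewrite /= fe // mulN1r.
Qed.

Lemma smX U f n : sm U f -> sm U (fun z => f z ^+ n).
Proof.
move=> hf; elim: n => [|n IH]; first by under eq_fun do rewrite expr0; exact: sm_cst.
by under eq_fun do rewrite exprS; exact: smM.
Qed.

Lemma smV U f : (forall z, U z -> f z != 0) -> sm U f -> sm U (fun z => (f z)^-1).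
Proof.
move=> h [e we fe]; exists (EInv e) => [|z Uz]; last by rewrite /= fe.
by split => // z Uz; rewrite -fe // h.
Qed.

Lemma sm_rsq U f : (forall z, U z -> 0 < f z) -> sm U f -> sm U (fun z => rsq (f z)).
Proof.
move=> h [e we fe]; exists (ERsq e) => [|z Uz]; last by rewrite /= fe.
by split => // z Uz; rewrite -fe // h.
Qed.

Lemma sm_sum U (I : Type) (r : seq I) (P : pred I) (F : I -> C -> C) :
  (forall i, sm U (F i)) -> sm U (fun z => \sum_(i <- r | P i) F i z).
Proof.
move=> h; elim: r => [|i r IH].
  by under eq_fun do rewrite big_nil; exact: sm_cst.
under eq_fun do rewrite big_cons.
by case: (P i) => //; exact: smD.
Qed.

Lemma sm_eq U f g : (forall z, U z -> f z = g z) -> sm U f -> sm U g.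
Proof. by move=> fg [e we fe]; exists e => // z Uz; rewrite -fg // fe. Qed.

Lemma sm_wz U f : Defs.openC U -> sm U f -> sm U (wz f).
Proof.
move=> oU [e we fe]; exists (ediff 1 0 e); first exact: wf_ediff.
by move=> z Uz; rewrite (wz_ev oU Uz we fe).
Qed.

Lemma sm_wzb U f : Defs.openC U -> sm U f -> sm U (wzb f).
Proof.
move=> oU [e we fe]; exists (ediff 0 1 e); first exact: wf_ediff.
by move=> z Uz; rewrite (wzb_ev oU Uz we fe).
Qed.

Section Rules.
Variable U : set C.
Hypothesis oU : Defs.openC U.

Lemma wz_eq f g z : U z -> (forall z, U z -> f z = g z) -> sm U f -> wz g z = wz f z.
Proof.
move=> Uz fg [e we fe]; rewrite (wz_ev oU Uz we fe) (wz_ev oU Uz we) // => w Uw.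
by rewrite -fg // fe.
Qed.

Lemma wzb_eq f g z : U z -> (forall z, U z -> f z = g z) -> sm U f -> wzb g z = wzb f z.
Proof.
move=> Uz fg [e we fe]; rewrite (wzb_ev oU Uz we fe) (wzb_ev oU Uz we) // => w Uw.
by rewrite -fg // fe.
Qed.

Lemma wzD f g z : U z -> sm U f -> sm U g ->
  wz (fun z => f z + g z) z = wz f z + wz g z.
Proof.
move=> Uz [e we fe] [e' we' fe']; rewrite (wz_ev oU Uz we fe) (wz_ev oU Uz we' fe').
by rewrite (wz_ev oU Uz (e := EAdd e e')) // => w Uw; rewrite /= fe // fe'.
Qed.

Lemma wzbD f g z : U z -> sm U f -> sm U g ->
  wzb (fun z => f z + g z) z = wzb f z + wzb g z.
Proof.
move=> Uz [e we fe] [e' we' fe']; rewrite (wzb_ev oU Uz we fe) (wzb_ev oU Uz we' fe').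
by rewrite (wzb_ev oU Uz (e := EAdd e e')) // => w Uw; rewrite /= fe // fe'.
Qed.

Lemma wzM f g z : U z -> sm U f -> sm U g ->
  wz (fun z => f z * g z) z = wz f z * g z + f z * wz g z.
Proof.
move=> Uz [e we fe] [e' we' fe']; rewrite (wz_ev oU Uz we fe) (wz_ev oU Uz we' fe').
rewrite (wz_ev oU Uz (e := EMul e e')) //= ?fe ?fe' // => w Uw; by rewrite /= fe // fe'.
Qed.

Lemma wzbM f g z : U z -> sm U f -> sm U g ->
  wzb (fun z => f z * g z) z = wzb f z * g z + f z * wzb g z.
Proof.
move=> Uz [e we fe] [e' we' fe']; rewrite (wzb_ev oU Uz we fe) (wzb_ev oU Uz we' fe').
rewrite (wzb_ev oU Uz (e := EMul e e')) //= ?fe ?fe' // => w Uw; by rewrite /= fe // fe'.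
Qed.

Lemma wz_cst (c : C) z : U z -> wz (fun=> c) z = 0.
Proof. by move=> Uz; rewrite (wz_ev oU Uz (e := ECst c)). Qed.

Lemma wzb_cst (c : C) z : U z -> wzb (fun=> c) z = 0.
Proof. by move=> Uz; rewrite (wzb_ev oU Uz (e := ECst c)). Qed.

Lemma wz_conj f z : U z -> sm U f ->
  wz (fun z => Num.conj (f z)) z = Num.conj (wzb f z).
Proof.
move=> Uz sf; have [e we fe] := sf.
rewrite (wz_ev oU Uz (e := econj e)); last first.
- by move=> w Uw; rewrite ev_econj fe.
- exact: wf_econj.
rewrite (wzb_ev oU Uz we fe); elim: e {we fe} => //=.
- by rewrite conjC0.
- by rewrite conjC0.
- by rewrite conjC1.
- by move=> e -> f' ->; rewrite rmorphD.
- by move=> e -> f' ->; rewrite !ev_econj rmorphD !rmorphM.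
- by move=> e ->; rewrite !ev_econj !rmorphM fmorphV rmorphN1.
- move=> e ->; rewrite !ev_econj rsqJ.
  have := conj_rsq (ev e z); move: (rsq _) => q hq.
  by rewrite !(rmorphM Num.conj) /= hq rmorphN fmorphV rmorph_nat.
Qed.

Lemma wzb_conj f z : U z -> sm U f ->
  wzb (fun z => Num.conj (f z)) z = Num.conj (wz f z).
Proof.
move=> Uz sf; apply: (can_inj (@conjCK _)).
rewrite conjCK -wz_conj //; last exact: sm_conj.
by apply: wz_eq => // w Uw; rewrite conjCK.
Qed.

Lemma wz_wzb f z : U z -> sm U f -> wz (wzb f) z = wzb (wz f) z.
Proof.
move=> Uz [e we fe].
rewrite (wz_ev oU Uz (e := ediff 0 1 e)); last first.
- by move=> w Uw; rewrite (wzb_ev oU Uw we fe).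
- exact: wf_ediff.
rewrite (wzb_ev oU Uz (e := ediff 1 0 e)); last first.
- by move=> w Uw; rewrite (wz_ev oU Uw we fe).
- exact: wf_ediff.
exact: ev_ediffC.
Qed.

Lemma wz_id z : U z -> wz id z = 1.
Proof. by move=> Uz; rewrite (wz_ev oU Uz (e := EVar)). Qed.

Lemma wzb_id z : U z -> wzb id z = 0.
Proof. by move=> Uz; rewrite (wzb_ev oU Uz (e := EVar)). Qed.

End Rules.
End SmoothFunctions.

(** * Cauchy's theorem on rectangles and rigidity on the circle *)

Section Goursat.
Variable R : realType.
Local Notation mu := (@lebesgue_measure R).
Implicit Types (a b c d x y : R) (u v : R -> R).

Definition seg_int a b u : R := \int[mu]_(x in `[a, b]) u x.

Definition cont_seg a b u := forall x, a <= x <= b -> {for x, continuous u}.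

Lemma cont_seg_within a b u : cont_seg a b u -> {within `[a, b], continuous u}.
Proof.
move=> h; apply: continuous_in_subspaceT => x; rewrite inE /= in_itv /=.
exact: h.
Qed.

Lemma seg_integrable a b u : cont_seg a b u -> mu.-integrable `[a, b] (EFin \o u).
Proof.
move=> h; apply: continuous_compact_integrable; first exact: segment_compact.
exact: cont_seg_within.
Qed.

Lemma seg_intB a b u v : cont_seg a b u -> cont_seg a b v ->
  seg_int a b (fun x => u x - v x) = seg_int a b u - seg_int a b v.
Proof. by move=> hu hv; apply: RintegralB => //; exact: seg_integrable. Qed.

Lemma seg_int_cst a b c : a <= b -> seg_int a b (fun=> c) = c * (b - a).
Proof.
move=> ab; rewrite /seg_int Rintegral_cst //= lebesgue_measure_itv /= lte_fin.
case: ltP => // ba.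
by rewrite (_ : b = a) ?subrr ?mulr0 //; apply/eqP; rewrite eq_le ba ab.
Qed.

Lemma seg_int_le a b u c : a <= b -> cont_seg a b u ->
  (forall x, a <= x <= b -> `|u x| <= c) -> `|seg_int a b u| <= c * (b - a).
Proof.
move=> ab hu h; have iu := seg_integrable hu.
have c0 : cont_seg a b (fun=> c) by move=> x _; exact: cst_continuous.
have ch : cont_seg a b (fun x => `|u x|).
  move=> x xab; apply: continuous_comp (hu _ xab) _; exact: norm_continuous.
apply: le_trans (le_normr_Rintegral _ iu) _ => //.
rewrite -seg_int_cst //; apply: le_Rintegral => //.
- exact: (seg_integrable ch).
- exact: (seg_integrable c0).
Qed.

Lemma seg_int_ge a b u c : a <= b -> cont_seg a b u ->
  (forall x, a <= x <= b -> c <= u x) -> c * (b - a) <= seg_int a b u.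
Proof.
move=> ab hu h; rewrite -seg_int_cst //; apply: le_Rintegral => //.
- by apply: seg_integrable => x _; exact: cst_continuous.
- exact: seg_integrable.
Qed.

Lemma seg_int_split a c b u : a <= c <= b -> cont_seg a b u ->
  seg_int a b u = seg_int a c u + seg_int c b u.
Proof.
move=> /andP[ac cb] hu; have iu := seg_integrable hu.
have -> : seg_int c b u = \int[mu]_(x in `]c, b]) u x.
  rewrite /seg_int Rintegral_itv_obnd_cbnd //.
  apply: (integrableS _ _ _ iu) => //.
  by apply: subset_itv; rewrite bnd_simp.
have := @Rintegral_itvB R u (BLeft a) (BRight b) c iu.
rewrite !bnd_simp => /(_ ac cb) => <-.
by rewrite /seg_int addrC subrK.
Qed.

(** Total differentiability at (s, t) with partial derivatives [p] and [q]; nothing is assumed on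
    their continuity. *)
Definition tdiff (P : R -> R -> R) (s t p q : R) := forall e : R, 0 < e ->
  exists2 dl : R, 0 < dl & forall s' t' : R, `|s' - s| < dl -> `|t' - t| < dl ->
  `|P s' t' - P s t - p * (s' - s) - q * (t' - t)| <= e * (`|s' - s| + `|t' - t|).

Lemma tdiff_cont P (s t p q : R) : tdiff P s t p q -> forall e : R, 0 < e ->
  exists2 dl : R, 0 < dl & forall s' t' : R, `|s' - s| < dl -> `|t' - t| < dl ->
  `|P s' t' - P s t| < e.
Proof.
move=> h e e0; have [dl dl0 H] := h 1 ltr01.
pose K : R := 1 + `|p| + `|q|.
have p0 := normr_ge0 p; have q0 := normr_ge0 q.
have K0 : 0 < K by rewrite /K; lra.
exists (Num.min dl (e / (4 * K))).
  by rewrite lt_min dl0 divr_gt0 // mulr_gt0.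
move=> s' t'; rewrite !lt_min => /andP[s1 s2] /andP[t1 t2].
have := H _ _ s1 t1; rewrite mul1r.
rewrite ltr_pdivlMr ?mulr_gt0 // in s2; rewrite ltr_pdivlMr ?mulr_gt0 // in t2.
have bnd (x y : R) : `|x| + 1 <= K -> `|x * y| <= `|y| * K /\ `|y| <= `|y| * K.
  move=> xK; rewrite normrM mulrC; split; first by rewrite ler_wpM2l //; lra.
  by rewrite ler_peMr //; have := normr_ge0 x; lra.
have [pe se] : `|p * (s' - s)| <= `|s' - s| * K /\ `|s' - s| <= `|s' - s| * K.
  by apply: bnd; rewrite /K; lra.
have [qe te] : `|q * (t' - t)| <= `|t' - t| * K /\ `|t' - t| <= `|t' - t| * K.
  by apply: bnd; rewrite /K; lra.
have := ler_normD (P s' t' - P s t - p * (s' - s) - q * (t' - t)) (p * (s' - s) + q * (t' - t)).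
have -> : P s' t' - P s t - p * (s' - s) - q * (t' - t) + (p * (s' - s) + q * (t' - t)) = P s' t' - P s t by ring.
have := ler_normD (p * (s' - s)) (q * (t' - t)).
lra.
Qed.

Lemma tdiff_cont1 P (s t p q : R) : tdiff P s t p q -> {for s, continuous (P ^~ t)}.
Proof.
move=> /tdiff_cont h; apply/cvgrPdist_lt => e /h[dl dl0 H].
apply/nbhs_ballP; exists dl => //= x; rewrite /ball /= distrC => hx.
by rewrite distrC; apply: H => //; rewrite subrr normr0.
Qed.

Lemma tdiff_cont2 P (s t p q : R) : tdiff P s t p q -> {for t, continuous (P s)}.
Proof.
move=> /tdiff_cont h; apply/cvgrPdist_lt => e /h[dl dl0 H].
apply/nbhs_ballP; exists dl => //= x; rewrite /ball /= distrC => hx.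
by rewrite distrC; apply: H => //; rewrite subrr normr0.
Qed.

(* The integral of the 1-form [P ds + Q dt] over the boundary of
   [a, b] x [c, d]. *)
Definition bd_int (P Q : R -> R -> R) a b c d :=
  (seg_int a b (P ^~ c) - seg_int a b (P ^~ d)) +
  (seg_int c d (Q b) - seg_int c d (Q a)).

Lemma bd_int_quarter (P Q : R -> R -> R) a m b c n d :
  a <= m <= b -> c <= n <= d ->
  (forall s t, a <= s <= b -> c <= t <= d -> {for s, continuous (P ^~ t)}) ->
  (forall s t, a <= s <= b -> c <= t <= d -> {for t, continuous (Q s)}) ->
  bd_int P Q a b c d = (bd_int P Q a m c n + bd_int P Q m b c n) +
                       (bd_int P Q a m n d + bd_int P Q m b n d).
Proof.
move=> amb cnd hP hQ; have /andP[am mb] := amb; have /andP[cn nd] := cnd.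
have ab := le_trans am mb; have cd := le_trans cn nd.
have sP t : c <= t <= d -> cont_seg a b (P ^~ t) by move=> ? s ?; exact: hP.
have sQ s : a <= s <= b -> cont_seg c d (Q s) by move=> ? t ?; exact: hQ.
rewrite /bd_int.
rewrite (seg_int_split amb (sP c _)) ?lexx // (seg_int_split amb (sP d _)) ?lexx ?andbT //.
rewrite (seg_int_split cnd (sQ a _)) ?lexx // (seg_int_split cnd (sQ b _)) ?lexx ?andbT //.
ring.
Qed.

(** Nested rectangles whose side lengths are tied to the level [n]: a property inherited by one of
    the four quarters survives along a sequence that shrinks to a point. The bounds on [x] and [y]
    keep the sequence inside the initial rectangle. *)
Lemma bisection (Bad : R -> R -> nat -> Prop) a c w h : 0 <= w -> 0 <= h ->
  (forall x y n, a <= x -> x + w / 2 ^+ n <= a + w ->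
     c <= y -> y + h / 2 ^+ n <= c + h -> Bad x y n ->
     exists i j : bool, Bad (x + i%:R * (w / 2 ^+ n.+1)) (y + j%:R * (h / 2 ^+ n.+1)) n.+1) ->
  Bad a c 0%N ->
  exists s t, [/\ a <= s <= a + w, c <= t <= c + h &
    forall n, exists x y, [/\ [/\ Bad x y n, a <= x & x + w / 2 ^+ n <= a + w],
       [/\ c <= y & y + h / 2 ^+ n <= c + h],
       x <= s <= x + w / 2 ^+ n & y <= t <= y + h / 2 ^+ n]].
Proof.
move=> w0 h0 step B0.
(* Corner and level are packed with their invariants, so that a chosen quarter is a function on [T]
   and the sequence is its iteration. *)
pose T := {p : R * R * nat | [/\ Bad p.1.1 p.1.2 p.2, a <= p.1.1,
   p.1.1 + w / 2 ^+ p.2 <= a + w, c <= p.1.2 & p.1.2 + h / 2 ^+ p.2 <= c + h]}.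
have half (z : R) n : z / 2 ^+ n = z / 2 ^+ n.+1 + z / 2 ^+ n.+1.
  by rewrite exprS invfM; field; exact: expf_neq0.
have t0P : [/\ Bad (a, c, 0%N).1.1 (a, c, 0%N).1.2 (a, c, 0%N).2, a <= (a, c, 0%N).1.1,
   (a, c, 0%N).1.1 + w / 2 ^+ (a, c, 0%N).2 <= a + w, c <= (a, c, 0%N).1.2 & (a, c, 0%N).1.2 + h / 2 ^+ (a, c, 0%N).2 <= c + h].
  by rewrite /= !expr0 !divr1.
pose t0 : T := exist _ (a, c, 0%N) t0P.
have nx (t : T) : exists t' : T, [/\ (sval t').2 = (sval t).2.+1,
    (exists i : bool, (sval t').1.1 = (sval t).1.1 + i%:R * (w / 2 ^+ (sval t).2.+1))
   & exists j : bool, (sval t').1.2 = (sval t).1.2 + j%:R * (h / 2 ^+ (sval t).2.+1)].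
  case: t => -[[x y] n] /= [B ax xw cy yh].
  have [i [j Bij]] := step _ _ _ ax xw cy yh B.
  have wn : 0 <= w / 2 ^+ n.+1 by rewrite divr_ge0 // exprn_ge0.
  have hn : 0 <= h / 2 ^+ n.+1 by rewrite divr_ge0 // exprn_ge0.
  have P' : [/\ Bad (x + i%:R * (w / 2 ^+ n.+1)) (y + j%:R * (h / 2 ^+ n.+1)) n.+1,
     a <= x + i%:R * (w / 2 ^+ n.+1),
     x + i%:R * (w / 2 ^+ n.+1) + w / 2 ^+ n.+1 <= a + w,
     c <= y + j%:R * (h / 2 ^+ n.+1) &
     y + j%:R * (h / 2 ^+ n.+1) + h / 2 ^+ n.+1 <= c + h].
    move: xw yh; rewrite (half w) (half h) => xw yh.
    by split=> //; case: (i); case: (j); rewrite ?mul1r ?mul0r; lra.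
  exists (exist _ (_, _, _) P') => /=; split => //; [by exists i|by exists j].
pose next t := sval (cid (nx t)).
pose u n := iter n next t0.
have uS n : [/\ (sval (u n.+1)).2 = (sval (u n)).2.+1,
    (exists i : bool, (sval (u n.+1)).1.1 = (sval (u n)).1.1 + i%:R * (w / 2 ^+ (sval (u n)).2.+1))
   & exists j : bool, (sval (u n.+1)).1.2 = (sval (u n)).1.2 + j%:R * (h / 2 ^+ (sval (u n)).2.+1)].
  exact: (svalP (cid (nx (u n)))).
have un n : (sval (u n)).2 = n by elim: n => // n IH; have [-> _ _] := uS n; rewrite IH.
pose X n := (sval (u n)).1.1; pose Y n := (sval (u n)).1.2.
have nested (Z : nat -> R) z : 0 <= z ->
    (forall n, exists i : bool, Z n.+1 = Z n + i%:R * (z / 2 ^+ n.+1)) ->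
    exists s, forall n, Z n <= s <= Z n + z / 2 ^+ n.
  move=> z0 hZ.
  have zn n : 0 <= z / 2 ^+ n by rewrite divr_ge0 // exprn_ge0.
  have mon n : Z n <= Z n.+1 /\ Z n.+1 + z / 2 ^+ n.+1 <= Z n + z / 2 ^+ n.
    have [i ->] := hZ n; have := zn n.+1; rewrite (half z n).
    by case: (i); rewrite ?mul1r ?mul0r => *; split; lra.
  have up n m : (n <= m)%N -> Z n <= Z m /\ Z m + z / 2 ^+ m <= Z n + z / 2 ^+ n.
    elim: m => [|m IH]; first by rewrite leqn0 => /eqP ->.
    rewrite leq_eqVlt => /orP[/eqP -> //|]; rewrite ltnS => /IH[i1 i2].
    by have [m1 m2] := mon m; split; [exact: le_trans m1|exact: le_trans m2 _].
  have bd n m : Z m <= Z n + z / 2 ^+ n.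
    case: (leqP n m) => [/up[_ hh]|/ltnW /up[hh _]].
      by apply: le_trans hh; rewrite lerDl.
    by apply: le_trans hh _; rewrite lerDl.
  have hs : has_sup (range Z).
    by split; [exists (Z 0%N); exists 0%N|exists (Z 0%N + z / 2 ^+ 0) => _ [m _ <-]].
  exists (sup (range Z)) => n; apply/andP; split.
    by apply: sup_upper_bound => //; exists n.
  by apply: ge_sup; [exists (Z 0%N); exists 0%N|move=> _ [m _ <-]].
have [s hs] : exists s, forall n, X n <= s <= X n + w / 2 ^+ n.
  by apply: nested => // n; have [_ + _] := uS n; rewrite un.
have [t ht] : exists t, forall n, Y n <= t <= Y n + h / 2 ^+ n.
  by apply: nested => // n; have [_ _ +] := uS n; rewrite un.
exists s, t; split.
- by have := hs 0%N; rewrite expr0 divr1.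
- by have := ht 0%N; rewrite expr0 divr1.
move=> n; exists (X n), (Y n); have := svalP (u n); rewrite /= un => -[? ? ? ? ?].
by split.
Qed.

(** The form P ds + Q dt is closed pointwise: the t-derivative of P and the s-derivative of Q share
    the value [k]. If the boundary integral has absolute value J > 0, some rectangle of level n has
    at least J / 4^n; at the limit point the affine parts of P and Q contribute nothing and the
    remainder is too small. *)
Lemma goursat (P Q : R -> R -> R) a b c d : a <= b -> c <= d ->
  (forall s t, a <= s <= b -> c <= t <= d ->
     exists p q k, tdiff P s t p k /\ tdiff Q s t k q) ->
  bd_int P Q a b c d = 0.
Proof.
move=> ab cd hd; apply/eqP; rewrite -normr_le0 leNgt; apply/negP => J0.
have cP s t : a <= s <= b -> c <= t <= d -> {for s, continuous (P ^~ t)}.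
  by move=> ? ?; have [||p [q [k [h _]]]] := hd s t => //; exact: tdiff_cont1 h.
have cQ s t : a <= s <= b -> c <= t <= d -> {for t, continuous (Q s)}.
  by move=> ? ?; have [||p [q [k [_ h]]]] := hd s t => //; exact: tdiff_cont2 h.
pose w : R := b - a; pose h : R := d - c.
have w0 : 0 <= w by rewrite subr_ge0.
have h0 : 0 <= h by rewrite subr_ge0.
have aw : a + w = b by rewrite addrC subrK.
have ch : c + h = d by rewrite addrC subrK.
pose J : R := `|bd_int P Q a b c d|.
pose Bad x y n := J / 4 ^+ n <= `|bd_int P Q x (x + w / 2 ^+ n) y (y + h / 2 ^+ n)|.
have half (z : R) n : z / 2 ^+ n = z / 2 ^+ n.+1 + z / 2 ^+ n.+1.
  by rewrite exprS invfM; field; exact: expf_neq0.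
have pw n : 0 <= w / 2 ^+ n by rewrite divr_ge0 // exprn_ge0.
have ph n : 0 <= h / 2 ^+ n by rewrite divr_ge0 // exprn_ge0.
have [||s [t [hs ht H]]] := @bisection Bad a c w h w0 h0.
- move=> x y n ax xb cy yd B; rewrite aw in xb; rewrite ch in yd.
  pose m := x + w / 2 ^+ n.+1; pose k := y + h / 2 ^+ n.+1.
  have xm : x + w / 2 ^+ n = m + w / 2 ^+ n.+1 by rewrite half addrA.
  have yk : y + h / 2 ^+ n = k + h / 2 ^+ n.+1 by rewrite half addrA.
  move: B; rewrite /Bad (@bd_int_quarter P Q x m _ y k); last 4 first.
  + by rewrite xm /m; have := pw n.+1; move: (w / _) => ? ?; lra.
  + by rewrite yk /k; have := ph n.+1; move: (h / _) => ? ?; lra.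
  + move=> s t sx ty; apply: cP; lra.
  + move=> s t sx ty; apply: cQ; lra.
  move=> B; apply: contrapT => /forallNP /= nB.
  have e4 : J / 4 ^+ n = 4 * (J / 4 ^+ n.+1).
    by rewrite exprS invfM; field; exact: expf_neq0.
  have N i j : `|bd_int P Q (x + (i : bool)%:R * (w / 2 ^+ n.+1))
     (x + i%:R * (w / 2 ^+ n.+1) + w / 2 ^+ n.+1) (y + (j : bool)%:R * (h / 2 ^+ n.+1))
     (y + j%:R * (h / 2 ^+ n.+1) + h / 2 ^+ n.+1)| < J / 4 ^+ n.+1.
    by rewrite ltNge; apply/negP => Bij; apply: (nB i); exists j.
  have n00 := N false false; have n01 := N false true.
  have n10 := N true false; have n11 := N true true.
  rewrite !(mul0r, mul1r, addr0) -/m -/k -xm -yk in n00 n01 n10 n11.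
  have := ler_normD (bd_int P Q x m y k + bd_int P Q m (x + w / 2 ^+ n) y k)
   (bd_int P Q x m k (y + h / 2 ^+ n) + bd_int P Q m (x + w / 2 ^+ n) k (y + h / 2 ^+ n)).
  have := ler_normD (bd_int P Q x m y k) (bd_int P Q m (x + w / 2 ^+ n) y k).
  have := ler_normD (bd_int P Q x m k (y + h / 2 ^+ n)) (bd_int P Q m (x + w / 2 ^+ n) k (y + h / 2 ^+ n)).
  lra.
- by rewrite /Bad !expr0 !divr1 aw ch.
rewrite aw in hs; rewrite ch in ht.
have [p [q [k [dP dQ]]]] := hd _ _ hs ht.
(* The summand 1 covers degenerate rectangles. With the [e] below, the remainder at level n is at
   most 2 e (K / 2^n)^2, which is half of J / 4^n. *)
pose K : R := w + h + 1.
have K0 : 0 < K by rewrite ltr_wpDl // addr_ge0.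
pose e : R := J / (4 * K ^+ 2).
have e0 : 0 < e by rewrite divr_gt0 // mulr_gt0 // exprn_gt0.
have [d1 d10 H1] := dP _ e0; have [d2 d20 H2] := dQ _ e0.
have [n Hn] : exists n, K / 2 ^+ n < Num.min d1 d2.
  have m0 : 0 < Num.min d1 d2 by rewrite lt_min d10.
  have [n hn] : exists n, K / Num.min d1 d2 < n%:R.
    by exists (Num.truncn (K / Num.min d1 d2)).+1; exact: truncnS_gt.
  exists n; rewrite ltr_pdivrMr ?exprn_gt0 // mulrC -ltr_pdivrMr //.
  apply: lt_trans hn _; rewrite -natrX ltr_nat; exact: ltn_expl.
have [x [y [[B ax xb] [cy yd] xs yt]]] := H n; rewrite aw in xb; rewrite ch in yd.
move: Hn; rewrite lt_min => /andP[Hn1 Hn2].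
have wK : w / 2 ^+ n + h / 2 ^+ n <= K / 2 ^+ n.
  by rewrite -mulrDl ler_wpM2r ?invr_ge0 ?exprn_ge0 // /K lerDl.
move: B; rewrite /Bad leNgt => /negP; apply.
have := pw n; have := ph n; set w' := w / 2 ^+ n in xb xs wK *; set h' := h / 2 ^+ n in yd yt wK *.
move=> h'0 w'0.
have eK : 2 * e * (K / 2 ^+ n) ^+ 2 < J / 4 ^+ n.
  have -> : 2 * e * (K / 2 ^+ n) ^+ 2 = J / 4 ^+ n / 2.
    rewrite /e (_ : 4 ^+ n = 2 ^+ n ^+ 2); last by rewrite exprAC; congr (_ ^+ _); rewrite -natrX.
    by field; rewrite expf_neq0 //= gt_eqF.
  by rewrite ltr_pdivrMr // ltr_pMr ?divr_gt0 ?exprn_gt0 // ltr1n.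
apply: le_lt_trans eK.
have bP s' t' : x <= s' <= x + w' -> y <= t' <= y + h' ->
    `|P s' t' - P s t - p * (s' - s) - k * (t' - t)| <= e * (w' + h').
  move=> hs' ht'.
  have l1 : `|s' - s| <= w' by rewrite ler_norml; lra.
  have l2 : `|t' - t| <= h' by rewrite ler_norml; lra.
  apply: le_trans (H1 _ _ _ _) _; [lra|lra|].
  by rewrite ler_pM2l // lerD.
have bQ s' t' : x <= s' <= x + w' -> y <= t' <= y + h' ->
    `|Q s' t' - Q s t - k * (s' - s) - q * (t' - t)| <= e * (w' + h').
  move=> hs' ht'.
  have l1 : `|s' - s| <= w' by rewrite ler_norml; lra.
  have l2 : `|t' - t| <= h' by rewrite ler_norml; lra.
  apply: le_trans (H2 _ _ _ _) _; [lra|lra|].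
  by rewrite ler_pM2l // lerD.
have xw' : x <= x + w' by rewrite lerDl.
have yh' : y <= y + h' by rewrite lerDl.
have sP t' : y <= t' <= y + h' -> cont_seg x (x + w') (P ^~ t').
  by move=> ? s' ?; apply: cP; lra.
have sQ s' : x <= s' <= x + w' -> cont_seg y (y + h') (Q s').
  by move=> ? t' ?; apply: cQ; lra.
have y1 : y <= y <= y + h' by rewrite lexx.
have y2 : y <= y + h' <= y + h' by rewrite lexx andbT.
have x1 : x <= x <= x + w' by rewrite lexx.
have x2 : x <= x + w' <= x + w' by rewrite lexx andbT.
have cB (a' b' : R) u v : cont_seg a' b' u -> cont_seg a' b' v -> cont_seg a' b' (fun z => u z - v z).
  by move=> hu hv z hz; apply: continuousB; [exact: hu|exact: hv].
have cC (a' b' r : R) : cont_seg a' b' (fun=> r) by move=> z _; exact: cst_continuous.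
(* The affine parts of P on the two horizontal sides differ by the constant -k h', those of Q on the
   vertical sides by k w'; integrated, the two contributions cancel. *)
have E1 : seg_int x (x + w') (P ^~ y) - seg_int x (x + w') (P ^~ (y + h')) + k * h' * w' =
   seg_int x (x + w') (fun z => P z y - P z (y + h') - (- (k * h'))).
  have c1 := sP _ y1; have c2 := sP _ y2.
  rewrite (seg_intB (cB _ _ _ _ c1 c2) (cC _ _ _)) (seg_intB c1 c2) seg_int_cst //; ring.
have E2 : seg_int y (y + h') (Q (x + w')) - seg_int y (y + h') (Q x) - k * w' * h' =
   seg_int y (y + h') (fun z => Q (x + w') z - Q x z - k * w').
  have c1 := sQ _ x2; have c2 := sQ _ x1.
  rewrite (seg_intB (cB _ _ _ _ c1 c2) (cC _ _ _)) (seg_intB c1 c2) seg_int_cst //; ring.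
have B1 : `|seg_int x (x + w') (P ^~ y) - seg_int x (x + w') (P ^~ (y + h')) + k * h' * w'|
   <= 2 * (e * (w' + h')) * w'.
  rewrite E1; have -> : 2 * (e * (w' + h')) * w' = 2 * (e * (w' + h')) * (x + w' - x) by ring.
  apply: seg_int_le => //.
    by exact: (cB _ _ _ _ (cB _ _ _ _ (sP _ y1) (sP _ y2)) (cC _ _ _)).
  move=> z hz; have := bP _ _ hz y1; have := bP _ _ hz y2.
  rewrite !ler_norml; lra.
have B2 : `|seg_int y (y + h') (Q (x + w')) - seg_int y (y + h') (Q x) - k * w' * h'|
   <= 2 * (e * (w' + h')) * h'.
  rewrite E2; have -> : 2 * (e * (w' + h')) * h' = 2 * (e * (w' + h')) * (y + h' - y) by ring.
  apply: seg_int_le => //.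
    by exact: (cB _ _ _ _ (cB _ _ _ _ (sQ _ x2) (sQ _ x1)) (cC _ _ _)).
  move=> z hz; have := bQ _ _ x1 hz; have := bQ _ _ x2 hz.
  rewrite !ler_norml; lra.
have -> : bd_int P Q x (x + w') y (y + h') =
  (seg_int x (x + w') (P ^~ y) - seg_int x (x + w') (P ^~ (y + h')) + k * h' * w') +
  (seg_int y (y + h') (Q (x + w')) - seg_int y (y + h') (Q x) - k * w' * h').
  by rewrite /bd_int; ring.
apply: le_trans (ler_normD _ _) _; apply: le_trans (lerD B1 B2) _.
have -> : 2 * (e * (w' + h')) * w' + 2 * (e * (w' + h')) * h' = 2 * e * (w' + h') ^+ 2 by ring.
apply: ler_wpM2l; first by rewrite mulr_ge0 // ltW.
by apply: lerXn2r => //; rewrite nnegrE ?addr_ge0 // (le_trans _ wK) ?addr_ge0.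
Qed.

End Goursat.

(** * Mean values on circles about the origin *)

Section CircleRigidity.
Variable R : realType.
Local Notation C := R[i].
Local Notation RtoC := (real_complex R).
Implicit Types (z w : C) (s t : R).

Definition cnorm z : R := complex.Re `|z|.

Lemma cnormE z : `|z| = RtoC (cnorm z).
Proof. by rewrite /cnorm normc_def. Qed.

Lemma cnorm_ge0 z : 0 <= cnorm z.
Proof. by rewrite -ler0c -cnormE. Qed.

Lemma cnormM z w : cnorm (z * w) = cnorm z * cnorm w.
Proof. by apply: complexI; rewrite rmorphM -!cnormE normrM. Qed.

Lemma cnormD z w : cnorm (z + w) <= cnorm z + cnorm w.
Proof. by rewrite -lecR rmorphD -!cnormE ler_normD. Qed.

Lemma Re_le_cnorm z : `|complex.Re z| <= cnorm z.
Proof. by rewrite -lecR -cnormE; exact: normc_ge_Re. Qed.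

Lemma Im_le_cnorm z : `|complex.Im z| <= cnorm z.
Proof.
rewrite -lecR -cnormE normc_def lecR -sqrtr_sqr ler_wsqrtr // lerDr; exact: sqr_ge0.
Qed.

Lemma cnorm_le z : cnorm z <= `|complex.Re z| + `|complex.Im z|.
Proof.
rewrite /cnorm normc_def /= -[leRHS]ger0_norm; last first.
  by rewrite addr_ge0.
rewrite -sqrtr_sqr ler_wsqrtr // sqrrD !real_normK ?num_real //.
by rewrite -addrA lerD2l lerDr mulrn_wge0 // mulr_ge0.
Qed.

(** The map exp(s + i t), that is, logarithmic polar coordinates on the punctured plane. *)
Definition polar s t : C := Complex (expR s * cos t) (expR s * sin t).

Lemma polarD s t s' t' : polar (s + s') (t + t') = polar s t * polar s' t'.
Proof.
apply: complexP; rewrite /= expRD ?cosD ?sinD; ring.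
Qed.

Lemma cnorm_polar s t : cnorm (polar s t) = expR s.
Proof.
rewrite /cnorm normc_def /= !exprMn -mulrDr cos2Dsin2 mulr1 sqrtr_sqr ger0_norm //.
Qed.

Lemma derive0_est (f : R -> R) (c : R) : is_derive (0 : R) (1:R) f c -> forall e : R, 0 < e ->
  exists2 dl : R, 0 < dl & forall x : R, `|x| < dl -> `|f x - f 0 - c * x| <= e * `|x|.
Proof.
move=> df e e0; have [+ dv] := df.
move=> /cvgrPdist_le /(_ _ e0); rewrite -/('D_1 f 0) dv.
rewrite /= near_withinE near_simpl => /nbhs_ballP[dl /= dl0 H]; exists dl => // x hx.
have [->|x0] := eqVneq x 0; first by rewrite mulr0 subr0 subrr !normr0 mulr0.
have := H x; rewrite /ball /= sub0r normrN => /(_ hx x0).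
rewrite addr0 /GRing.scale /= mulr1 => hh.
have -> : f x - f 0 - c * x = - (c - x^-1 * (f x - f 0)) * x by field.
by rewrite normrM normrN ler_wpM2r.
Qed.

Lemma polar_est (e : R) : 0 < e -> exists2 dl : R, 0 < dl & forall s t : R,
  `|s| < dl -> `|t| < dl ->
  cnorm (polar s t - 1 - Complex s t) <= e * (`|s| + `|t|).
Proof.
move=> e0; pose e1 : R := Num.min (e / 8) 1.
have e10 : 0 < e1 by rewrite lt_min ltr01 divr_gt0.
have e1e : e1 <= e / 8 by rewrite ge_min lexx.
have e11 : e1 <= 1 by rewrite ge_min lexx orbT.
have [d1 d10 H1] := derive0_est (is_derive_expR 0) e10.
have [d2 d20 H2] := derive0_est (is_derive_cos 0) e10.
have [d3 d30 H3] := derive0_est (is_derive_sin 0) e10.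
exists (Num.min (Num.min d1 d2) (Num.min d3 (e1 / 2))).
  by rewrite !lt_min d10 d20 d30 divr_gt0.
move=> s t; rewrite !lt_min => /andP[/andP[s1 s2] /andP[s3 s4]] /andP[/andP[t1 t2] /andP[t3 t4]].
have := H1 _ s1; have := H2 _ t2; have := H3 _ t3.
rewrite expR0 cos0 sin0 oppr0 !mul1r mul0r !subr0 addr0 => hs hc he.
apply: le_trans (cnorm_le _) _ => /=.
rewrite !subr0 ?oppr0 ?addr0.
have s0 := normr_ge0 s; have t0 := normr_ge0 t.
have E1 : `|expR s - 1| <= e1.
  have := ler_normD (expR s - 1 - s) s; rewrite subrK.
  have : e1 * `|s| <= 1 * `|s| by rewrite ler_wpM2r.
  lra.
have E2 : `|expR s| <= 2.
  have := ler_normD (expR s - 1) 1; rewrite subrK normr1; lra.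
have B1 : `|expR s * cos t - 1 - s| <= 2 * (e1 * `|t|) + e1 * `|s|.
  have -> : expR s * cos t - 1 - s = expR s * (cos t - 1) + (expR s - 1 - s) by ring.
  apply: le_trans (ler_normD _ _) _; apply: lerD => //.
  by rewrite normrM ler_pM.
have B2 : `|expR s * sin t - t| <= 2 * (e1 * `|t|) + e1 * `|t|.
  have -> : expR s * sin t - t = expR s * (sin t - t) + (expR s - 1) * t by ring.
  apply: le_trans (ler_normD _ _) _; apply: lerD; rewrite normrM.
    exact: ler_pM.
  by rewrite ler_wpM2r.
have B3 : e1 * `|t| <= e / 8 * `|t| by rewrite ler_wpM2r.
have B4 : e1 * `|s| <= e / 8 * `|s| by rewrite ler_wpM2r.
have B5 : 0 <= e * `|t| by rewrite mulr_ge0 // ltW.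
have B6 : 0 <= e * `|s| by rewrite mulr_ge0 // ltW.
rewrite mulrDr; lra.
Qed.

Definition cderiv (f : C -> C) z (c : C) := forall e : R, 0 < e ->
  exists2 dl : R, 0 < dl & forall h, cnorm h < dl ->
  cnorm (f (z + h) - f z - c * h) <= e * cnorm h.

Lemma derivable_cderiv (f : C -> C) z :
  derivable (f : cplx R -> cplx R) (z : cplx R) 1 -> exists c, cderiv f z c.
Proof.
set c := 'D_1 (f : cplx R -> cplx R) (z : cplx R) => df; exists c => e e0.
have e0' : 0 < RtoC e by rewrite ltcR.
have := df => /(@cvgrPdist_le (cplx R) (cplx R) _ _ _ _ _) /(_ _ e0').
rewrite near_withinE near_simpl => /(@nbhs_ballP (cplx R)) [dl /gt0_complex [dl0 ->] H].
exists (complex.Re dl) => // h hh.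
have [->|h0] := eqVneq h 0.
  by rewrite addr0 subrr mulr0 subr0 /cnorm !normr0 mulr0.
have := H h; rewrite /ball /= sub0r normrN cnormE ltcR => /(_ hh h0).
rewrite -/c [h *: 1]mulr1 [h + z]addrC.
have -> : c - h^-1 *: (f (z + h) - f z) = - (f (z + h) - f z - c * h) / h.
  by rewrite /GRing.scale /=; field.
rewrite normrM normrN normfV !cnormE -fmorphV -rmorphM lecR.
rewrite ler_pdivrMr // lt_def cnorm_ge0 andbT.
by apply: contra h0 => /eqP h0; rewrite -normr_eq0 cnormE h0 rmorph0.
Qed.

Lemma Re_est (A B k : C) s t : complex.Re (A - B - k * Complex s t) =
  complex.Re A - complex.Re B - complex.Re k * s - - complex.Im k * t.
Proof. by rewrite !ReD !ReN ReM /=; ring. Qed.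

Lemma Im_est (A B k : C) s t : complex.Im (A - B - k * Complex s t) =
  complex.Im A - complex.Im B - complex.Im k * s - complex.Re k * t.
Proof. by rewrite !ImD !ImN ImM /=; ring. Qed.

(** Chain rule for f(exp(s + i t)): the derivative in s is [k] and the one in t is i k, so that Im f
    ds + Re f dt is a closed form. *)
Lemma tdiff_polar (f : C -> C) s t c : cderiv f (polar s t) c ->
  let k := c * polar s t in
  tdiff (fun s t => complex.Re (f (polar s t))) s t (complex.Re k) (- complex.Im k) /\
  tdiff (fun s t => complex.Im (f (polar s t))) s t (complex.Im k) (complex.Re k).
Proof.
move=> df k; set z := polar s t in df k *.
suff H : forall e : R, 0 < e -> exists2 dl : R, 0 < dl & forall s' t' : R,
    `|s' - s| < dl -> `|t' - t| < dl ->
    cnorm (f (polar s' t') - f z - k * Complex (s' - s) (t' - t)) <=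
     e * (`|s' - s| + `|t' - t|).
  split=> e /H[dl dl0 Hd]; exists dl => // s' t' hs ht; apply: le_trans (Hd _ _ hs ht).
    by rewrite -Re_est; exact: Re_le_cnorm.
  by rewrite -Im_est; exact: Im_le_cnorm.
move=> e e0.
pose M : R := cnorm z + cnorm k + 1.
have cz := cnorm_ge0 z; have ck := cnorm_ge0 k.
have M0 : 0 < M by rewrite /M; lra.
have e10 : 0 < e / (4 * M) by rewrite divr_gt0 // mulr_gt0.
have [d1 d10 H1] := df _ e10.
pose e2 : R := Num.min 1 (e / (4 * M)).
have e20 : 0 < e2 by rewrite lt_min ltr01.
have [d2 d20 H2] := polar_est e20.
exists (Num.min d2 (d1 / (4 * M))).
  by rewrite lt_min d20 divr_gt0 // mulr_gt0.
move=> s' t'; rewrite !lt_min => /andP[s1 s2] /andP[t1 t2].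
have := H2 _ _ s1 t1; set sg := s' - s in s1 s2 *; set ta := t' - t in t1 t2 *.
set rho := polar sg ta - 1 - Complex sg ta => hr.
have zE : polar s' t' = z + z * (Complex sg ta + rho).
  have -> : polar s' t' = polar (s + sg) (t + ta) by congr polar; rewrite /sg /ta; ring.
  by rewrite polarD -/z /rho; ring.
set h := z * (Complex sg ta + rho) in zE.
have n0 := normr_ge0 sg; have m0 := normr_ge0 ta.
have ns : cnorm (Complex sg ta) <= `|sg| + `|ta| by exact: cnorm_le.
have hr1 : cnorm rho <= `|sg| + `|ta|.
  apply: le_trans hr _; rewrite -[leRHS]mul1r ler_wpM2r ?addr_ge0 //.
  by rewrite ge_min lexx.
have hr2 : cnorm rho <= e / (4 * M) * (`|sg| + `|ta|).
  apply: le_trans hr _; rewrite ler_wpM2r ?addr_ge0 //.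
  by rewrite ge_min lexx orbT.
have hn : cnorm h <= M * (2 * (`|sg| + `|ta|)).
  rewrite cnormM; apply: ler_pM; rewrite ?cnorm_ge0 //; first by rewrite /M; lra.
  by have := cnormD (Complex sg ta) rho; lra.
have hd : cnorm h < d1.
  apply: le_lt_trans hn _.
  rewrite ltr_pdivlMr ?mulr_gt0 // in s2; rewrite ltr_pdivlMr ?mulr_gt0 // in t2.
  rewrite mulrDr; lra.
have := H1 _ hd; rewrite -zE => h1.
have -> : f (polar s' t') - f z - k * Complex sg ta =
  (f (polar s' t') - f z - c * h) + k * rho by rewrite /h /k; ring.
apply: le_trans (cnormD _ _) _.
have b1 : e / (4 * M) * cnorm h <= e / 2 * (`|sg| + `|ta|).
  apply: le_trans (ler_wpM2l (ltW e10) hn) _.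
  rewrite le_eqVlt; apply/orP; left; apply/eqP; field; by rewrite gt_eqF.
have b2 : cnorm (k * rho) <= e / 4 * (`|sg| + `|ta|).
  rewrite cnormM; apply: le_trans (_ : M * (e / (4 * M) * (`|sg| + `|ta|)) <= _).
    by apply: ler_pM; rewrite ?cnorm_ge0 // /M; lra.
  rewrite le_eqVlt; apply/orP; left; apply/eqP; field; by rewrite gt_eqF.
have : 0 <= e * (`|sg| + `|ta|) by rewrite mulr_ge0 ?addr_ge0 // ltW.
lra.
Qed.

Definition hol_disc (f : C -> C) := forall z, `|z| <= 1 -> exists c, cderiv f z c.

Lemma polar_disc s t : s <= 0 -> `|polar s t| <= 1.
Proof.
by move=> s0; rewrite cnormE cnorm_polar -[1](rmorph1 RtoC) lecR -expR0 ler_expR.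
Qed.

(** [goursat] on [a, 0] x [0, 2 pi]: the sides t = 0 and t = 2 pi cancel by periodicity, so the mean
    over the circle of radius e^a is the same for all a <= 0. On a small circle it is close to the
    value at 0, by differentiability there. *)
Lemma circle_mean (f : C -> C) : hol_disc f ->
  seg_int 0 (2 * pi) (fun t => complex.Re (f (polar 0 t))) = 2 * pi * complex.Re (f 0).
Proof.
move=> hf; set I := seg_int _ _ _.
have pi0 : 0 < 2 * pi :> R by rewrite mulr_gt0 // pi_gt0.
have E a : a <= 0 -> seg_int 0 (2 * pi) (fun t => complex.Re (f (polar a t))) = I.
  move=> a0.
  pose P s t := complex.Im (f (polar s t)); pose Q s t := complex.Re (f (polar s t)).
  have := @goursat R P Q a 0 0 (2 * pi) a0 (ltW pi0).
  rewrite /bd_int (_ : seg_int a 0 (P^~ 0) = seg_int a 0 (P^~ (2 * pi))); last first.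
    congr seg_int; apply/funext => s; rewrite /P /polar.
    by rewrite mulr_natl cos2pi sin2pi cos0 sin0.
  rewrite subrr add0r => H; apply/esym/eqP; rewrite -subr_eq0; apply/eqP; apply: H.
  move=> s t /andP[_ s0] _; have [c hc] := hf _ (polar_disc t s0).
  have [h1 h2] := tdiff_polar hc.
  by exists (complex.Im (c * polar s t)), (- complex.Im (c * polar s t)), (complex.Re (c * polar s t)).
apply/eqP; rewrite -subr_eq0 -normr_le0 leNgt; apply/negP => D0.
set D := `|_| in D0.
have [c hc] : exists c, cderiv f 0 c by apply: hf; rewrite normr0.
pose K : R := cnorm c + 1.
have K0 : 0 < K by rewrite /K; have := cnorm_ge0 c; lra.
have [dl dl0 H] := hc _ ltr01.
(* A radius so small that the estimate ep K 2 pi of the defect falls below D; the bound by 1 makes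
   its logarithm [a] nonpositive. *)
pose ep : R := Num.min (Num.min dl 1) (D / (4 * pi * K)) / 2.
have ep1 : 0 < Num.min (Num.min dl 1) (D / (4 * pi * K)).
  by rewrite !lt_min dl0 ltr01 divr_gt0 // !mulr_gt0 // pi_gt0.
have ep0 : 0 < ep by rewrite divr_gt0.
have epm : ep < Num.min (Num.min dl 1) (D / (4 * pi * K)).
  by rewrite /ep ltr_pdivrMr // ltr_pMr // ltr1n.
move: epm; rewrite !lt_min => /andP[/andP[e1 e2] e3].
pose a := ln ep.
have ea : expR a = ep by rewrite /a lnK // posrE.
have a0 : a <= 0 by rewrite /a ln_le0 // ltW.
have ct b : b <= 0 -> cont_seg 0 (2 * pi) (fun t => complex.Re (f (polar b t))).
  move=> b0 t _; have [c' hc'] := hf _ (polar_disc t b0).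
  have [h1 _] := tdiff_polar hc'; exact: (tdiff_cont2 h1).
have cc (r : R) : cont_seg 0 (2 * pi) (fun=> r) by move=> z _; exact: cst_continuous.
have DE : I - 2 * pi * complex.Re (f 0) =
   seg_int 0 (2 * pi) (fun t => complex.Re (f (polar a t)) - complex.Re (f 0)).
  rewrite (seg_intB (ct _ a0) (cc _)) seg_int_cst ?(ltW pi0) // E //; ring.
have : D <= ep * K * (2 * pi - 0).
  rewrite /D DE; apply: seg_int_le; first exact: ltW.
    move=> t ht; apply: continuousB; [exact: ct|exact: cc].
  move=> t _; have := H (polar a t); rewrite cnorm_polar ea => /(_ e1).
  rewrite mul1r add0r => h1; rewrite -ReN -ReD.
  apply: le_trans (Re_le_cnorm _) _.
  have -> : f (polar a t) - f 0 = (f (polar a t) - f 0 - c * polar a t) + c * polar a t by ring.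
  apply: le_trans (cnormD _ _) _; rewrite cnormM cnorm_polar ea /K; lra.
rewrite subr0 leNgt => /negP; apply.
move: e3; rewrite ltr_pdivlMr ?mulr_gt0 ?pi_gt0 //.
have := mulr_gt0 (mulr_gt0 ep0 K0) pi0 => h1 h2.
have -> : ep * K * (2 * pi) = ep * (4 * pi * K) / 2 by field.
lra.
Qed.

(** The mean of -i f shows that f 0 is real. Then (f - f 0)^2 is nonnegative on the circle and has
    mean zero, so it vanishes there by continuity; the point 1 is t = 0. *)
Lemma circle_rigid1 (f : C -> C) : hol_disc f ->
  (forall z, `|z| = 1 -> f z \is Num.real) ->
  (forall c, hol_disc (fun z => c * f z)) -> hol_disc (fun z => (f z - f 0) ^+ 2) -> f 1 = f 0.
Proof.
move=> hf rf hcf hf2.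
have pi0 : 0 < 2 * pi :> R by rewrite mulr_gt0 // pi_gt0.
have n1 t : `|polar 0 t| = 1 by rewrite cnormE cnorm_polar expR0.
have im0 : complex.Im (f 0) = 0.
  have := circle_mean (hcf (Complex 0 (-1))).
  rewrite (_ : (fun t => _) = fun=> 0); last first.
    apply/funext => t; have /RIm_real h := rf _ (n1 t).
    by rewrite ReM /= mul0r sub0r mulN1r opprK; have [] := h.
  rewrite seg_int_cst ?(ltW pi0) // mul0r ReM /= mul0r sub0r mulN1r opprK => /esym/eqP.
  by rewrite mulf_eq0 gt_eqF //= => /eqP.
pose g t := complex.Re ((f (polar 0 t) - f 0) ^+ 2).
have I0 : seg_int 0 (2 * pi) g = 0.
  by rewrite /g (circle_mean hf2) subrr expr0n /= mulr0.
have gE t : g t = complex.Re (f (polar 0 t) - f 0) ^+ 2.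
  rewrite /g expr2 ReM [complex.Im _](_ : _ = 0) ?mulr0 ?subr0 ?expr2 //.
  by rewrite ImD ImN im0 subr0; have /RIm_real[] := rf _ (n1 t).
have cg t : {for t, continuous g}.
  have [c hc] := hf2 (polar 0 t) (polar_disc t (lexx 0)).
  have [h1 _] := tdiff_polar hc; exact: (tdiff_cont2 h1).
have p1 : polar 0 0 = 1 by apply: complexP; rewrite /= expR0 ?cos0 ?sin0 mul1r.
suff g0 : g 0 = 0.
  apply/eqP; rewrite -subr_eq0 eq_complex /=; apply/andP; split.
    by move/eqP: g0; rewrite gE p1 sqrf_eq0.
  by rewrite ImD ImN im0 subr0; have /RIm_real[->] := rf 1 (normr1 _).
have g_ge t : 0 <= g t by rewrite gE sqr_ge0.
apply/eqP; rewrite eq_le g_ge andbT leNgt; apply/negP => g0.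
have [dl dl0 H] : exists2 dl : R, 0 < dl & forall t : R, `|t| < dl -> g 0 / 2 < g t.
  have /cvgrPdist_lt /(_ (g 0 / 2)) := cg 0.
  rewrite divr_gt0 // => /(_ isT) /nbhs_ballP [dl /= dl0 H]; exists dl => // t ht.
  have := H t; rewrite /ball /= sub0r normrN => /(_ ht); rewrite ltr_norml; lra.
(* A segment [0, m] on which g exceeds g 0 / 2 would make the integral of the nonnegative g
   positive. *)
pose m : R := Num.min dl (2 * pi) / 2.
have m0 : 0 < m by rewrite divr_gt0 // lt_min dl0.
have m1 : m < Num.min dl (2 * pi) by rewrite ltr_pdivrMr // ltr_pMr ?ltr1n // lt_min dl0.
move: m1; rewrite lt_min => /andP[md mp].
have cgs a b : cont_seg a b g by move=> ? _; exact: cg.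
have := @seg_int_split R 0 m (2 * pi) g; rewrite I0 (ltW m0) (ltW mp) => /(_ isT (cgs _ _)).
have h1 : g 0 / 2 * (m - 0) <= seg_int 0 m g.
  apply: seg_int_ge; [exact: ltW|exact: cgs|move=> t /andP[t0 tm]].
  by apply/ltW/H; rewrite ger0_norm //; exact: le_lt_trans md.
have h2 : 0 * (2 * pi - m) <= seg_int m (2 * pi) g.
  by apply: seg_int_ge; [exact: ltW|exact: cgs|].
have : 0 < g 0 / 2 * (m - 0) by rewrite mulr_gt0 ?divr_gt0 ?subr0.
lra.
Qed.

(* Mean value property on the circle for [f] and [(f - f 0)^2]: the variance
   of [f] on the circle vanishes. *)
Lemma circle_rigid (O : set C) (f : C -> C) : [set l | `|l| <= 1] `<=` O ->
  holomorphic O f -> (forall z, `|z| = 1 -> f z \is Num.real) ->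
  forall l, `|l| = 1 -> f l = f 0.
Proof.
move=> sO hf rf l l1.
have dl z : `|z| <= 1 -> derivable (f : cplx R -> cplx R) (l * z : cplx R) 1.
  by move=> hz; apply: hf; apply: sO; rewrite /= normrM l1 mul1r.
(* Rotation by [l] moves the point [l] to 1, where [circle_rigid1] applies. *)
pose g (z : cplx R) : cplx R := f (l * z).
have dg (z : C) : `|z| <= 1 -> derivable g (z : cplx R) 1.
  move=> hz; apply/derivable1_diffP.
  apply: (@differentiable_comp (cplx R) (cplx R) (cplx R) (cplx R) (fun z => l * z) f).
    have h : derivable (cst (l : cplx R) * (@id (cplx R))) (z : cplx R) 1.
      by apply: derivableM; [exact: derivable_cst|exact: derivable_id].
    exact/derivable1_diffP.
  by apply/derivable1_diffP; exact: dl.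
have dm (u v : cplx R -> cplx R) (z : cplx R) : derivable u z 1 -> derivable v z 1 ->
    derivable (u * v) z 1 by exact: derivableM.
have := @circle_rigid1 g; rewrite /g mulr1 mulr0; apply.
- by move=> z hz; exact/derivable_cderiv/dg.
- by move=> z hz; apply: rf; rewrite normrM l1 hz mulr1.
- move=> c z hz; apply: derivable_cderiv.
  by apply: (dm (cst (c : cplx R)) g); [exact: derivable_cst|exact: dg].
- move=> z hz; apply: derivable_cderiv.
  have db : derivable (g - cst (f 0 : cplx R)) (z : cplx R) 1.
    by apply: derivableB; [exact: dg|exact: derivable_cst].
  have := dm _ _ _ db db.
  rewrite (_ : (_ - _) * _ = (fun z => (f (l * z) - f 0) ^+ 2)) //.
Qed.

End CircleRigidity.

(** * Vector fields in Lorentz space *)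

Section VectorFields.
Variable R : realType.
Local Notation C := R[i].
Variable U : set C.
Hypothesis oU : Defs.openC U.

Definition smv p q (F : C -> 'M[C]_(p, q)) := forall i j, sm U (fun z => F z i j).

Section General.
Variables p q : nat.
Implicit Types F G : C -> 'M[C]_(p, q).

Lemma smv_smooth F : smv F -> smooth U F.
Proof. by move=> hF k i j; exact: sm_Ck. Qed.

Lemma dzE F z i j : dz F z i j = wz (fun w => F w i j) z.
Proof. by rewrite !mxE. Qed.

Lemma dzbE F z i j : dzb F z i j = wzb (fun w => F w i j) z.
Proof. by rewrite !mxE. Qed.

Lemma duE F z i j : du F z i j = pderive 1 (fun w => F w i j) z.
Proof. by rewrite mxE. Qed.

Lemma dvE F z i j : dv F z i j = pderive 'i (fun w => F w i j) z.
Proof. by rewrite mxE. Qed.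

Opaque dz dzb du dv wz wzb pderive.

Lemma dz_ext F (M : 'M[C]_(p, q)) z : (forall i j, wz (fun w => F w i j) z = M i j) -> dz F z = M.
Proof. by move=> h; apply/matrixP => i j; rewrite dzE. Qed.

Lemma dzb_ext F (M : 'M[C]_(p, q)) z : (forall i j, wzb (fun w => F w i j) z = M i j) -> dzb F z = M.
Proof. by move=> h; apply/matrixP => i j; rewrite dzbE. Qed.

Lemma entryD F G i j : (fun w => (F w + G w) i j) = (fun w => F w i j + G w i j).
Proof. by apply/funext => w; rewrite mxE. Qed.

Lemma entryZ f F i j : (fun w : C => (f w *: F w) i j) = (fun w => f w * F w i j).
Proof. by apply/funext => w; rewrite mxE. Qed.

Lemma entryJ F i j : (fun w => (mxconj (F w)) i j) = (fun w => Num.conj (F w i j)).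
Proof. by apply/funext => w; rewrite mxE. Qed.

Lemma entry_dz F i j : (fun w => dz F w i j) = wz (fun w => F w i j).
Proof. by apply/funext => w; rewrite (dzE F). Qed.

Lemma entry_dzb F i j : (fun w => dzb F w i j) = wzb (fun w => F w i j).
Proof. by apply/funext => w; rewrite (dzbE F). Qed.

Lemma smv_dz F : smv F -> smv (dz F).
Proof.
by move=> hF i j; rewrite (entry_dz F i j); exact: sm_wz.
Qed.

Lemma smv_dzb F : smv F -> smv (dzb F).
Proof.
by move=> hF i j; rewrite (entry_dzb F i j); exact: sm_wzb.
Qed.

Lemma smv_conj F : smv F -> smv (fun z => mxconj (F z)).
Proof.
by move=> hF i j; rewrite (entryJ F i j); exact: sm_conj.
Qed.

Lemma smvD F G : smv F -> smv G -> smv (fun z => F z + G z).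
Proof. by move=> hF hG i j; rewrite (entryD F G i j); exact: smD. Qed.

Lemma smvZ f F : sm U f -> smv F -> smv (fun z => f z *: F z).
Proof. by move=> hf hF i j; rewrite (entryZ f F i j); exact: smM. Qed.

Lemma smv_eq F G : (forall z, U z -> F z = G z) -> smv F -> smv G.
Proof. by move=> FG hF i j; apply: sm_eq (hF i j) => z Uz; rewrite FG. Qed.

Lemma dzD F G z : U z -> smv F -> smv G -> dz (fun z => F z + G z) z = dz F z + dz G z.
Proof.
move=> Uz hF hG; apply: dz_ext => i j; rewrite (entryD F G i j) [RHS]mxE.
apply: etrans (wzD oU Uz (hF i j) (hG i j)) _.
by congr (_ + _); symmetry; [exact: (dzE F)|exact: (dzE G)].
Qed.

Lemma dzbD F G z : U z -> smv F -> smv G -> dzb (fun z => F z + G z) z = dzb F z + dzb G z.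
Proof.
move=> Uz hF hG; apply: dzb_ext => i j; rewrite (entryD F G i j) [RHS]mxE.
apply: etrans (wzbD oU Uz (hF i j) (hG i j)) _.
by congr (_ + _); symmetry; [exact: (dzbE F)|exact: (dzbE G)].
Qed.

Lemma dzZ f F z : U z -> sm U f -> smv F ->
  dz (fun z => f z *: F z) z = wz f z *: F z + f z *: dz F z.
Proof.
move=> Uz hf hF; apply: dz_ext => i j.
rewrite (entryZ f F i j) [RHS]mxE [X in _ = X + _]mxE [X in _ = _ + X]mxE.
apply: etrans (wzM oU Uz hf (hF i j)) _.
by congr (_ + _ * _); symmetry; exact: (dzE F).
Qed.

Lemma dzbZ f F z : U z -> sm U f -> smv F ->
  dzb (fun z => f z *: F z) z = wzb f z *: F z + f z *: dzb F z.
Proof.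
move=> Uz hf hF; apply: dzb_ext => i j.
rewrite (entryZ f F i j) [RHS]mxE [X in _ = X + _]mxE [X in _ = _ + X]mxE.
apply: etrans (wzbM oU Uz hf (hF i j)) _.
by congr (_ + _ * _); symmetry; exact: (dzbE F).
Qed.

Lemma dz_conj F z : U z -> smv F -> dz (fun z => mxconj (F z)) z = mxconj (dzb F z).
Proof.
move=> Uz hF; apply: dz_ext => i j; rewrite (entryJ F i j) [RHS]mxE (dzbE F).
exact: (wz_conj oU Uz (hF i j)).
Qed.

Lemma dzb_conj F z : U z -> smv F -> dzb (fun z => mxconj (F z)) z = mxconj (dz F z).
Proof.
move=> Uz hF; apply: dzb_ext => i j; rewrite (entryJ F i j) [RHS]mxE (dzE F).
exact: (wzb_conj oU Uz (hF i j)).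
Qed.

Lemma dz_dzb F z : U z -> smv F -> dz (dzb F) z = dzb (dz F) z.
Proof.
move=> Uz hF; apply: dz_ext => i j; rewrite entry_dzb (dzbE (dz F)) entry_dz.
exact: (wz_wzb oU Uz (hF i j)).
Qed.

Lemma dzb_eq F G z : U z -> (forall z, U z -> F z = G z) -> smv F -> dzb G z = dzb F z.
Proof.
move=> Uz FG hF; apply: dzb_ext => i j; rewrite (dzbE F).
by apply: (wzb_eq oU Uz _ (hF i j)) => w Uw; rewrite FG.
Qed.

Lemma du_wz F z : U z -> smv F -> du F z = dz F z + dzb F z.
Proof.
move=> Uz hF; apply/matrixP => i j; rewrite [RHS]mxE dzE dzbE duE.
by rewrite (pderive_wz 1 oU Uz (hF i j)) conjC1 !mul1r.
Qed.

Lemma dv_wz F z : U z -> smv F -> dv F z = 'i *: (dz F z - dzb F z).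
Proof.
move=> Uz hF; apply/matrixP => i j; rewrite [RHS]mxE [X in _ = _ * X]mxE [X in _ * (_ + X)]mxE dzE dzbE dvE.
by rewrite (pderive_wz 'i oU Uz (hF i j)) conjCi; ring.
Qed.

End General.

Section Lorentz.
Variable n : nat.
Implicit Types (u v w : 'cV[C]_n.+1) (X Y : C -> 'cV[C]_n.+1).

Lemma lorC u v : lor u v = lor v u.
Proof.
by rewrite /lor mulrC; congr (- _ + _); apply: eq_bigr => i _; rewrite mulrC.
Qed.

Lemma lorDl u v w : lor (u + v) w = lor u w + lor v w.
Proof.
rewrite /lor mxE mulrDl opprD addrACA; congr (_ + _).
by rewrite -big_split /=; apply: eq_bigr => i _; rewrite mxE mulrDl.
Qed.

Lemma lorZl a u v : lor (a *: u) v = a * lor u v.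
Proof.
rewrite /lor mxE mulrDr mulrN mulrA; congr (_ + _).
by rewrite big_distrr /=; apply: eq_bigr => i _; rewrite mxE mulrA.
Qed.

Lemma lorDr u v w : lor w (u + v) = lor w u + lor w v.
Proof. by rewrite lorC lorDl ![lor _ w]lorC. Qed.

Lemma lorZr a u v : lor u (a *: v) = a * lor u v.
Proof. by rewrite lorC lorZl lorC. Qed.

Lemma lorNl u v : lor (- u) v = - lor u v.
Proof. by rewrite -scaleN1r lorZl mulN1r. Qed.

Lemma lorNr u v : lor u (- v) = - lor u v.
Proof. by rewrite lorC lorNl lorC. Qed.

Lemma lor0l v : lor 0 v = 0.
Proof. by rewrite -(scale0r 0) lorZl mul0r. Qed.

Lemma lor_conj u v : lor (mxconj u) (mxconj v) = Num.conj (lor u v).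
Proof.
rewrite /lor rmorphD rmorphN rmorphM !mxE rmorph_sum /=; congr (_ + _).
by apply: eq_bigr => i _; rewrite rmorphM !mxE.
Qed.

Lemma mxconjK u : mxconj (mxconj u) = u.
Proof. by apply/matrixP => i j; rewrite !mxE conjCK. Qed.

Lemma mxconjD u v : mxconj (u + v) = mxconj u + mxconj v.
Proof. by apply/matrixP => i j; rewrite !mxE rmorphD. Qed.

Lemma mxconjZ a u : mxconj (a *: u) = Num.conj a *: mxconj u.
Proof. by apply/matrixP => i j; rewrite !mxE rmorphM. Qed.

Lemma mxconjN u : mxconj (- u) = - mxconj u.
Proof. by apply/matrixP => i j; rewrite !mxE rmorphN. Qed.

Lemma smv_lor X Y : smv X -> smv Y -> sm U (fun z => lor (X z) (Y z)).
Proof.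
move=> hX hY; apply: smD; first by apply/smN/smM.
by apply: sm_sum => i; exact: smM.
Qed.

Lemma wz_sum (I : Type) (r : seq I) (F : I -> C -> C) z : U z ->
  (forall i, sm U (F i)) ->
  wz (fun z => \sum_(i <- r) F i z) z = \sum_(i <- r) wz (F i) z.
Proof.
move=> Uz h; elim: r => [|i r IH].
  by under eq_fun do rewrite big_nil; rewrite big_nil (wz_cst oU).
under eq_fun do rewrite big_cons.
rewrite big_cons -IH.
exact: (wzD oU Uz (h i) (sm_sum _ _ h)).
Qed.

Lemma lor_dz X Y z : U z -> smv X -> smv Y ->
  wz (fun z => lor (X z) (Y z)) z = lor (dz X z) (Y z) + lor (X z) (dz Y z).
Proof.
move=> Uz hX hY; rewrite /lor.
have M i : wz (fun z => X z i 0 * Y z i 0) z = dz X z i 0 * Y z i 0 + X z i 0 * dz Y z i 0.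
  apply: etrans (wzM oU Uz (hX i 0) (hY i 0)) _.
  by congr (_ * _ + _ * _); symmetry; [exact: (dzE X)|exact: (dzE Y)].
have sXY i : sm U (fun z => X z i 0 * Y z i 0) by exact: smM.
apply: etrans (wzD oU Uz (smN (sXY ord0)) (sm_sum _ _ (fun j => sXY (lift ord0 j)))) _.
rewrite [RHS]addrACA; congr (_ + _).
  rewrite -opprD -M -mulN1r.
  have -> : (fun z => - (X z ord0 0 * Y z ord0 0)) = (fun z => -1 * (X z ord0 0 * Y z ord0 0)).
    by apply/funext => w; rewrite mulN1r.
  apply: etrans (wzM oU Uz (sm_cst _ _) (sXY ord0)) _.
  by rewrite (wz_cst oU _ Uz) mul0r add0r.
apply: etrans (wz_sum _ Uz (fun j => sXY (lift ord0 j))) _.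
rewrite -big_split /=; apply: eq_bigr => k _; exact: M.
Qed.

Lemma wzb_sum (I : Type) (r : seq I) (F : I -> C -> C) z : U z ->
  (forall i, sm U (F i)) ->
  wzb (fun z => \sum_(i <- r) F i z) z = \sum_(i <- r) wzb (F i) z.
Proof.
move=> Uz h; elim: r => [|i r IH].
  by under eq_fun do rewrite big_nil; rewrite big_nil (wzb_cst oU).
under eq_fun do rewrite big_cons.
rewrite big_cons -IH.
exact: (wzbD oU Uz (h i) (sm_sum _ _ h)).
Qed.

Lemma lor_dzb X Y z : U z -> smv X -> smv Y ->
  wzb (fun z => lor (X z) (Y z)) z = lor (dzb X z) (Y z) + lor (X z) (dzb Y z).
Proof.
move=> Uz hX hY; rewrite /lor.
have M i : wzb (fun z => X z i 0 * Y z i 0) z = dzb X z i 0 * Y z i 0 + X z i 0 * dzb Y z i 0.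
  apply: etrans (wzbM oU Uz (hX i 0) (hY i 0)) _.
  by congr (_ * _ + _ * _); symmetry; [exact: (dzbE X)|exact: (dzbE Y)].
have sXY i : sm U (fun z => X z i 0 * Y z i 0) by exact: smM.
apply: etrans (wzbD oU Uz (smN (sXY ord0)) (sm_sum _ _ (fun j => sXY (lift ord0 j)))) _.
rewrite [RHS]addrACA; congr (_ + _).
  rewrite -opprD -M -mulN1r.
  have -> : (fun z => - (X z ord0 0 * Y z ord0 0)) = (fun z => -1 * (X z ord0 0 * Y z ord0 0)).
    by apply/funext => w; rewrite mulN1r.
  apply: etrans (wzbM oU Uz (sm_cst _ _) (sXY ord0)) _.
  by rewrite (wzb_cst oU _ Uz) mul0r add0r.
apply: etrans (wzb_sum _ Uz (fun j => sXY (lift ord0 j))) _.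
rewrite -big_split /=; apply: eq_bigr => k _; exact: M.
Qed.

Lemma lor_dz0 X Y c z : smv X -> smv Y -> (forall z, U z -> lor (X z) (Y z) = c) -> U z ->
  lor (dz X z) (Y z) = - lor (X z) (dz Y z).
Proof.
move=> hX hY h Uz; apply/eqP; rewrite -addr_eq0 -lor_dz //.
by rewrite (wz_eq oU Uz (f := fun=> c)) ?(wz_cst oU) // => [w Uw|]; [rewrite h|exact: sm_cst].
Qed.

Lemma lor_dzb0 X Y c z : smv X -> smv Y -> (forall z, U z -> lor (X z) (Y z) = c) -> U z ->
  lor (dzb X z) (Y z) = - lor (X z) (dzb Y z).
Proof.
move=> hX hY h Uz; apply/eqP; rewrite -addr_eq0 -lor_dzb //.
by rewrite (wzb_eq oU Uz (f := fun=> c)) ?(wzb_cst oU) // => [w Uw|]; [rewrite h|exact: sm_cst].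
Qed.

End Lorentz.
End VectorFields.

(** * Expansion in dual isotropic bases *)

Section Frames.
Variable R : realType.
Local Notation C := R[i].

Lemma lor_mx n (u v : 'cV[C]_n.+1) : lor u v = (u^T *m Defs.minkowski R n *m v) 0 0.
Proof.
rewrite mul_mx_diag mxE big_ord_recl !mxE eqxx /lor mulrN1 mulNr; congr (_ + _).
by apply: eq_bigr => i _; rewrite !mxE /= mulr1.
Qed.

Lemma lor_mxE n k k' (P : 'M[C]_(n.+1, k)) (Q : 'M[C]_(n.+1, k')) i j :
  (P^T *m Defs.minkowski R n *m Q) i j = lor (col i P) (col j Q).
Proof.
rewrite lor_mx mxE [RHS]mxE; apply: eq_bigr => a _.
by rewrite !mul_mx_diag !mxE.
Qed.

(** The pairing relations read (M^T J) (M N) = 1 for the square matrix M with columns e and f. A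
    left inverse of a square matrix is a right inverse, and (M N) (M^T J) = 1 is the expansion; this
    is where 8 = 4 + 4 enters. *)
Lemma frame_expand (e f : 'I_4 -> 'cV[C]_8) (c : 'I_4 -> C) :
  (forall i j, lor (e i) (e j) = 0) -> (forall i j, lor (f i) (f j) = 0) ->
  (forall i j, lor (e i) (f j) = if i == j then c i else 0) ->
  (forall i, c i != 0) ->
  forall v, v = \sum_i ((lor (f i) v / c i) *: e i + (lor (e i) v / c i) *: f i).
Proof.
move=> ee ff ef c0 v.
pose A : 'M[C]_(8, 4) := \matrix_(i, j) e j i 0.
pose B : 'M[C]_(8, 4) := \matrix_(i, j) f j i 0.
pose M : 'M[C]_(8, 4 + 4) := row_mx A B.
pose J := Defs.minkowski R 7.
pose D : 'M[C]_4 := diag_mx (\row_i (c i)^-1).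
pose N : 'M[C]_(4 + 4) := block_mx 0 D D 0.
have colA i : col i A = e i by apply/colP => k; rewrite !mxE.
have colB i : col i B = f i by apply/colP => k; rewrite !mxE.
have AA : A^T *m J *m A = 0.
  by apply/matrixP => i j; rewrite lor_mxE !colA ee mxE.
have BB : B^T *m J *m B = 0.
  by apply/matrixP => i j; rewrite lor_mxE !colB ff mxE.
have AB : A^T *m J *m B *m D = 1%:M.
  apply/matrixP => i j; rewrite mul_mx_diag mxE lor_mxE colA colB ef !mxE.
  by case: eqVneq => [->|_]; rewrite ?mul0r // divff.
have BA : B^T *m J *m A *m D = 1%:M.
  apply/matrixP => i j; rewrite mul_mx_diag mxE lor_mxE colA colB lorC ef !mxE eq_sym.
  by have [_|_] := eqVneq i j; rewrite ?mul0r // divff.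
have E1 : (M^T *m J) *m (M *m N) = 1%:M.
  rewrite /M /N mul_row_block !mulmx0 addr0 add0r tr_row_mx mul_col_mx mul_col_row.
  by rewrite !mulmxA AA BB AB BA !mul0mx -scalar_mx_block.
have := mulmx1C E1.
rewrite /M /N mul_row_block !mulmx0 addr0 add0r tr_row_mx mul_col_mx mul_row_col => E2.
rewrite -{1}[v]mul1mx -E2 mulmxDl -!(mulmxA (_ *m D)).
have L (P : 'M[C]_(8, 4)) i : (P^T *m J *m v) i 0 = lor (col i P) v.
  by rewrite lor_mxE; congr lor; apply/colP => k; rewrite mxE.
apply/colP => k; rewrite mxE [X in X + _]mxE [X in _ + X]mxE summxE -big_split /=.
apply: eq_bigr => i _; rewrite !L colA colB !mul_mx_diag !mxE; ring.
Qed.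

End Frames.

Transparent dz dzb du dv wz wzb pderive.

(** * Polynomials in z and its conjugate, null coordinates *)

Section Polynomials.
Variable R : realType.
Local Notation C := R[i].

(* A term [(c, (i, j))] stands for [c z^i \bar z^j]. *)
Definition pol := seq (Z * (nat * nat)).

Definition mon (c : Z) (i j : nat) : Z * (nat * nat) := (c, (i, j)).

(** Coefficients are binary integers so that [vm_compute] can decide identities; [zC] carries them
    to C. *)
Definition zC (c : Z) : C := (int_of_Z c)%:~R.

Lemma zCD a b : zC (Z.add a b) = zC a + zC b.
Proof. by rewrite /zC -intrD; congr intmul; exact: (rmorphD int_of_Z). Qed.

Lemma zCM a b : zC (Z.mul a b) = zC a * zC b.
Proof. by rewrite /zC -intrM; congr intmul; exact: (rmorphM int_of_Z). Qed.

Lemma zCN a : zC (Z.opp a) = - zC a.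
Proof. by rewrite /zC -intrN; congr intmul; exact: (rmorphN int_of_Z). Qed.

Lemma zC_nat n : zC (Z.of_nat n) = n%:R.
Proof. by rewrite /zC -[Z.of_nat n]/(Z_of_int n) Z_of_intK. Qed.

Definition tev (t : Z * (nat * nat)) (z : C) : C :=
  zC t.1 * (z ^+ t.2.1 * Num.conj z ^+ t.2.2).

Fixpoint pev (p : pol) (z : C) : C :=
  if p is t :: p' then tev t z + pev p' z else 0.

Fixpoint pins (t : Z * (nat * nat)) (p : pol) : pol :=
  if p is t' :: p' then
    if (t.2.1 == t'.2.1) && (t.2.2 == t'.2.2) then (Z.add t.1 t'.1, t.2) :: p'
    else t' :: pins t p'
  else [:: t].

Definition padd (p q : pol) : pol := foldr pins q p.
Definition pscale (t : Z * (nat * nat)) (p : pol) : pol :=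
  [seq (Z.mul t.1 s.1, (t.2.1 + s.2.1, t.2.2 + s.2.2)%N) | s <- p].
Definition pmul (p q : pol) : pol := foldr (fun t r => padd (pscale t q) r) [::] p.
Definition popp (p : pol) : pol := [seq (Z.opp t.1, t.2) | t <- p].
Definition pconj (p : pol) : pol := [seq (t.1, (t.2.2, t.2.1)) | t <- p].
Definition pdz (p : pol) : pol :=
  [seq (Z.mul t.1 (Z.of_nat t.2.1), (t.2.1.-1, t.2.2)) | t <- p].
Definition pdzb (p : pol) : pol :=
  [seq (Z.mul t.1 (Z.of_nat t.2.2), (t.2.1, t.2.2.-1)) | t <- p].
(** A sound test: like terms are collected by [pins], and then all coefficients must be 0. *)
Definition pzero (p : pol) : bool := all (fun t => Z.eqb t.1 Z0) (foldr pins [::] p).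
Definition peq (p q : pol) : bool := pzero (padd p (popp q)).
(** A sufficient criterion that fits the data: all terms are c |z|^(2i) with c >= 0, and there is a
    positive constant term. *)
Definition ppos (p : pol) : bool :=
  all (fun t => Z.leb Z0 t.1 && (t.2.1 == t.2.2)) p &&
  has (fun t => [&& Z.ltb Z0 t.1, t.2.1 == 0%N & t.2.2 == 0%N]) p.

Lemma pev_ins t p z : pev (pins t p) z = tev t z + pev p z.
Proof.
elim: p => //= t' p IH; case: ifP => [/andP[/eqP h1 /eqP h2]|_] /=.
  by rewrite addrA /tev /= h1 h2 zCD mulrDl.
by rewrite IH addrCA.
Qed.

Lemma pevD p q z : pev (padd p q) z = pev p z + pev q z.
Proof. by elim: p => [|t p IH] /=; rewrite ?add0r // pev_ins IH addrA. Qed.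

Lemma pev_scale t p z : pev (pscale t p) z = tev t z * pev p z.
Proof.
elim: p => [|s p IH] /=; rewrite ?mulr0 // IH mulrDr; congr (_ + _).
rewrite /tev /= zCM !exprD; ring.
Qed.

Lemma pevM p q z : pev (pmul p q) z = pev p z * pev q z.
Proof. by elim: p => [|t p IH] /=; rewrite ?mul0r // pevD pev_scale IH mulrDl. Qed.

Lemma pevN p z : pev (popp p) z = - pev p z.
Proof.
by elim: p => [|t p IH] /=; rewrite ?oppr0 // IH opprD /tev /= zCN mulNr.
Qed.

Lemma pev_conj p z : pev (pconj p) z = Num.conj (pev p z).
Proof.
elim: p => [|t p IH] /=; first by rewrite conjC0.
rewrite IH rmorphD; congr (_ + _).
by rewrite /tev /= !rmorphM !rmorphXn /= conjCK rmorph_int; congr (_ * _); exact: mulrC.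
Qed.

Lemma pzeroP p z : pzero p -> pev p z = 0.
Proof.
have -> : pev p z = pev (foldr pins [::] p) z by rewrite [RHS]pevD addr0.
rewrite /pzero; elim: (foldr _ _ _) => //= t q IH /andP[/Z.eqb_eq h /IH ->].
by rewrite /tev h mul0r addr0.
Qed.

Lemma peqP p q : peq p q -> forall z, pev p z = pev q z.
Proof.
by move=> /pzeroP h z; apply/eqP; rewrite -subr_eq0 -pevN -pevD h.
Qed.

Lemma zC_ge0 c : Z.leb Z0 c -> 0 <= zC c.
Proof. by case: c => //= c _; rewrite /zC /= ler0n. Qed.

Lemma zC_gt0 c : Z.ltb Z0 c -> 0 < zC c.
Proof. by case: c => //= c _; rewrite /zC /= ltr0n; lia. Qed.

Lemma pposP p : ppos p -> forall z, 0 < pev p z.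
Proof.
rewrite /ppos => /andP[h1 h2] z.
have T t : Z.leb Z0 t.1 && (t.2.1 == t.2.2) -> 0 <= tev t z.
  move=> /andP[/zC_ge0 c0 /eqP e]; rewrite /tev -e -exprMn mulr_ge0 // exprn_ge0 //.
  exact: mul_conjC_ge0.
elim: p h1 h2 => //= t p IH /andP[ht hp] /orP[/and3P[c0 /eqP e1 /eqP e2]|/(IH hp) h].
  have -> : 0 < tev t z + pev p z; last by [].
  apply: ltr_wpDr; last by rewrite /tev e1 e2 !expr0 !mulr1 zC_gt0.
  by elim: p hp {IH} => //= s p IH /andP[hs /IH h]; rewrite addr_ge0 // T.
by rewrite ltr_wpDl // T.
Qed.

Lemma sm_pev U p : sm U (pev p).
Proof.
elim: p => [|t p IH]; first exact: sm_cst.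
apply: (smD (f := tev t)) IH; apply: smM; first exact: sm_cst.
by apply: smM; apply: smX; [exact: sm_id|apply: sm_conj; exact: sm_id].
Qed.

Section Derivatives.
Variable U : set C.
Hypothesis oU : Defs.openC U.

Lemma wz_exp n z : U z -> wz (fun z => z ^+ n) z = n%:R * z ^+ n.-1.
Proof.
move=> Uz; elim: n => [|n IH].
  by under eq_fun do rewrite expr0; rewrite (wz_cst oU _ Uz) mul0r.
under eq_fun do rewrite exprS.
apply: etrans (wzM oU Uz (sm_id _) (smX _ (sm_id _))) _.
rewrite IH (wz_id oU Uz) mul1r /=; case: n {IH} => [|n]; first by rewrite mul0r mulr0 addr0 expr0 mulr1.
by rewrite /= exprS [n.+2%:R]mulrS; ring.
Qed.

Lemma wzb_exp n z : U z -> wzb (fun z => z ^+ n) z = 0.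
Proof.
move=> Uz; elim: n => [|n IH].
  by under eq_fun do rewrite expr0; rewrite (wzb_cst oU _ Uz).
under eq_fun do rewrite exprS.
apply: etrans (wzbM oU Uz (sm_id _) (smX _ (sm_id _))) _.
by rewrite IH (wzb_id oU Uz) mul0r mulr0 addr0.
Qed.

Lemma wz_conjexp n z : U z -> wz (fun z => Num.conj z ^+ n) z = 0.
Proof.
move=> Uz; have -> : (fun z : C => Num.conj z ^+ n) = fun z => Num.conj (z ^+ n).
  by apply/funext => w; rewrite rmorphXn.
apply: etrans (wz_conj oU Uz (smX n (sm_id _))) _.
by rewrite (wzb_exp _ Uz) conjC0.
Qed.

Lemma wzb_conjexp n z : U z ->
  wzb (fun z => Num.conj z ^+ n) z = n%:R * Num.conj z ^+ n.-1.
Proof.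
move=> Uz; have -> : (fun z : C => Num.conj z ^+ n) = fun z => Num.conj (z ^+ n).
  by apply/funext => w; rewrite rmorphXn.
apply: etrans (wzb_conj oU Uz (smX n (sm_id _))) _.
by rewrite (wz_exp _ Uz) rmorphM rmorphXn rmorph_nat.
Qed.

Let sz n : sm U (fun z => z ^+ n) := smX n (sm_id U).
Let sc n : sm U (fun z => Num.conj z ^+ n) := smX n (sm_conj (sm_id U)).

Lemma wz_pev p z : U z -> wz (pev p) z = pev (pdz p) z.
Proof.
move=> Uz; elim: p => [|[c [i j]] p IH]; first exact: (wz_cst oU).
have st : sm U (tev (c, (i, j))) by apply: smM; [exact: sm_cst|exact: smM (sz _) (sc _)].
apply: etrans (wzD oU Uz st (sm_pev _ _)) _; rewrite IH /=; congr (_ + _).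
apply: etrans (wzM oU Uz (sm_cst _ _) (smM (sz _) (sc _))) _.
rewrite (wz_cst oU _ Uz) mul0r add0r.
rewrite (wzM oU Uz (sz _) (sc _)) (wz_exp _ Uz) (wz_conjexp _ Uz) mulr0 addr0.
by rewrite /tev /= zCM zC_nat; ring.
Qed.

Lemma wzb_pev p z : U z -> wzb (pev p) z = pev (pdzb p) z.
Proof.
move=> Uz; elim: p => [|[c [i j]] p IH]; first exact: (wzb_cst oU).
have st : sm U (tev (c, (i, j))) by apply: smM; [exact: sm_cst|exact: smM (sz _) (sc _)].
apply: etrans (wzbD oU Uz st (sm_pev _ _)) _; rewrite IH /=; congr (_ + _).
apply: etrans (wzbM oU Uz (sm_cst _ _) (smM (sz _) (sc _))) _.
rewrite (wzb_cst oU _ Uz) mul0r add0r.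
rewrite (wzbM oU Uz (sz _) (sc _)) (wzb_exp _ Uz) (wzb_conjexp _ Uz) mul0r add0r.
by rewrite /tev /= zCM zC_nat; ring.
Qed.

End Derivatives.
End Polynomials.

Section Conjugation.
Variable R : realType.
Implicit Types x y : R[i].

Lemma cjD x y : Num.conj (x + y) = Num.conj x + Num.conj y.
Proof. exact: rmorphD. Qed.
Lemma cjN x : Num.conj (- x) = - Num.conj x.
Proof. exact: rmorphN. Qed.
Lemma cjM x y : Num.conj (x * y) = Num.conj x * Num.conj y.
Proof. exact: rmorphM. Qed.
Lemma cjV x : Num.conj x^-1 = (Num.conj x)^-1.
Proof. exact: fmorphV. Qed.
Lemma cjX x n : Num.conj (x ^+ n) = Num.conj x ^+ n.
Proof. exact: rmorphXn. Qed.
Lemma cj_nat n : Num.conj (n%:R : R[i]) = n%:R.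
Proof. exact: rmorph_nat. Qed.

End Conjugation.

Section NullCoordinates.
Variable R : realType.
Local Notation C := R[i].
Variable l : C.
Hypothesis l1 : `|l| = 1.

Lemma l_neq0 : l != 0.
Proof. by rewrite -normr_gt0 l1. Qed.

Lemma conj_l : Num.conj l = l^-1.
Proof. by rewrite invC_norm l1 expr1n invr1 mul1r. Qed.

(* Coordinates [p, q, a_1, b_1, a_2, b_2, a_3, b_3]: [p = x_0 + x_1] and
   [q = x_0 - x_1] are light-cone coordinates, and [a_k], [b_k] are the
   coefficients of [l^-1 (-i, 1)] and [l (i, 1)] in the k-th Euclidean plane.
   The loop parameter [l] drops out of all pairings. *)
Definition nullv (c : nat -> C) : 'cV[C]_8 := col_of 8
  [:: (c 0%N + c 1%N) / 2; (c 0%N - c 1%N) / 2;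
      'i * (l * c 3 - l^-1 * c 2); l^-1 * c 2 + l * c 3;
      'i * (l * c 5 - l^-1 * c 4); l^-1 * c 4 + l * c 5;
      'i * (l * c 7 - l^-1 * c 6); l^-1 * c 6 + l * c 7].

Lemma lor8 (u v : 'cV[C]_8) : lor u v =
  - (u (inord 0) 0 * v (inord 0) 0) + \sum_(1 <= k < 8) u (inord k) 0 * v (inord k) 0.
Proof.
rewrite /lor; congr (- (_ * _) + _).
- by congr (u _ 0); apply: val_inj; rewrite /= inordK.
- by congr (v _ 0); apply: val_inj; rewrite /= inordK.
rewrite big_add1 /= big_mkord; apply: eq_bigr => i _.
have E : lift ord0 i = inord i.+1 :> 'I_8 by apply: val_inj; rewrite /= inordK // ltnS.
by rewrite E.
Qed.

Lemma col_ofE s k : (k < 8)%N -> (col_of 8 s : 'cV[C]_8) (inord k) 0 = s`_k.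
Proof. by move=> k8; rewrite mxE inordK. Qed.

(** The factor i^2 = -1 cancels the terms in l^2 and l^-2, so l survives only against l^-1. *)
Lemma null_pair a b c d :
  'i * (l * b - l^-1 * a) * ('i * (l * d - l^-1 * c)) + (l^-1 * a + l * b) * (l^-1 * c + l * d)
  = 2 * (a * d + b * c).
Proof.
have -> : 'i * (l * b - l^-1 * a) * ('i * (l * d - l^-1 * c)) =
  ('i * 'i) * ((l * b - l^-1 * a) * (l * d - l^-1 * c)) by ring.
have := l_neq0; rewrite ii => l0; field; exact: l0.
Qed.

Lemma lor_nullv c d : lor (nullv c) (nullv d) =
  - (c 0%N * d 1%N + c 1%N * d 0%N) / 2 + 2 * ((c 2 * d 3 + c 3 * d 2) +
   (c 4 * d 5 + c 5 * d 4) + (c 6 * d 7 + c 7 * d 6)).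
Proof.
have -> (x y w : C) : 2 * (x + y + w) = 2 * x + 2 * y + 2 * w by ring.
rewrite -!null_pair lor8 unlock /= !col_ofE //= addr0; field; exact: l_neq0.
Qed.

Lemma mxconj_nullv c : mxconj (nullv c) =
  nullv (fun k => Num.conj (c (nth 0%N [:: 0; 1; 3; 2; 5; 4; 7; 6]%N k))).
Proof.
have conj_li : Num.conj l^-1 = l by rewrite cjV conj_l invrK.
have h2 (x : C) : Num.conj (x / 2) = Num.conj x / 2 by rewrite cjM cjV cj_nat.
have hA (a b : C) : Num.conj (l^-1 * a + l * b) = l^-1 * Num.conj b + l * Num.conj a.
  by rewrite cjD !cjM conj_li conj_l addrC.
have hB (a b : C) : Num.conj ('i * (l * b - l^-1 * a)) =
     'i * (l * Num.conj a - l^-1 * Num.conj b).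
  by rewrite cjM cjD cjN !cjM conjCi conj_li conj_l; ring.
apply/colP => k; rewrite !mxE.
case: k => -[|[|[|[|[|[|[|[|//]]]]]]]] i /=;
  by rewrite ?h2 ?hA ?hB ?cjD ?cjN.
Qed.

Lemma nullvD c d : nullv (fun k => c k + d k) = nullv c + nullv d.
Proof.
apply/colP => k; rewrite /nullv !mxE; case: k => -[|[|[|[|[|[|[|[|//]]]]]]]] i /=; ring.
Qed.

Lemma nullvZ a c : nullv (fun k => a * c k) = a *: nullv c.
Proof.
apply/colP => k; rewrite /nullv !mxE; case: k => -[|[|[|[|[|[|[|[|//]]]]]]]] i /=; ring.
Qed.

Lemma nullvE c : nullv c = \sum_(k < 8) c k *: nullv (fun j => (j == k)%:R).
Proof.
rewrite !big_ord_recl big_ord0 /=.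
apply/colP => k; rewrite /nullv !mxE /=.
by case: k => -[|[|[|[|[|[|[|[|//]]]]]]]] i /=; ring.
Qed.

Section Derivatives.
Variable U : set C.
Hypothesis oU : Defs.openC U.
Implicit Types c : nat -> C -> C.

Lemma smv_nullv c : (forall k, sm U (c k)) -> smv U (fun z => nullv (c ^~ z)).
Proof.
move=> h i j.
have -> : (fun z => nullv (c ^~ z) i j) =
    fun z => \sum_(k < 8) c k z * nullv (fun j => (j == k)%:R) i j.
  by apply/funext => z; rewrite nullvE summxE; apply: eq_bigr => k _; rewrite mxE.
by apply: sm_sum => k; apply: smM => //; exact: sm_cst.
Qed.

Lemma dz_nullv c z : U z -> (forall k, sm U (c k)) ->
  dz (fun z => nullv (c ^~ z)) z = nullv (fun k => wz (c k) z).
Proof.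
move=> Uz h; apply: dz_ext => i j.
have -> : (fun z => nullv (c ^~ z) i j) =
    fun z => \sum_(k < 8) c k z * nullv (fun j => (j == k)%:R) i j.
  by apply/funext => w; rewrite nullvE summxE; apply: eq_bigr => k _; rewrite mxE.
have s0 (k : 'I_8) : sm U (fun z => c k z * nullv (fun j => (j == k)%:R) i j).
  by apply: smM => //; exact: sm_cst.
apply: etrans (wz_sum oU _ Uz s0) _.
rewrite (nullvE (fun k => wz (c k) z)) summxE; apply: eq_bigr => k _; rewrite [RHS]mxE.
apply: etrans (wzM oU Uz (h k) (sm_cst _ _)) _.
by rewrite (wz_cst oU _ Uz) mulr0 addr0.
Qed.

Lemma dzb_nullv c z : U z -> (forall k, sm U (c k)) ->
  dzb (fun z => nullv (c ^~ z)) z = nullv (fun k => wzb (c k) z).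
Proof.
move=> Uz h; apply: dzb_ext => i j.
have -> : (fun z => nullv (c ^~ z) i j) =
    fun z => \sum_(k < 8) c k z * nullv (fun j => (j == k)%:R) i j.
  by apply/funext => w; rewrite nullvE summxE; apply: eq_bigr => k _; rewrite mxE.
have s0 (k : 'I_8) : sm U (fun z => c k z * nullv (fun j => (j == k)%:R) i j).
  by apply: smM => //; exact: sm_cst.
apply: etrans (wzb_sum oU _ Uz s0) _.
rewrite (nullvE (fun k => wzb (c k) z)) summxE; apply: eq_bigr => k _; rewrite [RHS]mxE.
apply: etrans (wzbM oU Uz (h k) (sm_cst _ _)) _.
by rewrite (wzb_cst oU _ Uz) mulr0 addr0.
Qed.

End Derivatives.

Definition pvec := seq pol.

Definition vev (v : pvec) (z : C) : 'cV[C]_8 := nullv (fun k => pev (nth [::] v k) z).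

(** Twice the Lorentz product, whose light-cone part carries the denominator 2. *)
Definition vlor2 (v w : pvec) : pol :=
  let c k := nth [::] v k in let d k := nth [::] w k in
  padd (popp (padd (pmul (c 0%N) (d 1%N)) (pmul (c 1%N) (d 0%N))))
    (pmul [:: mon 4 0 0] (padd (padd (pmul (c 2) (d 3)) (pmul (c 3) (d 2)))
      (padd (padd (pmul (c 4) (d 5)) (pmul (c 5) (d 4)))
            (padd (pmul (c 6) (d 7)) (pmul (c 7) (d 6)))))).
Definition vconj (v : pvec) : pvec :=
  [seq pconj (nth [::] v k) | k <- [:: 0; 1; 3; 2; 5; 4; 7; 6]%N].
Definition vdz (v : pvec) : pvec := map pdz v.
Definition vdzb (v : pvec) : pvec := map pdzb v.
Definition vadd (v w : pvec) : pvec :=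
  [seq padd (nth [::] v k) (nth [::] w k) | k <- iota 0 8].
Definition vscale (p : pol) (v : pvec) : pvec := map (pmul p) v.
Definition veq (v w : pvec) : bool :=
  all (fun k => peq (nth [::] v k) (nth [::] w k)) (iota 0 8).

Lemma nth_map_nil (f : pol -> pol) v k : f [::] = [::] ->
  nth [::] (map f v) k = f (nth [::] v k).
Proof.
move=> f0; case: (ltnP k (size v)) => h; first by rewrite (nth_map [::]).
by rewrite !nth_default ?size_map.
Qed.

Lemma nullv_ext (c d : nat -> C) : (forall k, (k < 8)%N -> c k = d k) -> nullv c = nullv d.
Proof. by move=> h; rewrite nullvE [RHS]nullvE; apply: eq_bigr => k _; rewrite h. Qed.

Lemma lor_vev v w z : 2 * lor (vev v z) (vev w z) = pev (vlor2 v w) z.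
Proof.
have z4 : pev [:: mon 4 0 0] z = 4 :> C.
  by rewrite /= /tev /= !expr0 !mulr1 addr0 -(zC_nat R 4).
by rewrite lor_nullv /vlor2 !(pevD, pevN, pevM) z4; field.
Qed.

Lemma lor_vev0 v w z : pzero (vlor2 v w) -> lor (vev v z) (vev w z) = 0.
Proof.
move=> /pzeroP h; apply: (@mulfI _ 2); first by rewrite pnatr_eq0.
by rewrite lor_vev h mulr0.
Qed.

Lemma vev_conj v z : vev (vconj v) z = mxconj (vev v z).
Proof.
rewrite /vev mxconj_nullv; apply: nullv_ext => k k8.
rewrite (nth_map 0%N); last by [].
by rewrite pev_conj.
Qed.

Lemma vevD v w z : vev (vadd v w) z = vev v z + vev w z.
Proof.
rewrite /vev -nullvD; apply: nullv_ext => k k8.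
by rewrite (nth_map 0%N) ?size_iota // nth_iota // pevD.
Qed.

Lemma vevZ p v z : vev (vscale p v) z = pev p z *: vev v z.
Proof.
rewrite /vev -nullvZ; apply: nullv_ext => k k8.
rewrite nth_map_nil ?pevM //; by elim: p.
Qed.

Lemma veqP v w z : veq v w -> vev v z = vev w z.
Proof.
move=> /allP h; apply: nullv_ext => k k8; apply: peqP; apply: h.
by rewrite mem_iota.
Qed.

Section PolynomialFields.
Variable U : set C.
Hypothesis oU : Defs.openC U.

Lemma smv_vev v : smv U (vev v).
Proof. by apply: (smv_nullv (c := fun k => pev (nth [::] v k))) => k; exact: sm_pev. Qed.

Lemma dz_vev v z : U z -> dz (vev v) z = vev (vdz v) z.
Proof.
move=> Uz; apply: etrans (dz_nullv oU Uz (c := fun k => pev (nth [::] v k)) _) _.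
  by move=> k; exact: sm_pev.
by apply: nullv_ext => k k8; rewrite nth_map_nil // (wz_pev oU).
Qed.

Lemma dzb_vev v z : U z -> dzb (vev v) z = vev (vdzb v) z.
Proof.
move=> Uz; apply: etrans (dzb_nullv oU Uz (c := fun k => pev (nth [::] v k)) _) _.
  by move=> k; exact: sm_pev.
by apply: nullv_ext => k k8; rewrite nth_map_nil // (wzb_pev oU).
Qed.

End PolynomialFields.
End NullCoordinates.

(** * Adapted null frames and the normal projection *)

Section NullFrame.
Variable R : realType.
Local Notation C := R[i].
Implicit Types u v y w a b : 'cV[C]_8.

(* [y], [yz], [w] stand for Y, Y_z, Y_{z\bar z} at a point, and [a], [b] for
   an isotropic unitary frame of half of the normal space. *)
Record null_frame y yz w a b : Prop := NullFrame {
  nf_y : mxconj y = y; nf_w : mxconj w = w;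
  nf_yy : lor y y = 0; nf_yyz : lor y yz = 0; nf_yzyz : lor yz yz = 0;
  nf_yzyb : lor yz (mxconj yz) = 2^-1;
  nf_yw : lor y w = - 2^-1; nf_yzw : lor yz w = 0;
  nf_aa : lor a a = 0; nf_bb : lor b b = 0; nf_ab : lor a b = 0;
  nf_aac : lor a (mxconj a) = 2; nf_bbc : lor b (mxconj b) = 2;
  nf_abc : lor a (mxconj b) = 0;
  nf_ay : lor a y = 0; nf_ayz : lor a yz = 0;
  nf_ayb : lor a (mxconj yz) = 0; nf_aw : lor a w = 0;
  nf_by : lor b y = 0; nf_byz : lor b yz = 0;
  nf_byb : lor b (mxconj yz) = 0; nf_bw : lor b w = 0 }.

(** The orthogonal projection to the span of a, b and their conjugates when a, b are isotropic,
    Hermitian orthogonal and of Hermitian square 2, whence the factor 1/2. *)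
Definition nproj a b v : 'cV[C]_8 :=
  2^-1 *: (lor v (mxconj a) *: a + lor v a *: mxconj a
           + lor v (mxconj b) *: b + lor v b *: mxconj b).

Lemma nprojD a b u v : nproj a b (u + v) = nproj a b u + nproj a b v.
Proof. by rewrite /nproj !lorDl; apply/colP => i; rewrite !mxE; ring. Qed.

Lemma nprojZ a b c v : nproj a b (c *: v) = c *: nproj a b v.
Proof. by rewrite /nproj !lorZl; apply/colP => i; rewrite !mxE; ring. Qed.

Lemma nproj_conj a b v : mxconj (nproj a b v) = nproj a b (mxconj v).
Proof.
have J x y : lor (mxconj x) y = Num.conj (lor x (mxconj y)) :> C.
  by rewrite -lor_conj mxconjK.
rewrite /nproj !J !mxconjK mxconjZ !mxconjD !mxconjZ !mxconjK cjV cj_nat.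
by apply/colP => i; rewrite !mxE; ring.
Qed.

Section WithFrame.
Variables y yz w a b : 'cV[C]_8.
Hypothesis F : null_frame y yz w a b.
Local Notation yb := (mxconj yz).
Local Notation ac := (mxconj a).
Local Notation bc := (mxconj b).

Lemma lor_conjl u v : lor (mxconj u) v = Num.conj (lor u (mxconj v)).
Proof. by rewrite -lor_conj mxconjK. Qed.

Lemma nf_yby : lor yb y = 0.
Proof. by rewrite lor_conjl (nf_y F) lorC (nf_yyz F) conjC0. Qed.
Lemma nf_ybyb : lor yb yb = 0.
Proof. by rewrite lor_conj (nf_yzyz F) conjC0. Qed.
Lemma nf_ybw : lor yb w = 0.
Proof. by rewrite lor_conjl (nf_w F) (nf_yzw F) conjC0. Qed.
Lemma nf_acac : lor ac ac = 0.
Proof. by rewrite lor_conj (nf_aa F) conjC0. Qed.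
Lemma nf_bcbc : lor bc bc = 0.
Proof. by rewrite lor_conj (nf_bb F) conjC0. Qed.
Lemma nf_acbc : lor ac bc = 0.
Proof. by rewrite lor_conj (nf_ab F) conjC0. Qed.
Lemma nf_acb : lor ac b = 0.
Proof. by rewrite lor_conjl (nf_abc F) conjC0. Qed.
Lemma nf_acy : lor ac y = 0.
Proof. by rewrite lor_conjl (nf_y F) (nf_ay F) conjC0. Qed.
Lemma nf_acyz : lor ac yz = 0.
Proof. by rewrite lor_conjl (nf_ayb F) conjC0. Qed.
Lemma nf_acyb : lor ac yb = 0.
Proof. by rewrite lor_conj (nf_ayz F) conjC0. Qed.
Lemma nf_acw : lor ac w = 0.
Proof. by rewrite lor_conjl (nf_w F) (nf_aw F) conjC0. Qed.
Lemma nf_bcy : lor bc y = 0.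
Proof. by rewrite lor_conjl (nf_y F) (nf_by F) conjC0. Qed.
Lemma nf_bcyz : lor bc yz = 0.
Proof. by rewrite lor_conjl (nf_byb F) conjC0. Qed.
Lemma nf_bcyb : lor bc yb = 0.
Proof. by rewrite lor_conj (nf_byz F) conjC0. Qed.
Lemma nf_bcw : lor bc w = 0.
Proof. by rewrite lor_conjl (nf_w F) (nf_bw F) conjC0. Qed.

Let tab := (nf_yy F, nf_yyz F, nf_yzyz F, nf_yzyb F, nf_yw F, nf_yzw F, nf_aa F,
  nf_bb F, nf_ab F, nf_aac F, nf_bbc F, nf_abc F, nf_ay F, nf_ayz F, nf_ayb F,
  nf_aw F, nf_by F, nf_byz F, nf_byb F, nf_bw F, nf_yby, nf_ybyb, nf_ybw,
  nf_acac, nf_bcbc, nf_acbc, nf_acb, nf_acy, nf_acyz, nf_acyb, nf_acw,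
  nf_bcy, nf_bcyz, nf_bcyb, nf_bcw).

(** The null vector dual to y: <y, nvec> = -1, and the multiple of y is the one that makes it
    isotropic. *)
Definition nvec : 'cV[C]_8 := 2 *: w + (2 * lor w w) *: y.

Lemma nf_expand v : v = - lor v nvec *: y + (2 * lor v yb) *: yz
  + (- lor v y *: nvec + (2 * lor v yz) *: yb) + nproj a b v.
Proof.
pose e (i : 'I_4) := nth 0 [:: y; 2 *: yz; a; b] i.
pose f (i : 'I_4) := nth 0 [:: nvec; 2 *: yb; ac; bc] i.
pose c (i : 'I_4) : C := nth 0 [:: -1; 2; 2; 2] i.
have s u u' d : lor u u' = d -> lor u' u = d by rewrite lorC.
have tab' := (s _ _ _ (nf_yyz F), s _ _ _ (nf_yzyb F), s _ _ _ (nf_yw F),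
  s _ _ _ (nf_yzw F), s _ _ _ (nf_ab F), s _ _ _ (nf_ay F), s _ _ _ (nf_ayz F),
  s _ _ _ (nf_ayb F), s _ _ _ (nf_aw F), s _ _ _ (nf_by F), s _ _ _ (nf_byz F),
  s _ _ _ (nf_byb F), s _ _ _ (nf_bw F), s _ _ _ nf_acb, s _ _ _ nf_yby, s _ _ _ nf_ybw,
  s _ _ _ nf_acbc, s _ _ _ nf_acy, s _ _ _ nf_acyz, s _ _ _ nf_acyb, s _ _ _ nf_acw,
  s _ _ _ nf_bcy, s _ _ _ nf_bcyz, s _ _ _ nf_bcyb, s _ _ _ nf_bcw).
have E := @frame_expand R e f c _ _ _ _ v.
rewrite {1}E.
- rewrite !big_ord_recl big_ord0 /e /f /c /= /nproj.
  by rewrite ![lor _ v]lorC !lorZr; apply/colP => i; rewrite !mxE; field.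
- move=> [[|[|[|[|//]]]] hi] [[|[|[|[|//]]]] hj]; rewrite /e /=;
    by rewrite ?lorZl ?lorZr ?tab ?tab' ?mulr0.
- move=> [[|[|[|[|//]]]] hi] [[|[|[|[|//]]]] hj]; rewrite /f /= /nvec;
    rewrite ?lorDl ?lorDr ?lorZl ?lorZr ?lorDl ?lorDr ?lorZl ?lorZr ?tab ?tab';
    by field.
- move=> [[|[|[|[|//]]]] hi] [[|[|[|[|//]]]] hj]; rewrite /e /f /c /= /nvec;
    rewrite ?lorDl ?lorDr ?lorZl ?lorZr ?lorDl ?lorDr ?lorZl ?lorZr ?tab ?tab';
    by field.
- by move=> [[|[|[|[|//]]]] hi]; rewrite /c /= ?oppr_eq0 ?oner_eq0 ?pnatr_eq0.
Qed.

Lemma nproj_y : nproj a b y = 0.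
Proof.
rewrite /nproj ![lor y _]lorC !tab; apply/colP => i; rewrite !mxE; ring.
Qed.

Lemma nproj_yz : nproj a b yz = 0.
Proof.
rewrite /nproj ![lor yz _]lorC !tab; apply/colP => i; rewrite !mxE; ring.
Qed.

Lemma nproj_yb : nproj a b yb = 0.
Proof.
rewrite /nproj ![lor yb _]lorC !tab; apply/colP => i; rewrite !mxE; ring.
Qed.

Lemma nproj_w : nproj a b w = 0.
Proof.
rewrite /nproj ![lor w _]lorC !tab; apply/colP => i; rewrite !mxE; ring.
Qed.

Lemma nproj_a : nproj a b a = a.
Proof.
by rewrite /nproj !tab; apply/colP => i; rewrite !mxE; field.
Qed.

(* Vectors orthogonal to the maximal isotropic space spanned by y, yz, a, b. *)
Definition in_iso v := [/\ lor v y = 0, lor v yz = 0, lor v a = 0 & lor v b = 0].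

(** A maximal isotropic space is its own orthogonal complement: the four conditions kill the
    coefficients of the dual half in [nf_expand]. *)
Lemma in_isoP v : in_iso v -> v = - lor v nvec *: y + (2 * lor v yb) *: yz
  + ((2^-1 * lor v ac) *: a + (2^-1 * lor v bc) *: b).
Proof.
case=> h1 h2 h3 h4; rewrite {1}[v]nf_expand h1 h2 /nproj h3 h4.
by apply/colP => i; rewrite !mxE; ring.
Qed.

Lemma in_iso_orth u v : in_iso u -> in_iso v -> lor u v = 0.
Proof.
move=> [h1 h2 h3 h4] /in_isoP ->.
by rewrite !lorDr !lorZr h1 h2 h3 h4 !mulr0 !addr0.
Qed.

Lemma nproj_normal v u : (exists c1 c2 c3 c4, u = c1 *: y + c2 *: yz + c3 *: yb + c4 *: w) ->
  lor (nproj a b v) u = 0.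
Proof.
case=> c1 [c2 [c3 [c4 ->]]]; rewrite /nproj lorZl !lorDl !lorDr !lorZl !lorZr !tab; ring.
Qed.

Lemma nproj_tan v : exists c1 c2 c3 c4,
  v - nproj a b v = c1 *: y + c2 *: yz + c3 *: yb + c4 *: w.
Proof.
exists (- lor v nvec + - lor v y * (2 * lor w w)), (2 * lor v yb), (2 * lor v yz), (- lor v y * 2).
rewrite {1}[v]nf_expand /nvec; apply/colP => i; rewrite !mxE; ring.
Qed.

End WithFrame.
End NullFrame.

Opaque dz dzb du dv wz wzb pderive mxconj lor.

Lemma lor_comb3 (R : realType) (u x y v : 'cV[R[i]]_8) (c1 c2 c3 : R[i]) :
  lor u x = 0 -> lor u y = 0 -> lor u v = 0 ->
  lor u (c1 *: x + c2 *: y + c3 *: v) = 0.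
Proof. by move=> h1 h2 h3; rewrite !lorDr !lorZr h1 h2 h3 !mulr0 !addr0. Qed.

Lemma nproj_lin (R : realType) (a b x y u v : 'cV[R[i]]_8) c d :
  nproj a b x = u -> nproj a b y = v -> nproj a b (c *: x + d *: y) = c *: u + d *: v.
Proof. by move=> h1 h2; rewrite nprojD !nprojZ h1 h2. Qed.

(** * Isotropic surfaces and the Willmore equation *)

Section IsotropicSurface.
Variable R : realType.
Local Notation C := R[i].
Local Notation T := [set: C].

(** Put L = span(Y, Y_z, A, B) and P = span(A, B). With [is_Yzz] and [is_dzAB] the space L is stable
    under d/dz, and [is_dzbAB] makes P parallel for D_{\bar z}. The value 1/2 of <Y_z, Y_{\bar z}>
    expresses |dY|^2 = |dz|^2. *)
Record iso_surface (Y A B : C -> 'cV[C]_8) : Prop := IsoSurface {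
  is_sY : smv T Y;
  is_sA : smv T A;
  is_sB : smv T B;
  is_Yreal : forall z, mxconj (Y z) = Y z;
  is_YY : forall z, lor (Y z) (Y z) = 0;
  is_YzYz : forall z, lor (dz Y z) (dz Y z) = 0;
  is_YzYb : forall z, lor (dz Y z) (dzb Y z) = 2^-1;
  is_AA : forall z, lor (A z) (A z) = 0;
  is_BB : forall z, lor (B z) (B z) = 0;
  is_AB : forall z, lor (A z) (B z) = 0;
  is_AAc : forall z, lor (A z) (mxconj (A z)) = 2;
  is_BBc : forall z, lor (B z) (mxconj (B z)) = 2;
  is_ABc : forall z, lor (A z) (mxconj (B z)) = 0;
  is_AY : forall z, lor (A z) (Y z) = 0;
  is_AYz : forall z, lor (A z) (dz Y z) = 0;
  is_AYb : forall z, lor (A z) (dzb Y z) = 0;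
  is_AYzb : forall z, lor (A z) (dzb (dz Y) z) = 0;
  is_BY : forall z, lor (B z) (Y z) = 0;
  is_BYz : forall z, lor (B z) (dz Y z) = 0;
  is_BYb : forall z, lor (B z) (dzb Y z) = 0;
  is_BYzb : forall z, lor (B z) (dzb (dz Y) z) = 0;
  is_Yzz : forall z, exists c1 c2 c3,
    dz (dz Y) z = c1 *: Y z + c2 *: dz Y z + c3 *: A z;
  is_dzAB : forall z, lor (dz A z) (B z) = 0;
  is_dzbAB : forall z, lor (dzb A z) (B z) = 0 }.

Variables Y A B : C -> 'cV[C]_8.
Hypothesis H : iso_surface Y A B.

Local Notation sY := (is_sY H).
Local Notation sA := (is_sA H).
Local Notation sB := (is_sB H).
Local Notation Yreal := (is_Yreal H).
Local Notation YY := (is_YY H).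
Local Notation YzYz := (is_YzYz H).
Local Notation YzYb := (is_YzYb H).
Local Notation AA := (is_AA H).
Local Notation BB := (is_BB H).
Local Notation AB := (is_AB H).
Local Notation AAc := (is_AAc H).
Local Notation BBc := (is_BBc H).
Local Notation ABc := (is_ABc H).
Local Notation AY := (is_AY H).
Local Notation AYz := (is_AYz H).
Local Notation AYb := (is_AYb H).
Local Notation AYzb := (is_AYzb H).
Local Notation BY := (is_BY H).
Local Notation BYz := (is_BYz H).
Local Notation BYb := (is_BYb H).
Local Notation BYzb := (is_BYzb H).
Local Notation Yzz := (is_Yzz H).
Local Notation dzAB := (is_dzAB H).
Local Notation dzbAB := (is_dzbAB H).

Let oT : Defs.openC T := @openCT R.
Let sYz : smv T (dz Y) := smv_dz oT sY.
Let sYb : smv T (dzb Y) := smv_dzb oT sY.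
Let sYzb : smv T (dzb (dz Y)) := smv_dzb oT sYz.
Let sYzz : smv T (dz (dz Y)) := smv_dz oT sYz.

Lemma opp_self (x : C) : x = - x -> x = 0.
Proof.
move=> h; apply: (@mulfI _ 2); first by rewrite pnatr_eq0.
by rewrite mulr0 mulr_natl mulr2n {1}h addNr.
Qed.

Lemma Yb_conj z : mxconj (dz Y z) = dzb Y z.
Proof.
rewrite -(dzb_conj oT I sY); congr (dzb _ z); apply/funext => x; exact: Yreal.
Qed.

Lemma dzdzbY z : dz (dzb Y) z = dzb (dz Y) z.
Proof. exact: (dz_dzb oT I sY). Qed.

Lemma YYz z : lor (Y z) (dz Y z) = 0.
Proof.
by apply: opp_self; rewrite -(lor_dz0 oT sY sY (fun z _ => YY z) I) lorC.
Qed.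

Lemma Yzb_conj z : mxconj (dzb (dz Y) z) = dzb (dz Y) z.
Proof.
rewrite -(dz_conj oT I sYz) -dzdzbY; congr (dz _ z).
by apply/funext => x; exact: Yb_conj.
Qed.

Lemma frameP z : null_frame (Y z) (dz Y z) (dzb (dz Y) z) (A z) (B z).
Proof.
have yb := Yb_conj z.
have yw : lor (Y z) (dzb (dz Y) z) = - 2^-1.
  have := lor_dzb0 oT sY sYz (fun z _ => YYz z) I (z := z).
  by rewrite lorC YzYb => ->; rewrite opprK.
have yzw : lor (dz Y z) (dzb (dz Y) z) = 0.
  apply: opp_self; rewrite -(lor_dzb0 oT sYz sYz (fun z _ => YzYz z) I).
  exact: lorC.
have c1 := etrans (congr1 (lor (dz Y z)) yb) (YzYb z).
have c2 := etrans (congr1 (lor (A z)) yb) (AYb z).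
have c3 := etrans (congr1 (lor (B z)) yb) (BYb z).
exact: (NullFrame (Yreal z) (Yzb_conj z) (YY z) (YYz z) (YzYz z) c1 yw yzw (AA z)
  (BB z) (AB z) (AAc z) (BBc z) (ABc z) (AY z) (AYz z) c2 (AYzb z) (BY z) (BYz z) c3
  (BYzb z)).
Qed.

Lemma lor_Yzz (u : 'cV[C]_8) z : lor u (Y z) = 0 -> lor u (dz Y z) = 0 -> lor u (A z) = 0 ->
  lor u (dz (dz Y) z) = 0.
Proof.
move=> h1 h2 h3; have [c1 [c2 [c3 E]]] := Yzz z.
exact: etrans (congr1 (lor u) E) (lor_comb3 c1 c2 c3 h1 h2 h3).
Qed.

Lemma flip (u v : 'cV[C]_8) (c : C) : lor u v = c -> lor v u = c.
Proof. by rewrite lorC. Qed.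

Local Notation iso z v := (in_iso (Y z) (dz Y z) (A z) (B z) v).

Lemma neg0 (x : C) : x = 0 -> - x = 0.
Proof. by move->; rewrite oppr0. Qed.

Lemma iso_Yz z : iso z (dz Y z).
Proof.
split; [exact: flip (YYz z)|exact: YzYz|exact: flip (AYz z)|exact: flip (BYz z)].
Qed.

Lemma iso_Yzz z : iso z (dz (dz Y) z).
Proof.
split; apply: flip.
- exact: lor_Yzz (YY z) (YYz z) (flip (AY z)).
- exact: lor_Yzz (flip (YYz z)) (YzYz z) (flip (AYz z)).
- exact: lor_Yzz (AY z) (AYz z) (AA z).
- exact: lor_Yzz (BY z) (BYz z) (flip (AB z)).
Qed.

Lemma iso_dzA z : iso z (dz A z).
Proof.
split.
- exact: etrans (lor_dz0 oT sA sY (fun z _ => AY z) I) (neg0 (AYz z)).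
- exact: etrans (lor_dz0 oT sA sYz (fun z _ => AYz z) I) (neg0 (lor_Yzz (AY z) (AYz z) (AA z))).
- exact/opp_self/(etrans (lor_dz0 oT sA sA (fun z _ => AA z) I))/congr1/lorC.
- exact: dzAB.
Qed.

Lemma iso_dzB z : iso z (dz B z).
Proof.
split.
- exact: etrans (lor_dz0 oT sB sY (fun z _ => BY z) I) (neg0 (BYz z)).
- apply: etrans (lor_dz0 oT sB sYz (fun z _ => BYz z) I) (neg0 _).
  exact: lor_Yzz (BY z) (BYz z) (flip (AB z)).
- exact: etrans (lor_dz0 oT sB sA (fun z _ => flip (AB z)) I) (neg0 (flip (dzAB z))).
- exact/opp_self/(etrans (lor_dz0 oT sB sB (fun z _ => BB z) I))/congr1/lorC.
Qed.

(** Differentiating <u, e> = 0 moves d/dz from u to e. For e among Y, Y_z, A, B the derivative lies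
    in L, which is isotropic and equal to its orthogonal complement; so u_z is orthogonal to L,
    hence in L. *)
Lemma iso_dz (u : C -> 'cV[C]_8) : smv T u -> (forall z, iso z (u z)) ->
  forall z, iso z (dz u z).
Proof.
move=> su iu z.
have X (e : C -> 'cV[C]_8) : smv T e -> (forall z, lor (u z) (e z) = 0) ->
    iso z (dz e z) -> lor (dz u z) (e z) = 0.
  move=> se ue ie; apply: etrans (lor_dz0 oT su se (fun z _ => ue z) I) (neg0 _).
  exact (in_iso_orth (frameP z) (iu z) ie).
split.
- by apply: X (iso_Yz z) => [|z']; [exact: sY|have [] := iu z'].
- by apply: X (iso_Yzz z) => [|z']; [exact: sYz|have [] := iu z'].
- by apply: X (iso_dzA z) => [|z']; [exact: sA|have [] := iu z'].
- by apply: X (iso_dzB z) => [|z']; [exact: sB|have [] := iu z'].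
Qed.

Lemma smv_iter j : smv T (iter j (@dz R _ _) Y).
Proof. by elim: j => [|j IH]; [exact sY|exact (smv_dz oT IH)]. Qed.

Lemma iso_iter j z : iso z (iter j.+1 (@dz R _ _) Y z).
Proof.
elim: j z => [|j IH] z; first exact (iso_Yz z).
exact (iso_dz (smv_iter j.+1) IH z).
Qed.

Lemma surface_totally_isotropic : totally_isotropic Y.
Proof.
move=> [|j] [|k] z // _ _; exact (in_iso_orth (frameP z) (iso_iter j z) (iso_iter k z)).
Qed.

Lemma normalC_nproj z v : Defs.normalC Y z (nproj (A z) (B z) v).
Proof. by move=> u hu; exact: (nproj_normal (frameP z) v hu). Qed.

Lemma normal_part_nproj z v : normal_part Y z v (nproj (A z) (B z) v).
Proof. by split; [exact: normalC_nproj|exact: (nproj_tan (frameP z))]. Qed.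

Lemma normal_expand (y yz w a b : 'cV[C]_8) v : null_frame y yz w a b ->
  (forall u, (exists c1 c2 c3 c4, u = c1 *: y + c2 *: yz + c3 *: mxconj yz + c4 *: w) ->
     lor v u = 0) -> nproj a b v = v.
Proof.
move=> F tan.
have t1 : lor v y = 0.
  by apply: tan; exists 1, 0, 0, 0; rewrite !scale0r !addr0 scale1r.
have t2 : lor v yz = 0.
  by apply: tan; exists 0, 1, 0, 0; rewrite !scale0r !addr0 add0r scale1r.
have t3 : lor v (mxconj yz) = 0.
  by apply: tan; exists 0, 0, 1, 0; rewrite !scale0r !addr0 !add0r scale1r.
have t4 : lor v w = 0.
  by apply: tan; exists 0, 0, 0, 1; rewrite !scale0r !add0r scale1r.
have := nf_expand F v.
rewrite {1}/nvec lorDr !lorZr t1 t2 t3 t4 !mulr0 !addr0 oppr0 !scale0r !add0r.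
by move=> {2}->.
Qed.

Lemma normalCE z v : Defs.normalC Y z v -> nproj (A z) (B z) v = v.
Proof. move=> h; exact (normal_expand (frameP z) h). Qed.

(** E_1 is 2 Y_z because the frame asks for Hermitian square 2 while <Y_z, Y_{\bar z}> = 1/2. *)
Definition frame3 (j : nat) : C -> 'cV[C]_8 :=
  if j == 1%N then (fun z => 2 *: dz Y z) else if j == 2 then A else B.

Lemma frame3_gram (y yz w a b : 'cV[C]_8) : null_frame y yz w a b ->
  let E j := if j == 1%N then 2 *: yz else if j == 2 then a else b in
  forall j k, (1 <= j <= 3)%N -> (1 <= k <= 3)%N ->
  lor (E j) (E k) = 0 /\ lor (E j) (mxconj (E k)) = (if j == k then 2 else 0).
Proof.
move=> F E [|[|[|[|//]]]] // [|[|[|[|//]]]] // _ _; rewrite /E /=;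
  rewrite ?mxconjZ ?cj_nat ?lorZl ?lorZr.
- by rewrite (nf_yzyz F) (nf_yzyb F); split; [ring|field].
- by rewrite lorC (nf_ayz F) lorC (nf_acyz F) mulr0.
- by rewrite lorC (nf_byz F) lorC (nf_bcyz F) mulr0.
- by rewrite (nf_ayz F) (nf_ayb F) mulr0.
- by rewrite (nf_aa F) (nf_aac F).
- by rewrite (nf_ab F) (nf_abc F).
- by rewrite (nf_byz F) (nf_byb F) mulr0.
- by rewrite lorC (nf_ab F) lorC (nf_acb F).
- by rewrite (nf_bb F) (nf_bbc F).
Qed.

Lemma frame3_smooth j : smv T (frame3 j).
Proof.
rewrite /frame3; case: ifP => _; first exact (smvZ (sm_cst _ _) sYz).
by case: ifP => _; [exact sA|exact sB].
Qed.

Lemma nproj_b (y yz w a b : 'cV[C]_8) : null_frame y yz w a b -> nproj a b b = b.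
Proof.
move=> F; rewrite /nproj (nf_bbc F) (flip (nf_ab F)) (nf_bb F) (flip (nf_acb F)).
by apply/colP => i; rewrite !mxE; field.
Qed.

Lemma frame3_E z j : frame3 j z =
  if j == 1%N then 2 *: dz Y z else if j == 2 then A z else B z.
Proof. by rewrite /frame3; case: ifP => _ //; case: ifP. Qed.

Lemma frame3_normal z j : (2 <= j <= 3)%N ->
  nproj (A z) (B z) (frame3 j z) = frame3 j z.
Proof.
rewrite frame3_E; move: j => [|[|[|[|//]]]] // _ /=.
  exact (nproj_a (frameP z)).
exact (nproj_b (frameP z)).
Qed.

Lemma sum23 (f : nat -> 'cV[C]_8) : \sum_(2 <= j < 4) f j = f 2 + f 3.
Proof. by rewrite big_nat_recr //= big_nat1. Qed.

Lemma frame3_iter z j : (1 <= j <= 3)%N -> exists a b (c : nat -> C),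
  iter j (@dz R _ _) Y z =
  a *: frame3 j z + (b *: Y z + \sum_(1 <= l < j) c l *: frame3 l z).
Proof.
move: j => [|[|[|[|//]]]] // _.
- exists 2^-1, 0, (fun=> 0); rewrite big_geq // scale0r !addr0 frame3_E eqxx.
  by rewrite scalerA mulVf ?scale1r // pnatr_eq0.
- have [c1 [c2 [c3 E]]] := Yzz z; exists c3, c1, (fun=> c2 / 2).
  rewrite big_nat1 !frame3_E /= scalerA divfK ?pnatr_eq0 //.
  by apply: (etrans E); exact: addrC.
(* The third derivative lies in L; its B component is the new direction. *)
- have E := in_isoP (frameP z) (iso_iter 2 z).
  move: E; set c1 := - _; set c2 := 2 * _; set c3 := _ * _; set c4 := _ * _ => E.
  exists c4, c1, (fun k => if k == 1%N then c2 / 2 else c3).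
  rewrite big_nat_recr //= big_nat1 !frame3_E /= scalerA divfK ?pnatr_eq0 //.
  apply: (etrans E); move: (Y z) (dz Y z) (A z) (B z) => y x a b.
  by apply/colP => i; rewrite !mxE; ring.
Qed.

Lemma frame3_isotropic : isotropic_frame 3 Y T frame3.
Proof.
split.
  move=> j _; exact (smv_smooth oT (frame3_smooth j)).
move=> z _; split.
- move=> j k hj hk; rewrite !frame3_E; exact (frame3_gram (frameP z) hj hk).
- move=> j hj; exact (frame3_iter z hj).
- move=> j hj; rewrite -(frame3_normal z hj) nproj_conj; split; exact: normalC_nproj.
- move=> v /normalCE <-; rewrite /nproj.
  exists (fun k => 2^-1 * (if k == 2 then lor v (mxconj (A z)) else lor v (mxconj (B z)))),
         (fun k => 2^-1 * (if k == 2 then lor v (A z) else lor v (B z))).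
  rewrite sum23 !frame3_E /=; move: (A z) (B z) => a b.
  by apply/colP => i; rewrite !mxE; ring.
Qed.

(* P = span(A, B) is parallel for D_{\bar z}. *)
Lemma nproj_dzb_frame (u : C -> 'cV[C]_8) z : smv T u ->
  (forall z, lor (u z) (A z) = 0) -> (forall z, lor (u z) (B z) = 0) ->
  lor (u z) (dzb A z) = 0 -> lor (u z) (dzb B z) = 0 ->
  nproj (A z) (B z) (dzb u z) =
  (2^-1 * lor (dzb u z) (mxconj (A z))) *: A z + (2^-1 * lor (dzb u z) (mxconj (B z))) *: B z.
Proof.
move=> su uA uB h1 h2; rewrite /nproj.
have -> := etrans (lor_dzb0 oT su sA (fun z _ => uA z) I) (neg0 h1).
have -> := etrans (lor_dzb0 oT su sB (fun z _ => uB z) I) (neg0 h2).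
move: (dzb u z) (A z) (B z) => x a b.
by apply/colP => i; rewrite !mxE; ring.
Qed.

Lemma AdzbA z : lor (A z) (dzb A z) = 0.
Proof.
apply: opp_self; apply: etrans (lorC _ _) _.
exact (lor_dzb0 oT sA sA (fun z _ => AA z) I).
Qed.

Lemma BdzbB z : lor (B z) (dzb B z) = 0.
Proof.
apply: opp_self; apply: etrans (lorC _ _) _.
exact (lor_dzb0 oT sB sB (fun z _ => BB z) I).
Qed.

Lemma BdzbA z : lor (B z) (dzb A z) = 0.
Proof. exact (flip (dzbAB z)). Qed.

Lemma AdzbB z : lor (A z) (dzb B z) = 0.
Proof.
apply: flip; apply: etrans (lor_dzb0 oT sB sA (fun z _ => flip (AB z)) I) (neg0 _).
exact (BdzbA z).
Qed.

Lemma frame3_H z j : (2 <= j <= 3)%N -> exists chi (a : nat -> C),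
  Dzb Y (frame3 j) z chi /\ chi = \sum_(2 <= l < 4) a l *: frame3 l z.
Proof.
move=> hj; exists (nproj (A z) (B z) (dzb (frame3 j) z)).
have X (u : C -> 'cV[C]_8) : smv T u ->
  (forall z, lor (u z) (A z) = 0) -> (forall z, lor (u z) (B z) = 0) ->
  lor (u z) (dzb A z) = 0 -> lor (u z) (dzb B z) = 0 ->
  exists a : nat -> C, Dzb Y u z (nproj (A z) (B z) (dzb u z)) /\
    nproj (A z) (B z) (dzb u z) = \sum_(2 <= l < 4) a l *: frame3 l z.
  move=> su uA uB h1 h2.
  exists (fun k => 2^-1 * lor (dzb u z) (mxconj (if k == 2 then A z else B z))).
  split; first exact (normal_part_nproj z _).
  by rewrite (nproj_dzb_frame su uA uB h1 h2) sum23 !frame3_E.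
move: j hj => [|[|[|[|//]]]] // _.
  exact (X A sA AA AB (AdzbA z) (AdzbB z)).
exact (X B sB (fun z => flip (AB z)) BB (BdzbA z) (BdzbB z)).
Qed.

(** Pairing Y_zz = -(s/2) Y + kappa with Y_{z \bar z} kills kappa, and <Y, Y_{z \bar z}> = -1/2
    leaves s/4. *)
Definition schwarz z : C := 4 * lor (dz (dz Y) z) (dzb (dz Y) z).
Definition hopf z : 'cV[C]_8 := dz (dz Y) z + (schwarz z / 2) *: Y z.

Lemma sm_schwarz : sm T schwarz.
Proof. exact (smM (sm_cst _ _) (smv_lor sYzz sYzb)). Qed.

Lemma smv_hopf : smv T hopf.
Proof. exact (smvD sYzz (smvZ (smM sm_schwarz (sm_cst _ _)) sY)). Qed.

Lemma hopf_pure (y yz w a b v : 'cV[C]_8) c1 c2 c3 : null_frame y yz w a b ->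
  v = c1 *: y + c2 *: yz + c3 *: a -> lor v (mxconj yz) = 0 ->
  v + (4 * lor v w / 2) *: y = c3 *: a.
Proof.
move=> F ->; have yyb := flip (nf_yby F).
rewrite !lorDl !lorZl (nf_yzyb F) (nf_ayb F) yyb (nf_yw F) (nf_yzw F) (nf_aw F).
rewrite !mulr0 add0r !addr0 => /eqP; rewrite mulf_eq0 invr_eq0 pnatr_eq0 orbF => /eqP ->.
by apply/colP => i; rewrite !mxE; field.
Qed.

(** The Y_z component of Y_zz vanishes, since differentiating <Y_z, Y_{\bar z}> = 1/2 gives <Y_zz,
    Y_{\bar z}> = 0. What remains modulo Y is the A component. *)
Lemma hopf_A z : exists c, hopf z = c *: A z.
Proof.
have [c1 [c2 [c3 E]]] := Yzz z; exists c3; apply: (hopf_pure (frameP z) E).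
apply: etrans (congr1 (lor _) (Yb_conj z)) _.
apply: etrans (lor_dz0 oT sYz sYb (fun z _ => YzYb z) I) (neg0 _).
exact (etrans (congr1 (lor (dz Y z)) (dzdzbY z)) (nf_yzw (frameP z))).
Qed.

Lemma hopf_perp z v : lor (A z) v = 0 -> lor (hopf z) v = 0.
Proof. by move=> h; have [c ->] := hopf_A z; rewrite lorZl h mulr0. Qed.

Lemma hopf_nproj z : nproj (A z) (B z) (hopf z) = hopf z.
Proof.
by have [c ->] := hopf_A z; rewrite nprojZ (nproj_a (frameP z)).
Qed.

Lemma surface_hopf_schwarz : hopf_schwarz Y schwarz hopf.
Proof.
move=> z; split; first by rewrite -hopf_nproj; exact: normalC_nproj.
rewrite /hopf; move: (dz (dz Y) z) (Y z) => a b.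
by apply/colP => i; rewrite !mxE; ring.
Qed.

Definition hopf1 z := nproj (A z) (B z) (dzb hopf z).
Definition hopf2 z := nproj (A z) (B z) (dzb hopf1 z).

Lemma hopf1E z : hopf1 z = (2^-1 * lor (dzb hopf z) (mxconj (A z))) *: A z +
   (2^-1 * lor (dzb hopf z) (mxconj (B z))) *: B z.
Proof.
exact (nproj_dzb_frame smv_hopf (fun z => hopf_perp (AA z)) (fun z => hopf_perp (AB z))
  (hopf_perp (AdzbA z)) (hopf_perp (AdzbB z))).
Qed.

Lemma smv_hopf1 : smv T hopf1.
Proof.
apply: (smv_eq (F := fun z => (2^-1 * lor (dzb hopf z) (mxconj (A z))) *: A z +
   (2^-1 * lor (dzb hopf z) (mxconj (B z))) *: B z)).
  move=> z _; exact (esym (hopf1E z)).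
have s1 := smv_dzb oT smv_hopf.
exact (smvD (smvZ (smM (sm_cst _ _) (smv_lor s1 (smv_conj sA))) sA)
            (smvZ (smM (sm_cst _ _) (smv_lor s1 (smv_conj sB))) sB)).
Qed.

Lemma hopf1_perp z v : lor (A z) v = 0 -> lor (B z) v = 0 -> lor (hopf1 z) v = 0.
Proof. by move=> h1 h2; rewrite hopf1E lorDl !lorZl h1 h2 !mulr0 addr0. Qed.

Lemma hopf2E z : hopf2 z = (2^-1 * lor (dzb hopf1 z) (mxconj (A z))) *: A z +
   (2^-1 * lor (dzb hopf1 z) (mxconj (B z))) *: B z.
Proof.
exact (nproj_dzb_frame smv_hopf1 (fun z => hopf1_perp (AA z) (flip (AB z)))
  (fun z => hopf1_perp (AB z) (BB z))
  (hopf1_perp (AdzbA z) (BdzbA z)) (hopf1_perp (AdzbB z) (BdzbB z))).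
Qed.

(** There is no component along Y_{\bar z} or [nvec]: kappa is a multiple of A, and A is orthogonal
    to Y and Y_z as well as to their \bar z-derivatives. *)
Lemma hopf_dzb z : dzb hopf z = hopf1 z
  + (- lor (dzb hopf z) (nvec (Y z) (dzb (dz Y) z)) *: Y z
     + (2 * lor (dzb hopf z) (mxconj (dz Y z))) *: dz Y z).
Proof.
have e1 : lor (dzb hopf z) (Y z) = 0.
  apply: etrans (lor_dzb0 oT smv_hopf sY (fun z _ => hopf_perp (AY z)) I) (neg0 _).
  exact (hopf_perp (AYb z)).
have e2 : lor (dzb hopf z) (dz Y z) = 0.
  apply: etrans (lor_dzb0 oT smv_hopf sYz (fun z _ => hopf_perp (AYz z)) I) (neg0 _).
  exact (hopf_perp (AYzb z)).
have := nf_expand (frameP z) (dzb hopf z); rewrite e1 e2 -/(hopf1 z) => {1}->.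
by rewrite oppr0 !mulr0 !scale0r !addr0 addrC.
Qed.

Local Notation np z := (nproj (A z) (B z)).

Lemma np_dzb_Y z f : sm T f -> np z (dzb (fun z => f z *: Y z) z) = 0.
Proof.
move=> sf; apply: etrans (congr1 (np z) (dzbZ oT I sf sY)) _.
have e := nproj_yb (frameP z); rewrite (Yb_conj z) in e.
by apply: etrans (nproj_lin _ _ (nproj_y (frameP z)) e) _; rewrite !scaler0 addr0.
Qed.

Lemma np_dzb_Yz z f : sm T f -> np z (dzb (fun z => f z *: dz Y z) z) = 0.
Proof.
move=> sf; apply: etrans (congr1 (np z) (dzbZ oT I sf sYz)) _.
apply: etrans (nproj_lin _ _ (nproj_yz (frameP z)) (nproj_w (frameP z))) _.
by rewrite !scaler0 addr0.
Qed.

Lemma dzbdzbY_conj z : dzb (dzb Y) z = mxconj (dz (dz Y) z).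
Proof.
rewrite -(dzb_conj oT I sYz); congr (dzb _ z); apply/funext => x.
exact (esym (Yb_conj x)).
Qed.

Lemma dzbdzbY z : dzb (dzb Y) z = - (Num.conj (schwarz z) / 2) *: Y z + mxconj (hopf z).
Proof.
rewrite dzbdzbY_conj /hopf mxconjD mxconjZ Yreal cjM cjV cj_nat.
move: (mxconj _) (Y z) => a b; by apply/colP => i; rewrite !mxE; ring.
Qed.

Lemma np_dzb_Yb z f : sm T f -> np z (dzb (fun z => f z *: dzb Y z) z) = f z *: mxconj (hopf z).
Proof.
move=> sf; apply: etrans (congr1 (np z) (dzbZ oT I sf sYb)) _.
have e := nproj_yb (frameP z); rewrite (Yb_conj z) in e.
apply: etrans (nproj_lin _ _ e (erefl _)) _; rewrite scaler0 add0r; congr (_ *: _).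
apply: etrans (congr1 (np z) (dzbdzbY z)) _.
have h : np z (mxconj (hopf z)) = mxconj (hopf z) by rewrite -nproj_conj hopf_nproj.
have := nproj_lin (- (Num.conj (schwarz z) / 2)) 1 (nproj_y (frameP z)) h.
by rewrite !scale1r scaler0 add0r.
Qed.

Let nv z := nvec (Y z) (dzb (dz Y) z).
Let ca z := - lor (dzb hopf z) (nv z).
Let cb z := 2 * lor (dzb hopf z) (mxconj (dz Y z)).
Let cs z := - (schwarz z / 2).

Lemma smv_nv : smv T nv.
Proof.
exact (smvD (smvZ (sm_cst _ _) sYzb) (smvZ (smM (sm_cst _ _) (smv_lor sYzb sYzb)) sY)).
Qed.

Lemma sm_ca : sm T ca.
Proof. exact (smN (smv_lor (smv_dzb oT smv_hopf) smv_nv)). Qed.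

Lemma sm_cb : sm T cb.
Proof. exact (smM (sm_cst _ _) (smv_lor (smv_dzb oT smv_hopf) (smv_conj sYz))). Qed.

Lemma sm_cs : sm T cs.
Proof. exact (smN (smM sm_schwarz (sm_cst _ _))). Qed.

Lemma YzzE : dz (dz Y) = fun z => cs z *: Y z + hopf z.
Proof.
apply/funext => x; have [_ E] := surface_hopf_schwarz x; exact E.
Qed.

Lemma YzzbE : dzb (dz (dz Y)) = fun z => ((wzb cs z + ca z) *: Y z + cb z *: dz Y z)
     + (cs z *: dzb Y z + hopf1 z).
Proof.
apply/funext => x; rewrite YzzE.
apply: etrans (dzbD oT I (smvZ sm_cs sY) smv_hopf) _.
rewrite (dzbZ oT I sm_cs sY) hopf_dzb -/(nv x) -/(ca x) -/(cb x).
move: (hopf1 x) (Y x) (dz Y x) (dzb Y x) => a b c d.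
by apply/colP => i; rewrite !mxE; ring.
Qed.

(** Differentiating -(s/2) Y + kappa twice in \bar z, the terms along Y and Y_z leave no normal
    part, while Y_{\bar z \bar z} contributes the conjugate of kappa. Together with [Yzzbb_real]
    this is the Codazzi equation in the form used below. *)
Lemma np_Yzzbb z : np z (dzb (dzb (dz (dz Y))) z) =
  hopf2 z - (schwarz z / 2) *: mxconj (hopf z).
Proof.
have sw : sm T (fun z => wzb cs z + ca z) by exact (smD (sm_wzb oT sm_cs) sm_ca).
have s1 := smvD (smvZ sw sY) (smvZ sm_cb sYz).
have s2 := smvD (smvZ sm_cs sYb) smv_hopf1.
rewrite YzzbE; apply: etrans (congr1 (np z) (dzbD oT I s1 s2)) _.
rewrite (dzbD oT I (smvZ sw sY) (smvZ sm_cb sYz)) (dzbD oT I (smvZ sm_cs sYb) smv_hopf1).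
have h (a b c d : 'cV[C]_8) : np z a = 0 -> np z b = 0 -> np z (a + b + (c + d)) = np z c + np z d.
  by move=> h1 h2; rewrite !nprojD h1 h2 !add0r.
apply: etrans (h _ _ _ _ (np_dzb_Y z sw) (np_dzb_Yz z sm_cb)) _.
apply: etrans (congr1 (+%R^~ _) (np_dzb_Yb z sm_cs)) _.
by rewrite /cs scaleNr addrC.
Qed.

Lemma Yzzbb_real z : mxconj (dzb (dzb (dz (dz Y))) z) = dzb (dzb (dz (dz Y))) z.
Proof.
have sbb := smv_dzb oT sYb.
have c1 : (fun x => mxconj (dzb (dzb Y) x)) = dz (dz Y).
  by apply/funext => x; rewrite dzbdzbY_conj mxconjK.
have e1 : dzb (dz (dz Y)) = dz (dz (dzb Y)).
  apply: (etrans (y := dz (dzb (dz Y)))).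
    by apply/funext => x; exact (esym (dz_dzb oT I sYz)).
  by congr dz; apply/funext => x; exact (esym (dzdzbY x)).
have e2 : dzb (dz (dz (dzb Y))) = dz (dz (dzb (dzb Y))).
  apply: (etrans (y := dz (dzb (dz (dzb Y))))).
    by apply/funext => x; exact (esym (dz_dzb oT I (smv_dz oT sYb))).
  by congr dz; apply/funext => x; exact (esym (dz_dzb oT I sYb)).
have c2 := etrans (congr1 (@dzb R 8 1) e1) e2.
apply: etrans (congr1 (fun u => mxconj (u z)) c2) _.
apply: etrans (esym (dzb_conj oT I (smv_dz oT sbb))) _; congr (dzb _ z).
apply/funext => x; apply: etrans (esym (dzb_conj oT I sbb)) _; congr (dzb _ x).
exact c1.
Qed.

(** Pairing t with the conjugate of a reads off 2 p; as t is real, the same number is the conjugate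
    of <t, a> = 0. *)
Lemma parallel_real (y yz w a b t : 'cV[C]_8) p q : null_frame y yz w a b ->
  mxconj t = t -> t = p *: a + q *: b -> t = 0.
Proof.
move=> F tr tE; have two : 2 != 0 :> C by rewrite pnatr_eq0.
have hp : p = 0.
  apply: (mulIf two); rewrite mul0r; transitivity (lor t (mxconj a)).
    by rewrite tE lorDl !lorZl (nf_aac F) (flip (nf_acb F)) mulr0 addr0.
  rewrite -tr lor_conj tE lorDl !lorZl (nf_aa F) (flip (nf_ab F)).
  by rewrite !mulr0 addr0 conjC0.
have hq : q = 0.
  apply: (mulIf two); rewrite mul0r; transitivity (lor t (mxconj b)).
    by rewrite tE lorDl !lorZl (nf_bbc F) (nf_abc F) mulr0 add0r.
  by rewrite -tr lor_conj tE lorDl !lorZl (nf_bb F) (nf_ab F) !mulr0 addr0 conjC0.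
by rewrite tE hp hq !scale0r addr0.
Qed.

(* Codazzi: D_zb D_zb kappa + (conj s / 2) kappa is always real; here it also
   lies in P, which meets its conjugate trivially. *)
Lemma surface_willmore_eq z : hopf2 z + (Num.conj (schwarz z) / 2) *: hopf z = 0.
Proof.
have E := congr1 (@mxconj R 8 1) (np_Yzzbb z).
rewrite nproj_conj Yzzbb_real np_Yzzbb mxconjD mxconjN mxconjZ mxconjK in E.
have e2 x : Num.conj (x / 2) = Num.conj x / 2 :> C by rewrite cjM cjV cj_nat.
rewrite e2 in E.
have [c hc] := hopf_A z; have h2 := hopf2E z.
apply: (parallel_real (frameP z) (p := 2^-1 * lor (dzb hopf1 z) (mxconj (A z))
   + Num.conj (schwarz z) / 2 * c) (q := 2^-1 * lor (dzb hopf1 z) (mxconj (B z)))).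
  move: (schwarz z) (hopf2 z) (hopf z) E => s a b E.
  rewrite mxconjD mxconjZ cjM cjV cj_nat conjCK.
  move/eqP: E; rewrite -subr_eq0 => /eqP E.
  apply/eqP; rewrite -subr_eq0 -oppr_eq0 -E; apply/eqP.
  move: (mxconj a) (mxconj b) => c' d; by apply/colP => i; rewrite !mxE; ring.
apply: etrans (congr2 (fun u v => u + (Num.conj (schwarz z) / 2) *: v) h2 hc) _.
move: (A z) (B z) => a b; by apply/colP => i; rewrite !mxE; ring.
Qed.

End IsotropicSurface.

Transparent dz dzb du dv wz wzb pderive mxconj lor.

(** * Normalization of null fields *)

Section Lift.
Variable R : realType.
Local Notation C := R[i].
Local Notation T := [set: C].
Let oT : Defs.openC T := @openCT R.

Lemma lor_self_dz (X : C -> 'cV[C]_8) z : smv T X -> (forall z, lor (X z) (X z) = 0) ->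
  lor (X z) (dz X z) = 0.
Proof.
move=> sX XX; apply: opp_self; apply: etrans (lorC _ _) _.
exact (lor_dz0 oT sX sX (fun z _ => XX z) I).
Qed.

Lemma lor_self_dzb (X : C -> 'cV[C]_8) z : smv T X -> (forall z, lor (X z) (X z) = 0) ->
  lor (X z) (dzb X z) = 0.
Proof.
move=> sX XX; apply: opp_self; apply: etrans (lorC _ _) _.
exact (lor_dzb0 oT sX sX (fun z _ => XX z) I).
Qed.

Lemma lor_null_scale (x u v : 'cV[C]_8) p q h :
  lor x x = 0 -> lor x u = 0 -> lor x v = 0 ->
  lor (p *: x + h *: u) (q *: x + h *: v) = h ^+ 2 * lor u v.
Proof.
move=> h1 h2 h3; rewrite !lorDl !lorDr !lorZl !lorZr h1 h3 (lorC u) h2; ring.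
Qed.

Lemma lor_perp4 (e x u v w : 'cV[C]_8) c1 c2 c3 c4 :
  lor e x = 0 -> lor e u = 0 -> lor e v = 0 -> lor e w = 0 ->
  lor e ((c1 *: x + c2 *: u) + (c3 *: v + c4 *: w)) = 0.
Proof.
by move=> h1 h2 h3 h4; rewrite !lorDr !lorZr h1 h2 h3 h4 !mulr0 !addr0.
Qed.

Lemma span_scale (x xz a : 'cV[C]_8) p q h s c1 c2 c3 : h != 0 -> s != 0 ->
  exists d1 d2 d3,
   (q *: x + p *: xz) + (p *: xz + h *: (c1 *: x + c2 *: xz + c3 *: a)) =
   d1 *: (h *: x) + d2 *: (p *: x + h *: xz) + d3 *: (s *: a).
Proof.
move=> h0 s0; exists ((q + h * c1 - (2 * p + h * c2) / h * p) / h), ((2 * p + h * c2) / h), (h * c3 / s).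
apply/colP => i; rewrite !mxE; field; by rewrite h0 s0.
Qed.

(* A null field with an isotropic orthogonal frame of half of its normal
   space, both without normalization. *)
Record iso_data (X a b : C -> 'cV[C]_8) (G na nb : C -> C) : Prop := IsoData {
  id_sX : smv T X; id_sa : smv T a; id_sb : smv T b;
  id_sG : sm T G; id_sna : sm T na; id_snb : sm T nb;
  id_real : forall z, mxconj (X z) = X z;
  id_pos : forall z, 0 < X z ord0 0;
  id_G : forall z, 0 < G z; id_na : forall z, 0 < na z; id_nb : forall z, 0 < nb z;
  id_XX : forall z, lor (X z) (X z) = 0;
  id_XzXz : forall z, lor (dz X z) (dz X z) = 0;
  id_XzXb : forall z, lor (dz X z) (dzb X z) = G z;
  id_aa : forall z, lor (a z) (a z) = 0; id_bb : forall z, lor (b z) (b z) = 0;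
  id_ab : forall z, lor (a z) (b z) = 0;
  id_aac : forall z, lor (a z) (mxconj (a z)) = na z;
  id_bbc : forall z, lor (b z) (mxconj (b z)) = nb z;
  id_abc : forall z, lor (a z) (mxconj (b z)) = 0;
  id_aX : forall z, lor (a z) (X z) = 0; id_aXz : forall z, lor (a z) (dz X z) = 0;
  id_aXb : forall z, lor (a z) (dzb X z) = 0;
  id_aXzb : forall z, lor (a z) (dzb (dz X) z) = 0;
  id_bX : forall z, lor (b z) (X z) = 0; id_bXz : forall z, lor (b z) (dz X z) = 0;
  id_bXb : forall z, lor (b z) (dzb X z) = 0;
  id_bXzb : forall z, lor (b z) (dzb (dz X) z) = 0;
  id_Xzz : forall z, exists c1 c2 c3, dz (dz X) z = c1 *: X z + c2 *: dz X z + c3 *: a z;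
  id_dzab : forall z, lor (dz a z) (b z) = 0;
  id_dzbab : forall z, lor (dzb a z) (b z) = 0 }.

Section FromData.
Variables (X a b : C -> 'cV[C]_8) (G na nb : C -> C).
Hypothesis D : iso_data X a b G na nb.

(** The factor with h^2 G = 1/2, which makes h X the canonical lift; [afun] and [bfun] bring the
    Hermitian squares of a and b to 2. *)
Definition hfun z := rsq (2 * G z).
Definition afun z := rsq (2^-1 * na z).
Definition bfun z := rsq (2^-1 * nb z).
Definition Ylift z := hfun z *: X z.
Definition Aframe z := afun z *: a z.
Definition Bframe z := bfun z *: b z.

Lemma half_gt0 : 0 < 2^-1 :> C. Proof. by rewrite invr_gt0 ltr0n. Qed.

Lemma sm_hfun : sm T hfun.
Proof.
apply: sm_rsq => [z _|]; first exact (mulr_gt0 (ltr0n _ 2) (id_G D z)).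
exact (smM (sm_cst _ _) (id_sG D)).
Qed.

Lemma sm_afun : sm T afun.
Proof.
apply: sm_rsq => [z _|]; first exact (mulr_gt0 half_gt0 (id_na D z)).
exact (smM (sm_cst _ _) (id_sna D)).
Qed.

Lemma sm_bfun : sm T bfun.
Proof.
apply: sm_rsq => [z _|]; first exact (mulr_gt0 half_gt0 (id_nb D z)).
exact (smM (sm_cst _ _) (id_snb D)).
Qed.

Lemma hfun_gt0 z : 0 < hfun z.
Proof. exact: rsq_gt0 (mulr_gt0 (ltr0n _ 2) (id_G D z)). Qed.

Lemma afun_gt0 z : 0 < afun z.
Proof. exact: rsq_gt0 (mulr_gt0 half_gt0 (id_na D z)). Qed.

Lemma smv_Ylift : smv T Ylift. Proof. exact (smvZ sm_hfun (id_sX D)). Qed.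
Lemma smv_Aframe : smv T Aframe. Proof. exact (smvZ sm_afun (id_sa D)). Qed.
Lemma smv_Bframe : smv T Bframe. Proof. exact (smvZ sm_bfun (id_sb D)). Qed.

Lemma dz_Ylift z : dz Ylift z = wz hfun z *: X z + hfun z *: dz X z.
Proof. exact (dzZ oT I sm_hfun (id_sX D)). Qed.

Lemma dzb_Ylift z : dzb Ylift z = wzb hfun z *: X z + hfun z *: dzb X z.
Proof. exact (dzbZ oT I sm_hfun (id_sX D)). Qed.

Lemma dz_Ylift_fun : dz Ylift = fun z => wz hfun z *: X z + hfun z *: dz X z.
Proof. apply/funext => z; exact (dz_Ylift z). Qed.

Let sXz : smv T (dz X) := smv_dz oT (id_sX D).
Let swh : sm T (wz hfun) := sm_wz oT sm_hfun.

Lemma dzb_dz_Ylift z : dzb (dz Ylift) z =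
  (wzb (wz hfun) z *: X z + wz hfun z *: dzb X z)
  + (wzb hfun z *: dz X z + hfun z *: dzb (dz X) z).
Proof.
apply: etrans (congr1 (fun f => dzb f z) dz_Ylift_fun) _.
apply: etrans (dzbD oT I (smvZ swh (id_sX D)) (smvZ sm_hfun sXz)) _.
exact (congr2 +%R (dzbZ oT I swh (id_sX D)) (dzbZ oT I sm_hfun sXz)).
Qed.

Lemma dz_dz_Ylift z : dz (dz Ylift) z =
  (wz (wz hfun) z *: X z + wz hfun z *: dz X z)
  + (wz hfun z *: dz X z + hfun z *: dz (dz X) z).
Proof.
apply: etrans (congr1 (fun f => dz f z) dz_Ylift_fun) _.
apply: etrans (dzD oT I (smvZ swh (id_sX D)) (smvZ sm_hfun sXz)) _.
exact (congr2 +%R (dzZ oT I swh (id_sX D)) (dzZ oT I sm_hfun sXz)).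
Qed.

Let XXz z := lor_self_dz z (id_sX D) (id_XX D).
Let XXb z := lor_self_dzb z (id_sX D) (id_XX D).

Lemma lor_scale0 (u v : 'cV[C]_8) p q : lor u v = 0 -> lor (p *: u) (q *: v) = 0.
Proof. by move=> h; rewrite lorZl lorZr h !mulr0. Qed.

Lemma lor_perp2 (e x u : 'cV[C]_8) p c1 c2 : lor e x = 0 -> lor e u = 0 ->
  lor (p *: e) (c1 *: x + c2 *: u) = 0.
Proof. by move=> h1 h2; rewrite lorZl lorDr !lorZr h1 h2 !mulr0 addr0 mulr0. Qed.

Lemma lor_dscale (x y u : 'cV[C]_8) p q s : lor x u = 0 -> lor y u = 0 ->
  lor (p *: x + q *: y) (s *: u) = 0.
Proof. by move=> h1 h2; rewrite lorZr lorDl !lorZl h1 h2 !mulr0 addr0 mulr0. Qed.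

Lemma normalized (u : 'cV[C]_8) (n : C) : 0 < n -> lor u (mxconj u) = n ->
  lor (rsq (2^-1 * n) *: u) (mxconj (rsq (2^-1 * n) *: u)) = 2.
Proof.
move=> n0 h; have := rsq_sqr (mulr_gt0 half_gt0 n0).
rewrite mxconjZ conj_rsq lorZl lorZr h; move: (rsq _) => r E.
have -> : r * (r * n) = 2 * (r ^+ 2 * (2^-1 * n)) by field.
by rewrite E mulr1.
Qed.

Lemma rsq_half (g : C) : 0 < g -> rsq (2 * g) ^+ 2 * g = 2^-1.
Proof.
move=> g0; have E := rsq_sqr (mulr_gt0 (ltr0n _ 2) g0).
apply: (@mulfI _ 2); first by rewrite pnatr_eq0.
have e2 : 2 * 2^-1 = 1 :> C by rewrite mulfV // pnatr_eq0.
by rewrite e2 -[RHS]E; ring.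
Qed.

(** Rescaling is harmless: the derivatives of the factors only add multiples of fields for which the
    required orthogonality is already known. *)
Lemma iso_data_surface : iso_surface Ylift Aframe Bframe.
Proof.
split.
- exact smv_Ylift.
- exact smv_Aframe.
- exact smv_Bframe.
- move=> z; rewrite /Ylift mxconjZ conj_rsq; congr (_ *: _); exact (id_real D z).
- move=> z; exact (lor_scale0 _ _ (id_XX D z)).
- move=> z; rewrite dz_Ylift.
  apply: etrans (lor_null_scale _ _ _ (id_XX D z) (XXz z) (XXz z)) _.
  by rewrite (id_XzXz D z) mulr0.
- move=> z; rewrite dz_Ylift dzb_Ylift.
  apply: etrans (lor_null_scale _ _ _ (id_XX D z) (XXz z) (XXb z)) _.
  rewrite (id_XzXb D z); exact (rsq_half (id_G D z)).
- move=> z; exact (lor_scale0 _ _ (id_aa D z)).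
- move=> z; exact (lor_scale0 _ _ (id_bb D z)).
- move=> z; exact (lor_scale0 _ _ (id_ab D z)).
- move=> z; exact (normalized (id_na D z) (id_aac D z)).
- move=> z; exact (normalized (id_nb D z) (id_bbc D z)).
- move=> z; rewrite /Bframe mxconjZ; exact (lor_scale0 _ _ (id_abc D z)).
- move=> z; exact (lor_scale0 _ _ (id_aX D z)).
- move=> z; rewrite dz_Ylift; exact (lor_perp2 _ _ _ (id_aX D z) (id_aXz D z)).
- move=> z; rewrite dzb_Ylift; exact (lor_perp2 _ _ _ (id_aX D z) (id_aXb D z)).
- move=> z; rewrite dzb_dz_Ylift /Aframe lorZl.
  by rewrite (lor_perp4 _ _ _ _ (id_aX D z) (id_aXb D z) (id_aXz D z) (id_aXzb D z)) mulr0.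
- move=> z; exact (lor_scale0 _ _ (id_bX D z)).
- move=> z; rewrite dz_Ylift; exact (lor_perp2 _ _ _ (id_bX D z) (id_bXz D z)).
- move=> z; rewrite dzb_Ylift; exact (lor_perp2 _ _ _ (id_bX D z) (id_bXb D z)).
- move=> z; rewrite dzb_dz_Ylift /Bframe lorZl.
  by rewrite (lor_perp4 _ _ _ _ (id_bX D z) (id_bXb D z) (id_bXz D z) (id_bXzb D z)) mulr0.
- move=> z; have [c1 [c2 [c3 E]]] := id_Xzz D z.
  rewrite dz_Ylift dz_dz_Ylift E.
  exact (span_scale _ _ _ _ _ _ _ _ (lt0r_neq0 (hfun_gt0 z)) (lt0r_neq0 (afun_gt0 z))).
- move=> z; rewrite (dzZ oT I sm_afun (id_sa D)).
  exact (lor_dscale _ _ _ (id_ab D z) (id_dzab D z)).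
- move=> z; rewrite (dzbZ oT I sm_afun (id_sa D)).
  exact (lor_dscale _ _ _ (id_ab D z) (id_dzbab D z)).
Qed.

End FromData.
End Lift.

(** * From light-cone fields to surfaces in the sphere *)

Section Projectivization.
Variable R : realType.
Local Notation C := R[i].
Local Notation T := [set: C].
Let oT : Defs.openC T := @openCT R.

Lemma realmxP p q (A : 'M[C]_(p, q)) : Defs.realmx A <-> mxconj A = A.
Proof.
split=> [/mxOverP h|h]; first by apply/matrixP => i j; rewrite mxE; apply/CrealP.
by apply/mxOverP => i j; apply/CrealP; rewrite -[in RHS]h mxE.
Qed.

Lemma lift1_0 n (y : 'cV[C]_n) : lift1 y ord0 0 = 1.
Proof.
rewrite /lift1 -[ord0](_ : lshift n (ord0 : 'I_1) = ord0); last exact: val_inj.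
by apply: etrans (col_mxEu _ _ ord0 0) _; rewrite mxE eqxx.
Qed.

Lemma lift1_S n (y : 'cV[C]_n) j : lift1 y (lift ord0 j) 0 = y j 0.
Proof.
rewrite /lift1 -[lift ord0 j](_ : rshift 1 j = lift ord0 j); last exact: val_inj.
exact: col_mxEd.
Qed.

Lemma lift1_bracket n (X : 'cV[C]_n.+1) : X ord0 0 != 0 ->
  lift1 (bracket X) = (X ord0 0)^-1 *: X.
Proof.
move=> X0; apply/colP => i; case: (unliftP ord0 i) => [j|] ->.
  by rewrite lift1_S !mxE mulrC.
by rewrite lift1_0 mxE mulVf.
Qed.

Lemma bracketZ n h (X : 'cV[C]_n.+1) : h != 0 -> bracket (h *: X) = bracket X.
Proof.
move=> h0; apply/colP => j; rewrite !mxE invfM mulrACA mulfV // mul1r //.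
Qed.

Lemma lor_lift1 n (y : 'cV[C]_n) : lor (lift1 y) (lift1 y) = dot y y - 1.
Proof.
rewrite /lor lift1_0 mulr1 addrC; congr (_ - _).
by apply: eq_bigr => j _; rewrite lift1_S.
Qed.

Lemma on_sphere_bracket n (X : 'cV[C]_n.+1) : mxconj X = X -> X ord0 0 != 0 ->
  lor X X = 0 -> on_sphere (bracket X).
Proof.
move=> Xr X0 XX; split.
  apply/realmxP/colP => j; rewrite !mxE cjM cjV.
  by congr (_ / _); [rewrite -[in RHS]Xr mxE|rewrite -[in RHS]Xr mxE].
have := lor_lift1 (bracket X); rewrite (lift1_bracket X0) lorZl lorZr XX !mulr0.
by move/esym/eqP; rewrite subr_eq0 => /eqP.
Qed.

Section Derivatives.
Variables (n : nat) (y : C -> 'cV[C]_n).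
Hypothesis sy : smv T y.

Lemma smv_lift1 : smv T (fun z => lift1 (y z)).
Proof.
move=> i k; rewrite (ord1 k); case: (unliftP ord0 i) => [j|] ->.
  by apply: sm_eq (sy j 0) => z _; rewrite lift1_S.
by apply: sm_eq (sm_cst _ 1) => z _; rewrite lift1_0.
Qed.

Lemma dz_lift1_0 z : dz (fun z => lift1 (y z)) z ord0 0 = 0.
Proof.
rewrite dzE; under eq_fun do rewrite lift1_0.
exact (wz_cst oT _ I).
Qed.

Lemma dz_lift1_S z j : dz (fun z => lift1 (y z)) z (lift ord0 j) 0 = dz y z j 0.
Proof. by rewrite !dzE; under eq_fun do rewrite lift1_S. Qed.

Lemma dzb_lift1_S z j : dzb (fun z => lift1 (y z)) z (lift ord0 j) 0 = dzb y z j 0.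
Proof. by rewrite !dzbE; under eq_fun do rewrite lift1_S. Qed.

Lemma lor_dot (u v : 'cV[C]_n.+1) (a b : 'cV[C]_n) : u ord0 0 = 0 ->
  (forall j, u (lift ord0 j) 0 = a j 0) -> (forall j, v (lift ord0 j) 0 = b j 0) ->
  lor u v = dot a b.
Proof.
move=> u0 ua vb; rewrite /lor u0 mul0r oppr0 add0r.
by apply: eq_bigr => j _; rewrite ua vb.
Qed.

Lemma lor_dz_lift1 z (v : 'cV[C]_n.+1) (b : 'cV[C]_n) : (forall j, v (lift ord0 j) 0 = b j 0) ->
  lor (dz (fun z => lift1 (y z)) z) v = dot (dz y z) b.
Proof. by apply: lor_dot; [exact: dz_lift1_0|exact: dz_lift1_S]. Qed.

End Derivatives.

Lemma dotDl n (u v w : 'cV[C]_n) : dot (u + v) w = dot u w + dot v w.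
Proof. by rewrite /dot -big_split; apply: eq_bigr => j _; rewrite mxE mulrDl. Qed.

Lemma dotZl n a (u w : 'cV[C]_n) : dot (a *: u) w = a * dot u w.
Proof. by rewrite /dot mulr_sumr; apply: eq_bigr => j _; rewrite mxE mulrA. Qed.

Lemma dotC n (u w : 'cV[C]_n) : dot u w = dot w u.
Proof. by apply: eq_bigr => j _; rewrite mulrC. Qed.

Lemma dot_conj n (u w : 'cV[C]_n) : dot (mxconj u) (mxconj w) = Num.conj (dot u w).
Proof. by rewrite /dot rmorph_sum; apply: eq_bigr => j _; rewrite !mxE rmorphM. Qed.

Lemma dotDr n (u v w : 'cV[C]_n) : dot w (u + v) = dot w u + dot w v.
Proof. by rewrite dotC dotDl !(dotC w). Qed.

Lemma dotZr n a (u w : 'cV[C]_n) : dot w (a *: u) = a * dot w u.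
Proof. by rewrite dotC dotZl (dotC w). Qed.

Lemma lor_du_dv n (X : C -> 'cV[C]_n.+1) z p q : smv T X -> lor (dz X z) (dz X z) = p ->
  lor (dzb X z) (dzb X z) = p -> lor (dz X z) (dzb X z) = q -> p = 0 ->
  [/\ lor (du X z) (du X z) = 2 * q, lor (dv X z) (dv X z) = 2 * q
    & lor (du X z) (dv X z) = 0].
Proof.
move=> sX h1 h2 h3 p0; rewrite (du_wz oT I sX) (dv_wz oT I sX).
move: (dz X z) (dzb X z) h1 h2 h3 => a b h1 h2 h3.
rewrite !lorZr !lorZl !lorDr !lorDl !lorNr !lorNl (lorC b a) h1 h2 h3 p0.
by split; [ring|rewrite mulrA ii; ring|ring].
Qed.

Lemma dot_du_dv n (U : set C) (X : C -> 'cV[C]_n) z p q : Defs.openC U -> U z ->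
  smv U X -> dot (dz X z) (dz X z) = p ->
  dot (dzb X z) (dzb X z) = p -> dot (dz X z) (dzb X z) = q -> p = 0 ->
  [/\ dot (du X z) (du X z) = 2 * q, dot (dv X z) (dv X z) = 2 * q
    & dot (du X z) (dv X z) = 0].
Proof.
move=> oU Uz sX h1 h2 h3 p0; rewrite (du_wz oU Uz sX) (dv_wz oU Uz sX).
move: (dz X z) (dzb X z) h1 h2 h3 => a b h1 h2 h3.
rewrite -[- b]scaleN1r !dotZr !dotZl !dotDr !dotDl !dotZr !dotZl (dotC b a) h1 h2 h3 p0.
by split; [ring|rewrite mulrA ii; ring|ring].
Qed.

Record conformal_cone (X : C -> 'cV[C]_8) (G : C -> C) : Prop := ConformalCone {
  cc_s : smv T X;
  cc_real : forall z, mxconj (X z) = X z;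
  cc_pos : forall z, 0 < X z ord0 0;
  cc_null : forall z, lor (X z) (X z) = 0;
  cc_conf : forall z, lor (dz X z) (dz X z) = 0;
  cc_G : forall z, lor (dz X z) (dzb X z) = G z;
  cc_Gpos : forall z, 0 < G z }.

Section Cone.
Variables (X : C -> 'cV[C]_8) (G : C -> C).
Hypothesis D : conformal_cone X G.

Lemma cc_neq0 z : X z ord0 0 != 0. Proof. exact (lt0r_neq0 (cc_pos D z)). Qed.

Lemma cc_dzb z : dzb X z = mxconj (dz X z).
Proof.
rewrite -(dzb_conj oT I (cc_s D)); congr (dzb _ z); apply/funext => x.
exact (esym (cc_real D x)).
Qed.

Lemma cc_conf_conj z : lor (dzb X z) (dzb X z) = 0.
Proof. by rewrite cc_dzb lor_conj (cc_conf D z) conjC0. Qed.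

Lemma sm_invX0 : sm T (fun z => (X z ord0 0)^-1).
Proof. apply: smV (cc_s D ord0 0) => z _; exact (cc_neq0 z). Qed.

Lemma smv_bracket : smv T (fun z => bracket (X z)).
Proof.
move=> i k; rewrite (ord1 k).
apply: sm_eq (smM (cc_s D (lift ord0 i) 0) sm_invX0) => z _.
by rewrite mxE.
Qed.

Let y z := bracket (X z).

Lemma lift1_scaled : (fun z => lift1 (y z)) = fun z => (X z ord0 0)^-1 *: X z.
Proof. apply/funext => z; exact (lift1_bracket (cc_neq0 z)). Qed.

Lemma dot_dz_bracket z : dot (dz y z) (dz y z) = 0.
Proof.
rewrite -(lor_dz_lift1 y z (dz_lift1_S y z)) lift1_scaled (dzZ oT I sm_invX0 (cc_s D)).
have h := lor_self_dz z (cc_s D) (cc_null D).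
by apply: etrans (lor_null_scale _ _ _ (cc_null D z) h h) _; rewrite (cc_conf D z) mulr0.
Qed.

Lemma dot_dzb_bracket z : dot (dz y z) (dzb y z) = G z / X z ord0 0 ^+ 2.
Proof.
rewrite -(lor_dz_lift1 y z (dzb_lift1_S y z)) lift1_scaled (dzZ oT I sm_invX0 (cc_s D)).
rewrite (dzbZ oT I sm_invX0 (cc_s D)).
have h := lor_self_dz z (cc_s D) (cc_null D).
have h' := lor_self_dzb z (cc_s D) (cc_null D).
apply: etrans (lor_null_scale _ _ _ (cc_null D z) h h') _.
by rewrite (cc_G D z) mulrC exprVn.
Qed.

Lemma on_sphere_cone z : on_sphere (y z).
Proof. exact (on_sphere_bracket (cc_real D z) (cc_neq0 z) (cc_null D z)). Qed.

Lemma dzb_bracket z : dzb y z = mxconj (dz y z).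
Proof.
rewrite -(dzb_conj oT I smv_bracket); congr (dzb _ z); apply/funext => x.
by have [/realmxP ->] := on_sphere_cone x.
Qed.

Lemma conformal_immersion_cone : conformal_immersion setT y.
Proof.
split; first exact (smv_smooth oT smv_bracket).
move=> z _; have h : dot (dzb y z) (dzb y z) = 0.
  by rewrite dzb_bracket dot_conj dot_dz_bracket conjC0.
have [e1 e2 e3] := dot_du_dv oT I smv_bracket (dot_dz_bracket z) h (dot_dzb_bracket z) erefl.
rewrite e1 e2 e3; split => //; apply: mulr_gt0; first by rewrite ltr0n.
by apply: divr_gt0; [exact (cc_Gpos D z)|apply: exprn_gt0; exact (cc_pos D z)].
Qed.

End Cone.

Lemma canonical_lift_cone Y : conformal_cone Y (fun=> 2^-1) ->
  canonical_lift (fun z => bracket (Y z)) Y.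
Proof.
move=> D; split; first exact (smv_smooth oT (cc_s D)).
move=> z.
have [-> -> ->] := lor_du_dv (cc_s D) (cc_conf D z) (cc_conf_conj D z) (cc_G D z) erefl.
rewrite mulfV ?pnatr_eq0 //; split => //.
  split; [exact (proj2 (realmxP _) (cc_real D z))|exact (cc_pos D z)].
by rewrite (lift1_bracket (cc_neq0 D z)) scalerA mulfV ?scale1r // (cc_neq0 D z).
Qed.

(** Here [v] is not asked to lie in [sm]: it will be the first coordinate of an arbitrary canonical
    lift, which is smooth only in the sense of [Ck]. *)
Lemma du_scale (v : C -> C) (L : C -> 'cV[C]_8) z : pderivable 1 v z -> smv T L ->
  du (fun z => v z *: L z) z = pderive 1 v z *: L z + v z *: du L z.
Proof.
move=> dv sL; apply/matrixP => i j; rewrite duE [RHS]mxE.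
rewrite [X in _ = X + _]mxE [X in _ = _ + X]mxE duE.
have h : dirder (fun w => L w i j) z 1 (pderive 1 (fun w => L w i j) z).
  by have [e we fe] := sL i j; have h := @sm_dirder R T _ e z 1 oT I we fe; rewrite (dirder_pderive h).
apply: etrans _ (dirder_pderive (dirderM (pderivable_dirder dv) h)).
by congr (pderive _ _ z); apply/funext => w; rewrite mxE.
Qed.

(** Every lift is f L with L = (1, y). As <L, L> = 0, the u-derivative of f L has f^2 times the
    square length of that of L; so the normalization fixes f^2, and f > 0. *)
Lemma canonical_lift_unique Y Y' : conformal_cone Y (fun=> 2^-1) ->
  canonical_lift (fun z => bracket (Y z)) Y' -> Y' = Y.
Proof.
move=> D [sY' H]; apply/funext => z; have [[_ p1] E _ _ _] := H z.
have cone0 := canonical_lift_cone D; have [_ K] := cone0.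
have [_ E' _ _ _] := K z; rewrite E [RHS]E'; congr (_ *: _).
set L := fun z => lift1 (bracket (Y z)).
have sL : smv T L by exact (smv_lift1 (smv_bracket D)).
have LL w : lor (L w) (L w) = 0.
  by rewrite lor_lift1 (proj2 (on_sphere_cone D w)) subrr.
have LLu : lor (L z) (du L z) = 0.
  rewrite (du_wz oT I sL) lorDr (lor_self_dz z sL LL) (lor_self_dzb z sL LL).
  exact: addr0.
have X (W : C -> 'cV[C]_8) : smooth setT W -> (forall w, W w = W w ord0 0 *: L w) ->
    lor (du W z) (du W z) = 1 -> W z ord0 0 ^+ 2 * lor (du L z) (du L z) = 1.
  move=> sW WE; have [/(_ z I) [h _] _ _] := sW 1%N ord0 0.
  have -> : du W z = du (fun w => W w ord0 0 *: L w) z by congr (du _ z); apply/funext.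
  rewrite (du_scale h sL) => e; rewrite -e.
  exact (esym (lor_null_scale _ _ _ (LL z) LLu LLu)).
have [_ _ u1 _ _] := H z; have [_ _ u2 _ _] := K z.
have x1 := X Y' sY' (fun w => let: And5 _ e _ _ _ := H w in e) u1.
have x2 := X Y (proj1 cone0) (fun w => let: And5 _ e _ _ _ := K w in e) u2.
have n0 : lor (du L z) (du L z) != 0.
  by apply/eqP => e; move/eqP: x1; rewrite e mulr0 eq_sym oner_eq0.
have : Y' z ord0 0 ^+ 2 = Y z ord0 0 ^+ 2 by apply: (mulIf n0); rewrite x1 x2.
move=> h; apply: (pexpIrn (n := 2)) => //; rewrite nnegrE ltW //; exact (cc_pos D z).
Qed.

Section IsoSurface.
Variables Y A B : C -> 'cV[C]_8.
Hypothesis H : iso_surface Y A B.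
Hypothesis Ypos : forall z, 0 < Y z ord0 0.

Lemma surface_cone : conformal_cone Y (fun=> 2^-1).
Proof.
exact (ConformalCone (is_sY H) (is_Yreal H) Ypos (is_YY H) (is_YzYz H) (is_YzYb H)
  (fun=> half_gt0 R)).
Qed.

Lemma surface_HTI : HTI_willmore_immersion 3 (fun z => bracket (Y z)).
Proof.
have L := canonical_lift_cone surface_cone.
split.
- exact (on_sphere_cone surface_cone).
- exact (conformal_immersion_cone surface_cone).
- exists Y, (schwarz Y), (hopf Y), (hopf1 Y A B), (hopf2 Y A B); split.
  + exact L.
  + exact (surface_hopf_schwarz H).
  + move=> z; exact (normal_part_nproj H z _).
  + move=> z; exact (normal_part_nproj H z _).
  + exact (surface_willmore_eq H).
exists Y; first exact L.
split; first exact (surface_totally_isotropic H).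
move=> z0; exists T, (frame3 Y A B); split.
- exact oT.
- exact I.
- exact (frame3_isotropic H).
- move=> z j _ hj; exact (frame3_H H z hj).
Qed.

Lemma normalCB z u v : Defs.normalC Y z u -> Defs.normalC Y z v -> Defs.normalC Y z (u - v).
Proof. by move=> hu hv w hw; rewrite lorDl lorNl (hu w hw) (hv w hw) subrr. Qed.

Lemma nproj_comb4 (a b x1 x2 x3 x4 : 'cV[C]_8) c1 c2 c3 c4 :
  nproj a b x1 = 0 -> nproj a b x2 = 0 -> nproj a b x3 = 0 -> nproj a b x4 = 0 ->
  nproj a b (c1 *: x1 + c2 *: x2 + c3 *: x3 + c4 *: x4) = 0.
Proof.
by move=> h1 h2 h3 h4; rewrite !nprojD !nprojZ h1 h2 h3 h4 !scaler0 !addr0.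
Qed.

Lemma normal_tangential0 z u : Defs.normalC Y z u -> tangential Y z u -> u = 0.
Proof.
move=> hn [c1 [c2 [c3 [c4 E]]]]; rewrite -(normalCE H hn) E.
have F := frameP H z.
exact (nproj_comb4 _ _ _ _ (nproj_y F) (nproj_yz F) (nproj_yb F) (nproj_w F)).
Qed.

Lemma tangentialB z u v : tangential Y z u -> tangential Y z v -> tangential Y z (u - v).
Proof.
move=> [a [b [c [d ->]]]] [a' [b' [c' [d' ->]]]].
exists (a - a'), (b - b'), (c - c'), (d - d').
by move: (Y z) (dz Y z) (mxconj _) (dzb _ z) => p q r s; apply/colP => i; rewrite !mxE; ring.
Qed.

Lemma hopf_unique s k : hopf_schwarz Y s k -> k = hopf Y.
Proof.
move=> hk; apply/funext => z; have [n1 e1] := hk z.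
have [n2 e2] := surface_hopf_schwarz H z.
apply/eqP; rewrite -subr_eq0; apply/eqP; apply: (normal_tangential0 (normalCB n1 n2)).
rewrite e1 in e2; exists (s z / 2 - schwarz Y z / 2), 0, 0, 0.
move: e2; move: (k z) (hopf Y z) (Y z) (dz Y z) (mxconj _) (dzb _ z) => p q r s1 s2 s3 e2.
rewrite !scale0r !addr0; have -> : p = - (schwarz Y z / 2) *: r + q + (s z / 2) *: r.
  by rewrite -e2; apply/colP => i; rewrite !mxE; ring.
by apply/colP => i; rewrite !mxE; ring.
Qed.

Lemma Dzb_hopf_unique z k : Dzb Y (hopf Y) z k -> k = hopf1 Y A B z.
Proof.
move=> [n1 t1]; have [n2 t2] := normal_part_nproj H z (dzb (hopf Y) z).
apply/eqP; rewrite -subr_eq0; apply/eqP; apply: (normal_tangential0 (normalCB n1 n2)).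
have := tangentialB t2 t1.
by congr (tangential Y z _); move: (dzb _ z) => q; apply/colP => i; rewrite !mxE; ring.
Qed.

(** The lift, kappa and D_{\bar z} kappa are determined by the surface, so the existential data of
    [S_willmore] are those computed here. As kappa is a multiple of A, a B component of D_{\bar z}
    kappa at one point excludes every mu. *)
Lemma not_S_willmore z0 : lor (dzb (hopf Y) z0) (mxconj (B z0)) != 0 ->
  ~ S_willmore (fun z => bracket (Y z)).
Proof.
move=> h [_ [Y' [s [k [k1 [mu [cl hs hD hE]]]]]]].
rewrite (canonical_lift_unique surface_cone cl) in hs hD.
rewrite (hopf_unique hs) in hD hE; have := hE z0.
have [c Ec] := hopf_A H z0; rewrite (Dzb_hopf_unique (hD z0)) (hopf1E H).
move: (lor (dzb _ z0) (mxconj (A z0))) (lor (dzb _ z0) (mxconj (B z0))) h => p q q0.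
rewrite Ec => /(congr1 (fun u => lor u (mxconj (B z0)))).
rewrite !lorDl !lorZl lor0l (is_BBc H z0) (is_ABc H z0) !mulr0 add0r addr0.
by move/eqP; rewrite !mulf_eq0 invr_eq0 !pnatr_eq0 (negPf q0).
Qed.

Lemma lor_shift (x y a ac : 'cV[C]_8) p c : x + p *: y = c *: a ->
  lor a ac = 2 -> lor ac y = 0 -> lor x ac = 2 * c.
Proof.
move=> E h1 h2; have := congr1 (fun u => lor u ac) E.
by rewrite lorDl !lorZl h1 (lorC y) h2 mulr0 addr0 mulrC.
Qed.

(** Trades the derivative of kappa, which involves third derivatives of Y, for two pairings that are
    easy to compare with those of the unnormalized fields. *)
Lemma lor_dzb_hopf z : lor (dzb (hopf Y) z) (mxconj (B z)) * 2 =
  lor (dz (dz Y) z) (mxconj (A z)) * lor (dzb A z) (mxconj (B z)).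
Proof.
have sBc : smv T (fun z => mxconj (B z)) := smv_conj (is_sB H).
have h0 w : lor (hopf Y w) (mxconj (B w)) = 0 by exact (hopf_perp H (is_ABc H w)).
have e1 := lor_dzb0 oT (smv_hopf H) sBc (fun w _ => h0 w) (z := z) I.
have e2 := lor_dzb0 oT (is_sA H) sBc (fun w _ => is_ABc H w) (z := z) I.
have [c E] := hopf_A H z.
have e3 := lor_shift E (is_AAc H z) (nf_acy (frameP H z)).
have e4 : lor (hopf Y z) (dzb (fun w => mxconj (B w)) z) =
    c * lor (A z) (dzb (fun w => mxconj (B w)) z).
  exact (etrans (congr1 (fun u => lor u _) E) (lorZl _ _ _)).
apply: etrans (congr1 ( *%R^~ 2) (etrans e1 (congr1 -%R e4))) _.
apply: etrans _ (esym (congr2 *%R e3 e2)).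
move: (lor (A z) _) => q; ring.
Qed.

End IsoSurface.

Section FromData.
Variables (X a b : C -> 'cV[C]_8) (G na nb : C -> C).
Hypothesis D : iso_data X a b G na nb.

Lemma data_cone : conformal_cone X G.
Proof.
exact (ConformalCone (id_sX D) (id_real D) (id_pos D) (id_XX D) (id_XzXz D) (id_XzXb D) (id_G D)).
Qed.

Lemma Ylift_pos z : 0 < Ylift X G z ord0 0.
Proof. by rewrite mxE mulr_gt0 ?(id_pos D) // (hfun_gt0 D). Qed.

Lemma Ylift_bracket : (fun z => bracket (Ylift X G z)) = (fun z => bracket (X z)).
Proof. apply/funext => z; exact (bracketZ _ (lt0r_neq0 (hfun_gt0 D z))). Qed.

Lemma data_HTI : HTI_willmore_immersion 3 (fun z => bracket (X z)).
Proof.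
rewrite -Ylift_bracket; exact (surface_HTI (iso_data_surface D) Ylift_pos).
Qed.

Lemma nonzero_second (x xz xzz u : 'cV[C]_8) (n : C) p q h : rsq n != 0 -> h != 0 ->
  lor (mxconj u) x = 0 -> lor (mxconj u) xz = 0 -> lor xzz (mxconj u) != 0 ->
  lor ((p *: x + q *: xz) + (q *: xz + h *: xzz)) (mxconj (rsq n *: u)) != 0.
Proof.
move=> n0 h0 e1 e2 e3; rewrite mxconjZ conj_rsq lorZr lorC !lorDr !lorZr e1 e2.
by rewrite !mulr0 !add0r mulf_neq0 // mulf_neq0 // lorC.
Qed.

Lemma nonzero_first (x xb u : 'cV[C]_8) (n : C) p h : h != 0 -> rsq n != 0 ->
  lor x (mxconj u) = 0 -> lor xb (mxconj u) != 0 ->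
  lor (p *: x + h *: xb) (mxconj (rsq n *: u)) != 0.
Proof.
move=> h0 n0 e1 e2; rewrite mxconjZ conj_rsq lorZr lorDl !lorZl e1 mulr0 add0r.
by rewrite !mulf_neq0.
Qed.

Lemma data_not_S_willmore z : lor (dz (dz X) z) (mxconj (a z)) != 0 ->
  lor (dzb a z) (mxconj (b z)) != 0 -> ~ S_willmore (fun w => bracket (X w)).
Proof.
move=> h1 h2; rewrite -Ylift_bracket.
have S := iso_data_surface D.
apply: (not_S_willmore S Ylift_pos (z0 := z)).
have two : 2 != 0 :> C by rewrite pnatr_eq0.
suff : lor (dzb (hopf (Ylift X G)) z) (mxconj (Bframe b nb z)) * 2 != 0.
  by rewrite mulf_eq0 negb_or => /andP[].
rewrite (lor_dzb_hopf S); have aX : lor (mxconj (a z)) (X z) = 0.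
  by rewrite -(id_real D z) lor_conj (id_aX D z) conjC0.
have aXz : lor (mxconj (a z)) (dz X z) = 0.
  by rewrite -[dz X z]mxconjK -(cc_dzb data_cone) lor_conj (id_aXb D z) conjC0.
have a0 := lt0r_neq0 (afun_gt0 D z); have h0 := lt0r_neq0 (hfun_gt0 D z).
have b0 : bfun nb z != 0.
  exact (lt0r_neq0 (rsq_gt0 (mulr_gt0 (half_gt0 R) (id_nb D z)))).
apply: mulf_neq0.
  rewrite (dz_dz_Ylift D); exact (nonzero_second _ _ a0 h0 aX aXz h1).
rewrite (dzbZ oT I (sm_afun D) (id_sa D)).
exact (nonzero_first _ a0 b0 (id_abc D z) h2).
Qed.

End FromData.
End Projectivization.

(** * Decidable certificates for isotropic surfaces *)

Section PolynomialSurfaces.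
Variable R : realType.
Local Notation C := R[i].
Local Notation T := [set: C].
Let oT : Defs.openC T := @openCT R.
Variable l : C.
Hypothesis l1 : `|l| = 1.
Local Notation vev := (vev l).

(** Collects like terms and drops zeros, because [ppos] looks at terms one by one. *)
Definition pnorm (p : pol) : pol :=
  [seq t <- foldr pins [::] p | ~~ Z.eqb t.1 Z0].

Lemma pev_norm p z : pev (pnorm p) z = pev p z :> C.
Proof.
transitivity (pev (padd p [::]) z : C); last by rewrite pevD addr0.
rewrite /pnorm /padd; elim: (foldr _ _ _) => //= t q IH.
case h : (Z.eqb t.1 Z0); rewrite -IH //=.
by rewrite /tev (proj1 (Z.eqb_eq _ _) h) mul0r add0r.
Qed.

(* z^i \bar z^j times a polynomial in |z|^2 *)
Definition tpol (i j : nat) (c : seq Z) : pol :=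
  [seq mon (nth Z0 c e) (i + e) (j + e) | e <- iota 0 (size c)].

Definition vnorm (v w : pvec) : pol := pnorm (vlor2 v w).

Lemma lor_vnorm v w z : lor (vev v z) (vev w z) = 2^-1 * pev (vnorm v w) z.
Proof. by rewrite pev_norm -(lor_vev l1); field. Qed.

Lemma vnorm_gt0 v w z : ppos (vnorm v w) -> 0 < 2^-1 * pev (vnorm v w) z :> C.
Proof. by move=> h; rewrite mulr_gt0 ?half_gt0 //; exact: pposP. Qed.

Lemma sm_vnorm v w : sm T (fun z : C => 2^-1 * pev (vnorm v w) z).
Proof. exact (smM (sm_cst _ _) (sm_pev _ _)). Qed.

(** The certificate for [iso_data]. With D = 2 <X_z, X_{\bar z}>, the polynomials [p1] and [p3] are
    the coefficients of X and a in D X_zz; that of X_z is found by pairing with X_{\bar z}, which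
    forces 2 <X_zz, X_{\bar z}>. *)
Definition iso_check (X a b : pvec) (p1 p3 : pol) : bool :=
  let Xz := vdz X in let Xb := vdzb X in let Xzb := vdzb Xz in
  let D := vnorm Xz Xb in
  [&& veq (vconj X) X, ppos (pnorm (padd (nth [::] X 0) (nth [::] X 1))),
    ppos D, ppos (vnorm a (vconj a)), ppos (vnorm b (vconj b)) &
  [&& pzero (vlor2 X X), pzero (vlor2 Xz Xz), pzero (vlor2 a a), pzero (vlor2 b b),
      pzero (vlor2 a b), pzero (vlor2 a (vconj b)) &
  [&& pzero (vlor2 a X), pzero (vlor2 a Xz), pzero (vlor2 a Xb), pzero (vlor2 a Xzb) &
  [&& pzero (vlor2 b X), pzero (vlor2 b Xz), pzero (vlor2 b Xb), pzero (vlor2 b Xzb) &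
  [&& pzero (vlor2 (vdz a) b), pzero (vlor2 (vdzb a) b) &
    veq (vscale D (vdz Xz)) (vadd (vadd (vscale p1 X) (vscale (vnorm (vdz Xz) Xb) Xz))
      (vscale p3 a))]]]]].

Lemma vev_0 v z : vev v z ord0 0 = 2^-1 * pev (padd (nth [::] v 0) (nth [::] v 1)) z.
Proof. by apply: etrans (mxE _ _ _ _) _; rewrite /= pevD mulrC. Qed.

Lemma dzdz_vev v z : dz (dz (vev v)) z = vev (vdz (vdz v)) z.
Proof.
have -> : dz (vev v) = vev (vdz v) by apply/funext => w; exact (dz_vev l oT v I).
exact (dz_vev l oT _ I).
Qed.

Lemma dzbdz_vev v z : dzb (dz (vev v)) z = vev (vdzb (vdz v)) z.
Proof.
have -> : dz (vev v) = vev (vdz v) by apply/funext => w; exact (dz_vev l oT v I).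
exact (dzb_vev l oT _ I).
Qed.

Lemma vec_quotient (x u v w : 'cV[C]_8) d c1 c2 c3 : d != 0 ->
  d *: x = c1 *: u + c2 *: v + c3 *: w ->
  x = (c1 / d) *: u + (c2 / d) *: v + (c3 / d) *: w.
Proof.
move=> d0 /(congr1 (fun y => d^-1 *: y)); rewrite scalerA mulVf // scale1r => ->.
by apply/colP => i; rewrite !mxE; ring.
Qed.

Lemma iso_checkP X a b p1 p3 : iso_check X a b p1 p3 ->
  iso_data (vev X) (vev a) (vev b) (fun z => 2^-1 * pev (vnorm (vdz X) (vdzb X)) z)
    (fun z => 2^-1 * pev (vnorm a (vconj a)) z) (fun z => 2^-1 * pev (vnorm b (vconj b)) z).
Proof.
case/and5P=> c1 c2 c3 c4 /andP[c5] /and5P[c6 c7 c8 c9 /and3P[c10 c11]].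
case/and5P=> c12 c13 c14 c15 /and5P[c16 c17 c18 c19 /and3P[c20 c21 c22]].
have s v := smv_vev l T v; have Z := fun v w z h => @lor_vev0 R l l1 v w z h.
have dX z := dz_vev l oT X (I : T z); have dbX z := dzb_vev l oT X (I : T z).
split.
- exact (s X).
- exact (s a).
- exact (s b).
- exact (sm_vnorm _ _).
- exact (sm_vnorm _ _).
- exact (sm_vnorm _ _).
- by move=> z; rewrite -(vev_conj l1) (veqP _ _ c1).
- move=> z; rewrite vev_0 -pev_norm mulr_gt0 ?half_gt0 //; exact (pposP c2 z).
- by move=> z; exact (vnorm_gt0 z c3).
- by move=> z; exact (vnorm_gt0 z c4).
- by move=> z; exact (vnorm_gt0 z c5).
- by move=> z; exact (Z _ _ z c6).
- by move=> z; rewrite dX; exact (Z _ _ z c7).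
- by move=> z; rewrite dX dbX; exact (lor_vnorm _ _ z).
- by move=> z; exact (Z _ _ z c8).
- by move=> z; exact (Z _ _ z c9).
- by move=> z; exact (Z _ _ z c10).
- by move=> z; rewrite -(vev_conj l1); exact (lor_vnorm _ _ z).
- by move=> z; rewrite -(vev_conj l1); exact (lor_vnorm _ _ z).
- by move=> z; rewrite -(vev_conj l1); exact (Z _ _ z c11).
- by move=> z; exact (Z _ _ z c12).
- by move=> z; rewrite dX; exact (Z _ _ z c13).
- by move=> z; rewrite dbX; exact (Z _ _ z c14).
- by move=> z; rewrite dzbdz_vev; exact (Z _ _ z c15).
- by move=> z; exact (Z _ _ z c16).
- by move=> z; rewrite dX; exact (Z _ _ z c17).
- by move=> z; rewrite dbX; exact (Z _ _ z c18).
- by move=> z; rewrite dzbdz_vev; exact (Z _ _ z c19).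
- move=> z; rewrite dzdz_vev dX; have := veqP l z c22; rewrite !vevD !vevZ => E.
  by eexists; eexists; eexists; exact (vec_quotient (lt0r_neq0 (pposP c3 z)) E).
- by move=> z; rewrite (dz_vev l oT a (I : T z)); exact (Z _ _ z c20).
- by move=> z; rewrite (dzb_vev l oT a (I : T z)); exact (Z _ _ z c21).
Qed.

End PolynomialSurfaces.

Delimit Scope Z_scope with ZZ.

(** Up to the factor sqrt 2 / (2 varsigma), [YX] and [HX] are 18 Y and 36 \hat Y, which clears
    denominators. In each triple the field a spans the direction of kappa, and b completes the
    isotropic half of the normal space. *)
Definition YX : pvec :=
 [:: tpol 1 1 [:: 36]; tpol 0 0 [:: 36; 0; 9; 4];
   tpol 2 1 [:: 9]; tpol 1 2 [:: 9]; tpol 1 0 [:: -18]; tpol 0 1 [:: -18];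
   tpol 3 1 [:: 6]; tpol 1 3 [:: 6]]%ZZ.
Definition Ya : pvec :=
 [:: [::]; tpol 0 1 [:: 36; 72; 0; -2]; tpol 0 0 [:: 18; 0; 0; -4]; [::];
   [::]; tpol 0 2 [:: -9; -24]; tpol 1 0 [:: 36; 0; 3]; [::]]%ZZ.
Definition Yb : pvec :=
 [:: [::]; tpol 0 2 [:: 6]; tpol 0 1 [:: 6]; [::];
   [::]; tpol 0 3 [:: -1]; tpol 0 0 [:: -3]; [::]]%ZZ.
Definition HX : pvec :=
 [:: tpol 0 0 [:: 72; 0; 18; 32]; tpol 1 1 [:: 72; 72; 0; 2];
   tpol 1 0 [:: 36; 0; 0; 4]; tpol 0 1 [:: 36; 0; 0; 4];
   tpol 2 1 [:: -18; -24]; tpol 1 2 [:: -18; -24];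
   tpol 2 0 [:: 36; 0; -3]; tpol 0 2 [:: 36; 0; -3]]%ZZ.
Definition Ha : pvec :=
 [:: tpol 0 2 [:: 3888; 15552; 31104; 2160; 1728; 0; -24];
   tpol 0 2 [:: -7776; 0; 3888; 8640; 486; 432; 192];
   tpol 0 1 [:: -7776; 0; 3888; 8640; 486; 432; 192];
   tpol 0 3 [:: 972; 3888; 7776; 540; 432; 0; -6];
   tpol 0 1 [:: -1944; -7776; -15552; -1080; -864; 0; 12];
   tpol 0 3 [:: 1296; 0; -648; -1440; -81; -72; -32];
   tpol 0 0 [:: 3888; 0; -1944; -4320; -243; -216; -96];
   tpol 0 4 [:: 648; 2592; 5184; 360; 288; 0; -4]]%ZZ.
Definition Hb : pvec :=
 [:: tpol 0 1 [:: -432; 0; 108; 96]; tpol 1 2 [:: -216; -432; 0; 12];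
   tpol 1 1 [:: -216; -432; 0; 12]; tpol 0 2 [:: -108; 0; 27; 24];
   tpol 0 0 [:: 216; 0; -54; -48]; tpol 1 3 [:: 36; 72; 0; -2];
   tpol 1 0 [:: 108; 216; 0; -6]; tpol 0 3 [:: -72; 0; 18; 16]]%ZZ.
(* The same in the coordinate w = 1/z, multiplied by |w|^8. *)
Definition OX : pvec :=
 [:: tpol 1 1 [:: 32; 18; 0; 72]; tpol 0 0 [:: 2; 0; 72; 72];
   tpol 0 1 [:: 4; 0; 0; 36]; tpol 1 0 [:: 4; 0; 0; 36];
   tpol 1 2 [:: -24; -18]; tpol 2 1 [:: -24; -18];
   tpol 0 2 [:: -3; 0; 36]; tpol 2 0 [:: -3; 0; 36]]%ZZ.
Definition Oa : pvec :=
 [:: tpol 0 2 [:: -24; 0; 1728; 2160; 31104; 15552; 3888];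
   tpol 0 2 [:: 192; 432; 486; 8640; 3888; 0; -7776];
   tpol 0 3 [:: 192; 432; 486; 8640; 3888; 0; -7776];
   tpol 0 1 [:: -6; 0; 432; 540; 7776; 3888; 972];
   tpol 0 3 [:: 12; 0; -864; -1080; -15552; -7776; -1944];
   tpol 0 1 [:: -32; -72; -81; -1440; -648; 0; 1296];
   tpol 0 4 [:: -96; -216; -243; -4320; -1944; 0; 3888];
   tpol 0 0 [:: -4; 0; 288; 360; 5184; 2592; 648]]%ZZ.
Definition Ob : pvec :=
 [:: tpol 1 2 [:: 96; 108; 0; -432]; tpol 0 1 [:: 12; 0; -432; -216];
   tpol 0 2 [:: 12; 0; -432; -216]; tpol 1 1 [:: 24; 27; 0; -108];
   tpol 1 3 [:: -48; -54; 0; 216]; tpol 0 0 [:: -2; 0; 72; 36];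
   tpol 0 3 [:: -6; 0; 216; 108]; tpol 1 0 [:: 16; 18; 0; -72]]%ZZ.

(** The coefficient 1296 \bar z of [Ya] shows that kappa vanishes at 0; this zero is divided out of
    [Ya], whose Hermitian square is positive everywhere. *)
Lemma Y_check : iso_check YX Ya Yb (tpol 0 2 [:: -648; -1728]%ZZ) (tpol 0 1 [:: 1296]%ZZ).
Proof. by vm_compute. Qed.

Lemma H_check : iso_check HX Ha Hb
  (tpol 0 2 [:: -2592; -6912; -13824; -1152; -768]%ZZ) (tpol 0 0 [:: 96]%ZZ).
Proof. by vm_compute. Qed.

Lemma O_check : iso_check OX Oa Ob
  (tpol 0 2 [:: -4608; -6912; -7776; -165888; -62208]%ZZ) (tpol 0 0 [:: 96]%ZZ).
Proof. by vm_compute. Qed.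

(** * The two surfaces *)

Section Extension.
Variable R : realType.
Local Notation C := R[i].
Local Notation T := [set: C].
Let oT : Defs.openC T := @openCT R.

Lemma continuousC_eq (f g : C -> C) z : continuousC f z -> continuousC g z ->
  (forall e : R, 0 < e -> exists2 w, `|z - w| < real_complex R e & f w = g w) -> f z = g z.
Proof.
move=> /continuousC_distP cf /continuousC_distP cg H; apply/eqP.
rewrite -subr_eq0 -normr_eq0; apply/negPn/negP => n0.
have : 0 < `|f z - g z| by rewrite lt_def n0 normr_ge0.
move=> /gt0_complex [e0 Ee]; move: e0 Ee; set e := complex.Re _ => e0 Ee.
have e2 : 0 < e / 2 by rewrite divr_gt0.
have [d1 d10 h1] := cf _ e2; have [d2 d20 h2] := cg _ e2.
have d0 : 0 < Num.min d1 d2 by rewrite lt_min d10.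
have [w hw fg] := H _ d0.
have w1 : `|z - w| < real_complex R d1.
  by apply: (lt_le_trans hw); rewrite lecR ge_min lexx.
have w2 : `|z - w| < real_complex R d2.
  by apply: (lt_le_trans hw); rewrite lecR ge_min lexx orbT.
have Ee2 : real_complex R (e / 2) + real_complex R (e / 2) = real_complex R e.
  by rewrite -(rmorphD (real_complex R)) -splitr.
have := ltrD (h1 _ w1) (h2 _ w2); rewrite Ee2 -Ee fg => h.
have := le_lt_trans (ler_normB (f z - g w) (g z - g w)) h.
by rewrite opprB addrA subrK ltxx.
Qed.

Lemma punctured_dense (z : C) (e : R) : 0 < e ->
  exists2 w, `|z - w| < real_complex R e & w != z.
Proof.
move=> e0; exists (z + real_complex R (e / 2)).
  rewrite opprD addrA subrr sub0r normrN normc_def /= expr0n addr0 sqrtr_sqr ltcR.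
  by rewrite ger0_norm ?ltW ?divr_gt0 // ltr_pdivrMr // ltr_pMr // ltr1n.
by rewrite -subr_eq0 addrAC subrr add0r fmorph_eq0 mulf_neq0 ?invr_eq0 ?pnatr_eq0 // gt_eqF.
Qed.

Definition glue (X0 Xoo : C -> 'cV[C]_8) (p : sphere R) : 'cV[C]_7 :=
  if p is Some z then bracket (X0 z) else bracket (Xoo 0).

(** Two positive null fields, one in each chart, that agree up to scale on the overlap. Density of
    [D] makes the continuous extension of [Y] unique. *)
Record glued (X0 Xoo : C -> 'cV[C]_8) (D : set C) (Y : C -> 'cV[C]_8) : Prop := Glued {
  gl_s0 : smv T X0; gl_soo : smv T Xoo;
  gl_r0 : forall z, mxconj (X0 z) = X0 z; gl_roo : forall z, mxconj (Xoo z) = Xoo z;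
  gl_p0 : forall z, 0 < X0 z ord0 0; gl_poo : forall z, 0 < Xoo z ord0 0;
  gl_n0 : forall z, lor (X0 z) (X0 z) = 0; gl_noo : forall z, lor (Xoo z) (Xoo z) = 0;
  gl_eq : forall w, w != 0 -> bracket (X0 w^-1) = bracket (Xoo w);
  gl_D : forall z (e : R), 0 < e -> exists2 w, `|z - w| < real_complex R e & D w;
  gl_Y : forall z, D z -> bracket (Y z) = bracket (X0 z) }.

Section Glued.
Variables (X0 Xoo : C -> 'cV[C]_8) (D : set C) (Y : C -> 'cV[C]_8).
Hypothesis H : glued X0 Xoo D Y.

Lemma glue_chartoo : (fun w => glue X0 Xoo (chart_oo w)) = fun w => bracket (Xoo w).
Proof.
apply/funext => w; rewrite /chart_oo; case: eqP => [->|/eqP w0] //=.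
exact (gl_eq H w0).
Qed.

Lemma bracket_continuous (X : C -> 'cV[C]_8) z j : smv T X -> (forall z, 0 < X z ord0 0) ->
  continuousC (fun w => bracket (X w) j 0) z.
Proof.
move=> sX X0p; have n0 w : T w -> X w ord0 0 != 0 by move=> _; exact (lt0r_neq0 (X0p w)).
apply: (sm_continuousC oT (U := T)) => //.
by apply: sm_eq (smM (sX (lift ord0 j) 0) (smV n0 (sX ord0 0))) => w _; rewrite mxE.
Qed.

Lemma glue_extends : extends_bracket D Y (glue X0 Xoo).
Proof.
split.
- split; first by move=> z j; exact (bracket_continuous (gl_s0 H) (gl_p0 H)).
  move=> z j; have -> : (fun w => glue X0 Xoo (chart_oo w) j 0) = fun w => bracket (Xoo w) j 0.
    by apply/funext => w; exact (congr1 (fun f : C -> 'cV[C]_7 => f w j 0) glue_chartoo).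
  exact (bracket_continuous (gl_soo H) (gl_poo H)).
- case=> [z|]; first exact (on_sphere_bracket (gl_r0 H z) (lt0r_neq0 (gl_p0 H z)) (gl_n0 H z)).
  exact (on_sphere_bracket (gl_roo H 0) (lt0r_neq0 (gl_poo H 0)) (gl_noo H 0)).
- by move=> z Dz; rewrite (gl_Y H Dz).
Qed.

Lemma extends_unique y : extends_bracket D Y y -> y = glue X0 Xoo.
Proof.
move=> [[c0 coo] _ yD]; have [[g0 goo] _ gD] := glue_extends.
have E0 z : y (Some z) = glue X0 Xoo (Some z).
  apply/colP => j; apply: (continuousC_eq (c0 z j) (g0 z j)) => e e0.
  have [w hw Dw] := gl_D H z e0; exists w => //.
  by rewrite (yD w Dw) (gD w Dw).
apply/funext => -[z|]; first exact (E0 z).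
have := fun j => continuousC_eq (coo 0 j) (goo 0 j); rewrite /chart_oo eqxx => h.
apply/colP => j; apply: h => e e0; have [w hw w0] := punctured_dense 0 e0.
by exists w => //; rewrite (negPf w0) E0.
Qed.

Lemma extends_exists_unique : exists! y, extends_bracket D Y y.
Proof.
exists (glue X0 Xoo); split; first exact glue_extends.
by move=> y hy; rewrite (extends_unique hy).
Qed.

End Glued.

(** The function 1 - r^4/4 - 2 r^6/9 decreases strictly in r, so a small radial move outwards leaves
    its zero set. *)
Lemma off_curve_dense (z : C) (e : R) : 0 < e ->
  exists2 w, `|z - w| < real_complex R e & off_curve w.
Proof.
move=> e0; case: (eqVneq (1 - `|z| ^+ 4 / 4 - 2 * `|z| ^+ 6 / 9) 0) => h; last first.
  by exists z => //; rewrite subrr normr0 ltcR.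
have z0 : 0 < `|z|.
  rewrite normr_gt0; apply/eqP => z0; move/eqP: h.
  by rewrite z0 normr0 !expr0n /= mulr0 !mul0r !subr0 oner_eq0.
pose d := real_complex R e / (2 * `|z|).
have d0 : 0 < d by rewrite divr_gt0 ?ltcR // mulr_gt0.
exists ((1 + d) * z).
  rewrite mulrDl mul1r opprD addrA subrr sub0r normrN normrM gtr0_norm //.
  have -> : d * `|z| = real_complex R e / 2.
    have X (a b : C) : 0 < b -> a / (2 * b) * b = a / 2.
      by move=> /lt0r_neq0 b0; field; exact b0.
    exact (X _ _ z0).
  by rewrite ltr_pdivrMr // ltr_pMr ?ltcR // ltr1n.
apply/negP => /eqP h'.
have lt : `|z| < `|(1 + d) * z|.
  by rewrite normrM [X in _ < X * _]gtr0_norm ?ltr_pMl ?ltrDl // addr_gt0.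
have m n : `|z| ^+ n.+1 < `|(1 + d) * z| ^+ n.+1 by rewrite ltrXn2r ?ltW.
suff : 1 - `|(1 + d) * z| ^+ 4 / 4 - 2 * `|(1 + d) * z| ^+ 6 / 9 <
       1 - `|z| ^+ 4 / 4 - 2 * `|z| ^+ 6 / 9 by rewrite h h' ltxx.
rewrite ltrD ?ltrD2l ?ltrN2 ?ltr_pM2r ?invr_gt0 ?ltr0n ?m //.
by rewrite ltr_pM2l ?ltr0n ?m.
Qed.

End Extension.

Section Numerals.
Variable R : realType.
Local Notation C := R[i].

Lemma zCE (n : nat) (a : Z) : a = Z.of_nat n -> zC R a = n%:R.
Proof. by move=> ->; exact: zC_nat. Qed.

Lemma zCEN (n : nat) (a : Z) : a = Z.opp (Z.of_nat n) -> zC R a = - n%:R.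
Proof. by move=> ->; rewrite zCN zC_nat. Qed.
End Numerals.

(** Turns the integer literals left by [tev] into numerals that [field] can handle. *)
Ltac znum := repeat match goal with
  | |- context [zC ?R (Zpos ?p)] =>
      let n := eval vm_compute in (Pos.to_nat p) in rewrite (@zCE R n (Zpos p) erefl)
  | |- context [zC ?R (Zneg ?p)] =>
      let n := eval vm_compute in (Pos.to_nat p) in rewrite (@zCEN R n (Zneg p) erefl)
  | |- context [zC ?R Z0] => rewrite (@zCE R 0 Z0 erefl)
  end.

Section Instances.
Variable R : realType.
Local Notation C := R[i].
Local Notation T := [set: C].
Let oT : Defs.openC T := @openCT R.
Variable l : C.
Hypothesis l1 : `|l| = 1.
Local Notation vev := (vev l).

Lemma norm_even k (z : C) : `|z| ^+ (2 * k) = (z * Num.conj z) ^+ k.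
Proof. by rewrite exprM normCK. Qed.

Lemma Yvec_vev z : Yvec l z = (sqrtC 2 / (2 * varsigma z) / 18) *: vev YX z.
Proof.
apply/colP => k; rewrite /vev /nullv !mxE; move: (sqrtC 2 / _) => s.
rewrite (norm_even 1 z : `|z| ^+ 2 = _) (norm_even 2 z : `|z| ^+ 4 = _)
  (norm_even 3 z : `|z| ^+ 6 = _).
have l0 := l_neq0 l1.
by case: k => -[|[|[|[|[|[|[|[|//]]]]]]]] i /=; rewrite /tev /=; znum; field.
Qed.

Lemma Yhvec_vev z : Yhvec l z = (sqrtC 2 / (2 * varsigma z) / 36) *: vev HX z.
Proof.
apply/colP => k; rewrite /vev /nullv !mxE; move: (sqrtC 2 / _) => s.
rewrite (norm_even 1 z : `|z| ^+ 2 = _) (norm_even 2 z : `|z| ^+ 4 = _)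
  (norm_even 3 z : `|z| ^+ 6 = _) (norm_even 4 z : `|z| ^+ 8 = _).
have l0 := l_neq0 l1.
by case: k => -[|[|[|[|[|[|[|[|//]]]]]]]] i /=; rewrite /tev /=; znum; field.
Qed.

Let dY := iso_checkP l1 Y_check.

Let dH := iso_checkP l1 H_check.

Let dO := iso_checkP l1 O_check.

(* [YX] in the coordinate w = 1/z, multiplied by |w|^6. *)
Definition PX : pvec :=
 [:: tpol 2 2 [:: 36]; tpol 0 0 [:: 4; 9; 0; 36]; tpol 1 2 [:: 9]; tpol 2 1 [:: 9];
   tpol 2 3 [:: -18]; tpol 3 2 [:: -18]; tpol 0 2 [:: 6]; tpol 2 0 [:: 6]]%ZZ.

Lemma nullv_scale a (c d : nat -> C) : (forall k, (k < 8)%N -> a * c k = d k) ->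
  a *: nullv l c = nullv l d.
Proof. by move=> h; rewrite -nullvZ; apply: nullv_ext => k k8; exact: h. Qed.

Lemma PX_inv w : w != 0 -> (w * Num.conj w) ^+ 3 *: vev YX w^-1 = vev PX w.
Proof.
move=> w0; apply: nullv_scale => k; have : Num.conj w != 0 by rewrite fmorph_eq0.
move: k => [|[|[|[|[|[|[|[|//]]]]]]]] v0 _ /=; rewrite /tev /= ?cjV; znum; field;
  by rewrite w0 v0.
Qed.

Lemma OX_inv w : w != 0 -> (w * Num.conj w) ^+ 4 *: vev HX w^-1 = vev OX w.
Proof.
move=> w0; apply: nullv_scale => k; have : Num.conj w != 0 by rewrite fmorph_eq0.
move: k => [|[|[|[|[|[|[|[|//]]]]]]]] v0 _ /=; rewrite /tev /= ?cjV; znum; field;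
  by rewrite w0 v0.
Qed.

Lemma bracket_inv (X Xo : C -> 'cV[C]_8) w k : w != 0 ->
  (w * Num.conj w) ^+ k *: X w^-1 = Xo w -> bracket (X w^-1) = bracket (Xo w).
Proof.
by move=> w0 <-; rewrite bracketZ // expf_neq0 // mulf_neq0 // fmorph_eq0.
Qed.

Lemma varsigma_off z : off_curve z -> varsigma z != 0 :> C.
Proof. by move=> h; rewrite normr_eq0. Qed.

Lemma scale_off z n : off_curve z -> sqrtC 2 / (2 * varsigma z) / n.+1%:R != 0 :> C.
Proof.
move=> /varsigma_off h; rewrite !mulf_neq0 ?invr_eq0 ?mulf_neq0 ?pnatr_eq0 //.
by rewrite sqrtC_eq0 pnatr_eq0.
Qed.

Record cone_check (X : pvec) : Prop := ConeCheck {
  ck_real : veq (vconj X) X;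
  ck_pos : ppos (pnorm (padd (nth [::] X 0) (nth [::] X 1)));
  ck_null : pzero (vlor2 X X) }.

Lemma vev_real X z : cone_check X -> mxconj (vev X z) = vev X z.
Proof. by move=> [h _ _]; rewrite -(vev_conj l1) (veqP _ _ h). Qed.

Lemma vev_pos X z : cone_check X -> 0 < vev X z ord0 0.
Proof.
by move=> [_ h _]; rewrite vev_0 -pev_norm mulr_gt0 ?half_gt0 //; exact (pposP h z).
Qed.

Lemma vev_null X z : cone_check X -> lor (vev X z) (vev X z) = 0.
Proof. by move=> [_ _ h]; exact (lor_vev0 l1 z h). Qed.

Lemma ck_YX : cone_check YX. Proof. by split; vm_compute. Qed.
Lemma ck_HX : cone_check HX. Proof. by split; vm_compute. Qed.
Lemma ck_OX : cone_check OX. Proof. by split; vm_compute. Qed.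
Lemma ck_PX : cone_check PX. Proof. by split; vm_compute. Qed.

Lemma glued_vev X Xo Y : cone_check X -> cone_check Xo ->
  (forall w, w != 0 -> bracket (vev X w^-1) = bracket (vev Xo w)) ->
  (forall z, off_curve z -> bracket (Y z) = bracket (vev X z)) ->
  glued (vev X) (vev Xo) (@off_curve R) Y.
Proof.
move=> c co h1 h2; split.
- exact (smv_vev l T X).
- exact (smv_vev l T Xo).
- move=> z; exact (vev_real z c).
- move=> z; exact (vev_real z co).
- move=> z; exact (vev_pos z c).
- move=> z; exact (vev_pos z co).
- move=> z; exact (vev_null z c).
- move=> z; exact (vev_null z co).
- exact h1.
- move=> z e e0; exact (off_curve_dense z e0).
- exact h2.
Qed.

Lemma glued_Y : glued (vev YX) (vev PX) (@off_curve R) (Yvec l).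
Proof.
apply: (glued_vev ck_YX ck_PX) => [w w0|z hz].
  exact (bracket_inv (X := vev YX) (Xo := vev PX) w0 (PX_inv w0)).
by rewrite Yvec_vev bracketZ // scale_off.
Qed.

Lemma glued_H : glued (vev HX) (vev OX) (@off_curve R) (Yhvec l).
Proof.
apply: (glued_vev ck_HX ck_OX) => [w w0|z hz].
  exact (bracket_inv (X := vev HX) (Xo := vev OX) w0 (OX_inv w0)).
by rewrite Yhvec_vev bracketZ // scale_off.
Qed.

Definition yglue := glue (vev YX) (vev PX).
Definition hglue := glue (vev HX) (vev OX).

Lemma hglue_HTI : in_charts (HTI_willmore_immersion 3) hglue.
Proof.
split; first exact (data_HTI dH).
have := data_HTI dO; rewrite -(glue_chartoo glued_H); exact.
Qed.

Lemma yglue_HTI : HTI_willmore_immersion 3 (fun z => yglue (chart_0 z)).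
Proof. exact (data_HTI dY). Qed.

Definition coef00 (p : pol) : Z :=
  foldr (fun t s => if (t.2.1 == 0%N) && (t.2.2 == 0%N) then Z.add t.1 s else s) Z0 p.

Lemma pev0 p : pev p 0 = zC R (coef00 p).
Proof.
elim: p => //= t p ->; rewrite /tev conjC0 !expr0n.
case: (t.2.1 == 0%N); case: (t.2.2 == 0%N) => /=;
  by rewrite ?zCD ?mul0r ?mulr0 ?add0r ?mulr1.
Qed.

Lemma zC_neq0 a : ~~ Z.eqb a Z0 -> zC R a != 0.
Proof.
case: a => [|p|p] // _; rewrite /zC /=.
  by rewrite pnatr_eq0; lia.
by rewrite intr_eq0; lia.
Qed.

Lemma lor_vev_neq0 v w : ~~ Z.eqb (coef00 (vlor2 v w)) Z0 -> lor (vev v 0) (vev w 0) != 0.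
Proof.
move=> h; apply/eqP => e; have := lor_vev l1 v w 0; rewrite e mulr0 pev0 => /esym/eqP.
exact/negP/zC_neq0.
Qed.

Lemma hglue_not_S : ~ in_charts (@S_willmore R 7) hglue.
Proof.
(* At z = 0 only constant terms survive, so both nonvanishing conditions are integer checks. *)
case=> h _; apply: (data_not_S_willmore dH (z := 0) _ _ h).
  by rewrite dzdz_vev -(vev_conj l1); apply: lor_vev_neq0; vm_compute.
rewrite (dzb_vev l oT _ (I : T 0)) -(vev_conj l1); apply: lor_vev_neq0; by vm_compute.
Qed.

Lemma metric_vev X (p q : pol) (z : C) : 
  peq (vlor2 (vdz X) (vdzb X)) p -> peq (padd (nth [::] X 0) (nth [::] X 1)) q ->
  2^-1 * pev (vnorm (vdz X) (vdzb X)) z / vev X z ord0 0 ^+ 2 = 2 * pev p z / pev q z ^+ 2.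
Proof.
move=> /peqP hp /peqP hq; rewrite vev_0 hq pev_norm hp.
case: (eqVneq (pev q z) 0) => [->|q0]; last by field.
by rewrite mulr0 !expr0n /= invr0 !mulr0.
Qed.

Lemma metric_ratio (n p q : C) : n != 0 -> 2 * (n * n * p) / (n * q) ^+ 2 = 2 * p / q ^+ 2.
Proof.
move=> n0; case: (eqVneq q 0) => [->|q0]; first by rewrite mulr0 !expr0n /= !invr0 !mulr0.
by field; rewrite n0 q0.
Qed.

Lemma hglue_ratio (z r : C) : r ^+ 2 = z * Num.conj z ->
  2 * pev (pmul [:: mon 16 0 0] (tpol 0 0 [:: 324; 1296; 81; 72; 144; 9; 4]%ZZ)) z / pev (tpol 0 0 [:: 72; 72; 90; 32; 2]%ZZ) z ^+ 2 =
  2 * (1 + 4 * r ^+ 2 + r ^+ 4 / 4 + 2 * r ^+ 6 / 9 + 4 * r ^+ 8 / 9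
       + r ^+ 10 / 36 + r ^+ 12 / 81)
  / (1 + r ^+ 2 + 5 * r ^+ 4 / 4 + 4 * r ^+ 6 / 9 + r ^+ 8 / 36) ^+ 2.
Proof.
move=> r2.
have -> : pev (tpol 0 0 [:: 72; 72; 90; 32; 2]%ZZ) z = 72 * (1 + r ^+ 2 + 5 * r ^+ 4 / 4 + 4 * r ^+ 6 / 9 + r ^+ 8 / 36).
  transitivity (let t := z * Num.conj z in 72 * (1 + t + 5 * t ^+ 2 / 4 + 4 * t ^+ 3 / 9 + t ^+ 4 / 36)).
    by rewrite /= /tev /=; znum; field.
  by rewrite -r2 /=; field.
have -> : pev (pmul [:: mon 16 0 0] (tpol 0 0 [:: 324; 1296; 81; 72; 144; 9; 4]%ZZ)) z = 72 * 72 * (1 + 4 * r ^+ 2 + r ^+ 4 / 4 + 2 * r ^+ 6 / 9 + 4 * r ^+ 8 / 9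
       + r ^+ 10 / 36 + r ^+ 12 / 81).
  transitivity (let t := z * Num.conj z in 72 * 72 * (1 + 4 * t + t ^+ 2 / 4 + 2 * t ^+ 3 / 9 + 4 * t ^+ 4 / 9
       + t ^+ 5 / 36 + t ^+ 6 / 81)).
    by rewrite pevM /= /tev /=; znum; field.
  by rewrite -r2 /=; field.
by apply: metric_ratio; rewrite pnatr_eq0.
Qed.

Lemma hglue_num : peq (vlor2 (vdz HX) (vdzb HX))
  (pmul [:: mon 16 0 0] (tpol 0 0 [:: 324; 1296; 81; 72; 144; 9; 4]%ZZ)).
Proof. by vm_compute. Qed.

Lemma hglue_den : peq (padd (nth [::] HX 0) (nth [::] HX 1)) (tpol 0 0 [:: 72; 72; 90; 32; 2]%ZZ).
Proof. by vm_compute. Qed.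

Lemma hglue_metric z : let f := fun w => hglue (chart_0 w) in let r := `|z| in
  dot (dz f z) (dzb f z) =
  2 * (1 + 4 * r ^+ 2 + r ^+ 4 / 4 + 2 * r ^+ 6 / 9 + 4 * r ^+ 8 / 9
       + r ^+ 10 / 36 + r ^+ 12 / 81)
  / (1 + r ^+ 2 + 5 * r ^+ 4 / 4 + 4 * r ^+ 6 / 9 + r ^+ 8 / 36) ^+ 2.
Proof.
apply: etrans (dot_dzb_bracket (data_cone dH) z) _.
exact (etrans (metric_vev z hglue_num hglue_den) (hglue_ratio (normCK z))).
Qed.

Lemma yglue_ratio (z r : C) : r ^+ 2 = z * Num.conj z ->
  2 * pev (pmul [:: mon 36 0 0] (tpol 0 0 [:: 36; 0; 9; 16]%ZZ)) z / pev (tpol 0 0 [:: 36; 36; 9; 4]%ZZ) z ^+ 2 =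
  2 * (1 + r ^+ 4 / 4 + 4 * r ^+ 6 / 9)
           / (1 + r ^+ 2 + r ^+ 4 / 4 + r ^+ 6 / 9) ^+ 2.
Proof.
move=> r2.
have -> : pev (tpol 0 0 [:: 36; 36; 9; 4]%ZZ) z = 36 * (1 + r ^+ 2 + r ^+ 4 / 4 + r ^+ 6 / 9).
  transitivity (let t := z * Num.conj z in 36 * (1 + t + t ^+ 2 / 4 + t ^+ 3 / 9)).
    by rewrite /= /tev /=; znum; field.
  by rewrite -r2 /=; field.
have -> : pev (pmul [:: mon 36 0 0] (tpol 0 0 [:: 36; 0; 9; 16]%ZZ)) z = 36 * 36 * (1 + r ^+ 4 / 4 + 4 * r ^+ 6 / 9).
  transitivity (let t := z * Num.conj z in 36 * 36 * (1 + t ^+ 2 / 4 + 4 * t ^+ 3 / 9)).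
    by rewrite pevM /= /tev /=; znum; field.
  by rewrite -r2 /=; field.
by apply: metric_ratio; rewrite pnatr_eq0.
Qed.

Lemma yglue_num : peq (vlor2 (vdz YX) (vdzb YX))
  (pmul [:: mon 36 0 0] (tpol 0 0 [:: 36; 0; 9; 16]%ZZ)).
Proof. by vm_compute. Qed.

Lemma yglue_den : peq (padd (nth [::] YX 0) (nth [::] YX 1)) (tpol 0 0 [:: 36; 36; 9; 4]%ZZ).
Proof. by vm_compute. Qed.

Lemma yglue_metric z : let f := fun w => yglue (chart_0 w) in let r := `|z| in
  dot (dz f z) (dzb f z) =
  2 * (1 + r ^+ 4 / 4 + 4 * r ^+ 6 / 9)
           / (1 + r ^+ 2 + r ^+ 4 / 4 + r ^+ 6 / 9) ^+ 2.
Proof.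
apply: etrans (dot_dzb_bracket (data_cone dY) z) _.
exact (etrans (metric_vev z yglue_num yglue_den) (yglue_ratio (normCK z))).
Qed.

(* X_0 W - W_0 X is divisible by the defining polynomial of the curve. *)
Definition curve_quotient : pvec :=
 [:: tpol 0 0 [:: 72; 0; -18; -16]; tpol 0 0 [:: -72; 0; 18; 16];
   tpol 1 0 [:: 36; 18; 0; -2]; tpol 0 1 [:: 36; 18; 0; -2];
   tpol 1 0 [:: 36; 18; 12]; tpol 0 1 [:: 36; 18; 12];
   tpol 2 0 [:: 36; 24; 3]; tpol 0 2 [:: 36; 24; 3]]%ZZ.

(** On the curve the combination divided in [curve_quotient] vanishes: the two null lines coincide
    there and no longer span a Lorentzian plane. *)
Lemma on_curve_eq z : ~ off_curve z -> yglue (chart_0 z) = hglue (chart_0 z).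
Proof.
move=> /negP/negPn/eqP h.
have S0 : pev (tpol 0 0 [:: 36; 0; -9; -8]%ZZ) z = 0 :> C.
  move: h; rewrite (norm_even 2 z : `|z| ^+ 4 = _) (norm_even 3 z : `|z| ^+ 6 = _) => h.
  rewrite -[RHS](mulr0 36) -h /= /tev /=; znum; by field.
pose x0 := padd (nth [::] YX 0) (nth [::] YX 1).
pose h0 := padd (nth [::] HX 0) (nth [::] HX 1).
have e : veq (vscale x0 HX) (vadd (vscale h0 YX) (vscale (tpol 0 0 [:: 36; 0; -9; -8]%ZZ) curve_quotient)).
  by vm_compute.
have := veqP l z e; rewrite vevD !vevZ S0 scale0r addr0 => E.
have px := vev_pos z ck_YX; have ph := vev_pos z ck_HX; rewrite vev_0 in px; rewrite vev_0 in ph.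
have x00 : pev x0 z != 0 by apply/eqP => e0; move: px; rewrite e0 mulr0 ltxx.
have h00 : pev h0 z != 0 by apply/eqP => e0; move: ph; rewrite e0 mulr0 ltxx.
change (bracket (vev YX z) = bracket (vev HX z)).
by rewrite -(bracketZ (vev HX z) x00) E bracketZ.
Qed.

End Instances.

(** * The branch point at infinity *)

Section BranchPoint.
Variable R : realType.
Local Notation C := R[i].
Local Notation T := [set: C].
Let oT : Defs.openC T := @openCT R.

Lemma smv_bracket_pos (X : C -> 'cV[C]_8) : smv T X -> (forall z, 0 < X z ord0 0) ->
  smv T (fun z => bracket (X z)).
Proof.
move=> sX X0p i k; rewrite (ord1 k).
have n0 w : T w -> X w ord0 0 != 0 by move=> _; exact (lt0r_neq0 (X0p w)).
by apply: sm_eq (smM (sX (lift ord0 i) 0) (smV n0 (sX ord0 0))) => z _; rewrite mxE.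
Qed.

Lemma dz_bracket (X : C -> 'cV[C]_8) z j : smv T X -> (forall z, 0 < X z ord0 0) ->
  dz (fun z => bracket (X z)) z j 0 =
  (X z ord0 0) ^- 2 * (X z ord0 0 *: dz X z - dz X z ord0 0 *: X z) (lift ord0 j) 0.
Proof.
move=> sX X0p; rewrite -dz_lift1_S.
have sL : smv T (fun z => lift1 (bracket (X z))) by exact (smv_lift1 (smv_bracket_pos sX X0p)).
have E : X = fun z => X z ord0 0 *: lift1 (bracket (X z)).
  apply/funext => w; have w0 := lt0r_neq0 (X0p w).
  by rewrite (lift1_bracket w0) scalerA mulfV ?scale1r.
have D : dz X z = dz X z ord0 0 *: lift1 (bracket (X z))
    + X z ord0 0 *: dz (fun z => lift1 (bracket (X z))) z.
  rewrite {1}E (dzZ oT I (sX ord0 0) sL); congr (_ *: _ + _).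
  exact (esym (dzE X z ord0 0)).
have w0 := lt0r_neq0 (X0p z); move: D; rewrite (lift1_bracket w0).
move: (dz X z) (dz (fun z => lift1 _) z) (X z) w0 => x d y w0 D.
have D' := congr1 (fun m : 'cV[C]_8 => m (lift ord0 j) 0) D; rewrite !mxE in D'.
rewrite !mxE D'; move: (x ord0 0) (y ord0 0) w0 (y (lift ord0 j) 0) (d (lift ord0 j) 0) => a b b0 c e.
by field.
Qed.

(** The quotient has absolute value |w|, and the convention 1/0 = 0 gives the right value at the
    origin. *)
Lemma conj_ratio_continuous : continuousC (fun w : C => Num.conj w ^+ 2 / w) 0.
Proof.
apply: continuousC_dist => e e0; exists e => // w.
rewrite sub0r normrN invr0 mulr0 sub0r normrN => h.
case: (eqVneq w 0) => [->|w0]; first by rewrite invr0 mulr0 normr0 ltcR.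
by rewrite normrM normfV normrX norm_conjC expr2 mulfK // normr_eq0.
Qed.

Variable l : C.
Hypothesis l1 : `|l| = 1.
Local Notation vev := (vev l).

(* p = z p_1 + \bar z^2 p_2 for the polynomials to which these are applied. *)
Definition pdivz (p : pol) : pol :=
  [seq mon t.1 t.2.1.-1 t.2.2 | t <- pnorm p & (0 < t.2.1)%N].
Definition pdivzb2 (p : pol) : pol :=
  [seq mon t.1 t.2.1 (t.2.2 - 2) | t <- pnorm p & t.2.1 == 0%N].

Lemma entry_scale (h p q : C) (a b : 'cV[C]_8) i :
  (h * p) ^- 2 * ((h * p) *: a - (h * q) *: b) i 0 = h * (h * p) ^- 2 * (p *: a + - q *: b) i 0.
Proof. by rewrite !mxE; ring. Qed.

(** Up to a factor 2, N is the numerator X_0 X_w - (X_0)_w X of the derivative of [X]. Writing N = w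
    P + \bar w^2 Q gives y_w = w Phi, with Phi continuous because \bar w^2 / w tends to 0. Phi(0) is
    a nonzero multiple of P(0), whose last entry is seen through its b_3 coordinate, that of a_3
    being zero. *)
Lemma branch_point_vev (X N : pvec) : cone_check X ->
  veq N (vadd (vscale (padd (nth [::] X 0) (nth [::] X 1)) (vdz X))
     (vscale (popp (padd (nth [::] (vdz X) 0) (nth [::] (vdz X) 1))) X)) ->
  veq N (vadd (vscale [:: mon 1 1 0] (map pdivz N)) (vscale [:: mon 1 0 2] (map pdivzb2 N))) ->
  ~~ Z.eqb (coef00 (nth [::] (map pdivz N) 7)) Z0 ->
  Z.eqb (coef00 (nth [::] (map pdivz N) 6)) Z0 ->
  branch_point_at_0 (fun w => bracket (vev X w)).
Proof.
move=> c h1 h2 n7 n6; set P := map pdivz N; set Q := map pdivzb2 N.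
have sX := smv_vev l T X; have Xp z := vev_pos l z c.
pose u (w : C) := 2^-1 * (vev X w ord0 0) ^- 2.
pose V w := vev P w + (Num.conj w ^+ 2 / w) *: vev Q w.
exists 1%N, (fun w => \col_j (u w * V w (lift ord0 j) 0)); split => //.
- move=> j; have -> : (fun w => (\col_j0 (u w * V w (lift ord0 j0) 0)) j 0) =
      fun w => u w * (vev P w (lift ord0 j) 0 + (Num.conj w ^+ 2 / w) * vev Q w (lift ord0 j) 0).
    by apply/funext => w; rewrite !mxE.
  have cs f : sm T f -> continuousC f 0 by move=> sf; exact (sm_continuousC oT I sf).
  apply: continuousCM.
    apply/cs/smM; first exact: sm_cst.
    apply: smV; last exact (smX 2 (sX ord0 0)).
    by move=> z _; rewrite expf_neq0 // (lt0r_neq0 (Xp z)).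
  apply: continuousCD; first exact (cs _ (smv_vev l T P _ _)).
  apply: continuousCM; first exact conj_ratio_continuous.
  exact (cs _ (smv_vev l T Q _ _)).
- have V0 : V 0 = vev P 0 by rewrite /V invr0 mulr0 scale0r addr0.
  apply/eqP => /(congr1 (fun m : 'cV[C]_7 => m ord_max 0)); rewrite mxE V0 [RHS]mxE.
  have E : vev P 0 (lift ord0 ord_max) 0 = l^-1 * pev (nth [::] P 6) 0 + l * pev (nth [::] P 7) 0.
    by apply: etrans (mxE _ _ _ _) _.
  rewrite E !pev0; have /Z.eqb_eq -> := n6; rewrite mulr0 add0r => /eqP.
  rewrite !mulf_eq0 !invr_eq0 pnatr_eq0 expf_eq0 /= (negPf (lt0r_neq0 (Xp 0))).
  by rewrite (negPf (l_neq0 l1)) (negPf (zC_neq0 R n7)).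
move=> w; apply/colP => j; rewrite (dz_bracket _ _ sX Xp) (dz_vev l oT X (I : T w)) !vev_0.
have e1 := veqP l w h1; rewrite vevD !vevZ pevN in e1.
have e2 := veqP l w h2; rewrite vevD !vevZ in e2.
have q1 : pev [:: mon 1 1 0] w = w by rewrite /= /tev /= (@zCE R 1) // expr1 expr0; ring.
have q2 : pev [:: mon 1 0 2] w = Num.conj w ^+ 2 by rewrite /= /tev /= (@zCE R 1) // expr0; ring.
rewrite q1 q2 in e2.
have e3 : w * V w (lift ord0 j) 0 = vev N w (lift ord0 j) 0.
  rewrite e2 /V !mxE mulrDr; congr (_ + _); rewrite mulrA.
  case: (eqVneq w 0) => [->|w0]; first by rewrite conjC0 expr0n /= !mul0r.
  by rewrite mulrCA mulfV // mulr1.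
transitivity (u w * (w * V w (lift ord0 j) 0)); last by rewrite [RHS]mxE expr1 [X in _ = w * X]mxE mulrCA.
rewrite e3 e1 /u vev_0; exact: entry_scale.
Qed.

Definition PN : pvec := map pnorm
  (vadd (vscale (padd (nth [::] PX 0) (nth [::] PX 1)) (vdz PX))
     (vscale (popp (padd (nth [::] (vdz PX) 0) (nth [::] (vdz PX) 1))) PX)).

Lemma yglue_branch : branch_point_at_0 (fun w => yglue l (chart_oo w)).
Proof.
rewrite (glue_chartoo (glued_Y l1)).
by apply: (branch_point_vev (N := PN) ck_PX); vm_compute.
Qed.

Lemma yglue_smooth : smooth setT (fun w => yglue l (chart_oo w)).
Proof.
rewrite (glue_chartoo (glued_Y l1)).
apply: (smv_smooth oT); apply: smv_bracket_pos; first exact (smv_vev l T PX).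
by move=> z; exact (vev_pos l z ck_PX).
Qed.

End BranchPoint.

(** * The minimal surface *)

Section MinimalSurface.
Variable R : realType.
Local Notation C := R[i].

Section Laplacian.
Variables (U : set C) (f : C -> C).
Hypotheses (oU : Defs.openC U) (sf : sm U f).
Let s1 := sm_wz oU sf.
Let s2 := sm_wzb oU sf.

Lemma wz_comb a b z : U z -> wz (fun w => a * wz f w + b * wzb f w) z =
  a * wz (wz f) z + b * wzb (wz f) z.
Proof.
move=> Uz; have sa := sm_cst U a; have sb := sm_cst U b.
apply: etrans (wzD oU Uz (smM sa s1) (smM sb s2)) _.
have e1 := wzM oU Uz sa s1; have e2 := wzM oU Uz sb s2.
rewrite (wz_cst oU _ Uz) mul0r add0r in e1; rewrite (wz_cst oU _ Uz) mul0r add0r in e2.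
exact (congr2 +%R e1 (etrans e2 (congr1 ( *%R b) (wz_wzb oU Uz sf)))).
Qed.

Lemma wzb_comb a b z : U z -> wzb (fun w => a * wz f w + b * wzb f w) z =
  a * wzb (wz f) z + b * wzb (wzb f) z.
Proof.
move=> Uz; have sa := sm_cst U a; have sb := sm_cst U b.
apply: etrans (wzbD oU Uz (smM sa s1) (smM sb s2)) _.
have e1 := wzbM oU Uz sa s1; have e2 := wzbM oU Uz sb s2.
rewrite (wzb_cst oU _ Uz) mul0r add0r in e1; rewrite (wzb_cst oU _ Uz) mul0r add0r in e2.
exact (congr2 +%R e1 e2).
Qed.

Lemma pderive2 d z : U z -> pderive d (pderive d f) z =
  d * (d * wz (wz f) z + Num.conj d * wzb (wz f) z)
  + Num.conj d * (d * wzb (wz f) z + Num.conj d * wzb (wzb f) z).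
Proof.
move=> Uz; have e w : U w -> d * wz f w + Num.conj d * wzb f w = pderive d f w.
  by move=> Uw; exact (esym (pderive_wz d oU Uw sf)).
have sg := smD (smM (sm_cst U d) s1) (smM (sm_cst U (Num.conj d)) s2).
apply: etrans (pderive_wz d oU Uz (sm_eq e sg)) _.
have e1 := etrans (wz_eq oU Uz e sg) (wz_comb d (Num.conj d) Uz).
have e2 := etrans (wzb_eq oU Uz e sg) (wzb_comb d (Num.conj d) Uz).
exact (congr2 (fun x y => d * x + Num.conj d * y) e1 e2).
Qed.

Lemma laplacian_wz z : U z ->
  pderive 1 (pderive 1 f) z + pderive 'i (pderive 'i f) z = 4 * wzb (wz f) z.
Proof.
move=> Uz; apply: etrans (congr2 +%R (pderive2 1 Uz) (pderive2 'i Uz)) _.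
move: (wz (wz f) z) (wzb (wz f) z) (wzb (wzb f) z) => a b c.
have := ii R; rewrite conjC1 conjCi; move: ('i : C) => j jj.
have -> : 1 * (1 * a + 1 * b) + 1 * (1 * b + 1 * c) + (j * (j * a + - j * b) + - j * (j * b + - j * c))
  = (1 + j * j) * (a + c) + 2 * (1 - j * j) * b by ring.
by rewrite jj; ring.
Qed.

End Laplacian.

Lemma laplacian (U : set C) n (x : C -> 'cV[C]_n) z : Defs.openC U -> U z -> smv U x ->
  du (du x) z + dv (dv x) z = 4 *: dzb (dz x) z.
Proof.
move=> oU Uz sx; apply/matrixP => i j.
have eu : (fun w => du x w i j) = pderive 1 (fun w => x w i j).
  by apply/funext => w; rewrite duE.
have ev : (fun w => dv x w i j) = pderive 'i (fun w => x w i j).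
  by apply/funext => w; rewrite dvE.
have ez : (fun w => dz x w i j) = wz (fun w => x w i j).
  by apply/funext => w; rewrite dzE.
have h := laplacian_wz oU (sx i j) Uz.
have h1 := etrans (duE (du x) z i j) (congr1 (fun g => pderive 1 g z) eu).
have h2 := etrans (dvE (dv x) z i j) (congr1 (fun g => pderive 'i g z) ev).
have h3 := etrans (dzbE (dz x) z i j) (congr1 (fun g => wzb g z) ez).
apply: etrans (mxE _ _ _ _) _.
apply: etrans (congr2 +%R h1 h2) (etrans h _).
exact (etrans (congr1 ( *%R 4) (esym h3)) (esym (mxE _ _ _ _))).
Qed.

(** In conformal parameters f = 0 and e = g, so the tested vector is e times the Laplacian 4 x_{z
    \bar z}, which vanishes. *)
Lemma minimal_harmonic (U : set C) n (x : C -> 'cV[C]_n) : Defs.openC U -> smv U x ->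
  (forall z, U z -> Defs.realmx (x z)) ->
  (forall z, U z -> dot (dz x z) (dz x z) = 0) ->
  (forall z, U z -> 0 < dot (dz x z) (dzb x z)) ->
  (forall z, U z -> dzb (dz x) z = 0) -> minimal_surface U x.
Proof.
move=> oU sx xr h1 h2 h3; split => //; first exact (smv_smooth oU sx).
move=> z Uz; have e0 : dzb x z = mxconj (dz x z).
  rewrite -(dzb_conj oU Uz sx); apply: (dzb_eq oU Uz _ (smv_conj sx)) => w Uw.
  by apply/realmxP/xr.
have h1' : dot (dzb x z) (dzb x z) = 0 by rewrite e0 dot_conj (h1 z Uz) conjC0.
have [-> -> ->] := dot_du_dv oU Uz sx (h1 z Uz) h1' erefl erefl.
have q0 := h2 z Uz; split.
  by rewrite expr0n /= subr0 mulr_gt0 // mulr_gt0.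
move=> nu _ _ _; have L := laplacian oU Uz sx; rewrite (h3 z Uz) scaler0 in L.
move: (dot (dz x z) _) (du (du x) z) (dv (dv x) z) (du (dv x) z) L => q a b c L.
have -> : (2 * q) *: a - (2 * 0) *: c + (2 * q) *: b = (2 * q) *: (a + b).
  by rewrite mulr0 scale0r subr0 scalerDr.
by rewrite L scaler0 /dot big1 // => i _; rewrite mxE mulr0.
Qed.

Variable l : C.
Hypothesis l1 : `|l| = 1.
Let U : set C := [set z | z != 0].

Lemma openC_punctured : Defs.openC U.
Proof.
have -> : (U : set (cplx R)) = ~` [set 0].
  by apply/seteqP; split => z /=; [move/eqP|move/eqP].
exact (closed_openC (accessible_closed_set1 (hausdorff_accessible
  (@norm_hausdorff (cplx R) (cplx R))) (x := (0 : cplx R)))).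
Qed.
Let oU := openC_punctured.

(** Null coordinates of x, with p = q = 0. Each one is holomorphic or antiholomorphic off 0, which
    explains why x is harmonic. *)
Definition xcoord (k : nat) (z : C) : C :=
  nth 0 [:: 0; 0; - z; - Num.conj z; 2 * (Num.conj z)^-1; 2 * z^-1; - (2 / 3) * z ^+ 2;
            - (2 / 3) * Num.conj z ^+ 2] k.
Definition x8 (z : C) : 'cV[C]_8 := nullv l (xcoord ^~ z).

Lemma conj_neq0 (z : C) : z != 0 -> Num.conj z != 0.
Proof. by rewrite fmorph_eq0. Qed.

Lemma sm_xcoord k : sm U (xcoord k).
Proof.
have s0 := sm_id U; have sc := sm_conj s0.
have si : sm U (fun z => z^-1) by apply: smV.
have sci : sm U (fun z => (Num.conj z)^-1) by apply: smV => // z; exact: conj_neq0.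
have cst := sm_cst U.
move: k => [|[|[|[|[|[|[|[|k]]]]]]]] //=; rewrite /xcoord /=.
- exact (cst 0).
- exact (cst 0).
- exact (smN s0).
- exact (smN sc).
- exact (smM (cst 2) sci).
- exact (smM (cst 2) si).
- exact (smM (cst _) (smX 2 s0)).
- exact (smM (cst _) (smX 2 sc)).
- by rewrite nth_nil.
Qed.

Lemma xvec_x8 z j : U z -> xvec l z j 0 = x8 z (lift ord0 (lift ord0 j)) 0.
Proof.
move=> z0; have c0 := conj_neq0 z0; have l0 := l_neq0 l1.
rewrite /x8 /nullv !mxE normCK.
case: j => -[|[|[|[|[|[|//]]]]]] i; rewrite /xcoord /=; field; by rewrite ?l0 ?z0 ?c0.
Qed.

Lemma smv_x8 : smv U x8.
Proof. exact (smv_nullv l sm_xcoord). Qed.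

Lemma smv_xvec : smv U (xvec l).
Proof.
move=> i k; rewrite (ord1 k); apply: sm_eq (smv_x8 (lift ord0 (lift ord0 i)) 0) => z Uz.
exact (esym (xvec_x8 i Uz)).
Qed.

Lemma dz_xvec z j : U z -> dz (xvec l) z j 0 = dz x8 z (lift ord0 (lift ord0 j)) 0.
Proof.
move=> Uz; rewrite !dzE.
by apply: (wz_eq oU Uz _ (smv_x8 _ 0)) => w Uw; rewrite (xvec_x8 j Uw).
Qed.

Lemma dzb_xvec z j : U z -> dzb (xvec l) z j 0 = dzb x8 z (lift ord0 (lift ord0 j)) 0.
Proof.
move=> Uz; rewrite !dzbE.
by apply: (wzb_eq oU Uz _ (smv_x8 _ 0)) => w Uw; rewrite (xvec_x8 j Uw).
Qed.

Definition xcoord_z (k : nat) (z : C) : C :=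
  nth 0 [:: 0; 0; -1; 0; 0; - 2 * (z^-1) ^+ 2; - (4 / 3) * z; 0] k.
Definition xcoord_zb (k : nat) (z : C) : C :=
  nth 0 [:: 0; 0; 0; -1; - 2 * ((Num.conj z)^-1) ^+ 2; 0; 0; - (4 / 3) * Num.conj z] k.

Lemma wz_scale (a : C) f z : U z -> sm U f -> wz (fun w => a * f w) z = a * wz f z.
Proof.
move=> Uz sf; have := wzM oU Uz (sm_cst U a) sf.
by rewrite (wz_cst oU _ Uz) mul0r add0r.
Qed.

Lemma wzb_scale (a : C) f z : U z -> sm U f -> wzb (fun w => a * f w) z = a * wzb f z.
Proof.
move=> Uz sf; have := wzbM oU Uz (sm_cst U a) sf.
by rewrite (wzb_cst oU _ Uz) mul0r add0r.
Qed.

Lemma sm_inv : sm U (fun z => z^-1).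
Proof. by apply: smV => //; exact: sm_id. Qed.

Lemma d_inv z : U z -> wz (fun z => z^-1) z = - (z^-1) ^+ 2 /\ wzb (fun z : C => z^-1) z = 0.
Proof.
move=> z0; have s0 := sm_id U; have si := sm_inv.
have one w : U w -> 1 = w * w^-1 by move=> w0; rewrite mulfV.
have e1 := wz_eq oU z0 (f := fun=> 1) (g := fun w => w * w^-1) (fun w h => one w h) (sm_cst _ _).
have e2 := wzb_eq oU z0 (f := fun=> 1) (g := fun w => w * w^-1) (fun w h => one w h) (sm_cst _ _).
have h1 := etrans (esym (wzM oU z0 s0 si)) (etrans e1 (wz_cst oU _ z0)).
have h2 := etrans (esym (wzbM oU z0 s0 si)) (etrans e2 (wzb_cst oU _ z0)).
rewrite (wz_id oU z0) in h1; rewrite (wzb_id oU z0) in h2.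
move: (wz _ z) (wzb _ z) h1 h2 => a b h1 h2; split; apply: (mulfI z0).
  by move/eqP: h1; rewrite mul1r addrC addr_eq0 => /eqP ->; rewrite expr2 mulrN mulrA mulfV // mul1r.
by move: h2; rewrite mul0r add0r => ->; rewrite mulr0.
Qed.

Lemma d_conj_inv z : U z -> wz (fun z : C => (Num.conj z)^-1) z = 0 /\
  wzb (fun z => (Num.conj z)^-1) z = - ((Num.conj z)^-1) ^+ 2.
Proof.
move=> z0; have [h1 h2] := d_inv z0.
have E : (fun z : C => (Num.conj z)^-1) = fun z => Num.conj z^-1.
  by apply/funext => w; rewrite cjV.
rewrite E; split.
  by apply: etrans (wz_conj oU z0 sm_inv) _; rewrite h2 conjC0.
by apply: etrans (wzb_conj oU z0 sm_inv) _; rewrite h1 cjN cjX cjV.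
Qed.

Lemma d_xcoord k z : U z -> wz (xcoord k) z = xcoord_z k z /\ wzb (xcoord k) z = xcoord_zb k z.
Proof.
move=> z0; have s0 := sm_id U; have sc := sm_conj s0; have si := sm_inv.
have sci : sm U (fun z => (Num.conj z)^-1) by apply: smV => // w; exact: conj_neq0.
have [i1 i2] := d_inv z0; have [c1 c2] := d_conj_inv z0.
have n1 : (fun z : C => - z) = fun z => (-1) * z by apply/funext => w; rewrite mulN1r.
have n2 : (fun z : C => - Num.conj z) = fun z => (-1) * Num.conj z.
  by apply/funext => w; rewrite mulN1r.
have e1 : (fun z : C => Num.conj z) = fun z => Num.conj z ^+ 1.
  by apply/funext => w; rewrite expr1.
have p1 := wz_conjexp oU 1 z0; have p2 := wzb_conjexp oU 1 z0.
rewrite -e1 /= expr0 mulr1 in p1 p2.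
have z00 : wz (fun _ : C => 0) z = 0 :> C := wz_cst oU _ z0.
have z01 : wzb (fun _ : C => 0) z = 0 :> C := wzb_cst oU _ z0.
move: k => [|[|[|[|[|[|[|[|k]]]]]]]]; rewrite /xcoord /xcoord_z /xcoord_zb /=.
- by [].
- by [].
- by rewrite n1 (wz_scale _ z0 s0) (wzb_scale _ z0 s0) (wz_id oU z0) (wzb_id oU z0) mulr1 mulr0.
- by rewrite n2 (wz_scale _ z0 sc) (wzb_scale _ z0 sc) p1 p2 mulr1 mulr0.
- by rewrite (wz_scale _ z0 sci) (wzb_scale _ z0 sci) c1 c2 mulr0 mulrN mulNr.
- by rewrite (wz_scale _ z0 si) (wzb_scale _ z0 si) i1 i2 mulr0 mulrN mulNr.
- rewrite (wz_scale _ z0 (smX 2 s0)) (wzb_scale _ z0 (smX 2 s0)).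
  rewrite (wz_exp oU 2 z0) (wzb_exp oU 2 z0) mulr0 expr1; split => //.
  by field.
- rewrite (wz_scale _ z0 (smX 2 sc)) (wzb_scale _ z0 (smX 2 sc)).
  rewrite (wz_conjexp oU 2 z0) (wzb_conjexp oU 2 z0) mulr0 expr1; split => //.
  by field.
- by rewrite !nth_nil.
Qed.

Lemma dz_x8 z : U z -> dz x8 z = nullv l (xcoord_z ^~ z).
Proof.
move=> Uz; apply: etrans (dz_nullv l oU Uz sm_xcoord) _.
by apply: nullv_ext => k _; have [] := d_xcoord k Uz.
Qed.

Lemma dzb_x8 z : U z -> dzb x8 z = nullv l (xcoord_zb ^~ z).
Proof.
move=> Uz; apply: etrans (dzb_nullv l oU Uz sm_xcoord) _.
by apply: nullv_ext => k _; have [] := d_xcoord k Uz.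
Qed.

Lemma lor_dot6 (u v : 'cV[C]_8) (a b : 'cV[C]_6) :
  u ord0 0 = 0 -> u (lift ord0 ord0) 0 = 0 ->
  (forall j, u (lift ord0 (lift ord0 j)) 0 = a j 0) ->
  (forall j, v (lift ord0 (lift ord0 j)) 0 = b j 0) -> dot a b = lor u v.
Proof.
move=> u0 u1 ua vb; rewrite /lor big_ord_recl u0 u1 !mul0r oppr0 !add0r.
by apply: eq_bigr => j _; rewrite ua vb.
Qed.

Lemma nullv_01 (c : nat -> C) : c 0%N = 0 -> c 1%N = 0 ->
  nullv l c ord0 0 = 0 /\ nullv l c (lift ord0 ord0) 0 = 0.
Proof. by move=> h1 h2; rewrite !mxE /= h1 h2 subr0 addr0 mul0r. Qed.

Lemma minimal_xvec : minimal_surface U (xvec l).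
Proof.
apply: (minimal_harmonic oU smv_xvec).
- move=> z Uz; apply/realmxP/colP => j; rewrite mxE (xvec_x8 j Uz).
  have -> : Num.conj (x8 z (lift ord0 (lift ord0 j)) 0) = mxconj (x8 z) (lift ord0 (lift ord0 j)) 0.
    by rewrite [RHS]mxE.
  congr (fun_of_matrix _ _ _); rewrite (mxconj_nullv l1); apply: nullv_ext.
  case=> [|[|[|[|[|[|[|[|//]]]]]]]] _; rewrite /xcoord /= ?conjC0 ?cjN ?cjM ?cjV ?cjX ?cj_nat ?conjCK //;
    by rewrite ?cjN ?cjM ?cjV ?cj_nat.
- move=> z Uz; have [u0 u1] := @nullv_01 (xcoord_z ^~ z) erefl erefl.
  rewrite -(dz_x8 Uz) in u0 u1.
  rewrite (lor_dot6 u0 u1 (fun j => esym (dz_xvec j Uz)) (fun j => esym (dz_xvec j Uz))).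
  by rewrite (dz_x8 Uz) (lor_nullv l1) /xcoord_z /=; field.
- move=> z Uz; have [u0 u1] := @nullv_01 (xcoord_z ^~ z) erefl erefl.
  rewrite -(dz_x8 Uz) in u0 u1.
  rewrite (lor_dot6 u0 u1 (fun j => esym (dz_xvec j Uz)) (fun j => esym (dzb_xvec j Uz))).
  rewrite (dz_x8 Uz) (dzb_x8 Uz) (lor_nullv l1) /xcoord_z /xcoord_zb /=.
  have c0 := conj_neq0 Uz.
  have -> : - (0 * 0 + 0 * 0) / 2 + 2 * ((-1 * -1 + 0 * 0) +
       (0 * 0 + - 2 * z^-1 ^+ 2 * (- 2 * (Num.conj z)^-1 ^+ 2)) +
       (- (4 / 3) * z * (- (4 / 3) * Num.conj z) + 0 * 0)) =
     2 + 8 * ((z * Num.conj z)^-1) ^+ 2 + 32 / 9 * (z * Num.conj z) :> C.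
    by field; rewrite c0 Uz.
  have t0 : 0 < z * Num.conj z by rewrite mul_conjC_gt0.
  move: (z * Num.conj z) t0 => t t0.
  by rewrite !addr_gt0 ?mulr_gt0 ?exprn_gt0 ?invr_gt0 ?ltr0n.
- move=> z Uz; apply/colP => j; rewrite dzbE [RHS]mxE.
  have e w : U w -> nullv l (xcoord_z ^~ w) (lift ord0 (lift ord0 j)) 0 = dz (xvec l) w j 0.
    by move=> Uw; rewrite (dz_xvec j Uw) (dz_x8 Uw).
  have s k : sm U (xcoord_z k).
    apply: sm_eq (sm_wz oU (sm_xcoord k)) => w Uw; by have [] := d_xcoord k Uw.
  apply: etrans (wzb_eq oU Uz e (smv_nullv l s _ _)) _.
  rewrite -dzbE (dzb_nullv l oU Uz s).
  have -> : nullv l (fun k => wzb (xcoord_z k) z) = nullv l (fun=> 0).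
    apply: nullv_ext => k _.
    have -> : wzb (xcoord_z k) z = wzb (wz (xcoord k)) z.
      apply: (wzb_eq oU Uz) (sm_wz oU (sm_xcoord k)) => w Uw; by have [] := d_xcoord k Uw.
    (* After the exchange only d/dz of the antiholomorphic expressions [xcoord_zb] is left. *)
    rewrite -(wz_wzb oU Uz (sm_xcoord k)).
    have -> : wz (wzb (xcoord k)) z = wz (xcoord_zb k) z.
      apply/esym/(wz_eq oU Uz) => [w Uw|]; first by have [] := d_xcoord k Uw.
      exact (sm_wzb oU (sm_xcoord k)).
    have sci : sm U (fun z => (Num.conj z)^-1).
      by apply: smV => [w|]; [exact: conj_neq0|exact (sm_conj (sm_id U))].
    have z00 : wz (fun _ : C => 0) z = 0 :> C := wz_cst oU _ Uz.
    move: k => [|[|[|[|[|[|[|[|k]]]]]]]] //=; rewrite /xcoord_zb /=.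
    + exact (wz_cst oU _ Uz).
    + rewrite (wz_scale _ Uz (smX 2 sci)).
      have := wzM oU Uz sci sci; have [c1 _] := d_conj_inv Uz; rewrite c1 mul0r mulr0 addr0.
      by move=> h; rewrite (h : wz (fun w : C => (Num.conj w)^-1 ^+ 2) z = 0) mulr0.
    + rewrite (wz_scale _ Uz (sm_conj (sm_id U))).
      apply: etrans (congr1 ( *%R (- (4 / 3))) (wz_conj oU Uz (sm_id U))) _.
      by rewrite (wzb_id oU Uz) conjC0 mulr0.
    + by rewrite nth_nil.
  by case: j {e} => -[|[|[|[|[|[|//]]]]]] i; rewrite !mxE /=; ring.
Qed.

End MinimalSurface.

(** * Conformal equivalence with the minimal surface *)

Section Moebius.
Variable R : realType.
Local Notation C := R[i].
Variable l : C.
Hypothesis l1 : `|l| = 1.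

(* The boost (p, q) -> (4 p, q / 4) in light-cone coordinates, composed with
   the antipodal map of the remaining Euclidean space. *)
Definition boost : 'M[C]_8 := \matrix_(i, j)
  if (i == j :> nat) then (if (i < 2)%N then 17 / 8 else -1)
  else if (i + j == 1)%N then 15 / 8 else 0.

(** The entries 17/8 and 15/8 are half the sum and half the difference of 4 and 1/4. *)
Lemma boost_nullv c : boost *m nullv l c =
  nullv l (fun k => nth 0 [:: 4; 4^-1; -1; -1; -1; -1; -1; -1] k * c k).
Proof.
have l0 := l_neq0 l1; apply/colP => i; rewrite mxE !big_ord_recl big_ord0 !mxE.
by case: i => -[|[|[|[|[|[|[|[|//]]]]]]]] i /=; field.
Qed.

Lemma boost_Op : Op boost.
Proof.
have cs (a b : C) : Num.conj (a / b) = Num.conj a / Num.conj b by rewrite cjM cjV.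
split.
- apply/realmxP/matrixP => i j; rewrite !mxE.
  by do ![case: ifP => _]; rewrite ?cs ?cjN ?conjC0 ?conjC1 ?cj_nat.
- apply/matrixP => i j; rewrite lor_mxE /lor !big_ord_recl big_ord0 !mxE.
  by case: i => -[|[|[|[|[|[|[|[|//]]]]]]]] i; case: j => -[|[|[|[|[|[|[|[|//]]]]]]]] j /=; field.
- by rewrite mxE /= divr_gt0 ?ltr0n.
Qed.

Lemma inv_stereo_0 n (x : 'cV[C]_n) : inv_stereo x ord0 0 = (1 + dot x x)^-1 * (1 - dot x x).
Proof.
rewrite /inv_stereo mxE; congr (_ * _).
rewrite -[ord0](_ : lshift n (ord0 : 'I_1) = ord0); last exact: val_inj.
by apply: etrans (col_mxEu _ _ ord0 0) _; rewrite mxE eqxx.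
Qed.

Lemma inv_stereo_S n (x : 'cV[C]_n) j :
  inv_stereo x (lift ord0 j) 0 = (1 + dot x x)^-1 * (2 * x j 0).
Proof.
rewrite /inv_stereo mxE; congr (_ * _).
rewrite -[lift ord0 j](_ : rshift 1 j = lift ord0 j); last exact: val_inj.
by apply: etrans (col_mxEd _ _ j 0) _; rewrite mxE.
Qed.

(** Null coordinates of (1 + N, 1 - N, 2 x), which is the lift of the inverse stereographic image
    times 1 + N for N = <x, x>. *)
Definition cone_coord (N : C) (z : C) (k : nat) : C :=
  if k == 0%N then 2 else if k == 1%N then 2 * N else 2 * xcoord k z.

Lemma lift1_inv_stereo z : z != 0 -> 1 + dot (xvec l z) (xvec l z) != 0 ->
  lift1 (inv_stereo (xvec l z)) = (1 + dot (xvec l z) (xvec l z))^-1 *: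
    nullv l (cone_coord (dot (xvec l z) (xvec l z)) z).
Proof.
move=> z0 N0; apply/colP => i; rewrite [RHS]mxE.
case: (unliftP ord0 i) => [i'|] ->; last first.
  rewrite lift1_0 mxE /= /cone_coord /=; move: (dot _ _) N0 => N N0.
  by field.
rewrite lift1_S; case: (unliftP ord0 i') => [j|] ->; last first.
  rewrite inv_stereo_0 mxE /= /cone_coord /=; move: (dot _ _) N0 => N N0.
  by field.
rewrite inv_stereo_S (xvec_x8 l1 j z0); congr (_ * _).
rewrite /x8 /nullv !mxE.
by case: j => -[|[|[|[|[|[|//]]]]]] j; rewrite /cone_coord /=; ring.
Qed.

Lemma dot_xvec z : z != 0 -> dot (xvec l z) (xvec l z) =
  4 * (z * Num.conj z + 4 / (z * Num.conj z) + 4 / 9 * (z * Num.conj z) ^+ 2).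
Proof.
move=> z0; have [u0 u1] := @nullv_01 R l (fun k => xcoord k z) erefl erefl.
rewrite (lor_dot6 u0 u1 (fun j => esym (xvec_x8 l1 j z0)) (fun j => esym (xvec_x8 l1 j z0))).
have c0 := conj_neq0 z0.
by rewrite (lor_nullv l1) /xcoord /=; field; rewrite z0 c0.
Qed.

Lemma moebius_xvec : moebius_equivalent [set z | z != 0]
  (fun z => yglue l (chart_0 z)) (xvec l).
Proof.
exists boost; first exact boost_Op.
move=> z z0; have c0 := conj_neq0 z0.
have t0 : 0 < z * Num.conj z by rewrite mul_conjC_gt0.
have N0 : 1 + dot (xvec l z) (xvec l z) != 0.
  rewrite (dot_xvec z0); move: (z * Num.conj z) t0 => t t0.
  by apply: lt0r_neq0; rewrite !addr_gt0 ?mulr_gt0 ?addr_gt0 ?mulr_gt0 ?exprn_gt0 ?invr_gt0 ?ltr0n.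
rewrite (lift1_inv_stereo z0 N0) -scalemxAr boost_nullv bracketZ ?invr_eq0 //.
change (bracket (vev l YX z) = bracket (nullv l (fun k => nth 0 [:: 4; 4^-1; -1; -1; -1; -1; -1; -1] k *
  cone_coord (dot (xvec l z) (xvec l z)) z k))).
(* The scale is read off from the p-coordinate: the boost turns 2 into 8, and 8 times 9/2 |z|^2 is
   the entry 36 |z|^2 of [YX]. *)
have s0 : 9 / 2 * (z * Num.conj z) != 0 by rewrite !mulf_neq0 ?invr_eq0 ?pnatr_eq0.
rewrite -[RHS](bracketZ _ s0); congr bracket; apply/esym/nullv_scale => k.
rewrite (dot_xvec z0).
move: k => [|[|[|[|[|[|[|[|//]]]]]]]] _; rewrite /cone_coord /xcoord /= /tev /=; znum; field;
  by rewrite ?z0 ?c0.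
Qed.

End Moebius.

(** * The potential and its solution *)

Section NullBasis.
Variable R : realType.
Local Notation C := R[i].
Implicit Types l : C.

Definition Enull l : 'M[C]_8 := \matrix_(i, k) nullv l (fun j => (j == k)%:R) i 0.

Lemma Enull_col l (c : nat -> C) : Enull l *m (\col_(k < 8) c k) = nullv l c.
Proof.
apply/colP => i; rewrite nullvE mxE summxE; apply: eq_bigr => k _.
by rewrite !mxE mulrC.
Qed.

Definition Einv l : 'M[C]_8 := \matrix_(k, i)
  nth 0 (nth [::] [:: [:: 1; 1]; [:: 1; -1];
    [:: 0; 0; l * 'i / 2; l / 2]; [:: 0; 0; - l^-1 * 'i / 2; l^-1 / 2];
    [:: 0; 0; 0; 0; l * 'i / 2; l / 2]; [:: 0; 0; 0; 0; - l^-1 * 'i / 2; l^-1 / 2];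
    [:: 0; 0; 0; 0; 0; 0; l * 'i / 2; l / 2];
    [:: 0; 0; 0; 0; 0; 0; - l^-1 * 'i / 2; l^-1 / 2]] k) i.

Lemma Einv_a l x y : l != 0 ->
  l * 'i / 2 * ('i * (l * y - l^-1 * x)) + l / 2 * (l^-1 * x + l * y) = x.
Proof.
move=> l0; have -> : l * 'i / 2 * ('i * (l * y - l^-1 * x)) =
  ('i * 'i) * (l / 2 * (l * y - l^-1 * x)) by ring.
by rewrite ii; field.
Qed.

Lemma Einv_b l x y : l != 0 ->
  - l^-1 * 'i / 2 * ('i * (l * y - l^-1 * x)) + l^-1 / 2 * (l^-1 * x + l * y) = y.
Proof.
move=> l0; have -> : - l^-1 * 'i / 2 * ('i * (l * y - l^-1 * x)) =
  ('i * 'i) * (- l^-1 / 2 * (l * y - l^-1 * x)) by ring.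
by rewrite ii; field.
Qed.

Lemma EinvK l (c : nat -> C) : l != 0 -> Einv l *m nullv l c = \col_(k < 8) c k.
Proof.
move=> l0; apply/colP => k; rewrite mxE !big_ord_recl big_ord0 !mxE.
case: k => -[|[|[|[|[|[|[|[|//]]]]]]]] i /=.
- by field.
- by field.
- by rewrite -[RHS](@Einv_a l _ (c 3) l0); ring.
- by rewrite -[RHS](@Einv_b l (c 2) _ l0); ring.
- by rewrite -[RHS](@Einv_a l _ (c 5) l0); ring.
- by rewrite -[RHS](@Einv_b l (c 4) _ l0); ring.
- by rewrite -[RHS](@Einv_a l _ (c 7) l0); ring.
- by rewrite -[RHS](@Einv_b l (c 6) _ l0); ring.
Qed.

Lemma col_Enull l k : col k (Enull l) = nullv l (fun j => (j == k)%:R).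
Proof. by apply/colP => i; rewrite !mxE. Qed.

Lemma Einv_Enull l : l != 0 -> Einv l *m Enull l = 1%:M.
Proof.
move=> l0; apply/matrixP => i k.
have -> : (Einv l *m Enull l) i k = (Einv l *m nullv l (fun j => (j == k)%:R)) i 0.
  by rewrite [LHS]mxE [RHS]mxE; apply: eq_bigr => j _; rewrite [Enull l j k]mxE.
by rewrite (EinvK _ l0) !mxE.
Qed.

Lemma Enull_Einv l : l != 0 -> Enull l *m Einv l = 1%:M.
Proof. by move=> l0; exact: mulmx1C (Einv_Enull l0). Qed.

(* Conjugation pairs p with p, q with q, a_k with b_k; the Lorentz form pairs
   p with q, a_k with b_k. *)
Definition cstar (k : nat) : nat := nth 0%N [:: 0; 1; 3; 2; 5; 4; 7; 6] k.
Definition gstar (k : nat) : nat := nth 0%N [:: 1; 0; 3; 2; 5; 4; 7; 6] k.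
Definition gweight (k : nat) : C := if (k < 2)%N then - 2^-1 else 2.
Definition Cmx : 'M[C]_8 := \matrix_(i, k) (k == cstar i :> nat)%:R.
Definition Gmx : 'M[C]_8 := \matrix_(i, k) (gweight i * (k == gstar i :> nat)%:R).
Definition Ginv : 'M[C]_8 := \matrix_(i, k) ((gweight i)^-1 * (k == gstar i :> nat)%:R).

Lemma Ginv_Gmx : Ginv *m Gmx = 1%:M.
Proof.
apply/matrixP => i k; rewrite !mxE !big_ord_recl big_ord0 !mxE /gweight /gstar.
by case: i => -[|[|[|[|[|[|[|[|//]]]]]]]] i; case: k => -[|[|[|[|[|[|[|[|//]]]]]]]] k /=; field.
Qed.

Lemma Cmx_Cmx : Cmx *m Cmx = 1%:M.
Proof.
apply/matrixP => i k; rewrite !mxE !big_ord_recl big_ord0 !mxE /cstar.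
by case: i => -[|[|[|[|[|[|[|[|//]]]]]]]] i; case: k => -[|[|[|[|[|[|[|[|//]]]]]]]] k /=; ring.
Qed.

Lemma Enull_Gram l : `|l| = 1 -> (Enull l)^T *m Defs.minkowski R 7 *m Enull l = Gmx.
Proof.
move=> l1; apply/matrixP => i k; rewrite lor_mxE !col_Enull (lor_nullv l1) mxE /gweight /gstar.
by case: i => -[|[|[|[|[|[|[|[|//]]]]]]]] i; case: k => -[|[|[|[|[|[|[|[|//]]]]]]]] k /=; field.
Qed.

Lemma mxconjM p q r (A : 'M[C]_(p, q)) (B : 'M[C]_(q, r)) :
  mxconj (A *m B) = mxconj A *m mxconj B.
Proof. exact: map_mxM. Qed.

Lemma mxconj1 p : mxconj (1%:M : 'M[C]_p) = 1%:M.
Proof. exact: map_mx1. Qed.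

Lemma mxconj_Enull l : `|l| = 1 -> mxconj (Enull l) = Enull l *m Cmx.
Proof.
move=> l1; apply/matrixP => i k; rewrite [RHS]mxE [LHS]mxE.
have -> : Num.conj (Enull l i k) = mxconj (nullv l (fun j => (j == k)%:R)) i 0 by rewrite !mxE.
rewrite (mxconj_nullv l1) nullvE summxE; apply: eq_bigr => j _.
rewrite mulrC !mxE; congr (_ * _); rewrite /cstar cj_nat.
by case: j => -[|[|[|[|[|[|[|[|//]]]]]]]] j; case: k => -[|[|[|[|[|[|[|[|//]]]]]]]] k.
Qed.

Lemma mxconj_Einv l : `|l| = 1 -> mxconj (Einv l) = Cmx *m Einv l.
Proof.
move=> l1; have l0 := l_neq0 l1.
have e : mxconj (Einv l) *m (Enull l *m Cmx) = 1%:M.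
  by rewrite -(mxconj_Enull l1) -mxconjM (Einv_Enull l0) mxconj1.
have h : (Enull l *m Cmx) *m (Cmx *m Einv l) = 1%:M.
  by rewrite mulmxA -(mulmxA _ Cmx Cmx) Cmx_Cmx mulmx1 (Enull_Einv l0).
by rewrite -[LHS]mulmx1 -h mulmxA e mul1mx.
Qed.

Definition D8 : 'M[C]_8 := diag_mx (\row_j (if (j < 2)%N then -1 else 1)).

Lemma D8_block : (block_mx (- 1%:M) 0 0 1%:M : 'M[C]_(2 + 6)) = D8.
Proof.
apply/matrixP => i j; rewrite !mxE.
case: (splitP i) => a ia; rewrite !mxE; case: (splitP j) => b jb; rewrite !mxE -!val_eqE /= ia jb.
- by rewrite mulNrn.
- case: eqP => // e; have := ltn_ord a; rewrite e; lia.
- case: eqP => // e; have := ltn_ord b; rewrite -e; lia.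
- by rewrite (inj_eq (@addnI 2)) val_eqE.
Qed.

Lemma sigma8E (A : 'M[C]_8) : sigma8 A = D8 *m A *m D8.
Proof. by rewrite /sigma8 D8_block. Qed.

Lemma D8_D8 : D8 *m D8 = 1%:M.
Proof.
rewrite mulmx_diag; apply/matrixP => i j; rewrite !mxE.
by case: ifP => _; rewrite ?mulrNN mulr1.
Qed.

Lemma Enull_opp l : Enull (- l) = - (D8 *m Enull l).
Proof.
apply/matrixP => i k; rewrite mul_diag_mx !mxE invrN.
by case: i => -[|[|[|[|[|[|[|[|//]]]]]]]] i /=; ring.
Qed.

Lemma Einv_opp l : l != 0 -> Einv (- l) = - (Einv l *m D8).
Proof.
move=> l0; have e : Einv (- l) *m - (D8 *m Enull l) = 1%:M.
  by rewrite -Enull_opp Einv_Enull // oppr_eq0.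
have h : - (D8 *m Enull l) *m - (Einv l *m D8) = 1%:M.
  by rewrite mulmxN mulNmx opprK !mulmxA -(mulmxA D8 (Enull l)) (Enull_Einv l0) mulmx1 D8_D8.
by rewrite -[LHS]mulmx1 -h mulmxA e mul1mx.
Qed.

Definition nconj l (A : 'M[C]_8) : 'M[C]_8 := Enull l *m A *m Einv l.

Lemma nconjM l A B : l != 0 -> nconj l A *m nconj l B = nconj l (A *m B).
Proof.
by move=> l0; rewrite /nconj !mulmxA -(mulmxA _ (Einv l) (Enull l)) (Einv_Enull l0) mulmx1.
Qed.

Lemma nconj1 l : l != 0 -> nconj l 1%:M = 1%:M.
Proof. by move=> l0; rewrite /nconj mulmx1 Enull_Einv. Qed.

(** As E(-l) = -D E(l) with D = diag(-I_2, I_6), a matrix that is independent of l in null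
    coordinates is automatically a twisted loop. *)
Lemma nconj_sigma l A : l != 0 -> nconj (- l) A = sigma8 (nconj l A).
Proof.
move=> l0; rewrite sigma8E /nconj Enull_opp (Einv_opp l0).
by rewrite mulmxN !mulNmx opprK !mulmxA.
Qed.

Lemma nconj_real l A : `|l| = 1 -> mxconj A = Cmx *m A *m Cmx ->
  Defs.realmx (nconj l A).
Proof.
move=> l1 h; apply/realmxP; rewrite /nconj !mxconjM (mxconj_Enull l1) (mxconj_Einv l1) h.
rewrite !mulmxA -(mulmxA _ Cmx Cmx) Cmx_Cmx mulmx1.
by rewrite -(mulmxA _ Cmx Cmx) Cmx_Cmx mulmx1.
Qed.

Lemma nconj_isometry l A : `|l| = 1 -> A^T *m Gmx *m A = Gmx ->
  (nconj l A)^T *m Defs.minkowski R 7 *m nconj l A = Defs.minkowski R 7.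
Proof.
move=> l1 h; have l0 := l_neq0 l1.
have eG : Defs.minkowski R 7 = (Einv l)^T *m Gmx *m Einv l.
  rewrite -(Enull_Gram l1) !mulmxA -trmx_mul -!mulmxA (Enull_Einv l0) mulmx1.
  by rewrite trmx1 mul1mx.
have -> : (nconj l A)^T *m Defs.minkowski R 7 *m nconj l A =
    (Einv l)^T *m (A^T *m ((Enull l)^T *m Defs.minkowski R 7 *m Enull l) *m A) *m Einv l.
  by rewrite /nconj !trmx_mul !mulmxA.
by rewrite (Enull_Gram l1) h -eG.
Qed.

Lemma det_nconj l A : l != 0 -> \det (nconj l A) = \det A.
Proof.
move=> l0; rewrite /nconj !det_mulmx mulrAC -det_mulmx (Enull_Einv l0) det1 mul1r //.
Qed.

End NullBasis.

(** * Matrix-valued functions and integer polynomial matrices *)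

Section MatrixCalculus.
Variable R : realType.
Local Notation C := R[i].
Local Notation T := [set: C].
Let oT : Defs.openC T := @openCT R.

Section Products.
Variables (p q r : nat) (U : set C).
Hypothesis oU : Defs.openC U.
Variables (F : C -> 'M[C]_(p, q)) (G : C -> 'M[C]_(q, r)).
Hypotheses (sF : smv U F) (sG : smv U G).

Lemma mulmx_entry i j : (fun z => (F z *m G z) i j) = fun z => \sum_k F z i k * G z k j.
Proof. by apply/funext => z; rewrite mxE. Qed.

Lemma smv_mulmx : smv U (fun z => F z *m G z).
Proof.
move=> i j; rewrite mulmx_entry; apply: sm_sum => k; exact (smM (sF i k) (sG k j)).
Qed.

Lemma dz_mulmx z : U z -> dz (fun z => F z *m G z) z = dz F z *m G z + F z *m dz G z.
Proof.
move=> Uz; apply: dz_ext => i j; rewrite mulmx_entry.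
apply: etrans (wz_sum oU _ Uz (fun k => smM (sF i k) (sG k j))) _.
apply: etrans (eq_bigr (fun k => dz F z i k * G z k j + F z i k * dz G z k j) _) _.
  move=> k _; apply: etrans (wzM oU Uz (sF i k) (sG k j)) _.
  exact (congr2 (fun x y => x * G z k j + F z i k * y) (esym (dzE F z i k)) (esym (dzE G z k j))).
move: (dz F z) (dz G z) => a b; by rewrite big_split !mxE.
Qed.

Lemma dzb_mulmx z : U z -> dzb (fun z => F z *m G z) z = dzb F z *m G z + F z *m dzb G z.
Proof.
move=> Uz; apply: dzb_ext => i j; rewrite mulmx_entry.
apply: etrans (wzb_sum oU _ Uz (fun k => smM (sF i k) (sG k j))) _.
apply: etrans (eq_bigr (fun k => dzb F z i k * G z k j + F z i k * dzb G z k j) _) _.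
  move=> k _; apply: etrans (wzbM oU Uz (sF i k) (sG k j)) _.
  exact (congr2 (fun x y => x * G z k j + F z i k * y) (esym (dzbE F z i k)) (esym (dzbE G z k j))).
move: (dzb F z) (dzb G z) => a b; by rewrite big_split !mxE.
Qed.

End Products.

Lemma smv_cst p q U (A : 'M[C]_(p, q)) : smv U (fun=> A).
Proof. by move=> i j; exact: sm_cst. Qed.

Lemma dz_cst p q U (A : 'M[C]_(p, q)) z : Defs.openC U -> U z -> dz (fun=> A) z = 0.
Proof. move=> oU Uz; apply: dz_ext => i j; rewrite mxE; exact (wz_cst oU _ Uz). Qed.

Lemma dzb_cst p q U (A : 'M[C]_(p, q)) z : Defs.openC U -> U z -> dzb (fun=> A) z = 0.
Proof. move=> oU Uz; apply: dzb_ext => i j; rewrite mxE; exact (wzb_cst oU _ Uz). Qed.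

Lemma smv_nconj U l (F : C -> 'M[C]_8) : smv U F -> smv U (fun z => nconj l (F z)).
Proof. by move=> sF; exact (smv_mulmx (smv_mulmx (smv_cst _ _) sF) (smv_cst _ _)). Qed.

Lemma dz_nconj l (F : C -> 'M[C]_8) z : smv T F -> dz (fun z => nconj l (F z)) z = nconj l (dz F z).
Proof.
move=> sF; have sE := smv_cst T (Enull l); have sI := smv_cst T (Einv l).
apply: etrans (dz_mulmx oT (smv_mulmx sE sF) sI I) _.
rewrite (dz_mulmx oT sE sF I) (dz_cst _ oT I) (dz_cst _ oT I).
by rewrite mul0mx mulmx0 add0r addr0.
Qed.

Lemma dzb_nconj l (F : C -> 'M[C]_8) z : smv T F -> dzb (fun z => nconj l (F z)) z = nconj l (dzb F z).
Proof.
move=> sF; have sE := smv_cst T (Enull l); have sI := smv_cst T (Einv l).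
apply: etrans (dzb_mulmx oT (smv_mulmx sE sF) sI I) _.
rewrite (dzb_mulmx oT sE sF I) (dzb_cst _ oT I) (dzb_cst _ oT I).
by rewrite mul0mx mulmx0 add0r addr0.
Qed.

(* A sequence of columns. *)
Definition pmx := seq pvec.
Definition pent (M : pmx) (i k : nat) : pol := nth [::] (nth [::] M k) i.
Definition mev (M : pmx) (z : C) : 'M[C]_8 := \matrix_(i, k) pev (pent M i k) z.
Definition pmxof (f : nat -> nat -> pol) : pmx := mkseq (fun k => mkseq (fun i => f i k) 8) 8.
Definition pmxmul (A B : pmx) : pmx :=
  pmxof (fun i k => foldr (fun j acc => padd (pmul (pent A i j) (pent B j k)) acc) [::] (iota 0 8)).
Definition pmxscale (p : pol) (A : pmx) : pmx := pmxof (fun i k => pmul p (pent A i k)).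
Definition pmxid : pmx := pmxof (fun i k => if i == k then [:: mon 1 0 0] else [::]).
Definition pmxdz (A : pmx) : pmx := pmxof (fun i k => pdz (pent A i k)).
Definition pmxeq (A B : pmx) : bool :=
  all (fun k => all (fun i => peq (pent A i k) (pent B i k)) (iota 0 8)) (iota 0 8).

Lemma pentof f (i k : 'I_8) : pent (pmxof f) i k = f i k.
Proof. by rewrite /pent nth_mkseq // nth_mkseq. Qed.

Lemma mevP A B z : pmxeq A B -> mev A z = mev B z.
Proof.
move=> /allP h; apply/matrixP => i k; rewrite !mxE; apply: peqP.
have /allP h' := h k (eq_ind_r is_true (ltn_ord k) (mem_iota 0 8 k)).
exact (h' i (eq_ind_r is_true (ltn_ord i) (mem_iota 0 8 i))).
Qed.

Lemma mev_mul A B z : mev (pmxmul A B) z = mev A z *m mev B z.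
Proof.
apply/matrixP => i k; rewrite !mxE pentof.
have -> : \sum_j mev A z i j * mev B z j k =
    \sum_(j <- iota 0 8) pev (pent A i j) z * pev (pent B j k) z.
  rewrite -[iota 0 8]/(index_iota 0 8) big_mkord; by apply: eq_bigr => j _; rewrite !mxE.
elim: (iota 0 8) => [|j s IH] /=; first by rewrite big_nil.
by rewrite pevD pevM IH big_cons.
Qed.

Lemma mev_scale p A z : mev (pmxscale p A) z = pev p z *: mev A z.
Proof. by apply/matrixP => i k; rewrite !mxE pentof pevM. Qed.

Lemma mev_id z : mev pmxid z = 1%:M.
Proof.
apply/matrixP => i k; rewrite !mxE pentof val_eqE.
by case: eqP => _ //=; rewrite /tev /= (@zCE R 1) // !expr0 !mulr1 addr0.
Qed.

Lemma smv_mev U A : smv U (mev A).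
Proof.
move=> i k; apply: sm_eq (sm_pev U (pent A i k)) => z _; by rewrite mxE.
Qed.

Lemma dz_mev A z : dz (mev A) z = mev (pmxdz A) z.
Proof.
apply: dz_ext => i k; rewrite mxE pentof -(wz_pev oT _ (I : T z)).
by congr (wz _ z); apply/funext => w; rewrite mxE.
Qed.

Lemma dzb_mev0 A z : all (all (all (fun t : Z * (nat * nat) => t.2.2 == 0%N))) A ->
  dzb (mev A) z = 0.
Proof.
move=> h; apply: dzb_ext => i k; rewrite mxE.
have -> : (fun w => mev A w i k) = pev (pent A i k) by apply/funext => w; rewrite mxE.
rewrite (wzb_pev oT _ (I : T z)).
have : all (fun t : Z * (nat * nat) => t.2.2 == 0%N) (pent A i k).
  rewrite /pent; case: (ltnP k (size A)) => hk; last by rewrite [nth _ A _]nth_default // nth_nil.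
  have hc := all_nthP [::] h k hk; case: (ltnP i (size (nth [::] A k))) => hi.
    exact (all_nthP [::] hc i hi).
  by rewrite nth_default.
elim: (pent A i k) => //= -[c [a b]] p IH /andP[/eqP /= -> /IH ->].
by rewrite /tev /= Z.mul_0_r /zC /= mul0r add0r.
Qed.

Lemma dirder_sum (I : Type) (s : seq I) (f : I -> C -> C) z d v :
  (forall i, dirder (f i) z d (v i)) ->
  dirder (fun z => \sum_(i <- s) f i z) z d (\sum_(i <- s) v i).
Proof.
move=> h; elim: s => [|i s IH].
  rewrite big_nil (_ : (fun _ => _) = fun=> 0); first exact: dirder_cst.
  by apply/funext => w; rewrite big_nil.
rewrite big_cons (_ : (fun _ => _) = fun w => f i w + \sum_(i <- s) f i w).
  exact: dirderD.
by apply/funext => w; rewrite big_cons.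
Qed.

(** Stated for [dirder] because one factor will be an arbitrary solution of the potential equation,
    smooth only in the sense of [Ck]. *)
Lemma dirder_mulmx p q r (F : C -> 'M[C]_(p, q)) (G : C -> 'M[C]_(q, r)) z d
  (A : 'M[C]_(p, q)) (B : 'M[C]_(q, r)) :
  (forall i j, dirder (fun w => F w i j) z d (A i j)) ->
  (forall i j, dirder (fun w => G w i j) z d (B i j)) ->
  forall i j, dirder (fun w => (F w *m G w) i j) z d ((A *m G z + F z *m B) i j).
Proof.
move=> hF hG i j; rewrite mulmx_entry; apply: dirder_eq.
  apply: (dirder_sum _ (v := fun k => A i k * G z k j + F z i k * B k j)) => k.
  exact: dirderM.
by rewrite big_split !mxE.
Qed.

Lemma dirder0_cst f d : (forall z, dirder f z d 0) ->
  forall z (t : R), f (z + real_complex R t * d) = f z.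
Proof.
move=> h z t.
have sh (g : C -> R) s : is_derive (0 : R) 1 (fun u : R => g (z + real_complex R s * d + real_complex R u * d)) 0 ->
    is_derive s 1 (fun u : R => g (z + real_complex R u * d)) 0.
  move=> hd; have e : (fun u : R => g (z + real_complex R u * d)) =
      (fun u => g (z + real_complex R s * d + real_complex R u * d)) \o (fun u => u - s).
    apply/funext => u /=; congr g.
    by rewrite (rmorphB (real_complex R)) /=; ring.
  rewrite e; have hs : is_derive s 1 (fun u : R => u - s) 1.
    by apply: is_derive_eq; rewrite subr0.
  rewrite -(mul0r (1 : R)); apply: is_derive1_comp hs; by rewrite subrr.
apply/complexP.
  have := is_derive_0_is_cst (f := fun u : R => complex.Re (f (z + real_complex R u * d))) t 0.
  rewrite rmorph0 mul0r addr0; apply => s; apply: (sh (fun w => complex.Re (f w))).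
  by have [] := h (z + real_complex R s * d).
have := is_derive_0_is_cst (f := fun u : R => complex.Im (f (z + real_complex R u * d))) t 0.
rewrite rmorph0 mul0r addr0; apply => s; apply: (sh (fun w => complex.Im (f w))).
by have [] := h (z + real_complex R s * d).
Qed.

Lemma dirder0_cst2 (f : C -> C) : (forall z, dirder f z 1 0) -> (forall z, dirder f z 'i 0) ->
  forall z, f z = f 0.
Proof.
move=> h1 hi z; have {1}-> : z = 0 + real_complex R (complex.Re z) * 1 + real_complex R (complex.Im z) * 'i.
  by rewrite add0r mulr1 {1}[z]complexE mulrC.
by rewrite (dirder0_cst hi) (dirder0_cst h1).
Qed.

End MatrixCalculus.

(* 6 F_- and 6 F_-^-1 in null coordinates; they do not depend on l. *)
Definition M6 : pmx :=
  [:: [:: [:: mon 6 0 0]; [::]; [:: mon 3 1 0]; [::]; [::]; [::]; [:: mon 3 2 0]; [::]];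
      [:: [::]; [:: mon 6 0 0]; [::]; [::]; [:: mon (-3) 1 0]; [::]; [::]; [::]];
      [:: [::]; [::]; [:: mon 6 0 0]; [::]; [::]; [::]; [::]; [::]];
      [:: [::]; [:: mon 12 1 0]; [::]; [:: mon 6 0 0]; [:: mon (-3) 2 0]; [::]; [::]; [::]];
      [:: [::]; [::]; [::]; [::]; [:: mon 6 0 0]; [::]; [::]; [::]];
      [:: [:: mon (-12) 1 0]; [::]; [:: mon (-3) 2 0]; [::]; [::]; [:: mon 6 0 0];
          [:: mon (-2) 3 0]; [::]];
      [:: [::]; [::]; [::]; [::]; [::]; [::]; [:: mon 6 0 0]; [::]];
      [:: [::]; [:: mon 12 2 0]; [::]; [::]; [:: mon (-4) 3 0]; [::]; [::]; [:: mon 6 0 0]]]%ZZ.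

Definition M6i : pmx :=
  [:: [:: [:: mon 6 0 0]; [::]; [:: mon (-3) 1 0]; [::]; [::]; [::]; [:: mon (-3) 2 0]; [::]];
      [:: [::]; [:: mon 6 0 0]; [::]; [::]; [:: mon 3 1 0]; [::]; [::]; [::]];
      [:: [::]; [::]; [:: mon 6 0 0]; [::]; [::]; [::]; [::]; [::]];
      [:: [::]; [:: mon (-12) 1 0]; [::]; [:: mon 6 0 0]; [:: mon (-3) 2 0]; [::]; [::]; [::]];
      [:: [::]; [::]; [::]; [::]; [:: mon 6 0 0]; [::]; [::]; [::]];
      [:: [:: mon 12 1 0]; [::]; [:: mon (-3) 2 0]; [::]; [::]; [:: mon 6 0 0];
          [:: mon (-4) 3 0]; [::]];
      [:: [::]; [::]; [::]; [::]; [::]; [::]; [:: mon 6 0 0]; [::]];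
      [:: [::]; [:: mon (-12) 2 0]; [::]; [::]; [:: mon (-2) 3 0]; [::]; [::]; [:: mon 6 0 0]]]%ZZ.

(* Twice the potential in null coordinates. *)
Definition eta2 : pmx :=
  [:: [:: [::]; [::]; [:: mon 1 0 0]; [::]; [::]; [::]; [:: mon 2 1 0]; [::]];
      [:: [::]; [::]; [::]; [::]; [:: mon (-1) 0 0]; [::]; [::]; [::]];
      [::]; [:: [::]; [:: mon 4 0 0]; [::]; [::]; [::]; [::]; [::]; [::]];
      [::]; [:: [:: mon (-4) 0 0]; [::]; [::]; [::]; [::]; [::]; [::]; [::]];
      [::]; [:: [::]; [:: mon 8 1 0]; [::]; [::]; [::]; [::]; [::]; [::]]]%ZZ.

Section Potential.
Variable R : realType.
Local Notation C := R[i].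
Local Notation T := [set: C].
Let oT : Defs.openC T := @openCT R.

Lemma pev_mon0 (n : nat) (a : Z) (z : C) : a = Z.of_nat n -> pev [:: mon a 0 0] z = n%:R.
Proof. by move=> e; rewrite /= /tev /= (zCE R e) !expr0 !mulr1 addr0. Qed.

Lemma M6_M6i (z : C) : mev M6 z *m mev M6i z = 36%:M.
Proof.
rewrite -mev_mul (@mevP R _ (pmxscale [:: mon 36 0 0] pmxid)); last by vm_compute.
by rewrite mev_scale mev_id (@pev_mon0 36) // scalemx1.
Qed.

Definition bent (z : C) (i j : nat) : C :=
  nth 0 (nth [::] [:: [:: - 'i; 1; 'i; -1; - 2 * 'i * z; 2 * z];
                      [:: 'i; -1; 'i; -1; 2 * 'i * z; - 2 * z]] i) j.

Lemma eta_entry (z : C) i j : eta_m1 z i j =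
  if (i < 2)%N then (if (j < 2)%N then 0 else 2^-1 * bent z i (j - 2))
  else if (j < 2)%N then - (2^-1 * bent z j (i - 2)) * (if j == 0%N :> nat then -1 else 1)
  else 0.
Proof.
have L (k : 'I_8) (h : (k < 2)%N) : k = lshift 6 (Ordinal h) :> 'I_(2 + 6) by exact: val_inj.
have h6 (k : 'I_8) : (2 <= k)%N -> (k - 2 < 6)%N by move=> h; have := ltn_ord k; lia.
have G (k : 'I_8) (h : (2 <= k)%N) : k = rshift 2 (Ordinal (h6 k h)) :> 'I_(2 + 6).
  by apply: val_inj; exact (esym (subnKC h)).
rewrite /eta_m1; have [i2|i2] := ltnP i 2; have [j2|j2] := ltnP j 2.
- rewrite (L i i2) (L j j2); apply: etrans (block_mxEul _ _ _ _ _ _) _; by rewrite mxE.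
- rewrite {1}(L i i2) {1}(G j j2); apply: etrans (block_mxEur _ _ _ _ _ _) _; by rewrite !mxE.
- rewrite {1}(G i i2) {1}(L j j2); apply: etrans (block_mxEdl _ _ _ _ _ _) _.
  by rewrite mul_mx_diag !mxE.
- rewrite (G i i2) (G j j2); apply: etrans (block_mxEdr _ _ _ _ _ _) _; by rewrite mxE.
Qed.

Lemma eta_nullv l (z : C) c : l != 0 -> eta_m1 z *m nullv l c =
  l *: nullv l (nth 0 [:: - 2 * c 5; 2 * c 3 + 4 * z * c 7; c 0%N / 2; 0; - c 1%N / 2; 0; z * c 0%N; 0]).
Proof.
move=> l0; apply/colP => i; rewrite [LHS]mxE !big_ord_recl !big_ord0 !eta_entry !mxE /bent.
have jj := ii R; move: ('i) jj (eqxx i) => j jj _.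
case: i => -[|[|[|[|[|[|[|[|//]]]]]]]] i; rewrite /=.
(* The relation i^2 = -1 is invisible to [field]: the two sides differ by an explicit multiple of 1
   + i^2. *)
- set r := RHS; transitivity (r - (1 + j * j) * (2^-1 * (l * c 3 - l^-1 * c 2
    - (l * c 5 - l^-1 * c 4) + 2 * z * (l * c 7 - l^-1 * c 6)))); last by rewrite jj; ring.
  by rewrite /r; field.
- set r := RHS; transitivity (r - (1 + j * j) * (2^-1 * (- (l * c 3 - l^-1 * c 2)
    - (l * c 5 - l^-1 * c 4) - 2 * z * (l * c 7 - l^-1 * c 6)))); last by rewrite jj; ring.
  by rewrite /r; field.
all: by field.
Qed.

Lemma mx_null_ext l (A B : 'M[C]_8) : l != 0 ->
  (forall c : nat -> C, A *m nullv l c = B *m nullv l c) -> A = B.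
Proof.
move=> l0 h; apply: (can_inj (mulmxK (_ : Enull l \in unitmx))).
  by case/mulmx1_unit: (Enull_Einv l0).
apply/matrixP => i k; have := congr1 (fun m : 'cV[C]_8 => m i 0) (h (fun j => (j == k)%:R)).
rewrite [X in X = _ -> _]mxE [X in _ = X -> _]mxE => e.
rewrite [LHS]mxE [RHS]mxE; apply: etrans (etrans e _); apply: eq_bigr => j _;
  by rewrite [Enull l j k]mxE.
Qed.

Lemma eta_null l (z : C) : l != 0 -> l^-1 *: eta_m1 z = nconj l (2^-1 *: mev eta2 z).
Proof.
move=> l0; apply: (mx_null_ext l0) => c.
rewrite -scalemxAl (eta_nullv z c l0) scalerA mulVf // scale1r /nconj -!mulmxA (EinvK c l0).
rewrite -scalemxAl.
have -> : 2^-1 *: (mev eta2 z *m \col_(k < 8) c k) = \col_(k < 8)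
  nth 0 [:: - 2 * c 5; 2 * c 3 + 4 * z * c 7; c 0%N / 2; 0; - c 1%N / 2; 0; z * c 0%N; 0] k.
  apply/colP => k; rewrite !mxE !big_ord_recl big_ord0 !mxE /pent.
  by case: k => -[|[|[|[|[|[|[|[|//]]]]]]]] k; rewrite /= /tev /=; znum; field.
by rewrite Enull_col.
Qed.

Definition Fm0 (z l : C) : 'M[C]_8 := nconj l (6^-1 *: mev M6 z).
Definition Fm0i (z l : C) : 'M[C]_8 := nconj l (6^-1 *: mev M6i z).

Lemma Fm0_Fm0i z l : l != 0 -> Fm0 z l *m Fm0i z l = 1%:M.
Proof.
move=> l0; rewrite /Fm0 /Fm0i (nconjM _ _ l0) -scalemxAl -scalemxAr M6_M6i scalerA.
by rewrite scale_scalar_mx (_ : _ * _ = 1) ?nconj1 //; field.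
Qed.

Lemma smv_scaled_mev U a M : smv U (fun z : C => a *: mev M z).
Proof. exact (smvZ (sm_cst _ _) (smv_mev _ _)). Qed.

Lemma dz_scaled_mev a M (z : C) : dz (fun z => a *: mev M z) z = a *: mev (pmxdz M) z.
Proof.
apply: etrans (dzZ oT I (sm_cst _ _) (smv_mev T M)) _.
by rewrite (wz_cst oT _ I) scale0r add0r dz_mev.
Qed.

Lemma dzb_scaled_mev a M (z : C) :
  all (all (all (fun t : Z * (nat * nat) => t.2.2 == 0%N))) M ->
  dzb (fun z => a *: mev M z) z = 0.
Proof.
move=> h; apply: etrans (dzbZ oT I (sm_cst _ _) (smv_mev T M)) _.
by rewrite (wzb_cst oT _ I) scale0r add0r (dzb_mev0 z h) scaler0.
Qed.

Lemma dz_M6 (z : C) : 6^-1 *: mev (pmxdz M6) z = (6^-1 *: mev M6 z) *m (2^-1 *: mev eta2 z).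
Proof.
rewrite -scalemxAl -scalemxAr scalerA -mev_mul.
have -> : mev (pmxmul M6 eta2) z = 2 *: mev (pmxdz M6) z.
  rewrite -[2 in RHS](@pev_mon0 2 2%ZZ z) // -mev_scale; apply: mevP; by vm_compute.
by rewrite scalerA; congr (_ *: _); field.
Qed.

Lemma dz_M6i (z : C) : 6^-1 *: mev (pmxdz M6i) z = - ((2^-1 *: mev eta2 z) *m (6^-1 *: mev M6i z)).
Proof.
rewrite -scalemxAl -scalemxAr scalerA -mev_mul -scaleNr.
have -> : mev (pmxmul eta2 M6i) z = (- 2) *: mev (pmxdz M6i) z.
  have e : pev [:: mon (-2)%ZZ 0 0] z = - 2 :> C.
    by rewrite /= /tev /= (@zCEN R 2) // !expr0 !mulr1 addr0.
  rewrite -e -mev_scale; apply: mevP; by vm_compute.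
by rewrite scalerA; congr (_ *: _); field.
Qed.

Lemma M6_0 : 6^-1 *: mev M6 0 = 1%:M :> 'M[C]_8.
Proof.
apply/matrixP => i j; rewrite !mxE pev0 /pent.
by case: i => -[|[|[|[|[|[|[|[|//]]]]]]]] i; case: j => -[|[|[|[|[|[|[|[|//]]]]]]]] j;
  rewrite /=; znum; field.
Qed.

Lemma dz_Fm0 z l : l != 0 -> dz (Fm0 ^~ l) z = Fm0 z l *m (l^-1 *: eta_m1 z).
Proof.
move=> l0; apply: etrans (dz_nconj l z (smv_scaled_mev T 6^-1 M6)) _.
by rewrite dz_scaled_mev dz_M6 -(nconjM _ _ l0) -(eta_null z l0).
Qed.

Lemma dz_Fm0i z l : l != 0 -> dz (Fm0i ^~ l) z = - ((l^-1 *: eta_m1 z) *m Fm0i z l).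
Proof.
move=> l0; apply: etrans (dz_nconj l z (smv_scaled_mev T 6^-1 M6i)) _.
rewrite dz_scaled_mev dz_M6i (eta_null z l0) /Fm0i (nconjM _ _ l0).
by rewrite /nconj mulmxN mulNmx.
Qed.

Lemma nconj0 l : nconj l 0 = 0 :> 'M[C]_8.
Proof. by rewrite /nconj mulmx0 mul0mx. Qed.

Lemma dzb_Fm0 z l : dzb (Fm0 ^~ l) z = 0.
Proof.
apply: etrans (dzb_nconj l z (smv_scaled_mev T 6^-1 M6)) _.
by rewrite dzb_scaled_mev ?nconj0.
Qed.

Lemma dzb_Fm0i z l : dzb (Fm0i ^~ l) z = 0.
Proof.
apply: etrans (dzb_nconj l z (smv_scaled_mev T 6^-1 M6i)) _.
by rewrite dzb_scaled_mev ?nconj0.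
Qed.

Lemma Fm0_solution : potential_solution Fm0.
Proof.
move=> l l0; split.
- exact (smv_smooth oT (smv_nconj l (smv_scaled_mev T 6^-1 M6))).
- by rewrite /Fm0 M6_0 nconj1.
move=> z; have [u _] := mulmx1_unit (Fm0_Fm0i z l0); split => //.
- by rewrite (dz_Fm0 z l0) mulKmx.
- by rewrite dzb_Fm0 mulmx0.
Qed.

Lemma du_dz p q (F : C -> 'M[C]_(p, q)) z : du F z = dz F z + dzb F z.
Proof.
Transparent dz dzb.
rewrite /dz /dzb; move: (du F z) (dv F z) => a b.
by apply/matrixP => i j; rewrite !mxE; field.
Qed.

Lemma dv_dz p q (F : C -> 'M[C]_(p, q)) z : dv F z = 'i *: (dz F z - dzb F z).
Proof.
rewrite /dz /dzb; move: (du F z) (dv F z) => a b.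
apply/matrixP => i j; rewrite !mxE; have := ii R; move: ('i) (a i j) (b i j) => k x y kk.
transitivity (y - (1 + k * k) * y); first by rewrite kk; ring.
by field.
Qed.
Opaque dz dzb.

Lemma solution_dirder (F : C -> 'M[C]_8) (l z d : C) : smooth setT F -> d = 1 \/ d = 'i ->
  dz F z = F z *m (l^-1 *: eta_m1 z) -> dzb F z = 0 ->
  forall i j, dirder (fun w => F w i j) z d ((d *: (F z *m (l^-1 *: eta_m1 z))) i j).
Proof.
move=> sF hd ez ezb i j; have [pd _ _] := sF 1%N i j; have [p1 pi] := pd z I.
have eu := du_dz F z; have ev := dv_dz F z; rewrite ez ezb ?addr0 ?subr0 in eu ev.
case: hd => ->.
  rewrite scale1r; apply: (dirder_eq (pderivable_dirder p1)).
  exact (etrans (esym (duE F z i j)) (congr1 (fun m : 'M[C]_8 => m i j) eu)).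
apply: (dirder_eq (pderivable_dirder pi)).
exact (etrans (esym (dvE F z i j)) (congr1 (fun m : 'M[C]_8 => m i j) ev)).
Qed.

(** The product of Fm with the inverse of [Fm0] has zero derivative in the directions 1 and i, so it
    is constant; at z = 0 it is the identity. *)
Lemma solution_unique Fm : potential_solution Fm -> forall z l, l != 0 -> Fm z l = Fm0 z l.
Proof.
move=> H z l l0; have [sF F0 Fz] := H l l0.
have ez w : dz (Fm ^~ l) w = Fm w l *m (l^-1 *: eta_m1 w).
  have [u e1 _] := Fz w; by rewrite -e1 mulKVmx.
have ezb w : dzb (Fm ^~ l) w = 0.
  have [u _ e2] := Fz w; by rewrite -[LHS](mulKVmx u) e2 mulmx0.
have sQ : smv T (Fm0i ^~ l) := smv_nconj l (smv_scaled_mev T 6^-1 M6i).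
have dQ d w : d = 1 \/ d = 'i -> forall i j,
    dirder (fun x => Fm0i x l i j) w d ((d *: - ((l^-1 *: eta_m1 w) *m Fm0i w l)) i j).
  move=> hd i j; have eu := du_dz (Fm0i ^~ l) w; have ev := dv_dz (Fm0i ^~ l) w.
  rewrite (dz_Fm0i w l0) dzb_Fm0i ?addr0 ?subr0 in eu ev.
  have [pd _ _] := smv_smooth oT sQ 1%N i j; have [p1 pi] := pd w I.
  case: hd => ->.
    rewrite scale1r; apply: (dirder_eq (pderivable_dirder p1)).
    exact (etrans (esym (duE _ w i j)) (congr1 (fun m : 'M[C]_8 => m i j) eu)).
  apply: (dirder_eq (pderivable_dirder pi)).
  exact (etrans (esym (dvE _ w i j)) (congr1 (fun m : 'M[C]_8 => m i j) ev)).
have dW d w : d = 1 \/ d = 'i -> forall i j,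
    dirder (fun x => (Fm x l *m Fm0i x l) i j) w d 0.
  move=> hd i j.
  have := dirder_mulmx (solution_dirder sF hd (ez w) (ezb w)) (dQ d w hd) i j.
  move=> h; apply: (dirder_eq h); move: (l^-1 *: _) (Fm w l) (Fm0i w l) => e a b.
  rewrite -scalemxAl -scalemxAr -mulmxA mulmxN -scalerDr addrN.
  by rewrite scaler0 mxE.
have W1 : Fm z l *m Fm0i z l = 1%:M.
  apply/matrixP => i j.
  have := dirder0_cst2 (fun w => dW 1 w (or_introl erefl) i j)
    (fun w => dW 'i w (or_intror erefl) i j) z.
  by move=> ->; rewrite F0 mul1mx -[Fm0i 0 l]mul1mx -{1}(_ : Fm0 0 l = 1%:M) ?Fm0_Fm0i // /Fm0 M6_0 nconj1.
by rewrite -[LHS]mulmx1 -(mulmx1C (Fm0_Fm0i z l0)) mulmxA W1 mul1mx.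
Qed.

End Potential.

Transparent dz dzb.

(* The columns of the Iwasawa frame in null coordinates, up to normalization:
   the two null fields, and the Gram-Schmidt process applied to the columns
   b_1, b_3, b_2 (in this order) of F_-. *)
Definition gs1 : pvec :=
 [:: [::]; tpol 1 0 [:: 4]; [::]; tpol 0 0 [:: 2]; tpol 2 0 [:: -1]; [::]; [::]; [::]]%ZZ.
Definition gs3 : pvec :=
 [:: [::]; tpol 2 0 [:: 24; 0; -2]; [::]; tpol 3 2 [:: -4]; tpol 3 0 [:: -8]; [::];
     [::]; tpol 0 0 [:: 12; 0; 3]]%ZZ.
Definition gs2 : pvec :=
 [:: tpol 1 0 [:: -432; 0; -108; -192]; tpol 2 1 [:: -432; -432; 0; -12];
     tpol 2 0 [:: -108; 0; -27; -48]; tpol 1 1 [:: -216; 0; 0; -24];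
     tpol 3 1 [:: 108; 144]; tpol 0 0 [:: 216; 0; 54; 96];
     tpol 3 0 [:: -72; 0; -18; -32]; tpol 1 2 [:: -216; 0; 18]]%ZZ.
Definition NP : pmx := [:: HX; YX; vconj gs1; gs1; vconj gs2; gs2; vconj gs3; gs3].

(* 36 times the equation of the curve, and 4 and 36 times the first two
   Gram-Schmidt minors. *)
Definition sP : pol := tpol 0 0 [:: 36; 0; -9; -8]%ZZ.
Definition dP1 : pol := tpol 0 0 [:: 4; 0; 1]%ZZ.
Definition dP2 : pol := tpol 0 0 [:: 36; 0; 9; 16]%ZZ.

Definition pcst (c : Z) (p : pol) : pol := pmul [:: mon c 0 0] p.

Lemma NP_orth : all (fun i => all (fun k => (k != gstar i) ==>
  pzero (vlor2 (nth [::] NP i) (nth [::] NP k))) (iota 0 8)) (iota 0 8).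
Proof. by vm_compute. Qed.

Lemma NP_conj : all (fun k => veq (vconj (nth [::] NP k)) (nth [::] NP (cstar k))) (iota 0 8).
Proof. by vm_compute. Qed.

(** The nonzero pairings factor into [sP], [dP1], [dP2]. As the last two are positive, normalization
    fails exactly on the curve. *)
Lemma NP_norms : [/\ peq (vlor2 HX YX) (pcst (-2) (pmul sP sP)),
  peq (vlor2 gs1 (vconj gs1)) (pcst 4 dP1),
  peq (vlor2 gs3 (vconj gs3)) (pcst 4 (pmul dP1 dP2))
  & peq (vlor2 gs2 (vconj gs2)) (pcst 4 (pmul dP2 (pmul sP sP)))].
Proof. by split; vm_compute. Qed.

Definition M6col k : pvec := nth [::] M6 k.

(* The flag a_1, a_3, a_2, q, p, b_2, b_3, b_1 makes F_- upper triangular and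
   F_+ lower triangular. *)
Definition flag (k : nat) : nat := nth 0%N [:: 2; 6; 4; 1; 0; 5; 7; 3]%N k.
(** The grading by powers of l: E(l) = l^-1 E(1) diag(l^ldeg), so the a_k have degree 0, the
    light-cone coordinates degree 1 and the b_k degree 2. *)
Definition ldeg (k : nat) : nat := nth 0%N [:: 1; 1; 0; 2; 0; 2; 0; 2]%N k.

Lemma NP_M6_flag : all (fun i => all (fun k => (i < k)%N ==>
  pzero (vlor2 (nth [::] NP (gstar (flag i))) (M6col (flag k)))) (iota 0 8)) (iota 0 8).
Proof. by vm_compute. Qed.

(** The entry (j, k) of F_+ carries l to the power [ldeg j] minus [ldeg k]; this check removes all
    negative powers. *)
Lemma NP_M6_deg : all (fun j => all (fun k => (ldeg j < ldeg k)%N ==>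
  pzero (vlor2 (nth [::] NP (gstar j)) (M6col k))) (iota 0 8)) (iota 0 8).
Proof. by vm_compute. Qed.

Definition diag_val (k : nat) : pol :=
  nth [::] [:: pcst (-6) sP; pcst (-12) sP; [:: mon 48 0 0]; pcst 12 dP1;
    pcst 144 dP2; pcst 4 (pmul sP sP); pcst 72 dP1; pcst 8 dP2]%ZZ k.

Lemma NP_M6_diag : all (fun k =>
  peq (vlor2 (nth [::] NP (gstar k)) (M6col k)) (diag_val k)) (iota 0 8).
Proof. by vm_compute. Qed.

Lemma M6_flag : all (fun i => all (fun k => (k < i)%N ==>
  pzero (pent M6 (flag i) (flag k))) (iota 0 8)) (iota 0 8).
Proof. by vm_compute. Qed.

Lemma M6_gram : all (fun i => all (fun k => peq (vlor2 (M6col i) (M6col k))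
  (if k == gstar i then [:: mon (if (i < 2)%N then (-36)%ZZ else 144%ZZ) 0 0] else [::]))
  (iota 0 8)) (iota 0 8).
Proof. by vm_compute. Qed.

(** * Iwasawa decomposition *)

Section Iwasawa.
Variable R : realType.
Local Notation C := R[i].
Local Notation T := [set: C].
Let oT : Defs.openC T := @openCT R.
Local Notation U := (@off_curve R).

Lemma all8 (P : pred nat) : all P (iota 0 8) -> forall k : 'I_8, P k.
Proof. by move=> /allP h k; apply: h; rewrite mem_iota ltn_ord. Qed.

Lemma all88 (P : nat -> nat -> bool) : all (fun i => all (P i) (iota 0 8)) (iota 0 8) ->
  forall i k : 'I_8, P i k.
Proof. by move=> h i k; exact (all8 (all8 h i) k). Qed.

Lemma gram_mev A B (z : C) i k : ((mev A z)^T *m Gmx R *m mev B z) i k =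
  2^-1 * pev (vlor2 (nth [::] A i) (nth [::] B k)) z.
Proof.
have l1 : `|1 : C| = 1 by exact: normr1.
have e M (j : 'I_8) : col j (Enull 1 *m mev M z) = vev 1 (nth [::] M j) z.
  rewrite /vev -(Enull_col 1); apply/colP => m; rewrite !mxE; apply: eq_bigr => n _.
  by rewrite !mxE.
have -> : (mev A z)^T *m Gmx R *m mev B z =
    (Enull 1 *m mev A z)^T *m Defs.minkowski R 7 *m (Enull 1 *m mev B z).
  by rewrite -(Enull_Gram l1) trmx_mul !mulmxA.
rewrite lor_mxE !e -(lor_vev l1) mulrA mulVf ?mul1r // pnatr_eq0.
Qed.

Lemma pev_cst c p (z : C) : pev (pcst c p) z = zC R c * pev p z.
Proof. by rewrite pevM /= /tev /= !expr0 !mulr1 addr0. Qed.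

Lemma off_sP (z : C) : off_curve z -> pev sP z != 0.
Proof.
apply: contraNneq => h; rewrite (norm_even 2 z : `|z| ^+ 4 = _) (norm_even 3 z : `|z| ^+ 6 = _).
apply/eqP; transitivity (pev sP z / 36); last by rewrite h mul0r.
by rewrite /sP /= /tev /=; znum; field.
Qed.

Lemma sP_real (z : C) : Num.conj (pev sP z) = pev sP z.
Proof. by rewrite -pev_conj; apply: peqP; vm_compute. Qed.

Definition sq (z : C) : C := pev sP z ^+ 2.

Lemma sq_gt0 z : off_curve z -> 0 < sq z.
Proof.
move=> /off_sP h; rewrite /sq expr2 -{2}sP_real mul_conjC_gt0 //.
Qed.

Lemma dP1_gt0 (z : C) : 0 < pev dP1 z. Proof. by apply: pposP; vm_compute. Qed.
Lemma dP2_gt0 (z : C) : 0 < pev dP2 z. Proof. by apply: pposP; vm_compute. Qed.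

(** The isometry condition fixes only the product of the first two factors. The extra 1/2
    compensates the scales 36 and 18 of [HX] and [YX], so that these columns represent \hat Y and Y
    divided by sqrt 2. *)
Definition rho (z : C) (k : nat) : C := nth 0 [:: 2^-1 * rsq (sq z); rsq (sq z);
  rsq (pev dP1 z); rsq (pev dP1 z); rsq (pev dP2 z * sq z); rsq (pev dP2 z * sq z);
  rsq (pev dP1 z * pev dP2 z); rsq (pev dP1 z * pev dP2 z)] k.

Definition Nmx (z : C) : 'M[C]_8 := mev NP z *m diag_mx (\row_k rho z k).

Lemma rho_gram z (i k : 'I_8) : off_curve z -> k = gstar i :> nat ->
  rho z i * rho z k * (2^-1 * pev (vlor2 (nth [::] NP i) (nth [::] NP k)) z) = gweight R i.
Proof.
move=> Uz e; have [h0 h1 h3 h2] := NP_norms.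
have p0 : pev (vlor2 HX YX) z = - 2 * sq z.
  by rewrite (peqP h0) pev_cst pevM (@zCEN R 2) // /sq expr2.
have p1 : pev (vlor2 gs1 (vconj gs1)) z = 4 * pev dP1 z.
  by rewrite (peqP h1) pev_cst (@zCE R 4).
have p3 : pev (vlor2 gs3 (vconj gs3)) z = 4 * (pev dP1 z * pev dP2 z).
  by rewrite (peqP h3) pev_cst pevM (@zCE R 4).
have p2 : pev (vlor2 gs2 (vconj gs2)) z = 4 * (pev dP2 z * sq z).
  by rewrite (peqP h2) pev_cst !pevM (@zCE R 4) // /sq expr2.
have sw v w : pev (vlor2 v w) z = pev (vlor2 w v) z.
  have l1 : `|1 : C| = 1 by exact: normr1.
  by rewrite -!(lor_vev l1) lorC.
have d1 := dP1_gt0 z; have d2 := dP2_gt0 z; have s0 := sq_gt0 Uz.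
have r0 := rsq_sqr s0; have r1 := rsq_sqr d1.
have r2 := rsq_sqr (mulr_gt0 d2 s0); have r3 := rsq_sqr (mulr_gt0 d1 d2).
have Q (r w p : C) : r ^+ 2 * w = 1 -> p = 4 * w -> r * r * (2^-1 * p) = 2.
  by move=> h ->; transitivity (2 * (r ^+ 2 * w)); [field|rewrite h mulr1].
have Q0 (r w p : C) : r ^+ 2 * w = 1 -> p = - 2 * w -> 2^-1 * r * r * (2^-1 * p) = - 2^-1.
  by move=> h ->; transitivity (- 2^-1 * (r ^+ 2 * w)); [field|rewrite h mulr1].
move: i e => [[|[|[|[|[|[|[|[|//]]]]]]]] i8] /= ek; rewrite ek.
- rewrite -[rho z 0]/(2^-1 * rsq (sq z)) -[rho z (gstar 0)]/(rsq (sq z)) -[gweight R 0]/(- 2^-1 : C)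
    -[nth [::] NP (gstar 0)]/YX.
  exact (Q0 _ _ _ r0 p0).
- rewrite -[rho z 1]/(rsq (sq z)) -[rho z (gstar 1)]/(2^-1 * rsq (sq z)) -[gweight R 1]/(- 2^-1 : C)
    -[nth [::] NP (gstar 1)]/HX.
  rewrite [X in X * _]mulrC; exact (Q0 _ _ _ r0 (etrans (sw _ _) p0)).
- rewrite -[rho z 2]/(rsq (pev dP1 z)) -[rho z (gstar 2)]/(rsq (pev dP1 z)) -[gweight R 2]/(2 : C)
    -[nth [::] NP (gstar 2)]/gs1.
  exact (Q _ _ _ r1 (etrans (sw _ _) p1)).
- rewrite -[rho z 3]/(rsq (pev dP1 z)) -[rho z (gstar 3)]/(rsq (pev dP1 z)) -[gweight R 3]/(2 : C)
    -[nth [::] NP (gstar 3)]/(vconj gs1).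
  exact (Q _ _ _ r1 p1).
- rewrite -[rho z 4]/(rsq (pev dP2 z * sq z)) -[rho z (gstar 4)]/(rsq (pev dP2 z * sq z)) -[gweight R 4]/(2 : C)
    -[nth [::] NP (gstar 4)]/gs2.
  exact (Q _ _ _ r2 (etrans (sw _ _) p2)).
- rewrite -[rho z 5]/(rsq (pev dP2 z * sq z)) -[rho z (gstar 5)]/(rsq (pev dP2 z * sq z)) -[gweight R 5]/(2 : C)
    -[nth [::] NP (gstar 5)]/(vconj gs2).
  exact (Q _ _ _ r2 p2).
- rewrite -[rho z 6]/(rsq (pev dP1 z * pev dP2 z)) -[rho z (gstar 6)]/(rsq (pev dP1 z * pev dP2 z)) -[gweight R 6]/(2 : C)
    -[nth [::] NP (gstar 6)]/gs3.
  exact (Q _ _ _ r3 (etrans (sw _ _) p3)).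
- rewrite -[rho z 7]/(rsq (pev dP1 z * pev dP2 z)) -[rho z (gstar 7)]/(rsq (pev dP1 z * pev dP2 z)) -[gweight R 7]/(2 : C)
    -[nth [::] NP (gstar 7)]/(vconj gs3).
  exact (Q _ _ _ r3 p3).
Qed.

Lemma Nmx_isometry z : off_curve z -> (Nmx z)^T *m Gmx R *m Nmx z = Gmx R.
Proof.
move=> Uz; rewrite /Nmx trmx_mul tr_diag_mx.
have -> : diag_mx (\row_k rho z k) *m (mev NP z)^T *m Gmx R *m (mev NP z *m diag_mx (\row_k rho z k))
  = diag_mx (\row_k rho z k) *m ((mev NP z)^T *m Gmx R *m mev NP z) *m diag_mx (\row_k rho z k).
  by rewrite !mulmxA.
apply/matrixP => i k; rewrite mul_mx_diag mul_diag_mx 3!mxE gram_mev [RHS]mxE.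
have [e|ne] := eqVneq (k : nat) (gstar i).
  by rewrite [RHS]mulr1 -(rho_gram Uz e) !mxE; ring.
have /implyP h := all88 NP_orth i k; rewrite (pzeroP z (h ne)).
by rewrite !mulr0 mul0r.
Qed.

Lemma Nmx_real z : off_curve z -> mxconj (Nmx z) = Cmx R *m Nmx z *m Cmx R.
Proof.
move=> Uz; have rr (k : 'I_8) : Num.conj (rho z k) = rho z (cstar k).
  by case: k => -[|[|[|[|[|[|[|[|//]]]]]]]] k; rewrite /rho /= ?cjM ?cjV ?cj_nat ?conj_rsq.
have cl (k : 'I_8) : (cstar k < 8)%N by case: k => -[|[|[|[|[|[|[|[|//]]]]]]]].
have cK (k : 'I_8) : cstar (cstar k) = k by case: k => -[|[|[|[|[|[|[|[|//]]]]]]]].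
have CE (A : 'M[C]_8) (i k : 'I_8) :
    (Cmx R *m A *m Cmx R) i k = A (Ordinal (cl i)) (Ordinal (cl k)).
  rewrite mxE (bigD1 (Ordinal (cl k))) //= big1 ?addr0.
    rewrite [X in _ * X]mxE /= cK eqxx mulr1 mxE (bigD1 (Ordinal (cl i))) //= big1 ?addr0.
      by rewrite mxE eqxx mul1r.
    by move=> j; rewrite -val_eqE /= => h; rewrite mxE (negPf h) mul0r.
  move=> j; rewrite -val_eqE /= => h; rewrite [X in _ * X]mxE.
  have [e|] := eqVneq; last by rewrite mulr0.
  by rewrite e cK eqxx in h.
apply/matrixP => i k; rewrite CE mxE /Nmx !mul_mx_diag !mxE cjM rr; congr (_ * _).
rewrite -pev_conj; have := all8 NP_conj k => /= h.
have := all8 h (Ordinal (cl i)) => /= /peqP <-; congr (pev _ z).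
rewrite /vconj (nth_map 0%N) /=; last exact: cl.
by rewrite -/(cstar _) cK.
Qed.

Lemma Nmx_inv z : off_curve z -> Nmx z *m (Ginv R *m (Nmx z)^T *m Gmx R) = 1%:M.
Proof.
move=> Uz; apply: mulmx1C; rewrite -!mulmxA (mulmxA (Nmx z)^T) (Nmx_isometry Uz).
exact: Ginv_Gmx.
Qed.

Definition Pmx (z : C) : 'M[C]_8 := Ginv R *m (Nmx z)^T *m Gmx R *m (6^-1 *: mev M6 z).

Lemma Nmx_Pmx z : off_curve z -> Nmx z *m Pmx z = 6^-1 *: mev M6 z.
Proof. by move=> Uz; rewrite /Pmx mulmxA (Nmx_inv Uz) mul1mx. Qed.

Lemma Pmx_entry z (j k s : 'I_8) : s = gstar j :> nat -> Pmx z j k = (gweight R j)^-1 * rho z s *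
  (12^-1 * pev (vlor2 (nth [::] NP s) (M6col k)) z).
Proof.
move=> es; rewrite /Pmx -!mulmxA mxE (bigD1 s) //= big1 ?addr0; last first.
  move=> i; rewrite -val_eqE /= es => h; by rewrite mxE (negPf h) mulr0 mul0r.
rewrite [X in X * _]mxE es eqxx mulr1 -mulrA; congr (_ * _).
rewrite /Nmx trmx_mul tr_diag_mx -!mulmxA mul_diag_mx 2!mxE; congr (_ * _); first by rewrite es.
rewrite -scalemxAr -scalemxAr mxE mulmxA gram_mev mulrA es; congr (_ * _).
by field.
Qed.

Lemma gstar_lt (j : 'I_8) : (gstar j < 8)%N.
Proof. by case: j => -[|[|[|[|[|[|[|[|//]]]]]]]]. Qed.

Lemma Pmx_zero z (j k : 'I_8) : pzero (vlor2 (nth [::] NP (gstar j)) (M6col k)) -> Pmx z j k = 0.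
Proof.
move=> h; rewrite (@Pmx_entry z j k (Ordinal (gstar_lt j)) erefl) /=.
by rewrite (pzeroP z h) !mulr0.
Qed.

Lemma M6_isometry z : (6^-1 *: mev M6 z)^T *m Gmx R *m (6^-1 *: mev M6 z) = Gmx R.
Proof.
rewrite [X in X *m _ *m _](_ : _ = 6^-1 *: (mev M6 z)^T); last by apply/matrixP => i j; rewrite !mxE.
rewrite -!scalemxAl -scalemxAr; apply/matrixP => i k; rewrite 2!mxE gram_mev [RHS]mxE.
have := all88 M6_gram i k => /= /peqP ->.
case: eqP => _; last by rewrite /= !mulr0.
rewrite mulr1 /gweight; case: ifP => _.
  by rewrite /= /tev /= (@zCEN R 36) //; field.
by rewrite /= /tev /= (@zCE R 144) //; field.
Qed.

Lemma isometry_factor (a b c g : 'M[C]_8) : a^T *m g *m a = g -> c^T *m g *m c = g ->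
  a *m b = c -> b^T *m g *m b = g.
Proof.
move=> h1 h2 h3; rewrite -{1}h1 -[RHS]h2 -h3 trmx_mul !mulmxA //.
Qed.

Lemma Pmx_isometry z : off_curve z -> (Pmx z)^T *m Gmx R *m Pmx z = Gmx R.
Proof.
move=> Uz; exact (isometry_factor (Nmx_isometry Uz) (M6_isometry z) (Nmx_Pmx Uz)).
Qed.

(** F_+ as a polynomial in l. The subtraction of degrees is truncated, but where it would be
    negative the entry of [Pmx] vanishes by [NP_M6_deg]. *)
Definition Pl (z l : C) : 'M[C]_8 := \matrix_(j, k) (Pmx z j k * l ^+ (ldeg j - ldeg k)).
Definition dgm (l : C) : 'M[C]_8 := diag_mx (\row_j l ^+ ldeg j).

Lemma dgm_inv l : l != 0 -> dgm l *m dgm l^-1 = 1%:M.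
Proof.
move=> l0; rewrite mulmx_diag; apply/matrixP => i j; rewrite !mxE.
by rewrite exprVn mulfV // expf_neq0.
Qed.

Lemma Pl_entry z l j k : Pl z l j k = Pmx z j k * l ^+ (ldeg j - ldeg k).
Proof. exact: mxE. Qed.

Lemma dgm_conj l m (A : 'M[C]_8) j k :
  (dgm l *m A *m dgm m) j k = l ^+ ldeg j * A j k * m ^+ ldeg k.
Proof. by rewrite mul_mx_diag mul_diag_mx !mxE. Qed.

Lemma Pl_dgm z l : l != 0 -> Pl z l = dgm l *m Pmx z *m dgm l^-1.
Proof.
move=> l0; apply/matrixP => j k; rewrite Pl_entry dgm_conj.
have [h|h] := leqP (ldeg k) (ldeg j); last first.
  have /implyP H := all88 NP_M6_deg j k; by rewrite (Pmx_zero z (H h)) !(mul0r, mulr0).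
move: (Pmx z j k) => p; rewrite exprVn -{2}(subnK h) exprD; field; by rewrite expf_neq0.
Qed.

Lemma Enull_dgm l : l != 0 -> Enull l = l^-1 *: (Enull 1 *m dgm l).
Proof.
move=> l0; apply/matrixP => i k; rewrite mxE mul_mx_diag !mxE invr1.
case: k => -[|[|[|[|[|[|[|[|//]]]]]]]] k; case: i => -[|[|[|[|[|[|[|[|//]]]]]]]] i;
  by rewrite /=; field.
Qed.

Lemma Einv_dgm l : l != 0 -> Einv l = l *: (dgm l^-1 *m Einv 1).
Proof.
move=> l0; have e : Einv l *m (l^-1 *: (Enull 1 *m dgm l)) = 1%:M.
  by rewrite -Enull_dgm // Einv_Enull.
have h : (l^-1 *: (Enull 1 *m dgm l)) *m (l *: (dgm l^-1 *m Einv 1)) = 1%:M.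
  rewrite -scalemxAl -scalemxAr scalerA mulVf // scale1r -mulmxA (mulmxA (dgm l)).
  by rewrite dgm_inv // mul1mx Enull_Einv // oner_neq0.
by rewrite -[LHS]mulmx1 -h mulmxA e mul1mx.
Qed.

Lemma nconj_dgm l A : l != 0 -> nconj l A = nconj 1 (dgm l *m A *m dgm l^-1).
Proof.
move=> l0; rewrite /nconj Enull_dgm // Einv_dgm // -!scalemxAl -scalemxAr scalerA mulVf //.
by rewrite scale1r !mulmxA.
Qed.

Lemma nconj_Pl z l : l != 0 -> nconj l (Pmx z) = nconj 1 (Pl z l).
Proof. by move=> l0; rewrite Pl_dgm // nconj_dgm. Qed.

(** Indices paired by the Lorentz form have degrees adding up to 2. *)
Lemma dgm_Gmx l : dgm l *m Gmx R *m dgm l = l ^+ 2 *: Gmx R.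
Proof.
apply/matrixP => i k; rewrite mul_mx_diag mul_diag_mx !mxE /gstar.
by case: k => -[|[|[|[|[|[|[|[|//]]]]]]]] k; case: i => -[|[|[|[|[|[|[|[|//]]]]]]]] i; rewrite /=; ring.
Qed.

Lemma tr_dgm l : (dgm l)^T = dgm l. Proof. exact: tr_diag_mx. Qed.

Lemma Pl_isometry_neq0 z l : off_curve z -> l != 0 -> (Pl z l)^T *m Gmx R *m Pl z l = Gmx R.
Proof.
move=> Uz l0; rewrite Pl_dgm //; move: (Pmx z) (Pmx_isometry Uz) => P h.
rewrite !trmx_mul !tr_dgm.
have -> : dgm l^-1 *m (P^T *m dgm l) *m Gmx R *m (dgm l *m P *m dgm l^-1) =
  dgm l^-1 *m (P^T *m (dgm l *m Gmx R *m dgm l) *m P) *m dgm l^-1 by rewrite !mulmxA.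
rewrite dgm_Gmx -scalemxAr -scalemxAl h -scalemxAr -scalemxAl dgm_Gmx scalerA.
by rewrite -exprMn mulfV // expr1n scale1r.
Qed.

Lemma smv_Pl z : smv T (Pl z).
Proof.
move=> j k; apply: sm_eq (smM (sm_cst T (Pmx z j k)) (smX (ldeg j - ldeg k) (sm_id T))) => l _.
exact (esym (Pl_entry z l j k)).
Qed.

Lemma smv_tr p q V (F : C -> 'M[C]_(p, q)) : smv V F -> smv V (fun z => (F z)^T).
Proof. by move=> sF i j; apply: sm_eq (sF j i) => z _; rewrite mxE. Qed.

Lemma Pl_isometry z l : off_curve z -> (Pl z l)^T *m Gmx R *m Pl z l = Gmx R.
Proof.
move=> Uz; have [->|l0] := eqVneq l 0; last exact: Pl_isometry_neq0.
apply/matrixP => i k.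
have s : smv T (fun l => (Pl z l)^T *m Gmx R *m Pl z l).
  exact (smv_mulmx (smv_mulmx (smv_tr (smv_Pl z)) (smv_cst _ _)) (smv_Pl z)).
have H (e : R) : 0 < e -> exists2 w : C, `|0 - w| < real_complex R e &
    ((Pl z w)^T *m Gmx R *m Pl z w) i k = Gmx R i k.
  move=> e0; have [w hw w0] := punctured_dense (0 : C) e0; exists w => //.
  by rewrite Pl_isometry_neq0.
exact (continuousC_eq (sm_continuousC oT (I : T 0) (s i k)) (@continuousC_cst R (Gmx R i k) 0) H).
Qed.

Lemma flag_lt (i : 'I_8) : (flag i < 8)%N.
Proof. by case: i => -[|[|[|[|[|[|[|[|//]]]]]]]]. Qed.

Definition flago (i : 'I_8) : 'I_8 := Ordinal (flag_lt i).

Lemma flago_inj : injective flago.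
Proof.
move=> i j /(congr1 val) /= e; apply: val_inj; move: e.
by case: j => -[|[|[|[|[|[|[|[|//]]]]]]]] j; case: i => -[|[|[|[|[|[|[|[|//]]]]]]]] i.
Qed.

Lemma det_flag (A : 'M[C]_8) : \det A = \det (\matrix_(i, j) A (flago i) (flago j)).
Proof.
have -> : (\matrix_(i, j) A (flago i) (flago j)) = row_perm (perm flago_inj) (col_perm (perm flago_inj) A).
  by apply/matrixP => i j; rewrite !mxE !permE.
by rewrite row_permE col_permE !det_mulmx !det_perm odd_permV mulrCA -signr_addb addbb mulr1.
Qed.

Lemma prod_flag (f : nat -> C) : \prod_(i < 8) f (flag i) = \prod_(i < 8) f i.
Proof. by rewrite !big_ord_recr !big_ord0 /flag /=; ring. Qed.

Lemma diag_valE (z : C) (j : 'I_8) : pev (diag_val j) z =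
  let s := pev sP z in let x := pev dP1 z in let y := pev dP2 z in
  nth 0 [:: - 6 * s; - 12 * s; 48; 12 * x; 144 * y; 4 * (s * s); 72 * x; 8 * y] j.
Proof.
have N c n p : c = Z.opp (Z.of_nat n) -> pev (pcst c p) z = - n%:R * pev p z.
  by move=> h; rewrite pev_cst (zCEN R h).
have P c n p : c = Z.of_nat n -> pev (pcst c p) z = n%:R * pev p z.
  by move=> h; rewrite pev_cst (zCE R h).
case: j => -[|[|[|[|[|[|[|[|//]]]]]]]] i.
- exact (N _ 6%N sP erefl).
- exact (N _ 12%N sP erefl).
- exact (@pev_mon0 R 48 _ z erefl).
- exact (P _ 12%N dP1 erefl).
- exact (P _ 144%N dP2 erefl).
- exact (etrans (P _ 4%N (pmul sP sP) erefl) (congr1 ( *%R 4) (pevM sP sP z))).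
- exact (P _ 72%N dP1 erefl).
- exact (P _ 8%N dP2 erefl).
Qed.

Lemma diag_product (a b c d s x y : C) : a ^+ 2 * s ^+ 2 = 1 -> b ^+ 2 * x = 1 ->
  c ^+ 2 * (y * s ^+ 2) = 1 -> d ^+ 2 * (x * y) = 1 ->
  \prod_(j < 8) ((gweight R j)^-1 * nth 0 [:: 2^-1 * a; a; b; b; c; c; d; d] (gstar j)
    * (12^-1 * nth 0 [:: - 6 * s; - 12 * s; 48; 12 * x; 144 * y; 4 * (s * s); 72 * x; 8 * y] j)) = 1.
Proof.
move=> r0 r1 r2 r3; rewrite !big_ord_recr !big_ord0 /= /gweight /=.
transitivity ((a ^+ 2 * s ^+ 2) * (b ^+ 2 * x) * (c ^+ 2 * (y * s ^+ 2)) * (d ^+ 2 * (x * y))).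
  by field.
by rewrite r0 r1 r2 r3 !mulr1.
Qed.

Lemma Pl_diag z : off_curve z -> \prod_(i < 8) Pmx z i i = 1.
Proof.
move=> Uz; have d1 := dP1_gt0 z; have d2 := dP2_gt0 z; have s0 := sq_gt0 Uz.
have := diag_product (rsq_sqr s0) (rsq_sqr d1) (rsq_sqr (mulr_gt0 d2 s0)) (rsq_sqr (mulr_gt0 d1 d2)).
apply: etrans; apply: eq_bigr => j _.
apply: etrans (@Pmx_entry z j j (Ordinal (gstar_lt j)) erefl) _.
have e := etrans (peqP (all8 NP_M6_diag j) z) (diag_valE z j).
exact (congr1 (fun v => (gweight R j)^-1 * rho z (gstar j) * (12^-1 * v)) e).
Qed.

(** In the order of the flag the matrix is triangular with diagonal independent of l. *)
Lemma det_Pl z l : off_curve z -> \det (Pl z l) = 1.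
Proof.
move=> Uz; rewrite det_flag det_trig; last first.
  apply/is_trig_mxP => i j ij; rewrite mxE Pl_entry.
  have /implyP H := all88 NP_M6_flag i j.
  by rewrite (@Pmx_zero z (flago i) (flago j) (H ij)) mul0r.
have e := prod_flag (fun k => Pmx z (inord k) (inord k)).
have e3 : \prod_(i < 8) Pmx z (inord i) (inord i) = \prod_(i < 8) Pmx z i i.
  by apply: eq_bigr => i _; rewrite inord_val.
rewrite e3 (Pl_diag Uz) in e; apply: etrans _ e; apply: eq_bigr => i _.
rewrite mxE Pl_entry subnn mulr1.
by have -> : inord (flag i) = flago i by apply: val_inj; rewrite /= inordK ?flag_lt.
Qed.

Lemma det_M6 (z : C) : \det (6^-1 *: mev M6 z) = 1.
Proof.
rewrite det_flag -det_tr det_trig; last first.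
  apply/is_trig_mxP => i j ij; rewrite !mxE.
  have /implyP H := all88 M6_flag j i.
  by rewrite (pzeroP z (H ij)) mulr0.
rewrite (eq_bigr (fun=> 1)) ?big1 // => i _; rewrite !mxE /pent.
by case: i => -[|[|[|[|[|[|[|[|//]]]]]]]] i; rewrite /= /tev /= !expr0; znum; field.
Qed.

Lemma det_Nmx z : off_curve z -> \det (Nmx z) = 1.
Proof.
move=> Uz; have := congr1 determinant (Nmx_Pmx Uz); rewrite det_mulmx det_M6.
have -> : Pmx z = Pl z 1 by apply/matrixP => i j; rewrite Pl_entry expr1n mulr1.
by rewrite det_Pl // mulr1.
Qed.

End Iwasawa.

(** * The two factors as loops: smoothness, holomorphy, twisting *)

Section Frames.
Variable R : realType.
Local Notation C := R[i].
Local Notation T := [set: C].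
Let oT : Defs.openC T := @openCT R.
Local Notation U := (@off_curve R).
Local Notation J := (Defs.minkowski R 7).

Lemma off_curveE (z : C) : off_curve z <-> pev sP z != 0.
Proof.
split; first exact: off_sP.
apply: contraNN => /eqP h; apply/eqP; transitivity (36 * (1 - `|z| ^+ 4 / 4 - 2 * `|z| ^+ 6 / 9)).
  rewrite (norm_even 2 z : `|z| ^+ 4 = _) (norm_even 3 z : `|z| ^+ 6 = _).
  by rewrite /sP /= /tev /=; znum; field.
by rewrite h mulr0.
Qed.

Lemma nbhsC_dist (z : C) (A : set C) (e : R) : 0 < e ->
  (forall w, `|z - w| < real_complex R e -> A w) -> nbhs (z : cplx R) A.
Proof.
move=> e0 h; apply/(@nbhs_ballP (cplx R) (cplx R)).
exists (real_complex R e); first by rewrite /= ltcR.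
by move=> w; rewrite -ball_normE /=; exact: h.
Qed.

Lemma openC_pos V (f : C -> C) : Defs.openC V -> (forall z, V z -> continuousC f z) ->
  Defs.openC [set z | V z /\ 0 < complex.Re (f z)].
Proof.
move=> oV cf; rewrite /Defs.openC openE => z [Vz fz].
apply: filterI; first by move: oV; rewrite /Defs.openC openE; apply.
have [d d0 hd] := continuousC_distP (cf z Vz) fz.
apply: (nbhsC_dist d0) => w /hd h /=.
have : `|complex.Re (f z - f w)| < complex.Re (f z).
  by rewrite -ltcR; apply: le_lt_trans h; exact: normc_ge_Re.
by rewrite ReD ReN ltr_norml => /andP[_]; rewrite ltrBlDr ltrDl.
Qed.

Lemma openC_neq0 (f : C -> C) : (forall z, continuousC f z) -> Defs.openC [set z | f z != 0].
Proof.
move=> cf; rewrite /Defs.openC openE => z fz.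
have /gt0_complex [e0 Ee] : 0 < `|f z| by rewrite normr_gt0.
have [d d0 hd] := continuousC_distP (cf z) e0.
apply: (nbhsC_dist d0) => w /hd h /=; apply/eqP => fw.
by move: h; rewrite fw subr0 -Ee ltxx.
Qed.

Lemma openC_off_curve : Defs.openC U.
Proof.
have -> : U = [set z | pev sP z != 0].
  by apply/seteqP; split => z /off_curveE.
by apply: openC_neq0 => z; exact (sm_continuousC oT I (sm_pev T sP)).
Qed.

Lemma connected_sign V (f : C -> C) z0 : Defs.openC V -> connectedC V ->
  (forall z, V z -> continuousC f z) -> (forall z, V z -> f z \is Num.real) ->
  (forall z, V z -> f z != 0) -> V z0 -> 0 < f z0 -> forall z, V z -> 0 < f z.
Proof.
move=> oV cV cf rf nf Vz0 f0.
have reE z : V z -> f z = real_complex R (complex.Re (f z)).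
  move=> Vz; apply: complexP => //=.
  by have /CrealP := rf z Vz; rewrite conjE => /(congr1 (@complex.Im R)) /= e;
    apply/eqP; rewrite -[_ == _](mulrn_eq0 _ 2) mulr2n -{1}e addNr.
have posE z : V z -> (0 < f z) = (0 < complex.Re (f z)) by move=> Vz; rewrite {1}(reE z Vz) ltcR.
suff E : [set z | V z /\ 0 < complex.Re (f z)] = V.
  by move=> z Vz; rewrite posE //; move: Vz; rewrite -{1}E => -[].
apply: cV.
- by exists z0; split => //; rewrite -posE.
- exists [set z | V z /\ 0 < complex.Re (f z)]; first exact: openC_pos.
  by apply/seteqP; split => z /=; [move=> [? ?]|move=> [? []]].
exists (~` [set z | V z /\ 0 < complex.Re (- f z)]).
  apply: open_closedC; refine (openC_pos oV _) => z Vz.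
  have -> : (fun z => - f z) = fun z => (-1) * f z by apply/funext => w; rewrite mulN1r.
  by apply: continuousCM (cf z Vz); exact: continuousC_cst.
apply/seteqP; split => z /=.
  move=> [Vz fz]; split => // -[_]; rewrite ReN oppr_gt0 => h.
  by have := lt_trans fz h; rewrite ltxx.
move=> [Vz h]; split => //; rewrite lt_def; apply/andP; split.
  by apply/eqP => e; have := nf z Vz; rewrite (reE z Vz) e rmorph0 eqxx.
by rewrite leNgt; apply/negP => fz; apply: h; split => //; rewrite ReN oppr_gt0.
Qed.

Section Holomorphic.
Variable O : set C.

Lemma hol_cst (c : C) : holomorphic O (fun=> c).
Proof. by move=> z _; exact: derivable_cst. Qed.

Lemma hol_id : holomorphic O id.
Proof. by move=> z _; exact: derivable_id. Qed.

Lemma holD f g : holomorphic O f -> holomorphic O g -> holomorphic O (fun z => f z + g z).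
Proof. by move=> hf hg z Oz; exact: derivableD (hf z Oz) (hg z Oz). Qed.

Lemma holM f g : holomorphic O f -> holomorphic O g -> holomorphic O (fun z => f z * g z).
Proof. by move=> hf hg z Oz; exact: derivableM (hf z Oz) (hg z Oz). Qed.

Lemma holX f n : holomorphic O f -> holomorphic O (fun z => f z ^+ n).
Proof.
move=> hf; elim: n => [|n IH]; first by under eq_fun do rewrite expr0; exact: hol_cst.
by under eq_fun do rewrite exprS; exact: holM.
Qed.

Lemma hol_sum (I : Type) (s : seq I) (f : I -> C -> C) : (forall i, holomorphic O (f i)) ->
  holomorphic O (fun z => \sum_(i <- s) f i z).
Proof.
move=> h; elim: s => [|i s IH].
  have -> : (fun z => \sum_(i <- [::]) f i z) = fun=> 0 by apply/funext => w; rewrite big_nil.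
  exact: hol_cst.
have -> : (fun z => \sum_(j <- i :: s) f j z) = fun z => f i z + \sum_(j <- s) f j z.
  by apply/funext => w; rewrite big_cons.
exact (holD (h i) IH).
Qed.

Definition holv p q (F : C -> 'M[C]_(p, q)) := forall i j, holomorphic O (fun l => F l i j).

Lemma holv_cst p q (A : 'M[C]_(p, q)) : holv (fun=> A).
Proof. by move=> i j; exact: hol_cst. Qed.

Lemma holv_mul p q r (F : C -> 'M[C]_(p, q)) (G : C -> 'M[C]_(q, r)) :
  holv F -> holv G -> holv (fun l => F l *m G l).
Proof.
move=> hF hG i j; rewrite mulmx_entry; apply: hol_sum => k.
exact: holM (hF i k) (hG k j).
Qed.

Lemma holv_tr p q (F : C -> 'M[C]_(p, q)) : holv F -> holv (fun l => (F l)^T).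
Proof.
move=> hF i j; have -> : (fun l => (F l)^T i j) = fun l => F l j i by apply/funext => l; rewrite mxE.
exact: hF.
Qed.

End Holomorphic.

(** The real factor is conjugated by E(l) and the other one by E(1); [nconj_Pl] passes from one to
    the other, moving the powers of l into [Pl]. *)
Definition Fr (z l : C) : 'M[C]_8 := nconj l (Nmx z).
Definition Fpl (z l : C) : 'M[C]_8 := nconj 1 (Pl z l).

Lemma hol_Fpl O z : holv O (Fpl z).
Proof.
have hP : holv O (Pl z).
  move=> i j; have -> : (fun l => Pl z l i j) = fun l => Pmx z i j * l ^+ (ldeg i - ldeg j).
    by apply/funext => l; exact: Pl_entry.
  by apply: holM; [exact: hol_cst|apply: holX; exact: hol_id].
exact (holv_mul (holv_mul (@holv_cst O 8 8 (Enull 1)) hP) (@holv_cst O 8 8 (Einv 1))).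
Qed.

Lemma norm1 : `|1 : C| = 1. Proof. exact: normr1. Qed.

Lemma Fpl_SO z l : off_curve z -> SO_C (Fpl z l).
Proof.
move=> Uz; split; first exact (nconj_isometry norm1 (Pl_isometry l Uz)).
by rewrite det_nconj ?oner_neq0 // det_Pl.
Qed.

Lemma nconjN1 (A : 'M[C]_8) : nconj 1 (dgm (-1) *m A *m dgm (-1)) = sigma8 (nconj 1 A).
Proof.
have n1 : (-1 : C) != 0 by rewrite oppr_eq0 oner_neq0.
have e1 := nconj_sigma A (oner_neq0 C); have e2 := nconj_dgm A n1.
by rewrite invrN1 in e2; exact (etrans (esym e2) e1).
Qed.

(** Conjugation by diag((-1)^ldeg) is sigma, and a sum and a difference of degrees have the same
    parity. *)
Lemma Fpl_twisted z l : Fpl z (- l) = sigma8 (Fpl z l).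
Proof.
rewrite -nconjN1 /Fpl; congr (nconj _ _); apply/matrixP => j k.
rewrite dgm_conj !Pl_entry exprNn mulrAC -exprD; move: (Pmx_zero z (j := j) (k := k)) => h0.
have [h|h] := leqP (ldeg k) (ldeg j); last first.
  have /implyP H := all88 NP_M6_deg j k; by rewrite (h0 (H h)) !(mul0r, mulr0).
have -> : (-1) ^+ (ldeg j + ldeg k) = (-1) ^+ (ldeg j - ldeg k) :> C.
  by rewrite -signr_odd -[in RHS]signr_odd oddD oddB.
by move: (Pmx z j k) => p; ring.
Qed.

Lemma Nmx_entry (z : C) i k : Nmx z i k = mev NP z i k * rho z k.
Proof. by rewrite /Nmx mul_mx_diag [LHS]mxE [X in _ * X = _]mxE. Qed.

Lemma smv_Nmx : smv U (@Nmx R).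
Proof.
move=> i k; have s0 : forall z, U z -> 0 < sq z by move=> z; exact: sq_gt0.
have ss : sm U (@sq R) by exact (smX 2 (sm_pev U sP)).
have s1 := sm_pev U dP1; have s2 := sm_pev U dP2.
have r0 := sm_rsq s0 ss; have r1 := sm_rsq (fun z _ => dP1_gt0 z) s1.
have r2 := sm_rsq (fun z Uz => mulr_gt0 (dP2_gt0 z) (s0 z Uz)) (smM s2 ss).
have r3 := sm_rsq (fun z _ => mulr_gt0 (dP1_gt0 z) (dP2_gt0 z)) (smM s1 s2).
have sr : sm U (fun z => rho z k).
  case: k => -[|[|[|[|[|[|[|[|//]]]]]]]] k8.
  - exact (smM (sm_cst U 2^-1) r0).
  - exact r0.
  - exact r1.
  - exact r1.
  - exact r2.
  - exact r2.
  - exact r3.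
  - exact r3.
apply: sm_eq (smM (smv_mev U NP i k) sr) => z _.
exact (esym (Nmx_entry z i k)).
Qed.

Lemma rsq_sqr_inv (a : C) : 0 < a -> rsq (a ^+ 2) = a^-1.
Proof.
move=> a0; have a2 : 0 < a ^+ 2 by rewrite exprn_gt0.
have h := rsq_sqr a2; have r0 := rsq_gt0 a2; move: (rsq _) h r0 => r h r0.
have : (r * a) ^+ 2 = 1 by rewrite exprMn.
move/eqP; rewrite sqrf_eq1 => /orP[] /eqP e.
  by apply: (mulIf (lt0r_neq0 a0)); rewrite e mulVf // lt0r_neq0.
by have := mulr_gt0 r0 a0; rewrite e ltr0N1.
Qed.

Lemma Nmx_0 : Nmx (0 : C) = 1%:M.
Proof.
have es : pev sP (0 : C) = 36 by rewrite pev0 (@zCE R 36).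
have e1 : pev dP1 (0 : C) = 4 by rewrite pev0 (@zCE R 4).
have e2 : pev dP2 (0 : C) = 36 by rewrite pev0 (@zCE R 36).
have pn n : 0 < n.+1%:R :> C by rewrite ltr0n.
have q0 : rsq (sq (0 : C)) = 36^-1 by rewrite /sq es rsq_sqr_inv ?ltr0n.
have q1 : rsq (pev dP1 (0 : C)) = 2^-1.
  have h : 4 = 2 ^+ 2 :> C by ring.
  exact (etrans (congr1 (@rsq R) (etrans e1 h)) (rsq_sqr_inv (pn 1%N))).
have q2 : rsq (pev dP2 (0 : C) * sq 0) = 216^-1.
  have h : 36 * 36 ^+ 2 = 216 ^+ 2 :> C by ring.
  rewrite e2 /sq es h; exact (rsq_sqr_inv (pn 215%N)).
have q3 : rsq (pev dP1 (0 : C) * pev dP2 0) = 12^-1.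
  have h : 4 * 36 = 12 ^+ 2 :> C by ring.
  rewrite e1 e2 h; exact (rsq_sqr_inv (pn 11%N)).
apply/matrixP => i k; rewrite Nmx_entry [RHS]mxE [X in X * _ = _]mxE pev0.
have re : rho (0 : C) k = nth 0 [:: 72^-1; 36^-1; 2^-1; 2^-1; 216^-1; 216^-1; 12^-1; 12^-1] k.
  rewrite /rho q0 q1 q2 q3; case: k => -[|[|[|[|[|[|[|[|//]]]]]]]] k8 //=.
  by field.
rewrite re; case: i => -[|[|[|[|[|[|[|[|//]]]]]]]] i8; case: k {re} => -[|[|[|[|[|[|[|[|//]]]]]]]] k8.
all: rewrite /pent /=; znum; by field.
Qed.

End Frames.

(** * The harmonic map and the obstruction on the curve *)

Section Harmonic.
Variable R : realType.
Local Notation C := R[i].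
Local Notation T := [set: C].
Let oT : Defs.openC T := @openCT R.
Local Notation U := (@off_curve R).
Local Notation J := (Defs.minkowski R 7).

Definition pcol (v : pvec) (z : C) : 'cV[C]_8 := \col_k pev (nth [::] v k) z.

Lemma vev_pcol l v z : vev l v z = Enull l *m pcol v z.
Proof. exact (esym (Enull_col l (fun k => pev (nth [::] v k) z))). Qed.

Definition e01 (x y : C) : 'cV[C]_8 := \col_k nth 0 [:: x; y] k.

Lemma e01_nullv l x y : e01 x y = nullv l (nth 0 [:: x + y; x - y]).
Proof.
apply/colP => k; rewrite !mxE.
by case: k => -[|[|[|[|[|[|[|[|//]]]]]]]] k /=; first [by ring|by field].
Qed.

Lemma Nmx_col01 z a b : Nmx z *m (\col_(k < 8) nth 0 [:: a; b] k) =
  (a * (2^-1 * rsq (sq z))) *: pcol HX z + (b * rsq (sq z)) *: pcol YX z.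
Proof.
have X (M : 'M[C]_8) (d : nat -> C) (i : 'I_8) : (M *m diag_mx (\row_k d k) *m
    (\col_(k < 8) nth 0 [:: a; b] k)) i 0 = a * d 0%N * M i 0 + b * d 1%N * M i 1.
  rewrite mul_mx_diag mxE !big_ord_recl big_ord0 !mxE /= !(mulr0, addr0).
  by rewrite (_ : lift _ _ = 1); [ring|exact: val_inj].
by apply/colP => i; rewrite [LHS](X (mev NP z) (rho z) i) !mxE /=.
Qed.

Lemma Fr_e01 z (l x y : C) : l != 0 -> Fr z l *m e01 x y =
  ((x + y) * (2^-1 * rsq (sq z))) *: vev l HX z + ((x - y) * rsq (sq z)) *: vev l YX z.
Proof.
move=> l0; rewrite (e01_nullv l) /Fr /nconj; move: (Nmx_col01 z (x + y) (x - y)).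
move: (Nmx z) => N h; rewrite -2!mulmxA (EinvK _ l0) h.
by rewrite mulmxDr -!scalemxAr -!vev_pcol.
Qed.

Lemma col0_e01 (A : 'M[C]_8) : col ord0 A = A *m e01 1 0.
Proof.
apply/colP => i; rewrite !mxE !big_ord_recl big_ord0 !mxE /=; ring.
Qed.

Lemma col1_e01 (A : 'M[C]_8) : col (lift ord0 ord0) A = A *m e01 0 1.
Proof.
apply/colP => i; rewrite !mxE !big_ord_recl big_ord0 !mxE /=; ring.
Qed.

(** Here 36 varsigma is |sP| and [rsq (sq z)] is its inverse; both are positive, so it suffices to
    compare squares. *)
Lemma varsigma_rsq (z : C) : off_curve z -> varsigma z * (36 * rsq (sq z)) = 1.
Proof.
move=> Uz; have s0 := sq_gt0 Uz; have h := rsq_sqr s0; have r0 := rsq_gt0 s0.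
have v0 : 0 < varsigma z by rewrite lt_def (varsigma_off Uz) normr_ge0.
have real : Num.conj (1 - `|z| ^+ 4 / 4 - 2 * `|z| ^+ 6 / 9) = 1 - `|z| ^+ 4 / 4 - 2 * `|z| ^+ 6 / 9.
  have n : Num.conj `|z| = `|z| by apply/CrealP/normr_real.
  by rewrite !(cjD, cjN, cjM, cjV, cjX, cj_nat, conjC1, n).
have e : (varsigma z * 36) ^+ 2 = sq z.
  rewrite exprMn /varsigma normCK real /sq -expr2 -exprMn; congr (_ ^+ 2).
  rewrite (norm_even 2 z : `|z| ^+ 4 = _) (norm_even 3 z : `|z| ^+ 6 = _).
  by rewrite /sP /= /tev /=; znum; field.
have : (varsigma z * (36 * rsq (sq z))) ^+ 2 = 1.
  transitivity (rsq (sq z) ^+ 2 * sq z); last exact: h.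
  by move: (rsq _) => q; rewrite -e; ring.
move/eqP; rewrite sqrf_eq1 => /orP[/eqP //|/eqP e1].
have : 0 < varsigma z * (36 * rsq (sq z)) by rewrite !mulr_gt0.
by rewrite e1 ltr0N1.
Qed.

Lemma oriented_plane_sub n (u v : 'cV[C]_n) (a : C) : 0 < a ->
  oriented_plane (a *: u) (a^-1 *: v) `<=` oriented_plane u v.
Proof.
move=> a0 p [c11 [c12 [c21 [c22 [[r1 r2 r3 r4] h e1 e2]]]]].
have ar : a \is Num.real by rewrite gtr0_real.
have n0 := lt0r_neq0 a0.
exists (c11 * a), (c12 * a^-1), (c21 * a), (c22 * a^-1); split.
- by split; rewrite rpredM ?rpredV.
- have -> : c11 * a * (c22 * a^-1) - c12 * a^-1 * (c21 * a) = c11 * c22 - c12 * c21 by field.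
  exact: h.
- by rewrite e1 !scalerA.
- by rewrite e2 !scalerA.
Qed.

Lemma oriented_plane_scale n (u v : 'cV[C]_n) (a : C) : 0 < a ->
  oriented_plane (a *: u) (a^-1 *: v) = oriented_plane u v.
Proof.
move=> a0; apply/seteqP; split; first exact: oriented_plane_sub.
have ai : 0 < a^-1 by rewrite invr_gt0.
have := @oriented_plane_sub n (a *: u) (a^-1 *: v) _ ai.
by rewrite !scalerA invrK mulVf ?mulfV ?(lt0r_neq0 a0) // !scale1r.
Qed.

Lemma frames_wedge_scale (F : 'M[C]_8) Y Yh (a : C) : 0 < a ->
  (sqrtC 2 / 2) *: (col ord0 F - col (lift ord0 ord0) F) = a *: Y ->
  (sqrtC 2 / 2) *: (col ord0 F + col (lift ord0 ord0) F) = a^-1 *: Yh ->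
  frames_wedge F Y Yh.
Proof.
move=> a0 e1 e2; split; first by rewrite e1 e2 oriented_plane_scale.
by exists a.
Qed.

Lemma Fr_null (z l : C) : off_curve z -> `|l| = 1 ->
  (sqrtC 2 / 2) *: (col ord0 (Fr z l) - col (lift ord0 ord0) (Fr z l)) = Yvec l z /\
  (sqrtC 2 / 2) *: (col ord0 (Fr z l) + col (lift ord0 ord0) (Fr z l)) = Yhvec l z.
Proof.
move=> Uz l1; have l0 := l_neq0 l1; rewrite col0_e01 col1_e01 !(Fr_e01 _ _ _ l0).
rewrite (Yvec_vev l1) (Yhvec_vev l1); have h := varsigma_rsq Uz; have v0 := varsigma_off Uz.
have e : rsq (sq z) = (36 * varsigma z)^-1.
  have n0 : 36 * varsigma z != 0 by rewrite mulf_neq0 ?pnatr_eq0.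
  apply: (mulfI n0); rewrite (mulfV n0); apply: etrans h.
  by move: (rsq _) (varsigma z) => a b; ring.
rewrite e; move: (vev l YX z) (vev l HX z) (varsigma z) (sqrtC 2) v0 => y x v s v0.
by split; apply/colP => i; rewrite !mxE; field.
Qed.

Lemma Fr_wedge (z l : C) : off_curve z -> `|l| = 1 -> frames_wedge (Fr z l) (Yvec l z) (Yhvec l z).
Proof.
move=> Uz l1; have [e1 e2] := Fr_null Uz l1.
by apply: (frames_wedge_scale (a := 1)) => //; rewrite ?invr1 scale1r.
Qed.

Lemma Fr_SOp (z l : C) : off_curve z -> `|l| = 1 -> SOp (Fr z l).
Proof.
move=> Uz l1; have l0 := l_neq0 l1; split.
- exact (nconj_real l1 (Nmx_real Uz)).
- split; first exact (nconj_isometry l1 (Nmx_isometry Uz)).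
  by rewrite (det_nconj _ l0) det_Nmx.
have -> : Fr z l ord0 ord0 = (Fr z l *m e01 1 0) ord0 0 by rewrite -col0_e01 [RHS]mxE.
rewrite (Fr_e01 _ _ _ l0); have h := vev_pos l z ck_HX; have y := vev_pos l z ck_YX.
have r0 := rsq_gt0 (sq_gt0 Uz).
have X (u v : 'cV[C]_8) a b : 0 < a -> 0 < b -> 0 < u ord0 0 -> 0 < v ord0 0 ->
    0 < (a *: u + b *: v) ord0 0.
  by move=> *; rewrite !mxE addr_gt0 ?mulr_gt0.
by apply: X => //; rewrite ?addr0 ?subr0 mul1r ?mulr_gt0 ?invr_gt0 ?ltr0n.
Qed.

Lemma Fr_iwasawa (z : C) : off_curve z -> iwasawa (Fm0 z) (Fr z) (Fpl z).
Proof.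
move=> Uz; split.
- move=> l l1; have l0 := l_neq0 l1.
  by rewrite /Fr /Fpl -(nconj_Pl _ l0) (nconjM _ _ l0) (Nmx_Pmx Uz).
- move=> l l1; split; first exact: Fr_SOp.
  exact: nconj_sigma (l_neq0 l1).
split.
  exists T; split; [exact: oT|by []|move=> i j; exact: hol_Fpl].
by move=> l _; split; [exact: Fpl_SO|exact: Fpl_twisted].
Qed.

Lemma off_curve0 : off_curve (0 : C).
Proof. by apply/off_curveE; rewrite pev0 (@zCE R 36) // pnatr_eq0. Qed.

Lemma iwasawa_ext (A B F Fp : C -> 'M[C]_8) : (forall l, `|l| = 1 -> A l = B l) ->
  iwasawa A F Fp -> iwasawa B F Fp.
Proof. by move=> e [h1 h2 h3]; split => // l l1; rewrite -e // h1. Qed.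

Lemma solution_circle (Fm : C -> C -> 'M[C]_8) : potential_solution Fm -> forall z l, `|l| = 1 -> Fm z l = Fm0 z l.
Proof. by move=> h z l l1; exact: (solution_unique h) (l_neq0 l1). Qed.

Lemma Fr_dpw (Fm : C -> C -> 'M[C]_8) : potential_solution Fm -> dpw_frame U Fm (@Fr R) (@Fpl R).
Proof.
move=> h; split.
- exact: (@openC_off_curve R).
- exact: off_curve0.
- move=> l l1; split; last by rewrite /Fr Nmx_0 (nconj1 (l_neq0 l1)).
  exact (smv_smooth (@openC_off_curve R) (smv_nconj l (@smv_Nmx R))).
move=> z Uz; apply: iwasawa_ext (Fr_iwasawa Uz) => l l1.
by rewrite (solution_circle h).
Qed.

Lemma minkowski2 : J *m J = 1%:M.
Proof.
rewrite mulmx_diag; apply/matrixP => i j; rewrite !mxE.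
by case: ifP => _; rewrite ?mulrNN mulr1.
Qed.

Lemma Cmx_pcol (v : pvec) (z : C) : Cmx R *m mxconj (pcol v z) = pcol (vconj v) z.
Proof.
apply/colP => i; rewrite mxE !big_ord_recl big_ord0 !mxE /cstar.
by case: i => -[|[|[|[|[|[|[|[|//]]]]]]]] i8; rewrite /= pev_conj; ring.
Qed.

(* On the curve the last Gram-Schmidt vector is isotropic for the Hermitian
   form; an Iwasawa decomposition F_- = F F_+ would then give, for a null
   vector v, a vector u = F_+ v whose conjugate is l times a holomorphic
   function of l on the unit circle, so that u = 0. *)
Lemma no_iwasawa (z : C) : ~ off_curve z -> ~ exists F Fp, iwasawa (Fm0 z) F Fp.
Proof.
move=> nU [F [Fp [FFp hF [[V [_ DV hol]] hFp]]]].
have s0 : pev sP z = 0.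
  by apply/eqP/negPn/negP => h; apply: nU; apply/off_curveE.
have SOinv l : `|l| <= 1 -> (J *m (Fp l)^T *m J) *m Fp l = 1%:M.
  move=> l1; have [[e _] _] := hFp l l1.
  by rewrite -!mulmxA (mulmxA (Fp l)^T) e minkowski2.
(* F_-^-1 applied to the last Gram-Schmidt vector and to its conjugate. [cv] sits in degree 2, and
   on the curve [om] has no part of degree 0; this produces the extra factor l in [Fcu]. *)
pose cv := 6^-1 *: (mev M6i z *m pcol gs2 z).
pose om := 6^-1 *: (mev M6i z *m pcol (vconj gs2) z).
have row w p (i : 'I_8) : peq (foldr (fun j acc => padd (pmul (pent M6i i j) (nth [::] w j)) acc)
    [::] (iota 0 8)) p -> (6^-1 *: (mev M6i z *m pcol w z)) i 0 = 6^-1 * pev p z.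
  move=> /peqP e; rewrite -e mxE; congr (_ * _); rewrite mxE.
  have -> : \sum_j mev M6i z i j * pcol w z j 0 =
      \sum_(j <- iota 0 8) pev (pent M6i i j) z * pev (nth [::] w j) z.
    by rewrite -[iota 0 8]/(index_iota 0 8) big_mkord; apply: eq_bigr => j _; rewrite !mxE.
  elim: (iota 0 8) => [|j s IH] /=; first by rewrite big_nil.
  by rewrite big_cons IH pevD pevM.
have cvE (i : 'I_8) : ldeg i != 2 -> cv i 0 = 0.
  by case: i => -[|[|[|[|[|[|[|[|//]]]]]]]] i8 // _;
    refine (etrans (row gs2 [::] _ _) (mulr0 _)); vm_compute.
(* The entry at a_2 is sP^2 / 6, the others are identically zero; this is where the curve enters. *)
have omE (i : 'I_8) : ldeg i = 0%N -> om i 0 = 0.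
  have es : 6^-1 * pev (pmul sP sP) z = 0 by rewrite pevM s0 mulr0 mulr0.
  case: i => -[|[|[|[|[|[|[|[|//]]]]]]]] i8 // _.
  - by refine (etrans (row (vconj gs2) [::] _ _) (mulr0 _)); vm_compute.
  - by refine (etrans (row (vconj gs2) (pmul sP sP) _ _) es); vm_compute.
  - by refine (etrans (row (vconj gs2) [::] _ _) (mulr0 _)); vm_compute.
have cv5 : cv (@Ordinal 8 5 isT) 0 != 0.
  have -> : cv (@Ordinal 8 5 isT) 0 = 6^-1 * pev (pcst 36 dP2) z.
    by refine (row gs2 (pcst 36 dP2) _ _); vm_compute.
  by rewrite pev_cst (@zCE R 36) // !mulf_neq0 ?invr_eq0 ?pnatr_eq0 // lt0r_neq0 // dP2_gt0.
have Ecv l : l != 0 -> Enull l *m cv = l *: (Enull 1 *m cv).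
  move=> l0; rewrite (Enull_dgm l0) -scalemxAl -mulmxA.
  have -> : dgm l *m cv = l ^+ 2 *: cv.
    apply/colP => i; rewrite mul_diag_mx [LHS]mxE [RHS]mxE [X in X * _ = _]mxE.
    by have [->|/cvE ->] := eqVneq (ldeg i) 2; rewrite ?mulr0.
  by rewrite -scalemxAr scalerA expr2 mulrA mulVf // mul1r.
pose om' l : 'cV[C]_8 := \col_i (om i 0 * l ^+ (ldeg i).-1).
have Eom l : l != 0 -> l *: (Enull l *m om) = l *: (Enull 1 *m om' l).
  move=> l0; rewrite (Enull_dgm l0) -!scalemxAl scalerA mulfV // scale1r -mulmxA scalemxAr.
  congr (_ *m _); apply/colP => i; rewrite mul_diag_mx [LHS]mxE [RHS]mxE [X in X * _ = _]mxE [X in _ = _ * X]mxE.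
  case E : (ldeg i) => [|d]; first by rewrite (omE i E) mulr0 mul0r mulr0.
  by rewrite exprS /=; move: (om i 0) => q; ring.
pose u l : 'cV[C]_8 := Fp l *m (Enull 1 *m cv).
pose h l : 'cV[C]_8 := Fp l *m (Enull 1 *m om' l).
have M6cv : (6^-1 *: mev M6 z) *m cv = pcol gs2 z.
  rewrite /cv -scalemxAr -scalemxAl scalerA mulmxA M6_M6i mul_scalar_mx scalerA.
  by rewrite (_ : _ * _ = 1) ?scale1r //; field.
have Fu l : `|l| = 1 -> F l *m u l = l^-1 *: (Enull l *m pcol gs2 z).
  move=> l1; have l0 := l_neq0 l1; rewrite /u mulmxA -(FFp l l1).
  have -> : Enull 1 *m cv = l^-1 *: (Enull l *m cv) by rewrite (Ecv l l0) scalerA mulVf // scale1r.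
  rewrite -scalemxAr /Fm0 /nconj -!mulmxA (mulmxA (Einv l)) (Einv_Enull l0) mul1mx.
  by rewrite M6cv.
have Fcu l : `|l| = 1 -> mxconj (u l) = l *: h l.
  move=> l1; have l0 := l_neq0 l1; have [[/realmxP Fr0 [Fo _] _] _] := hF l l1.
  have Finv : (J *m (F l)^T *m J) *m F l = 1%:M by rewrite -!mulmxA (mulmxA (F l)^T) Fo minkowski2.
  have e : F l *m mxconj (u l) = F l *m (l *: h l).
    have -> : F l *m mxconj (u l) = mxconj (F l *m u l) by rewrite mxconjM Fr0.
    rewrite (Fu l l1) mxconjZ mxconjM (mxconj_Enull l1) cjV (conj_l l1) invrK.
    have -> : F l *m (l *: h l) = Fm0 z l *m (l *: (Enull 1 *m om' l)).
      by rewrite (FFp l l1) -[LHS]scalemxAr -[RHS]scalemxAr -mulmxA.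
    rewrite -(Eom l l0) -scalemxAr; congr (_ *: _).
    rewrite /Fm0 /nconj -!mulmxA (mulmxA (Einv l)) (Einv_Enull l0) mul1mx; congr (_ *m _).
    have -> : (6^-1 *: mev M6 z) *m om = pcol (vconj gs2) z.
      rewrite /om -scalemxAr -scalemxAl scalerA mulmxA M6_M6i mul_scalar_mx scalerA.
      by rewrite (_ : _ * _ = 1) ?scale1r //; field.
    exact: Cmx_pcol.
  by have := congr1 (mulmx (J *m (F l)^T *m J)) e; rewrite !mulmxA Finv !mul1mx.
have hFpO : holv V Fp by move=> i j; exact: hol.
have hu : holv V u by exact (holv_mul hFpO (@holv_cst R V 8 1 (Enull 1 *m cv))).
have hom : holv V om'.
  move=> i j; have -> : (fun l => om' l i j) = fun l => om i 0 * l ^+ (ldeg i).-1.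
    by apply/funext => l; rewrite mxE.
  by apply: holM; [exact: hol_cst|apply: holX; exact: hol_id].
have hh : holv V h by exact (holv_mul hFpO (holv_mul (@holv_cst R V 8 8 (Enull 1)) hom)).
have u0 i : u 1 i 0 = 0.
  (* A holomorphic function that equals |u_i|^2 on the circle and vanishes at l = 0; by rigidity it
     vanishes on the circle. *)
  pose f l := u l i 0 * (l * h l i 0).
  have hf : holomorphic V f by exact (holM (hu i 0) (holM (@hol_id R V) (hh i 0))).
  have fE l : `|l| = 1 -> f l = u l i 0 * Num.conj (u l i 0).
    move=> l1; rewrite /f; congr (_ * _).
    have := congr1 (fun m : 'cV[C]_8 => m i 0) (Fcu l l1).
    by rewrite [X in X = _ -> _]mxE [X in _ = X -> _]mxE => ->.
  have fr l : `|l| = 1 -> f l \is Num.real by move=> l1; rewrite fE // ger0_real // mul_conjC_ge0.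
  have := circle_rigid DV hf fr (norm1 R); rewrite fE ?norm1 // /f mul0r mulr0 => /eqP.
  by rewrite mul_conjC_eq0 => /eqP.
have : u 1 = 0 by apply/colP => i; rewrite u0 mxE.
move/(congr1 (mulmx (J *m (Fp 1)^T *m J))); rewrite /u mulmxA SOinv ?norm1 // mul1mx mulmx0.
move/(congr1 (mulmx (Einv 1))); rewrite mulmxA Einv_Enull ?oner_neq0 // mul1mx mulmx0 => e.
by move: cv5; rewrite e mxE eqxx.
Qed.

End Harmonic.

(** * Uniqueness of the decomposition and of the framed plane *)

Section Uniqueness.
Variable R : realType.
Local Notation C := R[i].
Local Notation U := (@off_curve R).
Local Notation J := (Defs.minkowski R 7).

Lemma SO_C_inv (A : 'M[C]_8) : A^T *m J *m A = J -> (J *m A^T *m J) *m A = 1%:M.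
Proof. by move=> e; rewrite -!mulmxA (mulmxA A^T) e minkowski2. Qed.

Lemma isometry_J (A k : 'M[C]_8) : A^T *m J *m A = J -> (A *m k)^T *m J *m (A *m k) = J ->
  k^T *m J *m k = J.
Proof.
by move=> e; rewrite trmx_mul -!mulmxA (mulmxA J A) (mulmxA A^T) (mulmxA A^T) e mulmxA.
Qed.

(* Comparing two decompositions, k = F^-1 F' = F_+ F'_+^-1 is holomorphic in
   the disc and real on the circle, hence constant in l. *)
Lemma iwasawa_unique (A F Fp F1 Fp1 : C -> 'M[C]_8) : iwasawa A F Fp -> iwasawa A F1 Fp1 ->
  exists k, [/\ Defs.realmx k, k^T *m J *m k = J, D8 R *m k *m D8 R = k &
    forall l, `|l| = 1 -> F1 l = F l *m k].
Proof.
move=> [AF hF [[V [_ DV hol]] hFp]] [AF1 hF1 [[V1 [_ DV1 hol1]] hFp1]].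
pose q l : 'M[C]_8 := Fp l *m (J *m (Fp1 l)^T *m J).
pose W := V `&` V1.
have hq : holv W q.
  have h : holv W Fp by move=> i j z [Vz _]; exact: hol.
  have h1 : holv W Fp1 by move=> i j z [_ Vz]; exact: hol1.
  have hJ := @holv_cst R W 8 8 J.
  exact (holv_mul h (holv_mul (holv_mul hJ (holv_tr h1)) hJ)).
have DW : [set l | `|l| <= 1] `<=` W by move=> l h; split; [exact: DV|exact: DV1].
have e l : `|l| = 1 -> F1 l = F l *m q l.
  move=> l1; have l1' : `|l| <= 1 by rewrite l1.
  have [[e _] _] := hFp1 l l1'; have := SO_C_inv e => /mulmx1C h.
  by rewrite /q mulmxA -(AF l l1) (AF1 l l1) -mulmxA h mulmx1.
have eq l : `|l| = 1 -> q l = J *m (F l)^T *m J *m F1 l.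
  move=> l1; have [[_ [h _] _] _] := hF l l1.
  by rewrite (e l l1) mulmxA (SO_C_inv h) mul1mx.
have rJ : mxconj J = J.
  apply/matrixP => i j; rewrite !mxE rmorphMn; congr (_ *+ _).
  by case: ifP => _; rewrite ?rmorphN1 ?rmorph1.
have rq l : `|l| = 1 -> mxconj (q l) = q l.
  move=> l1; have [[/realmxP r _ _] _] := hF l l1; have [[/realmxP r1 _ _] _] := hF1 l l1.
  rewrite (eq l l1) !mxconjM rJ r1; congr (_ *m _ *m _ *m _).
  by rewrite -[in RHS]r; apply/matrixP => i j; rewrite !mxE.
have cq l : `|l| = 1 -> q l = q 0.
  move=> l1; apply/matrixP => i j; apply: (circle_rigid DW (hq i j)) => // z z1.
  by apply/CrealP; have := congr1 (fun M : 'M[C]_8 => M i j) (rq z z1); rewrite [X in X = _ -> _]mxE.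
have n1 := norm1 R; have nN : `|-1 : C| = 1 by rewrite normrN.
have [[_ [h1 _] _] t1] := hF 1 n1; have [[_ [h1' _] _] t1'] := hF1 1 n1.
exists (q 0); split.
- by apply/realmxP; rewrite -(cq 1 n1) (rq 1 n1).
- by apply: (isometry_J h1); rewrite -(cq 1 n1) -(e 1 n1).
- have a := e 1 n1; have b := e (-1) nN; rewrite t1 t1' !sigma8E (cq _ nN) in b.
  rewrite (cq _ n1) in a; move: (q 0) a b => k a b.
  have := congr1 (fun M => J *m (F 1)^T *m J *m (D8 R *m M *m D8 R)) b.
  rewrite !mulmxA -(mulmxA _ (D8 R) (D8 R)) D8_D8 mulmx1.
  rewrite -3!(mulmxA (J *m (F 1)^T *m J)) !mulmxA.
  rewrite -(mulmxA _ (D8 R) (D8 R)) D8_D8 mulmx1 a.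
  by rewrite !mulmxA (SO_C_inv h1) !mul1mx => /esym.
by move=> l l1; rewrite -(cq l l1) e.
Qed.

Lemma D8_block0 (k : 'M[C]_8) (i j : 'I_8) : D8 R *m k *m D8 R = k ->
  (2 <= i)%N -> (j < 2)%N -> k i j = 0.
Proof.
move=> /matrixP /(_ i j) + i2 j2; rewrite mul_mx_diag [X in X = _ -> _]mxE mul_diag_mx.
rewrite [X in X * _ = _ -> _]mxE [X in X * _ * _ = _ -> _]mxE [X in _ * _ * X = _ -> _]mxE.
rewrite j2 ltnNge i2 /= mul1r mulrN1 => /eqP; rewrite eq_sym -subr_eq0 opprK -mulr2n.
by rewrite mulrn_eq0 => /eqP.
Qed.

Let i0 : 'I_8 := ord0.
Let i1 : 'I_8 := lift ord0 ord0.

Lemma block_gram (k : 'M[C]_8) (i j : 'I_8) : D8 R *m k *m D8 R = k ->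
  k^T *m J *m k = J -> (i < 2)%N -> (j < 2)%N ->
  - (k i0 i * k i0 j) + k i1 i * k i1 j = J i j.
Proof.
move=> h e i2 j2; rewrite -[in RHS]e mul_mx_diag mxE.
rewrite (bigD1 i0) // (bigD1 i1) //= big1 => [|s /andP[s0 s1]].
  by rewrite !mxE /=; ring.
have s2 : (2 <= s)%N by move: s0 s1; rewrite -!val_eqE /=; case: (val s) => [|[]].
by rewrite (D8_block0 h s2 j2) mulr0.
Qed.

Lemma block_col (k : 'M[C]_8) (j : 'I_8) : D8 R *m k *m D8 R = k -> (j < 2)%N ->
  col j k = e01 (k i0 j) (k i1 j).
Proof.
move=> h j2; apply/colP => i; rewrite [LHS]mxE [RHS]mxE.
have [i2|i2] := leqP 2 i.
  by rewrite (D8_block0 h i2 j2) nth_default.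
by case: i i2 => -[|[|//]] h8 _; congr (k _ _); apply: val_inj.
Qed.

Lemma e01E (A : 'M[C]_8) x y : A *m e01 x y = x *: col ord0 A + y *: col (lift ord0 ord0) A.
Proof.
rewrite col0_e01 col1_e01 !scalemxAr -mulmxDr; congr (_ *m _).
by apply/colP => i; rewrite !mxE; case: i => -[|[|i]] h /=; rewrite ?nth_nil; ring.
Qed.

(** An isometry of the Lorentzian plane has determinant 1 or -1; determinant 1 forces the symmetric
    shape of a boost, up to sign. *)
Lemma boost_parameters (a b c d : C) : - (a * a) + c * c = -1 -> - (b * b) + d * d = 1 ->
  - (a * b) + c * d = 0 -> 0 < a * d - b * c -> d = a /\ b = c.
Proof.
move=> e1 e2 e3 D0.
have : (a * d - b * c) ^+ 2 = 1.
  transitivity ((- (a * a) + c * c) * - (- (b * b) + d * d) + (- (a * b) + c * d) ^+ 2); first by ring.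
  by rewrite e1 e2 e3; ring.
move/eqP; rewrite sqrf_eq1 => /orP[] /eqP D; last by move: D0; rewrite D ltr0N1.
split.
  transitivity (- (- (a * a) + c * c) * d); first by rewrite e1; ring.
  transitivity (a * (a * d - b * c) - c * (- (a * b) + c * d)); first by ring.
  by rewrite D e3; ring.
transitivity (- (- (a * a) + c * c) * b); first by rewrite e1; ring.
transitivity (c * (a * d - b * c) - a * (- (a * b) + c * d)); first by ring.
by rewrite D e3; ring.
Qed.

Lemma continuousC_mulmx p q r (F : C -> 'M[C]_(p, q)) (G : C -> 'M[C]_(q, r)) z i j :
  (forall k, continuousC (fun w => F w i k) z) -> (forall k, continuousC (fun w => G w k j) z) ->
  continuousC (fun w => (F w *m G w) i j) z.
Proof.
move=> cF cG; rewrite mulmx_entry; elim: (index_enum _) => [|k s IH].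
  have -> : (fun w => \sum_(k <- [::]) F w i k * G w k j) = fun=> 0.
    by apply/funext => w; rewrite big_nil.
  exact: continuousC_cst.
have -> : (fun w => \sum_(h <- k :: s) F w i h * G w h j) =
    fun w => F w i k * G w k j + \sum_(h <- s) F w i h * G w h j.
  by apply/funext => w; rewrite big_cons.
exact (continuousCD (continuousCM (cF k) (cG k)) IH).
Qed.

(** By [no_iwasawa] the domain avoids the curve, so any frame is [Fr] times a real isometry K(z)
    that is block diagonal. Starting from K(0) = 1, continuity on the connected domain fixes the
    signs of the first entry and of the determinant of the Lorentzian block, which is therefore a
    boost. *)
Lemma dpw_unique V (Fm F1 Fp1 : C -> C -> 'M[C]_8) : potential_solution Fm ->
  connectedC V -> dpw_frame V Fm F1 Fp1 ->
  forall z l, V z -> `|l| = 1 -> frames_wedge (F1 z l) (Yvec l z) (Yhvec l z).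
Proof.
move=> sol cV [oV V0 sm0 iw].
have VU z : V z -> U z.
  move=> Vz; apply: contrapT => nU; apply: (no_iwasawa nU); exists (F1 z), (Fp1 z).
  by apply: iwasawa_ext (iw z Vz) => l; exact: solution_circle.
have n1 := norm1 R.
(* The comparison matrix, constant in l, written by a formula at l = 1 that shows its continuity in
   z. *)
pose K z : 'M[C]_8 := (J *m (Fr z 1)^T *m J) *m F1 z 1.
have Kspec z : V z -> [/\ Defs.realmx (K z), (K z)^T *m J *m K z = J, D8 R *m K z *m D8 R = K z &
    forall l, `|l| = 1 -> F1 z l = Fr z l *m K z].
  move=> Vz; have iF : iwasawa (Fm z) (Fr z) (Fpl z).
    apply: iwasawa_ext (Fr_iwasawa (VU z Vz)) => l l1.
    by rewrite (solution_circle sol).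
  have [k [k1 k2 k3 k4]] := iwasawa_unique iF (iw z Vz).
  suff -> : K z = k by [].
  have [_ [h _] _] := Fr_SOp (VU z Vz) n1.
  by rewrite /K (k4 1 n1) mulmxA (SO_C_inv h) mul1mx.
have [sF1 F10] := sm0 1 n1.
have cK z i j : V z -> continuousC (fun w => K w i j) z.
  move=> Vz; apply: continuousC_mulmx => k; last exact: (sF1 0%N k j) z Vz.
  have s : smv U (fun w => J *m (Fr w 1)^T *m J).
    have sF : smv U (fun w => Fr w 1) := smv_nconj 1 (@smv_Nmx R).
    exact (smv_mulmx (smv_mulmx (smv_cst _ _) (smv_tr sF)) (smv_cst _ _)).
  exact (sm_continuousC (@openC_off_curve R) (VU z Vz) (s i k)).
have K0 : K 0 = 1%:M.
  rewrite /K F10 /Fr Nmx_0 (nconj1 (l_neq0 n1)) trmx1 !mulmx1; exact: minkowski2.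
pose a z := K z i0 i0; pose b z := K z i0 i1; pose c z := K z i1 i0; pose d z := K z i1 i1.
have rK z i j : V z -> K z i j \is Num.real.
  by move=> /Kspec [/mxOverP + _ _ _]; exact.
have gram z : V z -> [/\ - (a z * a z) + c z * c z = -1, - (b z * b z) + d z * d z = 1
    & - (a z * b z) + c z * d z = 0].
  move=> /Kspec [_ h2 h3 _].
  by split; rewrite (block_gram h3 h2) // !mxE.
have a_neq0 z : V z -> a z != 0.
  move=> Vz; have [e _ _] := gram z Vz; apply/eqP => h; move: e; rewrite h mulr0 oppr0 add0r => e.
  have : 0 <= c z * c z by rewrite -expr2 real_exprn_even_ge0 // rK.
  by rewrite e ler0N1.
have D_neq0 z : V z -> a z * d z - b z * c z != 0.
  move=> Vz; have [e1 e2 e3] := gram z Vz; apply/eqP => h.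
  have : (a z * d z - b z * c z) ^+ 2 = 1.
    transitivity ((- (a z * a z) + c z * c z) * - (- (b z * b z) + d z * d z) + (- (a z * b z) + c z * d z) ^+ 2).
      by ring.
    by rewrite e1 e2 e3; ring.
  by rewrite h expr0n => /eqP; rewrite eq_sym oner_eq0.
have a_gt0 z : V z -> 0 < a z.
  apply: (connected_sign oV cV _ _ a_neq0 V0) => [w Vw|w Vw|].
  - exact: cK.
  - exact: rK.
  - by rewrite /a K0 mxE ltr01.
have D_gt0 z : V z -> 0 < a z * d z - b z * c z.
  apply: (connected_sign oV cV _ _ D_neq0 V0) => [w Vw|w Vw|].
  - have -> : (fun z => a z * d z - b z * c z) = fun z => a z * d z + (-1) * (b z * c z).
      by apply/funext => x; rewrite mulN1r.
    apply: continuousCD; first by apply: continuousCM; exact: cK.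
    apply: continuousCM; first exact: (@continuousC_cst R (-1) w).
    by apply: continuousCM; exact: cK.
  - by rewrite rpredB ?rpredM ?rK.
  - by rewrite /a /b /c /d K0 !mxE /= mulr1 mul0r subr0 ltr01.
move=> z l Vz l1; have [e1 e2 e3] := gram z Vz.
have [ed eb] := boost_parameters e1 e2 e3 (D_gt0 z Vz).
have [_ _ h3 /(_ l l1) hF] := Kspec z Vz.
have [eY eYh] := Fr_null (VU z Vz) l1.
have col0 : col ord0 (F1 z l) = a z *: col ord0 (Fr z l) + c z *: col (lift ord0 ord0) (Fr z l).
  by rewrite hF colE -mulmxA -colE (block_col h3) // e01E.
have col1 : col (lift ord0 ord0) (F1 z l) = b z *: col ord0 (Fr z l) + d z *: col (lift ord0 ord0) (Fr z l).
  by rewrite hF colE -mulmxA -colE (block_col h3) // e01E.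
(* The block is symmetric with equal diagonal entries a and a^2 - c^2 = 1: it multiplies Y by a - c
   and \hat Y by the inverse a + c. *)
have p1 : (a z - c z) * (a z + c z) = 1.
  by transitivity (- (- (a z * a z) + c z * c z)); [ring|rewrite e1 opprK].
have n0 : a z - c z != 0.
  by apply/eqP => h; move/eqP: p1; rewrite h mul0r eq_sym oner_eq0.
have ei : (a z - c z)^-1 = a z + c z by apply: (mulfI n0); rewrite mulfV // p1.
have p2 : 0 < a z - c z.
  have s0 : 0 <= (a z + c z) ^+ 2 by rewrite real_exprn_even_ge0 // rpredD ?rK.
  have s1 : 0 < 1 + (a z + c z) ^+ 2 by rewrite ltr_pwDl.
  rewrite -(pmulr_lgt0 _ s1).
  have -> : (a z - c z) * (1 + (a z + c z) ^+ 2) = 2 * a z.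
    transitivity ((a z - c z) + ((a z - c z) * (a z + c z)) * (a z + c z)); first by ring.
    by rewrite p1; ring.
  by rewrite mulr_gt0 ?ltr0n // a_gt0.
apply: (frames_wedge_scale p2).
  by rewrite col0 col1 -eY eb ed; move: (a z) (c z) => x y; apply/colP => i; rewrite !mxE; ring.
by rewrite col0 col1 -eYh ei eb ed; move: (a z) (c z) => x y; apply/colP => i; rewrite !mxE; ring.
Qed.

End Uniqueness.

Theorem theorem5p6 (R : realType) :
  (* the associated family of harmonic maps of eta is Y /\ Yh *)
  (exists Fm : R[i] -> R[i] -> 'M[R[i]]_8, potential_solution Fm) /\
  (forall Fm : R[i] -> R[i] -> 'M[R[i]]_8, potential_solution Fm ->
     (exists F Fp, dpw_frame (@off_curve R) Fm F Fp /\
        forall z l, off_curve z -> `|l| = 1 ->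
          frames_wedge (F z l) (Yvec l z) (Yhvec l z)) /\
     (forall U F Fp, connectedC U -> dpw_frame U Fm F Fp ->
        forall z l, U z -> `|l| = 1 ->
          frames_wedge (F z l) (Yvec l z) (Yhvec l z))) /\
  forall l : R[i], `|l| = 1 ->
  (* (1) *)
  (forall yh : sphere R -> 'cV[R[i]]_7,
     extends_bracket (@off_curve R) (Yhvec l) yh ->
     [/\ in_charts (HTI_willmore_immersion 3) yh,
         forall z : R[i],
           let r := `|z| in
           let f := fun w => yh (chart_0 w) in
           dot (dz f z) (dzb f z) =
           2 * (1 + 4 * r ^+ 2 + r ^+ 4 / 4 + 2 * r ^+ 6 / 9 + 4 * r ^+ 8 / 9
                + r ^+ 10 / 36 + r ^+ 12 / 81)
           / (1 + r ^+ 2 + 5 * r ^+ 4 / 4 + 4 * r ^+ 6 / 9 + r ^+ 8 / 36) ^+ 2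
       & ~ in_charts (@S_willmore R 7) yh]) /\
  (* (2) *)
  (forall y : sphere R -> 'cV[R[i]]_7,
     extends_bracket (@off_curve R) (Yvec l) y ->
     [/\ HTI_willmore_immersion 3 (fun z => y (chart_0 z)),
         forall z : R[i],
           let r := `|z| in
           let f := fun w => y (chart_0 w) in
           dot (dz f z) (dzb f z) =
           2 * (1 + r ^+ 4 / 4 + 4 * r ^+ 6 / 9)
           / (1 + r ^+ 2 + r ^+ 4 / 4 + r ^+ 6 / 9) ^+ 2,
         smooth setT (fun w => y (chart_oo w)) /\
         branch_point_at_0 (fun w => y (chart_oo w)),
         minimal_surface [set z | z != 0] (xvec l)
       & moebius_equivalent [set z | z != 0]
           (fun z => y (chart_0 z)) (xvec l)]) /\
  (* (3) *)
  [/\ forall Fm : R[i] -> R[i] -> 'M[R[i]]_8, potential_solution Fm ->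
        forall z, ~ off_curve z -> ~ exists F Fp, iwasawa (Fm z) F Fp,
      exists! yh : sphere R -> 'cV[R[i]]_7,
        extends_bracket (@off_curve R) (Yhvec l) yh,
      exists! y : sphere R -> 'cV[R[i]]_7,
        extends_bracket (@off_curve R) (Yvec l) y
    & forall y yh : sphere R -> 'cV[R[i]]_7,
        extends_bracket (@off_curve R) (Yvec l) y ->
        extends_bracket (@off_curve R) (Yhvec l) yh ->
        forall z, ~ off_curve z -> y (chart_0 z) = yh (chart_0 z)].
Proof.
split; first by exists (@Fm0 R); exact: Fm0_solution.
split.
  move=> Fm sol; split; last by move=> V F Fp cV dF; exact: dpw_unique sol cV dF.
  exists (@Fr R), (@Fpl R); split; [exact: Fr_dpw|exact: Fr_wedge].
move=> l l1; have gY := glued_Y l1; have gH := glued_H l1.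
split.
  move=> yh /(extends_unique gH) ->.
  by split; [exact: hglue_HTI|exact: hglue_metric|exact: hglue_not_S].
split.
  move=> y /(extends_unique gY) ->; split.
  - exact: yglue_HTI.
  - exact: yglue_metric.
  - by split; [exact: yglue_smooth|exact: yglue_branch].
  - exact: minimal_xvec.
  - exact: moebius_xvec.
split.
- move=> Fm sol z nU [F [Fp h]]; apply: (no_iwasawa nU); exists F, Fp.
  by apply: iwasawa_ext h => m; exact: solution_circle.
- exact: extends_exists_unique gH.
- exact: extends_exists_unique gY.
move=> y yh /(extends_unique gY) -> /(extends_unique gH) -> z nU.
exact: on_curve_eq.
Qed.
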